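(* Let $n\ge3$, $r_0>0$, $M^n=\mathbb{S}^{n-1}\times(r_0,\infty)$ and $g=u^2(\theta,r)\,dr^2+r^2g_{\mathbb{S}^{n-1}}$ with $u\in C^\infty(M)$, $u>0$. Suppose there is a bounded function $V\in C^\infty(M)$ (not assumed positive and with no assumed asymptotics) satisfying $\mathrm{Hess}_gV=V\,\mathrm{Ric}_g$ and $\Delta_gV=0$. Then there is a constant $m\in\mathbb{R}$ with $r_0\ge r_m$ such that $u=(1-2mr^{2-n})^{-1/2}$, i.e. $g=g_m$ is the Schwarzschild metric, and $V$ is a constant multiple of the Schwarzschild potential $V_m$; in particular (after normalizing $V\to1$) $(M,g,V)$ is the Schwarzschild space $(\mathbb{S}^{n-1}\times(r_0,\infty),g_m,V_m)$.
   Context: For $m\in\mathbb{R}$, the Schwarzschild space of mass $m$ is $\mathbb{S}^{n-1}\times(r_m,\infty)$ with $g_m=(1-2mr^{2-n})^{-1}dr^2+r^2g_{\mathbb{S}^{n-1}}$ and potential $V_m=\sqrt{1-2mr^{2-n}}$, where $r_m^{n-2}=\max\{2m,0\}$ and $g_{\mathbb{S}^{n-1}}$ is the round unit-sphere metric.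
   Formalization: The bounded function V is assumed not identically zero; for V = 0 the equations hold for every u (for example u = 2), so the claim as worded fails in that case. *)

(* Defs.v *)
From HB Require Import structures.
From mathcomp Require Import all_boot all_order all_algebra.
From mathcomp Require Import all_classical all_reals all_analysis.
Set Implicit Arguments. Unset Strict Implicit. Unset Printing Implicit Defensive.
Import Order.TTheory GRing.Theory Num.Theory.
Import numFieldNormedType.Exports.
Local Open Scope classical_set_scope.
Local Open Scope ring_scope.

(* The manifold S^{n-1} x (r0,oo) is identified with the exterior domain
   {x in R^n : |x| > r0} via (theta, r) |-> r theta.  Points of R^n are
   row vectors 'rV[R]_n. *)

Definition eradius {R : realType} {n : nat} (x : 'rV[R]_n) : R :=
  Num.sqrt (\sum_(i < n) x ord0 i ^+ 2).

Definition exterior {R : realType} {n : nat} (r0 : R) : set 'rV[R]_n :=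
  [set x | r0 < eradius x].

Definition ev {R : realType} {n : nat} (i : 'I_n) : 'rV[R]_n := delta_mx ord0 i.

Definition pd {R : realType} {n : nat} (i : 'I_n) (f : 'rV[R]_n -> R)
  : 'rV[R]_n -> R := fun x => derive f x (ev i).

Fixpoint pds {R : realType} {n : nat} (s : seq 'I_n) (f : 'rV[R]_n -> R)
  : 'rV[R]_n -> R :=
  match s with [::] => f | i :: s' => pd i (pds s' f) end.

Definition smooth_on {R : realType} {n : nat} (U : set 'rV[R]_n)
  (f : 'rV[R]_n -> R) : Prop :=
  forall (s : seq 'I_n) (x : 'rV[R]_n), U x -> differentiable (pds s f) x.

(* The metric g = u^2 dr^2 + r^2 g_{S^{n-1}} in Cartesian coordinates:
   g_ij = delta_ij + (u^2 - 1) x_i x_j / |x|^2 *)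
Definition gmet {R : realType} {n : nat} (u : 'rV[R]_n -> R) (i j : 'I_n)
  (x : 'rV[R]_n) : R :=
  (i == j)%:R + (u x ^+ 2 - 1) * x ord0 i * x ord0 j / eradius x ^+ 2.

Definition gmx {R : realType} {n : nat} (u : 'rV[R]_n -> R) (x : 'rV[R]_n)
  : 'M[R]_n := \matrix_(i, j) gmet u i j x.

Definition ginv {R : realType} {n : nat} (u : 'rV[R]_n -> R) (i j : 'I_n)
  (x : 'rV[R]_n) : R := invmx (gmx u x) i j.

Definition christ {R : realType} {n : nat} (u : 'rV[R]_n -> R) (k i j : 'I_n)
  (x : 'rV[R]_n) : R :=
  2^-1 * \sum_(l < n) ginv u k l x *
    (pd i (gmet u j l) x + pd j (gmet u i l) x - pd l (gmet u i j) x).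

Definition ricci {R : realType} {n : nat} (u : 'rV[R]_n -> R) (i j : 'I_n)
  (x : 'rV[R]_n) : R :=
  \sum_(k < n) (pd k (christ u k i j) x - pd j (christ u k i k) x
    + \sum_(l < n) (christ u k k l x * christ u l i j x
                    - christ u k j l x * christ u l i k x)).

Definition hess {R : realType} {n : nat} (u V : 'rV[R]_n -> R) (i j : 'I_n)
  (x : 'rV[R]_n) : R :=
  pd i (pd j V) x - \sum_(k < n) christ u k i j x * pd k V x.

Definition lap {R : realType} {n : nat} (u V : 'rV[R]_n -> R) (x : 'rV[R]_n)
  : R := \sum_(i < n) \sum_(j < n) ginv u i j x * hess u V i j x.

Definition r_m {R : realType} (n : nat) (m : R) : R :=
  powR (Num.max (2 * m) 0) ((n - 2)%:R^-1).

Definition schw {R : realType} (n : nat) (m r : R) : R :=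
  1 - 2 * m * r ^- (n - 2).

(* Main.v *)
Require Import Defs.
From HB Require Import structures.
From mathcomp Require Import all_boot all_order all_algebra.
From mathcomp Require Import all_classical all_reals all_analysis.
From mathcomp Require Import ring lra.
Set Implicit Arguments. Unset Strict Implicit. Unset Printing Implicit Defensive.
Import Order.TTheory GRing.Theory Num.Theory.
Import numFieldNormedType.Exports.
Local Open Scope classical_set_scope.
Local Open Scope ring_scope.

(* Write E = u^-2.  The radial part of the static equations says that g has zero
scalar curvature, which for u is a quasilinear parabolic equation with r as time;
a maximum principle for the spherical gradient of y = 1 - 1/u (a Bernstein
estimate) gives decay of u - 1 and of the spherical gradient of u.  Since V is
bounded, its gradient decays too: a large gradient would persist along a cone of
rays and make V unbounded.  Hence V is close to a nonzero constant far out.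

There, put f = ln u and w = ln |V|.  The curl of the mixed equations makes the
spherical gradients of f and w parallel.  Along a ray, in an adapted parallel
frame, the equations become a closed ODE system for these gradients; a decaying
solution that is not zero enters an invariant cone, on which a second-order
quantity is both bounded and growing, a contradiction.  So u and V are radial near
infinity; this spreads inwards along rays by Gronwall, first where V does not
vanish and then, taking the infimum of the admissible radii, everywhere.
For radial u and V the equations say that (1 - E) r^(n-2) and u V are constant. *)

(** The sphere is never parametrised: its tangent vectors are Euclidean vectors orthogonal to the
    position, and its operators are built from rotation fields and the scale-free expressions [lapS]
    and [gamS]. V has no known sign or limit, so an equation for ln |V| makes sense only where V is
    known not to vanish. The estimates for V are therefore stated relative to a bound M of |V| on an
    exterior region; taking M to be the supremum there gives nonvanishing without any normalization.
    No bound on the radial derivative of u is available; the quantities followed along rays are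
    chosen so that it cancels or can be eliminated. n >= 3 supplies a tangent direction b besides
    the direction a of a spherical gradient, without which the curl would be empty. Linearized at
    flat space, the system for the two derivatives in direction a is a saddle with exponents -(n-1)
    and 1 in the radius. Decay excludes the growing mode but not the decaying one; this is why a
    second order constraint, found by differentiating the tangential equations further, has to be
    extracted. *)

Lemma near_eq_differentiable (K : numFieldType) (V W : normedModType K)
    (f g : V -> W) (x : V) :
  (\near x, f x = g x) -> differentiable f x -> differentiable g x.
Proof.
move=> fg /diff_locallyP [dc fE].
have gx : f x = g x by exact: nbhs_singleton fg.
have ge : g \o shift x = cst (g x) + 'd f x +o_ 0 id.
  apply/eqaddoP => e e0; move/eqaddoP: fE => /(_ e e0) fE.
  have : \forall h \near 0, f (h + x) = g (h + x).
    by move: fg; rewrite (near_shift 0) subr0.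
  move=> fgh; near=> h.
  have fgE : f (h + x) = g (h + x) by near: h.
  have : `|(f \o shift x) h - (f x + 'd f x h)| <= e * `|h| by near: h.
  by rewrite /= fgE gx.
have dE : 'd g x = 'd f x :> (_ -> _) by exact: diff_unique.
by apply/diff_locallyP; rewrite dE.
Unshelve. all: by end_near. Qed.

(** * Differentiation rules for scalar functions *)

Section Derivation.
Context {R : realType} {V : normedModType R}.
Implicit Types (f g : V -> R) (x v : V).

Lemma isd_eq f x v a b : is_derive x v f a -> a = b -> is_derive x v f b.
Proof. by move=> H <-. Qed.

Lemma isd_cst (a : R) x v : is_derive x v (fun=> a) 0.
Proof. exact: is_derive_cst. Qed.

Lemma isdD f g x v a b : is_derive x v f a -> is_derive x v g b ->
  is_derive x v (fun y => f y + g y) (a + b).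
Proof. by move=> ? ?; exact: is_deriveD. Qed.

Lemma isdN f x v a : is_derive x v f a -> is_derive x v (fun y => - f y) (- a).
Proof. by move=> ?; exact: is_deriveN. Qed.

Lemma isdM f g x v a b : is_derive x v f a -> is_derive x v g b ->
  is_derive x v (fun y => f y * g y) (f x * b + g x * a).
Proof. by move=> ? ?; exact: is_deriveM. Qed.

Lemma isdX f k x v a : is_derive x v f a ->
  is_derive x v (fun y => f y ^+ k.+1) (k.+1%:R * f x ^+ k * a).
Proof.
move=> fa; elim: k => [|k IH]; first by rewrite expr0 !mul1r.
have -> : (fun y => f y ^+ k.+2) = (fun y => f y * f y ^+ k.+1).
  by apply/funext => y; rewrite exprS.
by apply: isd_eq (isdM fa IH) _; rewrite -[in RHS]natr1 exprS; ring.
Qed.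

Lemma isdV f x v a : f x != 0 -> is_derive x v f a ->
  is_derive x v (fun y => (f y)^-1) (- (f x)^-2 * a).
Proof.
move=> fx0 fa; have dv := @ex_derive _ _ _ _ _ _ _ fa.
apply: DeriveDef; first exact: derivableV.
by rewrite deriveV // derive_val.
Qed.

Lemma isd_sum (I : Type) (s : seq I) (P : pred I) (f : I -> V -> R) (df : I -> R) x v :
  (forall i, is_derive x v (f i) (df i)) ->
  is_derive x v (fun y => \sum_(i <- s | P i) f i y) (\sum_(i <- s | P i) df i).
Proof.
move=> H; elim: s => [|i s IH].
  have -> : (fun y => \sum_(i <- [::] | P i) f i y) = (fun=> 0).
    by apply/funext => y; rewrite big_nil.
  by rewrite big_nil; exact: isd_cst.
have -> : (fun y => \sum_(j <- i :: s | P j) f j y) =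
    (fun y => (if P i then f i y else 0) + \sum_(j <- s | P j) f j y).
  by apply/funext => y; rewrite big_cons; case: ifP => // _; rewrite add0r.
rewrite big_cons; case: ifP => Pi; first exact: isdD.
by apply: isd_eq (isdD (isd_cst 0 x v) IH) _; rewrite add0r.
Qed.

End Derivation.

(* A sealed copy of [pd]: unification must not unfold derivatives. *)
HB.lock Definition dpd {R : realType} {n : nat} (i : 'I_n) (f : 'rV[R]_n -> R)
  : 'rV[R]_n -> R := pd i f.

Lemma pdE : @pd = @dpd.
Proof. by rewrite dpd.unlock. Qed.

(** * Smooth functions and their partial derivatives *)

Section Smooth.
Context {R : realType} {n : nat}.
Implicit Types (f g : 'rV[R]_n -> R) (U : set 'rV[R]_n) (x v : 'rV[R]_n).

Lemma evE (i j : 'I_n) : (ev i : 'rV[R]_n) ord0 j = (i == j)%:R.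
Proof. by rewrite /ev mxE eqxx andTb eq_sym. Qed.

Lemma isd_coord x v (k : 'I_n) :
  is_derive x v (fun y : 'rV[R]_n => y ord0 k) (v ord0 k).
Proof.
have df : differentiable (fun y : 'rV[R]_n => y ord0 k) x by exact: differentiable_coord.
apply: DeriveDef; first exact: diff_derivable.
rewrite deriveE //.
have @lf : {linear 'rV[R]_n -> R}.
  by exists (fun N : 'M[R]_(1, n) => N ord0 k); do 2![eexists]; do ?[constructor];
    rewrite ?mxE// => ? *; rewrite ?mxE//; move=> ?; rewrite !mxE.
by rewrite (_ : (fun _ => _) = lf) // diff_lin //; exact: coord_continuous.
Qed.

Lemma differentiable_isd f x v : differentiable f x ->
  is_derive x v f (\sum_i v ord0 i * dpd i f x).
Proof.
move=> df; apply: DeriveDef; first exact: diff_derivable.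
rewrite deriveE // [in LHS](row_sum_delta v) linear_sum; apply: eq_bigr => i _.
by rewrite linearZ -pdE /pd deriveE.
Qed.

Lemma pd_isd f x i a : is_derive x (ev i) f a -> dpd i f x = a.
Proof. by move=> H; rewrite -pdE /pd derive_val. Qed.

Lemma pd_near f g x i : (\near x, f x = g x) -> dpd i f x = dpd i g x.
Proof. by move=> H; rewrite -pdE /pd; exact: near_eq_derive. Qed.

Lemma open_near U f g x : open U -> U x -> (forall y, U y -> f y = g y) ->
  \near x, f x = g x.
Proof. by move=> oU Ux fg; apply: filterS (fun y Uy => fg y Uy) _; exact: open_nbhs_nbhs. Qed.

Lemma pds_rcons (s : seq 'I_n) i f : pds (rcons s i) f = pds s (dpd i f).
Proof. by rewrite -pdE; elim: s => //= j s ->. Qed.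

(** [smooth_on] speaks of all iterated partials at once and gives no induction for products and
    inverses; a finite order does. The recursion peels off the innermost partial, whereas [pds] adds
    the outermost one, hence [pds_rcons]. *)
Fixpoint Ck k U f : Prop := (forall x, U x -> differentiable f x) /\
  if k is k'.+1 then forall i, Ck k' U (dpd i f) else True.

Lemma smooth_Ck U f : smooth_on U f <-> forall k, Ck k U f.
Proof.
split=> [sf k|cf s].
  elim: k f sf => [|k IH] f sf /=; split=> //; first exact: (sf [::]).
    exact: (sf [::]).
  by move=> i; apply: IH => s; rewrite -pds_rcons; exact: sf.
elim/last_ind: s f cf => [|s i IH] f cf x Ux; first by have [+ _] := cf 0%N; apply.
rewrite pds_rcons; apply: IH => // k.
by have [_ +] := cf k.+1; apply.
Qed.

Lemma Ck_diff k U f x : Ck k U f -> U x -> differentiable f x.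
Proof. by case: k => [|k] [+ _]; apply. Qed.

Lemma CkW k U f : Ck k.+1 U f -> Ck k U f.
Proof.
elim: k f => [|k IH] f [df pf]; split=> // i; apply: IH; exact: pf.
Qed.

Lemma Ck_eq k U f g : open U -> (forall x, U x -> f x = g x) -> Ck k U f -> Ck k U g.
Proof.
move=> oU; elim: k f g => [|k IH] f g fg cf; split=> //.
- by move=> x Ux; apply: near_eq_differentiable (Ck_diff cf Ux); exact: open_near fg.
- by move=> x Ux; apply: near_eq_differentiable (Ck_diff cf Ux); exact: open_near fg.
- move=> i; apply: (IH (dpd i f)); last by have [_ +] := cf; apply.
  by move=> x Ux; apply: pd_near; exact: open_near fg.
Qed.

Lemma Ck_cst k U (a : R) : Ck k U (fun=> a).
Proof.
elim: k a => [|k IH] a; split=> //; try by move=> x _; exact: differentiable_cst.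
move=> i; suff -> : dpd i (fun=> a) = (fun=> 0) by [].
by apply/funext => x; apply: pd_isd; exact: isd_cst.
Qed.

Lemma Ck_coord k U j : Ck k U (fun x => x ord0 j).
Proof.
case: k => [|k]; split=> //; try by move=> x _; exact: differentiable_coord.
move=> i; suff -> : dpd i (fun x : 'rV[R]_n => x ord0 j) = (fun=> (i == j)%:R).
  exact: Ck_cst.
by apply/funext => x; apply: pd_isd; rewrite -evE; exact: isd_coord.
Qed.

Lemma diff_pd f x i : differentiable f x -> is_derive x (ev i) f (dpd i f x).
Proof. by move=> df; rewrite -pdE; apply/derivableP; exact: diff_derivable. Qed.

Lemma CkD k U f g : open U -> Ck k U f -> Ck k U g -> Ck k U (fun x => f x + g x).
Proof.
move=> oU; elim: k f g => [|k IH] f g cf cg; split=> //; try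
  by move=> x Ux; exact: differentiableD (Ck_diff cf Ux) (Ck_diff cg Ux).
move=> i; apply: (@Ck_eq _ _ (fun x => dpd i f x + dpd i g x)) => //; last first.
  by apply: IH; [have [_ +] := cf|have [_ +] := cg]; apply.
by move=> x Ux; apply/esym/pd_isd/isdD; apply: diff_pd;
  [exact: Ck_diff cf Ux|exact: Ck_diff cg Ux].
Qed.

Lemma CkM k U f g : open U -> Ck k U f -> Ck k U g -> Ck k U (fun x => f x * g x).
Proof.
move=> oU; elim: k f g => [|k IH] f g cf cg; split=> //; try
  by move=> x Ux; exact: differentiableM (Ck_diff cf Ux) (Ck_diff cg Ux).
move=> i; apply: (@Ck_eq _ _ (fun x => f x * dpd i g x + g x * dpd i f x)) => //; last first.
  have [_ pf] := cf; have [_ pg] := cg.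
  by apply: CkD => //; apply: IH; [exact: CkW cf|exact: pg|exact: CkW cg|exact: pf].
by move=> x Ux; apply/esym/pd_isd/isdM; apply: diff_pd;
  [exact: Ck_diff cf Ux|exact: Ck_diff cg Ux].
Qed.

Lemma CkV k U f : open U -> (forall x, U x -> f x != 0) -> Ck k U f ->
  Ck k U (fun x => (f x)^-1).
Proof.
move=> oU f0; elim: k => [|k IH] cf; split=> //; try
  by move=> x Ux; apply: differentiableV; [exact: Ck_diff cf Ux|exact: f0].
move=> i.
apply: (@Ck_eq _ _ (fun x => (-1) * ((f x)^-1 * (f x)^-1) * dpd i f x)) => //; last first.
  have [_ pf] := cf; have cV := IH (CkW cf).
  apply: CkM => //; last exact: pf.
  by apply: CkM => //; [exact: Ck_cst|apply: CkM].
move=> x Ux; apply/esym; have := isdV (f0 _ Ux) (diff_pd i (Ck_diff cf Ux)).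
by move=> /pd_isd ->; rewrite expr2 invfM mulN1r.
Qed.

Section SmoothOn.
Variable U : set 'rV[R]_n.
Hypothesis oU : open U.

Lemma smooth_pd f i : smooth_on U f -> smooth_on U (dpd i f).
Proof. by move=> sf s; rewrite -pds_rcons; exact: sf. Qed.

Lemma smooth_cst (a : R) : smooth_on U (fun=> a).
Proof. by apply/smooth_Ck => k; exact: Ck_cst. Qed.

Lemma smooth_coord j : smooth_on U (fun x => x ord0 j).
Proof. by apply/smooth_Ck => k; exact: Ck_coord. Qed.

Lemma smoothD f g : smooth_on U f -> smooth_on U g -> smooth_on U (fun x => f x + g x).
Proof. by move=> /smooth_Ck sf /smooth_Ck sg; apply/smooth_Ck => k; exact: CkD. Qed.

Lemma smoothM f g : smooth_on U f -> smooth_on U g -> smooth_on U (fun x => f x * g x).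
Proof. by move=> /smooth_Ck sf /smooth_Ck sg; apply/smooth_Ck => k; exact: CkM. Qed.

Lemma smoothV f : (forall x, U x -> f x != 0) -> smooth_on U f ->
  smooth_on U (fun x => (f x)^-1).
Proof. by move=> f0 /smooth_Ck sf; apply/smooth_Ck => k; exact: CkV. Qed.

Lemma smooth_eq f g : (forall x, U x -> f x = g x) -> smooth_on U f -> smooth_on U g.
Proof. by move=> fg /smooth_Ck sf; apply/smooth_Ck => k; exact: Ck_eq fg (sf k). Qed.

Lemma smoothN f : smooth_on U f -> smooth_on U (fun x => - f x).
Proof.
move=> sf; apply: (@smooth_eq (fun x => (-1) * f x)).
  by move=> x _; rewrite mulN1r.
by apply: smoothM => //; exact: smooth_cst.
Qed.

Lemma smoothX f k : smooth_on U f -> smooth_on U (fun x => f x ^+ k).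
Proof.
move=> sf; elim: k => [|k IH]; first exact: smooth_cst.
apply: (@smooth_eq (fun x => f x * f x ^+ k)); last exact: smoothM.
by move=> x _; rewrite exprS.
Qed.

Lemma smooth_sum (I : Type) (s : seq I) (P : pred I) (f : I -> 'rV[R]_n -> R) :
  (forall i, smooth_on U (f i)) -> smooth_on U (fun x => \sum_(i <- s | P i) f i x).
Proof.
move=> H; elim: s => [|i s IH].
  by apply: smooth_eq (smooth_cst 0) => x _; rewrite big_nil.
case Pi : (P i); last by apply: smooth_eq IH => x _; rewrite big_cons Pi.
by apply: smooth_eq (smoothD (H i) IH) => x _; rewrite big_cons Pi.
Qed.

Lemma smooth_diff f x : smooth_on U f -> U x -> differentiable f x.
Proof. by move=> sf; exact: (sf [::]). Qed.

Lemma smooth_isd f x v : smooth_on U f -> U x ->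
  is_derive x v f (\sum_i v ord0 i * dpd i f x).
Proof. by move=> sf Ux; apply/differentiable_isd/(smooth_diff sf). Qed.

Lemma smooth_isd_pd f x i : smooth_on U f -> U x -> is_derive x (ev i) f (dpd i f x).
Proof. by move=> sf Ux; apply/diff_pd/(smooth_diff sf). Qed.

Lemma smooth_continuous f x : smooth_on U f -> U x -> {for x, continuous f}.
Proof. by move=> sf Ux; apply/differentiable_continuous/(smooth_diff sf). Qed.

Lemma pd_eq_on f g i x : (forall y, U y -> f y = g y) -> U x -> dpd i f x = dpd i g x.
Proof. by move=> fg Ux; apply: pd_near; exact: open_near fg. Qed.

Lemma isd_eq_on f g i x a b : (forall y, U y -> f y = g y) -> U x ->
  is_derive x (ev i) f a -> is_derive x (ev i) g b -> a = b.
Proof. by move=> fg Ux /pd_isd <- /pd_isd <-; exact: pd_eq_on. Qed.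

End SmoothOn.
End Smooth.

(* Computes the derivative of an arithmetic expression; the atoms are left to
   the tactic passed as argument.  [is_derive] is a class, hence
   [notypeclasses]. *)
Ltac isd_with tac :=
  lazymatch goal with
  | |- is_derive _ _ (fun _ => ?a) _ => notypeclasses refine (isd_cst _ _ _)
  | |- is_derive _ _ (fun y => @?f y + @?g y) _ =>
      notypeclasses refine (@isdD _ _ f g _ _ _ _ _ _); isd_with tac
  | |- is_derive _ _ (fun y => - @?f y) _ =>
      notypeclasses refine (@isdN _ _ f _ _ _ _); isd_with tac
  | |- is_derive _ _ (fun y => @?f y * @?g y) _ =>
      notypeclasses refine (@isdM _ _ f g _ _ _ _ _ _); isd_with tac
  | |- is_derive _ _ (fun y => (@?f y) ^+ ?k.+1) _ =>
      notypeclasses refine (@isdX _ _ f k _ _ _ _); isd_with tac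
  | |- is_derive _ _ (fun y => (@?f y)^-1) _ =>
      notypeclasses refine (@isdV _ _ f _ _ _ _ _); [try done|isd_with tac]
  | |- is_derive _ _ (fun y => \sum_(i <- ?s | @?P i) @?F y i) _ =>
      notypeclasses refine (@isd_sum _ _ _ s P (fun i y => F y i) _ _ _ _);
      intros ?; isd_with tac
  | |- _ => tac
  end.

Ltac isd_id := first [eassumption | notypeclasses refine (isd_coord _ _ _)
  | notypeclasses refine (is_derive_id _ _)
  | match goal with H : forall _, is_derive _ _ _ _ |- _ => notypeclasses refine (H _) end].
Ltac isd := notypeclasses refine (isd_eq _ _); [isd_with isd_id|cbv beta].

(** * Chain rule along curves and lines *)

Section Curves.
Context {R : realType} {n : nat}.
Implicit Types (f : 'rV[R]_n -> R) (U : set 'rV[R]_n).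

Lemma curve_isd (c : R -> 'rV[R]_n) (dc : 'I_n -> R) f (s : R) :
  (forall k, is_derive s (1 : R) (fun t => c t ord0 k) (dc k)) ->
  differentiable f (c s) ->
  is_derive s (1 : R) (fun t => f (c t)) (\sum_k dc k * dpd k f (c s)).
Proof.
move=> hc df.
have dvc : derivable c s 1.
  by apply/derivable_mxP => i k; rewrite (ord1 i); exact: (@ex_derive _ _ _ _ _ _ _ (hc k)).
have dfc : differentiable c s by apply/derivable1_diffP.
have dfo : differentiable (f \o c) s by exact: differentiable_comp.
apply: DeriveDef; first exact: diff_derivable.
have -> : 'D_1 (fun t => f (c t)) s = 'd f (c s) ('D_1 c s).
  by rewrite -[fun _ => _]/(f \o c) deriveE // diff_comp //= [in RHS]deriveE.
rewrite -deriveE // (@derive_val _ _ _ _ _ _ _ (differentiable_isd ('D_1 c s) df)).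
apply: eq_bigr => k _; rewrite derive_mx // mxE.
by congr (_ * _); exact: (@derive_val _ _ _ _ _ _ _ (hc k)).
Qed.

Lemma line_isd f (x v : 'rV[R]_n) (s : R) : differentiable f (x + s *: v) ->
  is_derive s (1 : R) (fun t => f (x + t *: v)) (\sum_k v ord0 k * dpd k f (x + s *: v)).
Proof.
move=> df; apply: (@curve_isd (fun t => x + t *: v) (fun k => v ord0 k)) => // k.
have -> : (fun t : R => (x + t *: v) ord0 k) = (fun t => x ord0 k + v ord0 k * t).
  by apply/funext => t; rewrite !mxE mulrC.
by isd; rewrite /=; ring.
Qed.

Lemma line_ev_isd f (x : 'rV[R]_n) i (s : R) : differentiable f (x + s *: ev i) ->
  is_derive s (1 : R) (fun t => f (x + t *: ev i)) (dpd i f (x + s *: ev i)).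
Proof.
move=> df; apply: isd_eq (line_isd df) _.
rewrite (bigD1 i) //= big1 ?addr0 ?evE ?eqxx ?mul1r // => k ki.
by rewrite evE eq_sym (negbTE ki) mul0r.
Qed.

End Curves.

(** * Mean value theorem and monotonicity on an interval *)

Section OneVariable.
Context {R : realType}.
Implicit Types f : R -> R.

Lemma isd_continuous f (x a : R) : is_derive x (1 : R) f a -> {for x, continuous f}.
Proof.
by move=> H; apply/differentiable_continuous/derivable1_diffP; exact: (@ex_derive _ _ _ _ _ _ _ H).
Qed.

Lemma isd_within f df (a b : R) :
  (forall x, a <= x <= b -> is_derive x (1 : R) f (df x)) ->
  {within `[a, b], continuous f}.
Proof.
move=> H; apply: continuous_in_subspaceT => x; rewrite inE /= in_itv /= => xab.
exact: isd_continuous (H _ xab).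
Qed.

Lemma MVT_isd f df (a b : R) : a < b ->
  (forall x, a <= x <= b -> is_derive x (1 : R) f (df x)) ->
  exists c, [/\ a < c, c < b & f b - f a = df c * (b - a)].
Proof.
move=> ab H; have [|c + fE] := @MVT _ f df a b ab _ (isd_within H).
  by move=> x; rewrite in_itv /= => /andP [ax xb]; apply: H; rewrite !ltW.
by rewrite in_itv /= => /andP [ac cb]; exists c.
Qed.

Lemma isd_nondecr f df (a b : R) : a <= b ->
  (forall x, a <= x <= b -> is_derive x (1 : R) f (df x)) ->
  (forall x, a <= x <= b -> 0 <= df x) -> f a <= f b.
Proof.
rewrite le_eqVlt => /predU1P [-> //|ab] H d0.
have [c [ac cb fE]] := MVT_isd ab H.
by rewrite -subr_ge0 fE mulr_ge0 // ?d0 ?(ltW ac) ?(ltW cb) // subr_ge0 ltW.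
Qed.

End OneVariable.

(** * Symmetry of second partial derivatives *)

Section Clairaut.
Context {R : realType} {n : nat}.
Implicit Types (f : 'rV[R]_n -> R) (U : set 'rV[R]_n).

Lemma box_near (P : set 'rV[R]_n) (x : 'rV[R]_n) (i j : 'I_n) : (\forall y \near x, P y) ->
  exists2 h : R, 0 < h & forall s t, `|s| <= h -> `|t| <= h -> P (x + s *: ev i + t *: ev j).
Proof.
move=> /nbhs_ballP [e /= e0 He].
pose c : R := `|ev i : 'rV[R]_n| + `|ev j : 'rV[R]_n| + 1.
have c0 : 0 < c by rewrite ltr_wpDl // addr_ge0.
exists (e / (2 * c)); first by rewrite divr_gt0 // mulr_gt0.
move=> s t hs ht; apply: He; rewrite -ball_normE /ball_ /= -addrA opprD addrA subrr add0r normrN.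
apply: (le_lt_trans (ler_normD _ _)); rewrite !normrZ.
apply: (@le_lt_trans _ _ (e / (2 * c) * c)).
  have k0 : 0 <= e / (2 * c) by rewrite divr_ge0 ?(ltW e0) // mulr_ge0 // ltW.
  apply: (le_trans (lerD (ler_wpM2r _ hs) (ler_wpM2r _ ht))) => //.
  by move: k0; move: (e / (2 * c)) => k k0; rewrite /c !mulrDr mulr1 lerDl.
by rewrite invfM mulrA -mulrA mulVf ?gt_eqF // mulr1 ltr_pdivrMr // ltr_pMr // ltr1n.
Qed.

(** The second difference is symmetric in the two directions, while two applications of the mean
    value theorem turn it into one particular order of the mixed partial. Comparing both orders on a
    shrinking box gives [pd_comm]. *)
Lemma mixed_difference f U x i j (h : R) : 0 < h -> smooth_on U f ->
  (forall s t, `|s| <= h -> `|t| <= h -> U (x + s *: ev i + t *: ev j)) ->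
  exists s t, [/\ `|s| <= h, `|t| <= h &
    f (x + h *: ev i + h *: ev j) - f (x + h *: ev i) - f (x + h *: ev j) + f x
      = h ^+ 2 * dpd j (dpd i f) (x + s *: ev i + t *: ev j)].
Proof.
move=> h0 sf HU.
have lem s : 0 <= s <= h -> `|s| <= h by move=> /andP [s0 sh]; rewrite ger0_norm.
have h00 : `|0 : R| <= h by rewrite normr0 ltW.
have hh : `|h| <= h by rewrite ger0_norm // ltW.
pose phi s := f (x + h *: ev j + s *: ev i) - f (x + s *: ev i).
have [|c [c0 ch phiE]] := @MVT_isd _ phi (fun s => dpd i f (x + h *: ev j + s *: ev i) - dpd i f (x + s *: ev i)) 0 h h0.
  move=> s sh; apply: isdD; [|apply: isdN]; apply: line_ev_isd; apply: (smooth_diff sf).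
    by rewrite addrAC; apply: HU => //; exact: lem.
  by have := HU s 0 (lem _ sh) h00; rewrite scale0r addr0.
have cl : 0 <= c <= h by rewrite !ltW.
have [|d [d0 dh psiE]] := @MVT_isd _ (fun t => dpd i f (x + c *: ev i + t *: ev j))
    (fun t => dpd j (dpd i f) (x + c *: ev i + t *: ev j)) 0 h h0.
  move=> t th; apply: line_ev_isd; apply: (smooth_diff (smooth_pd i sf)).
  by apply: HU; exact: lem.
exists c, d; split; [exact: lem|by apply: lem; rewrite !ltW|].
move: phiE psiE; rewrite /phi !subr0 !scale0r !addr0 => phiE psiE.
have -> : f (x + h *: ev i + h *: ev j) - f (x + h *: ev i) - f (x + h *: ev j) + f x =
   f (x + h *: ev j + h *: ev i) - f (x + h *: ev i) - (f (x + h *: ev j) - f x).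
  by rewrite [x + _ + h *: ev j]addrAC; ring.
by rewrite phiE [x + _ + c *: ev i]addrAC psiE; ring.
Qed.

Lemma dist_half (a b c e : R) : `|a - c| < e / 2 -> `|b - c| < e / 2 -> `|a - b| <= e.
Proof.
move=> h1 h2; rewrite (splitr e) -(subrKA c) (le_trans (ler_normD _ _)) //.
by rewrite lerD ?ltW // distrC.
Qed.

Lemma pd_comm f U x i j : open U -> smooth_on U f -> U x ->
  dpd i (dpd j f) x = dpd j (dpd i f) x.
Proof.
move=> oU sf Ux; apply/eqP; rewrite -subr_eq0 -normr_le0; apply/ler_addgt0Pl => e e0.
rewrite addr0.
have e2 : 0 < e / 2 by rewrite divr_gt0.
have near_ij k l : \forall y \near x, `|dpd k (dpd l f) x - dpd k (dpd l f) y| < e / 2.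
  have := smooth_continuous (smooth_pd k (smooth_pd l sf)) Ux.
  by move=> /cvgrPdist_lt /(_ _ e2).
have nearU : \forall y \near x, U y by exact: open_nbhs_nbhs.
have [h h0 Hh] := box_near i j (filterI nearU (filterI (near_ij i j) (near_ij j i))).
have [s [t [hs ht E1]]] := mixed_difference h0 sf (fun s t hs ht => (Hh s t hs ht).1).
have Hsw s' t' : `|s'| <= h -> `|t'| <= h -> U (x + s' *: ev j + t' *: ev i).
  by move=> hs' ht'; rewrite addrAC; have [] := Hh t' s' ht' hs'.
have [s' [t' [hs' ht' E2]]] := mixed_difference h0 sf Hsw.
have E : dpd j (dpd i f) (x + s *: ev i + t *: ev j) = dpd i (dpd j f) (x + s' *: ev j + t' *: ev i).
  apply: (mulfI (x := h ^+ 2)); first by rewrite expf_neq0 // gt_eqF.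
  apply: etrans (esym E1) _; apply: etrans _ E2; rewrite (addrAC x (h *: ev j)).
  by congr (_ + _); exact: addrAC.
have [_ [_ B1]] := Hh s t hs ht.
have [_ [B2 _]] := Hh t' s' ht' hs'.
move: B2; rewrite [x + t' *: _ + _]addrAC -E => B2.
exact: dist_half B2 B1.
Qed.

End Clairaut.

Ltac smt :=
  lazymatch goal with
  | |- smooth_on _ (fun _ => ?a) => exact: smooth_cst
  | |- smooth_on _ (fun y => @?f y + @?g y) =>
      apply: (@smoothD _ _ _ _ f g); [try done|smt|smt]
  | |- smooth_on _ (fun y => - @?f y) => apply: (@smoothN _ _ _ _ f); [try done|smt]
  | |- smooth_on _ (fun y => @?f y * @?g y) =>
      apply: (@smoothM _ _ _ _ f g); [try done|smt|smt]
  | |- smooth_on _ (fun y => (@?f y) ^+ ?k) =>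
      apply: (@smoothX _ _ _ _ f k); [try done|smt]
  | |- smooth_on _ (fun y => (@?f y)^-1) => apply: (@smoothV _ _ _ _ f); [try done|try done|smt]
  | |- smooth_on _ (fun y => \sum_(i <- ?s | @?P i) @?F y i) =>
      refine (@smooth_sum _ _ _ _ _ s P (fun i y => F y i) _); [try done|move=> ?; smt]
  | |- smooth_on _ (dpd ?i ?f) => apply: (@smooth_pd _ _ _ f i); smt
  | |- smooth_on _ (fun y => dpd ?i ?f y) => apply: (@smooth_pd _ _ _ f i); smt
  | |- _ => first [assumption | exact: smooth_coord | idtac]
  end.

Lemma sum_delta (R : pzSemiRingType) n (f : 'I_n -> R) j : \sum_i f i * (i == j)%:R = f j.
Proof.
by rewrite (bigD1 j) //= eqxx mulr1 big1 ?addr0 // => i /negbTE ->; rewrite mulr0.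
Qed.

Lemma sum_deltar (R : pzSemiRingType) n (f : 'I_n -> R) j : \sum_i f i * (j == i)%:R = f j.
Proof. by under eq_bigr do rewrite eq_sym; exact: sum_delta. Qed.

(** * The squared radius and exterior domains *)

Section Euclid.
Context {R : realType} {n : nat}.
Implicit Types (x : 'rV[R]_n) (r : R).

(** The squared radius is polynomial, hence smooth everywhere; conditions on [eradius] are
    transported to it to keep square roots out of the calculus. *)
Definition r2 x : R := \sum_i x ord0 i * x ord0 i.

Lemma eradius_sqr x : eradius x ^+ 2 = r2 x.
Proof.
rewrite /eradius sqr_sqrtr; first by apply: eq_bigr => i _; rewrite expr2.
by apply: sumr_ge0 => i _; exact: sqr_ge0.
Qed.

Lemma r2_ge0 x : 0 <= r2 x.
Proof. by rewrite -eradius_sqr sqr_ge0. Qed.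

Lemma eradius_ge0 x : 0 <= eradius x.
Proof. exact: sqrtr_ge0. Qed.

Lemma eradius_r2 x : eradius x = Num.sqrt (r2 x).
Proof. by rewrite -eradius_sqr sqrtr_sqr ger0_norm ?eradius_ge0. Qed.

Lemma exteriorE (r0 : R) x : 0 <= r0 -> exterior r0 x <-> r0 ^+ 2 < r2 x.
Proof. by move=> h; rewrite /exterior /= -eradius_sqr ltr_pXn2r // nnegrE eradius_ge0. Qed.

Lemma r2_gt0 (r0 : R) x : 0 <= r0 -> exterior r0 x -> 0 < r2 x.
Proof. by move=> h /exteriorE -/(_ h); apply: le_lt_trans; exact: sqr_ge0. Qed.

Lemma smooth_r2 U : open U -> smooth_on U r2.
Proof. by move=> oU; rewrite /r2; smt. Qed.

Lemma r2_continuous : continuous r2.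
Proof. by move=> x; apply: (@smooth_continuous _ _ setT) => //; apply: smooth_r2 openT. Qed.

Lemma open_exterior (r0 : R) : 0 <= r0 -> open (exterior r0 : set 'rV[R]_n).
Proof.
move=> h; rewrite (_ : exterior r0 = r2 @^-1` [set t | r0 ^+ 2 < t]).
  by apply: open_comp => // x _; exact: r2_continuous.
by apply/seteqP; split=> x /= /exteriorE; apply.
Qed.

Lemma r2_isd x v : is_derive x v r2 (2 * \sum_i x ord0 i * v ord0 i).
Proof.
rewrite /r2; isd; rewrite mulr_sumr; apply: eq_bigr => i _; ring.
Qed.

Lemma r2_pd i x : is_derive x (ev i) r2 (2 * x ord0 i).
Proof.
apply: isd_eq (r2_isd _ _) _; congr (2 * _).
by under eq_bigr do rewrite evE eq_sym; rewrite sum_delta.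
Qed.

End Euclid.

(** * Algebra of the Ricci contraction at one point *)

Section RicciAlgebra.
Context {R : realFieldType} {n : nat}.
Implicit Types f : 'I_n -> R.
Variables (x e B : 'I_n -> R) (E Bd : 'I_n -> 'I_n -> R) (k : R) (kd : 'I_n -> R).

(** [G] is the shape that the Christoffel symbols of g take in Cartesian coordinates, with [e], [B],
    [k] in place of the fields [ee], [BB], [kk]. [E], [Bd], [kd] stand for the partials of these
    fields, and [dG] is the derivative of [G] by the product rule. As independent variables they
    turn the contractions into pure algebra. *)
Let A i j := e i * x j + e j * x i + k * (i == j)%:R.
Let G l i j := x l * A i j - 2^-1 * x i * x j * B l.
Let dG m l i j := (l == m)%:R * A i j
  + x l * (E i m * x j + e i * (j == m)%:R + E j m * x i + e j * (i == m)%:R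
           + kd m * (i == j)%:R)
  - 2^-1 * ((i == m)%:R * x j * B l + x i * (j == m)%:R * B l + x i * x j * Bd l m).
Let s := \sum_i x i * x i.
Let c := \sum_i e i * x i.
Let b := \sum_i B i * x i.
Let be := \sum_i e i * B i.
Let dB := \sum_i Bd i i.
Let kD := \sum_i kd i * x i.
Let eD i := \sum_m E i m * x m.

Lemma sum_div i j : \sum_m dG m m i j = n%:R * A i j
  + (eD i * x j + e i * x j + eD j * x i + e j * x i + kD * (i == j)%:R)
  - 2^-1 * (x j * B i + x i * B j + x i * x j * dB).
Proof.
under eq_bigr => m _.
  rewrite /dG eqxx /= (_ : _ - _ = A i j + ((E i m * x m) * x j + ((x m * e i) * (j == m)%:R
   + ((E j m * x m) * x i + ((x m * e j) * (i == m)%:R + ((kd m * x m) * (i == j)%:R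
   + ((B m * (- 2^-1 * x j)) * (i == m)%:R + ((B m * (- 2^-1 * x i)) * (j == m)%:R
   + Bd m m * (- 2^-1 * x i * x j))))))))); last by ring.
  over.
rewrite /= !big_split /= !sum_deltar -!mulr_suml !sumr_const card_ord -/(eD i) -/(eD j).
rewrite -/kD -/dB -[e i *+ n]mulr_natl -[e j *+ n]mulr_natl -[k *+ n]mulr_natl /A.
by ring.
Qed.

Lemma sum_trace i : \sum_l G l i l = e i * s + k * x i + c * x i - 2^-1 * b * x i.
Proof.
under eq_bigr => l _.
  rewrite /G /A (_ : _ - _ = (x l * x l) * e i + ((e l * x l) * x i + ((x l * k) * (i == l)%:R
     + (B l * x l) * (- 2^-1 * x i)))); last by ring.
  over.
by rewrite /= !big_split /= !sum_deltar -!mulr_suml -/s -/c -/b; ring.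
Qed.

(** Every summed index of [A] meets x or [B], so only the contractions [Ax], [AB] and [BA] are
    needed. The trace [w] stays abstract; for g it becomes the gradient of ln u. *)
Lemma sum_quad (w : 'I_n -> R) i j : (forall l, \sum_m G m m l = w l) ->
  \sum_m \sum_l (G m m l * G l i j - G m j l * G l i m) =
  (\sum_l w l * x l) * A i j - 2^-1 * x i * x j * (\sum_l w l * B l)
  - (e i * s + (c + k) * x i) * (e j * s + (c + k) * x j)
  + 2^-1 * s * (x i * (e j * b + x j * be + k * B j) + x j * (e i * b + x i * be + k * B i))
  - 4^-1 * x i * x j * b ^+ 2.
Proof.
move=> hw.
have Ax j' : \sum_l A j' l * x l = e j' * s + (c + k) * x j'.
  under eq_bigr => l _.
    rewrite /A (_ : _ * _ = (x l * x l) * e j' + ((e l * x l) * x j' + (x l * k) * (j' == l)%:R)); last by ring.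
    over.
  by rewrite /= !big_split /= !sum_deltar -!mulr_suml -/s -/c; ring.
have AB j' : \sum_l A j' l * B l = e j' * b + x j' * be + k * B j'.
  under eq_bigr => l _.
    rewrite /A (_ : _ * _ = (B l * x l) * e j' + ((e l * B l) * x j' + (B l * k) * (j' == l)%:R)); last by ring.
    over.
  by rewrite /= !big_split /= !sum_deltar -!mulr_suml -/b -/be; ring.
have BA j' : \sum_l B l * A j' l = e j' * b + x j' * be + k * B j'.
  by rewrite -AB; apply: eq_bigr => l _; rewrite mulrC.
under eq_bigr => m _ do rewrite sumrB.
rewrite sumrB -[in RHS]addrA -[in RHS]addrA -[in RHS]addrA -[in RHS]addrA addrA.
rewrite -[X in _ = _ + X]opprK; congr (_ - _).
  rewrite exchange_big /=; under eq_bigr => l _.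
    rewrite -mulr_suml hw /G (_ : _ * _ = (w l * x l) * A i j + (w l * B l) * (- 2^-1 * x i * x j)); last by ring.
    over.
  by rewrite /= !big_split /= -!mulr_suml; ring.
under eq_bigr => m _.
  under eq_bigr => l _.
    rewrite /G (_ : _ * _ = (A j l * x l) * (x m * A i m) + ((B l * A j l) * (x m * x m * x i * - 2^-1)
      + ((x l * x l) * (- 2^-1 * x j * B m * A i m) + (B l * x l) * (4^-1 * x j * x i * (B m * x m))))); last by field.
    over.
  rewrite /= !big_split /= -!mulr_suml Ax -/s -/b.
  rewrite BA (_ : _ + (_ + (_ + _)) = (A i m * x m) * (e j * s + (c + k) * x j)
     + ((x m * x m) * ((e j * b + x j * be + k * B j) * x i * - 2^-1)
     + ((A i m * B m) * (s * - 2^-1 * x j) + (B m * x m) * (b * (4^-1 * x j * x i))))); last by ring.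
  over.
by rewrite /= !big_split /= -!mulr_suml Ax AB -/s -/b; ring.
Qed.

End RicciAlgebra.

(** * Bilinear forms in coordinates *)

Section Bilinear.
Context {R : comRingType} {n : nat}.
Implicit Types (a b p q : 'I_n -> R) (f g : 'I_n -> 'I_n -> R).

Definition dp a p := \sum_i a i * p i.
Definition bil a b f := \sum_i \sum_j a i * b j * f i j.

Lemma dpC a p : dp a p = dp p a.
Proof. by apply: eq_bigr => i _; rewrite mulrC. Qed.

Lemma bilD a b f g : bil a b (fun i j => f i j + g i j) = bil a b f + bil a b g.
Proof.
rewrite /bil -big_split; apply: eq_bigr => i _; rewrite -big_split.
by apply: eq_bigr => j _; rewrite /= mulrDr.
Qed.

Lemma bilN a b f : bil a b (fun i j => - f i j) = - bil a b f.
Proof.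
rewrite /bil -sumrN; apply: eq_bigr => i _; rewrite -sumrN.
by apply: eq_bigr => j _; rewrite mulrN.
Qed.

Lemma bilZ a b t f : bil a b (fun i j => t * f i j) = t * bil a b f.
Proof.
rewrite /bil mulr_sumr; apply: eq_bigr => i _; rewrite mulr_sumr.
by apply: eq_bigr => j _; rewrite mulrCA.
Qed.

Lemma bil_sep a b p q : bil a b (fun i j => p i * q j) = dp a p * dp b q.
Proof.
rewrite /bil /dp big_distrlr; apply: eq_bigr => i _; apply: eq_bigr => j _ /=; ring.
Qed.

Lemma bil_delta a b : bil a b (fun i j => (i == j)%:R) = dp a b.
Proof. by apply: eq_bigr => i _; rewrite sum_deltar. Qed.

Lemma eq_bil a b f g : (forall i j, f i j = g i j) -> bil a b f = bil a b g.
Proof. by move=> fg; apply: eq_bigr => i _; apply: eq_bigr => j _; rewrite fg. Qed.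

Lemma bilC a b f : bil a b f = bil b a (fun i j => f j i).
Proof.
rewrite /bil exchange_big; apply: eq_bigr => i _; apply: eq_bigr => j _ /=; ring.
Qed.

Lemma bil_dp a b f : bil a b f = dp a (fun i => dp b (f i)).
Proof.
apply: eq_bigr => i _; rewrite mulr_sumr; apply: eq_bigr => j _; exact: esym (mulrA _ _ _).
Qed.

Lemma dpD a p q : dp a (fun i => p i + q i) = dp a p + dp a q.
Proof. by rewrite -big_split; apply: eq_bigr => i _; rewrite mulrDr. Qed.

Lemma dpZ a p t : dp a (fun i => t * p i) = t * dp a p.
Proof. by rewrite mulr_sumr; apply: eq_bigr => i _; rewrite mulrCA. Qed.

Lemma eq_dp a p q : p =1 q -> dp a p = dp a q.
Proof. by move=> pq; apply: eq_bigr => i _; rewrite pq. Qed.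

End Bilinear.

(** * Christoffel symbols and Ricci tensor of g *)

Section Geometry.
Context {R : realType} {n : nat} (r0 : R) (u : 'rV[R]_n -> R).
Hypothesis r0_gt0 : 0 < r0.
Let U : set 'rV[R]_n := exterior r0.
Hypothesis su : smooth_on U u.
Hypothesis u_gt0 : forall x, U x -> 0 < u x.
Implicit Types x : 'rV[R]_n.

Let oU : open U. Proof. exact: open_exterior (ltW r0_gt0). Qed.
Let u0 x : U x -> u x != 0. Proof. by move=> /u_gt0; exact: lt0r_neq0. Qed.
Let s0 x : U x -> r2 x != 0.
Proof. by move=> /(r2_gt0 (ltW r0_gt0)); exact: lt0r_neq0. Qed.

(** With h = u^2 [kk] the metric is delta_ij + h x_i x_j. Then [ee] is grad h / (2 u^2), [cc] its
    contraction with x, and [BB] is the gradient of h with its index raised by g. *)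
Definition kk x := (1 - (u x)^-1 * (u x)^-1) * (r2 x)^-1.
Definition ee i x := (dpd i u x * (u x)^-1 - kk x * x ord0 i) * (r2 x)^-1.
Definition cc x := \sum_i ee i x * x ord0 i.
Definition BB i x := 2 * (u x * u x) * (ee i x - kk x * cc x * x ord0 i).

Lemma smooth_kk : smooth_on U kk.
Proof. by rewrite /kk; smt; try exact: smooth_r2. Qed.
Let skk := smooth_kk.

Lemma smooth_ee i : smooth_on U (ee i).
Proof. by rewrite /ee; smt; try exact: smooth_r2. Qed.
Let see := smooth_ee.

Lemma smooth_cc : smooth_on U cc.
Proof. by rewrite /cc; smt. Qed.
Let scc := smooth_cc.

Lemma smooth_BB i : smooth_on U (BB i).
Proof. by rewrite /BB; smt. Qed.

Lemma kk_pd x m : U x ->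
  dpd m kk x = (2 * dpd m u x / u x ^+ 3 - 2 * kk x * x ord0 m) / r2 x.
Proof.
move=> Ux; have := s0 Ux; have := u0 Ux => u0x s0x.
have um := smooth_isd_pd m su Ux; have rm := r2_pd m x.
apply: pd_isd; rewrite /kk; isd.
by field; rewrite ?u0x ?s0x.
Qed.

Lemma ee_pd x i m : U x ->
  dpd m (ee i) x = (dpd m (dpd i u) x / u x - dpd i u x * dpd m u x / u x ^+ 2
     - dpd m kk x * x ord0 i - kk x * (i == m)%:R) / r2 x - 2 * x ord0 m * ee i x / r2 x.
Proof.
move=> Ux; have := s0 Ux; have := u0 Ux => u0x s0x.
have um := smooth_isd_pd m su Ux; have rm := r2_pd m x.
have km := smooth_isd_pd m skk Ux; have uim := smooth_isd_pd m (smooth_pd i su) Ux.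
apply: pd_isd; rewrite /ee; isd.
by rewrite evE [m == i]eq_sym; field; rewrite ?u0x ?s0x.
Qed.

Lemma ccE x : U x -> cc x = ((\sum_i dpd i u x * x ord0 i) / u x - kk x * r2 x) / r2 x.
Proof.
move=> Ux; rewrite /cc /ee.
under eq_bigr => i _.
  rewrite (_ : _ * _ = (dpd i u x * x ord0 i) * ((u x)^-1 / r2 x)
     + (x ord0 i * x ord0 i) * (- kk x / r2 x)); last by ring.
  over.
by rewrite /= big_split /= -!mulr_suml -/(r2 x); ring.
Qed.

Lemma u2kk x : U x -> u x * u x * (1 - kk x * r2 x) = 1.
Proof. by move=> Ux; rewrite /kk; field; rewrite u0 // s0. Qed.

Lemma sumB x : U x -> \sum_i BB i x * x ord0 i = 2 * cc x.
Proof.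
move=> Ux; rewrite /BB.
under eq_bigr => i _.
  rewrite (_ : _ * _ = (ee i x * x ord0 i) * (2 * (u x * u x))
     + (x ord0 i * x ord0 i) * (- 2 * (u x * u x) * kk x * cc x)); last by ring.
  over.
rewrite /= big_split /= -!mulr_suml -/(r2 x) -/(cc x).
transitivity (2 * cc x * (u x * u x * (1 - kk x * r2 x))); first ring.
by rewrite u2kk // mulr1.
Qed.

Lemma gmet_pd x i j l : U x -> dpd i (gmet u j l) x =
  2 * (u x * u x) * ee i x * x ord0 j * x ord0 l
  + (u x * u x) * kk x * ((i == j)%:R * x ord0 l + (i == l)%:R * x ord0 j).
Proof.
move=> Ux; have := s0 Ux; have := u0 Ux => u0x s0x.
have um := smooth_isd_pd i su Ux; have rm := r2_pd i x.
have -> : dpd i (gmet u j l) x =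
    dpd i (fun y => (j == l)%:R + (u y * u y - 1) * y ord0 j * y ord0 l * (r2 y)^-1) x.
  apply: (@pd_eq_on _ _ U) => // y Uy; rewrite /gmet eradius_sqr expr2.
  by rewrite eq_sym.
apply: pd_isd; isd.
rewrite !evE /ee /kk; field; by rewrite ?u0x ?s0x.
Qed.

Lemma gmetE x i j : gmet u i j x = (i == j)%:R + (u x * u x - 1) / r2 x * x ord0 i * x ord0 j.
Proof. by rewrite /gmet eradius_sqr expr2; ring. Qed.

Lemma invmx_eq (A B : 'M[R]_n) : A *m B = 1%:M -> invmx A = B.
Proof.
move=> AB; have [uA _] := mulmx1_unit AB.
by rewrite -[invmx A]mulmx1 -AB mulmxA mulVmx // mul1mx.
Qed.

(** The metric is a rank one perturbation of the identity, so its inverse is given by the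
    Sherman-Morrison formula. *)
Lemma ginvE x i j : U x -> ginv u i j x = (i == j)%:R - kk x * x ord0 i * x ord0 j.
Proof.
move=> Ux; rewrite /ginv.
rewrite (@invmx_eq _ (\matrix_(i, j) ((i == j)%:R - kk x * x ord0 i * x ord0 j))) ?mxE //.
apply/matrixP => a b; rewrite !mxE.
rewrite (eq_bigr (fun l => ((l == b)%:R - kk x * x ord0 l * x ord0 b) * (a == l)%:R
     + ((x ord0 l * ((u x * u x - 1) / r2 x * x ord0 a)) * (l == b)%:R
     + (x ord0 l * x ord0 l) * (- (u x * u x - 1) / r2 x * kk x * x ord0 a * x ord0 b)))).
  rewrite /= !big_split /= sum_deltar sum_delta -mulr_suml -/(r2 x) /kk.
  by field; rewrite ?u0 ?s0.
by move=> l _; rewrite !mxE gmetE; ring.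
Qed.

Lemma christE x l i j : U x -> christ u l i j x =
  x ord0 l * (ee i x * x ord0 j + ee j x * x ord0 i + kk x * (i == j)%:R)
  - 2^-1 * x ord0 i * x ord0 j * BB l x.
Proof.
move=> Ux; rewrite /christ pdE.
rewrite (eq_bigr (fun m => ((x ord0 m * (2 * (u x * u x) * (ee i x * x ord0 j + ee j x * x ord0 i + kk x * (i == j)%:R))
     + ee m x * (- 2 * (u x * u x) * x ord0 i * x ord0 j))) * (l == m)%:R
   + ((x ord0 m * x ord0 m) * (- 2 * (u x * u x) * kk x * x ord0 l * (ee i x * x ord0 j + ee j x * x ord0 i + kk x * (i == j)%:R))
   + (ee m x * x ord0 m) * (2 * (u x * u x) * kk x * x ord0 l * x ord0 i * x ord0 j)))); last first.
  by move=> m _; rewrite ginvE // !gmet_pd // [j == i]eq_sym [m == i]eq_sym [m == j]eq_sym; ring.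
rewrite /= !big_split /= sum_deltar -!mulr_suml -/(r2 x) -/(cc x) /BB.
set A := _ + _ + kk x * _.
have E : u x * u x * kk x * r2 x = u x * u x - 1 by have := u2kk Ux; lra.
transitivity (x ord0 l * A * (u x * u x) - x ord0 l * A * (u x * u x * kk x * r2 x)
  - (u x * u x) * x ord0 i * x ord0 j * ee l x + (u x * u x) * kk x * x ord0 l * x ord0 i * x ord0 j * cc x).
  by field.
by rewrite E; field.
Qed.

(** The Cartesian determinant of g is u^2, so the trace is the gradient of ln u. *)
Lemma christ_trace x i : U x -> \sum_l christ u l i l x = dpd i u x / u x.
Proof.
move=> Ux; under eq_bigr do rewrite christE //.
rewrite (sum_trace (fun i => x ord0 i) (fun i => ee i x) (fun i => BB i x) (kk x) i).
by rewrite sumB // -/(cc x) -/(r2 x) /ee; field; rewrite u0 // s0.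
Qed.

Lemma christ_pd x m l i j : U x -> is_derive x (ev m) (christ u l i j)
  ((l == m)%:R * (ee i x * x ord0 j + ee j x * x ord0 i + kk x * (i == j)%:R)
  + x ord0 l * (dpd m (ee i) x * x ord0 j + ee i x * (j == m)%:R
     + dpd m (ee j) x * x ord0 i + ee j x * (i == m)%:R + dpd m kk x * (i == j)%:R)
  - 2^-1 * ((i == m)%:R * x ord0 j * BB l x + x ord0 i * (j == m)%:R * BB l x
     + x ord0 i * x ord0 j * dpd m (BB l) x)).
Proof.
move=> Ux.
have km := smooth_isd_pd m skk Ux; have em j' := smooth_isd_pd m (smooth_ee j') Ux.
have emi := em i; have emj := em j; have bm := smooth_isd_pd m (smooth_BB l) Ux.
pose f (y : 'rV[R]_n) := y ord0 l * (ee i y * y ord0 j + ee j y * y ord0 i + kk y * (i == j)%:R)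
  - 2^-1 * y ord0 i * y ord0 j * BB l y.
apply: (@near_eq_is_derive _ _ _ f).
  by apply: open_near oU Ux _ => y Uy; rewrite /f christE.
rewrite /f; isd.
by rewrite !evE [m == l]eq_sym [m == i]eq_sym [m == j]eq_sym; ring.
Qed.

Definition Euler (f : 'rV[R]_n -> R) x := \sum_i dpd i f x * x ord0 i.

Lemma ricciE x i j : U x -> ricci u i j x =
  n%:R * (ee i x * x ord0 j + ee j x * x ord0 i + kk x * (i == j)%:R)
  + (Euler (ee i) x * x ord0 j + ee i x * x ord0 j + Euler (ee j) x * x ord0 i
     + ee j x * x ord0 i + Euler kk x * (i == j)%:R)
  - 2^-1 * (x ord0 j * BB i x + x ord0 i * BB j x + x ord0 i * x ord0 j * \sum_l dpd l (BB l) x)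
  - (dpd j (dpd i u) x / u x - dpd i u x * dpd j u x / u x ^+ 2)
  + (Euler u x / u x * (ee i x * x ord0 j + ee j x * x ord0 i + kk x * (i == j)%:R)
     - 2^-1 * x ord0 i * x ord0 j * (\sum_l dpd l u x / u x * BB l x)
     - (ee i x * r2 x + (cc x + kk x) * x ord0 i) * (ee j x * r2 x + (cc x + kk x) * x ord0 j)
     + 2^-1 * r2 x * (x ord0 i * (ee j x * (2 * cc x) + x ord0 j * (\sum_l ee l x * BB l x) + kk x * BB j x)
                    + x ord0 j * (ee i x * (2 * cc x) + x ord0 i * (\sum_l ee l x * BB l x) + kk x * BB i x))
     - 4^-1 * x ord0 i * x ord0 j * (2 * cc x) ^+ 2).
Proof.
move=> Ux; rewrite /ricci pdE big_split /= sumrB.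
rewrite [X in X - _ + _](eq_bigr _ (fun l _ => pd_isd (christ_pd l l i j Ux))).
rewrite (sum_div (fun i => x ord0 i) (fun i => ee i x) (fun i => BB i x)
  (fun i m => dpd m (ee i) x) (fun l m => dpd m (BB l) x) (kk x) (fun m => dpd m kk x)).
(* The trace is differentiated in its closed form, which spares the derivatives of [ee] and [BB]. *)
have -> : \sum_l dpd j (christ u l i l) x = dpd j (dpd i u) x / u x - dpd i u x * dpd j u x / u x ^+ 2.
  have uj := smooth_isd_pd j su Ux; have uij := smooth_isd_pd j (smooth_pd i su) Ux.
  have H1 : is_derive x (ev j) (fun y => \sum_l christ u l i l y) (\sum_l dpd j (christ u l i l) x).
    by apply: isd_sum => l; have H := christ_pd j l i l Ux; rewrite (pd_isd H).
  have u0x := u0 Ux.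
  have H2 : is_derive x (ev j) (fun y => dpd i u y / u y) (dpd j (dpd i u) x / u x - dpd i u x * dpd j u x / u x ^+ 2).
    by isd; field; rewrite ?u0x.
  by apply: (isd_eq_on oU _ Ux H1 H2) => y Uy; rewrite christ_trace.
have hw l : \sum_m (x ord0 m * (ee m x * x ord0 l + ee l x * x ord0 m + kk x * (m == l)%:R)
     - 2^-1 * x ord0 m * x ord0 l * BB m x) = dpd l u x / u x.
  rewrite -christ_trace //; apply: eq_bigr => m _; rewrite christE // eq_sym; ring.
have := sum_quad i j hw; rewrite sumB // => HQ.
have -> : \sum_i0 \sum_l (christ u i0 i0 l x * christ u l i j x - christ u i0 j l x * christ u l i i0 x) =
  \sum_m \sum_l ((x ord0 m * (ee m x * x ord0 l + ee l x * x ord0 m + kk x * (m == l)%:R)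
     - 2^-1 * x ord0 m * x ord0 l * BB m x)
    * (x ord0 l * (ee i x * x ord0 j + ee j x * x ord0 i + kk x * (i == j)%:R)
     - 2^-1 * x ord0 i * x ord0 j * BB l x)
    - (x ord0 m * (ee j x * x ord0 l + ee l x * x ord0 j + kk x * (j == l)%:R)
     - 2^-1 * x ord0 j * x ord0 l * BB m x)
    * (x ord0 l * (ee i x * x ord0 m + ee m x * x ord0 i + kk x * (i == m)%:R)
     - 2^-1 * x ord0 i * x ord0 m * BB l x)).
  by apply: eq_bigr => m _; apply: eq_bigr => l _; rewrite !christE.
rewrite HQ; congr (_ - _ + _).
have -> : \sum_l dpd l u x / u x * x ord0 l = Euler u x / u x.
  by rewrite /Euler mulr_suml; apply: eq_bigr => l _; ring.
by rewrite -/(r2 x) -/(cc x).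
Qed.

End Geometry.

(** * Ricci tensor and Hessian in radial and tangential directions *)

Section Contractions.
Context {R : realType} {n : nat} (r0 : R) (u : 'rV[R]_n -> R).
Hypothesis r0_gt0 : 0 < r0.
Let U : set 'rV[R]_n := exterior r0.
Hypothesis su : smooth_on U u.
Hypothesis u_gt0 : forall x, U x -> 0 < u x.
Implicit Types x : 'rV[R]_n.

Let oU : open U. Proof. exact: open_exterior (ltW r0_gt0). Qed.
Let u0 x : U x -> u x != 0. Proof. by move=> /u_gt0; exact: lt0r_neq0. Qed.
Let s0 x : U x -> r2 x != 0.
Proof. by move=> /(r2_gt0 (ltW r0_gt0)); exact: lt0r_neq0. Qed.

Definition coo x i := x ord0 i.
Definition grad (f : 'rV[R]_n -> R) x i := dpd i f x.
Definition hs (f : 'rV[R]_n -> R) x i j := dpd j (dpd i f) x.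

Lemma dp_coo x : dp (coo x) (coo x) = r2 x. Proof. by []. Qed.

Lemma dp_grad x f : dp (coo x) (grad f x) = Euler f x.
Proof. by rewrite dpC. Qed.

Notation e := (fun x i => ee u i x).
Notation B := (fun x i => BB u i x).
Notation k := (kk u).
Notation c := (cc u).
Notation Ee := (fun x i => Euler (ee u i) x).

(** As a combination of products of covectors, the Kronecker symbol and the Euclidean Hessian, the
    tensor is evaluated on two vectors through dot products only. *)
Lemma ricci_sep x i j : U x -> ricci u i j x =
  (n%:R + 1 + Euler u x / u x - r2 x * k x) * (ee u i x * coo x j)
  + (n%:R + 1 + Euler u x / u x - r2 x * k x) * (coo x i * ee u j x)
  + ((n%:R + Euler u x / u x) * k x + Euler k x) * (i == j)%:R
  + Euler (ee u i) x * coo x j + coo x i * Euler (ee u j) x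
  + (2^-1 * (r2 x * k x - 1)) * (coo x i * BB u j x)
  + (2^-1 * (r2 x * k x - 1)) * (BB u i x * coo x j)
  + (- 2^-1 * (\sum_l dpd l (BB u l) x) - 2^-1 * (\sum_l dpd l u x / u x * BB u l x)
     - (c x + k x) ^+ 2 + r2 x * (\sum_l ee u l x * BB u l x) - c x ^+ 2) * (coo x i * coo x j)
  + (- (u x)^-1) * hs u x i j + (u x ^- 2) * (grad u x i * grad u x j)
  + (- r2 x ^+ 2) * (ee u i x * ee u j x).
Proof. by move=> Ux; rewrite (ricciE r0_gt0 su u_gt0) // /coo /hs /grad; field; rewrite u0. Qed.

Lemma bil_ricci x a b : U x -> bil a b (fun i j => ricci u i j x) =
  (n%:R + 1 + Euler u x / u x - r2 x * k x) * (dp a (e x) * dp b (coo x))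
  + (n%:R + 1 + Euler u x / u x - r2 x * k x) * (dp a (coo x) * dp b (e x))
  + ((n%:R + Euler u x / u x) * k x + Euler k x) * dp a b
  + dp a (Ee x) * dp b (coo x) + dp a (coo x) * dp b (Ee x)
  + (2^-1 * (r2 x * k x - 1)) * (dp a (coo x) * dp b (B x))
  + (2^-1 * (r2 x * k x - 1)) * (dp a (B x) * dp b (coo x))
  + (- 2^-1 * (\sum_l dpd l (BB u l) x) - 2^-1 * (\sum_l dpd l u x / u x * BB u l x)
     - (c x + k x) ^+ 2 + r2 x * (\sum_l ee u l x * BB u l x) - c x ^+ 2)
    * (dp a (coo x) * dp b (coo x))
  + (- (u x)^-1) * bil a b (hs u x) + (u x ^- 2) * (dp a (grad u x) * dp b (grad u x))
  + (- r2 x ^+ 2) * (dp a (e x) * dp b (e x)).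
Proof.
move=> Ux; rewrite (eq_bil _ _ (fun i j => ricci_sep i j Ux)).
by rewrite !bilD !bilZ !bil_sep bil_delta.
Qed.

Lemma dp_e x a : U x ->
  dp a (e x) = (dp a (grad u x) / u x - k x * dp a (coo x)) / r2 x.
Proof.
move=> Ux; rewrite (@eq_dp _ _ _ _ (fun i => (u x)^-1 / r2 x * grad u x i + (- k x / r2 x) * coo x i)).
  by rewrite dpD !dpZ; ring.
by move=> i; rewrite /ee /grad /coo; ring.
Qed.

Lemma Euler_k x : U x -> Euler k x = (2 * Euler u x / u x ^+ 3 - 2 * k x * r2 x) / r2 x.
Proof.
move=> Ux; rewrite /Euler.
rewrite (eq_bigr (fun i => (dpd i u x * x ord0 i) * (2 / u x ^+ 3 / r2 x)
   + (x ord0 i * x ord0 i) * (- 2 * k x / r2 x))).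
  by rewrite big_split /= -!mulr_suml -/(r2 x); ring.
by move=> i _; rewrite (kk_pd r0_gt0 su u_gt0) //; ring.
Qed.

(** All terms with [coo] drop out, and the two gradient products cancel because [r2] times [ee]
    agrees with grad u / u on tangent vectors. *)
Lemma ric_tan x a b : U x -> dp a (coo x) = 0 -> dp b (coo x) = 0 ->
  bil a b (fun i j => ricci u i j x) =
  dp a b * (((n%:R - 2) * (1 - u x ^- 2) + Euler u x / u x * (1 + u x ^- 2)) / r2 x)
  - bil a b (hs u x) / u x.
Proof.
move=> Ux ax bx; have u0x := u0 Ux; have s0x := s0 Ux.
rewrite bil_ricci // !dp_e // ax bx Euler_k // /kk.
by field; rewrite ?u0x ?s0x.
Qed.

Lemma dp_B x a : U x -> dp a (B x) =
  2 * (u x * u x) * (dp a (e x) - k x * c x * dp a (coo x)).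
Proof.
move=> Ux; rewrite (@eq_dp _ _ _ _ (fun i => (2 * (u x * u x)) * ee u i x
   + (- 2 * (u x * u x) * k x * c x) * coo x i)).
  by rewrite dpD !dpZ; ring.
by move=> i; rewrite /BB /coo; ring.
Qed.

Lemma cE x : U x -> c x = (Euler u x / u x - k x * r2 x) / r2 x.
Proof. by move=> Ux; exact: (ccE u Ux). Qed.

Lemma dp_Ee x a : U x -> dp a (Ee x) =
  (bil a (coo x) (hs u x) / u x - dp a (grad u x) * Euler u x / u x ^+ 2
   - Euler k x * dp a (coo x) - k x * dp a (coo x)) / r2 x - 2 * dp a (e x).
Proof.
move=> Ux; have u0x := u0 Ux; have s0x := s0 Ux.
have EeE i : Euler (ee u i) x = (dp (coo x) (hs u x i) / u x - grad u x i * Euler u x / u x ^+ 2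
   - Euler k x * coo x i - k x * coo x i) / r2 x - 2 * ee u i x.
  rewrite /Euler.
  rewrite (eq_bigr (fun m => (coo x m * hs u x i m) * ((u x)^-1 / r2 x)
     + ((dpd m u x * x ord0 m) * (- dpd i u x / u x ^+ 2 / r2 x)
     + ((dpd m k x * x ord0 m) * (- x ord0 i / r2 x)
     + ((x ord0 m * (- k x / r2 x)) * (i == m)%:R
     + (x ord0 m * x ord0 m) * (- 2 * ee u i x / r2 x)))))).
    rewrite /= !big_split /= sum_deltar -!mulr_suml -/(r2 x) -/(Euler u x) -/(Euler k x).
    rewrite -/(dp (coo x) (hs u x i)) /grad /coo.
    by field; rewrite ?u0x ?s0x.
  by move=> m _; rewrite (ee_pd r0_gt0 su u_gt0) // /hs /coo; field; rewrite ?u0x ?s0x.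
rewrite (@eq_dp _ _ _ _ (fun i => (u x)^-1 / r2 x * dp (coo x) (hs u x i)
   + (- Euler u x / u x ^+ 2 / r2 x) * grad u x i
   + (- (Euler k x + k x) / r2 x) * coo x i + (- 2) * ee u i x)).
  by rewrite !dpD !dpZ -bil_dp; ring.
by move=> i; rewrite EeE; ring.
Qed.

(** The second derivatives of u cancel here; this is what makes the mixed static equation usable as
    an ordinary differential equation along rays. *)
Lemma ric_mix x a : U x -> dp a (coo x) = 0 ->
  bil a (coo x) (fun i j => ricci u i j x) = (n%:R - 2) * dp a (grad u x) / u x.
Proof.
move=> Ux ax; have u0x := u0 Ux; have s0x := s0 Ux.
rewrite bil_ricci // !dp_Ee // !dp_B // !dp_e // ax dp_coo dp_grad cE // Euler_k // /kk.
by field; rewrite ?u0x ?s0x.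
Qed.

Definition lapl (f : 'rV[R]_n -> R) x := \sum_i dpd i (dpd i f) x.
Definition g2 (f g : 'rV[R]_n -> R) x := dp (grad f x) (grad g x).

Lemma div_e x : U x -> \sum_l dpd l (ee u l) x =
  (lapl u x / u x - g2 u u x / u x ^+ 2 - Euler k x - n%:R * k x) / r2 x - 2 * c x / r2 x.
Proof.
move=> Ux; have u0x := u0 Ux; have s0x := s0 Ux.
rewrite (eq_bigr (fun m => (dpd m (dpd m u) x) * ((u x)^-1 / r2 x)
     + ((dpd m u x * dpd m u x) * (- (u x) ^- 2 / r2 x)
     + ((dpd m k x * x ord0 m) * (- (r2 x)^-1)
     + ((- k x / r2 x) + (ee u m x * x ord0 m) * (- 2 / r2 x)))))).
  rewrite /= !big_split /= -!mulr_suml sumr_const card_ord -[_ *+ n]mulr_natl -/(c x) -/(Euler k x).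
  by rewrite -/(lapl u x) /g2 /dp /grad; field; rewrite ?u0x ?s0x.
by move=> m _; rewrite (ee_pd r0_gt0 su u_gt0) // eqxx /=; field; rewrite ?u0x ?s0x.
Qed.

Lemma Euler_c x : U x -> Euler c x = dp (coo x) (Ee x) + c x.
Proof.
move=> Ux; have se := smooth_ee r0_gt0 su u_gt0.
have cm m : dpd m c x = \sum_i (ee u i x * (m == i)%:R + x ord0 i * dpd m (ee u i) x).
  apply: pd_isd; rewrite /cc; apply: isd_sum => i.
  have ei := smooth_isd_pd m (se i) Ux.
  by isd; rewrite evE.
rewrite /Euler; under eq_bigr => m _.
  rewrite cm big_split /= sum_deltar mulrDl mulr_suml; over.
rewrite /= big_split /= -/(c x) addrC; congr (_ + _).
rewrite exchange_big /=; apply: eq_bigr => i _; rewrite /Euler /coo mulr_sumr.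
by apply: eq_bigr => m _; ring.
Qed.

Lemma div_B x : U x -> \sum_l dpd l (BB u l) x =
  4 * u x * (dp (grad u x) (e x) - k x * c x * Euler u x)
  + 2 * (u x * u x) * (\sum_l dpd l (ee u l) x - Euler k x * c x - k x * Euler c x - n%:R * k x * c x).
Proof.
move=> Ux; have se := smooth_ee r0_gt0 su u_gt0.
rewrite (eq_bigr (fun m => (dpd m u x * ee u m x) * (4 * u x)
   + ((dpd m u x * x ord0 m) * (- 4 * u x * k x * c x)
   + (dpd m (ee u m) x * (2 * (u x * u x)) + ((dpd m k x * x ord0 m) * (- 2 * (u x * u x) * c x)
   + ((dpd m c x * x ord0 m) * (- 2 * (u x * u x) * k x)
   - 2 * (u x * u x) * k x * c x)))))).
  rewrite /= !big_split /= -!mulr_suml sumrN sumr_const card_ord -[_ *+ n]mulr_natl -/(Euler k x) -/(Euler c x) -/(Euler u x).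
  by rewrite /dp /grad; ring.
move=> m _; apply: pd_isd; rewrite /BB.
have um := smooth_isd_pd m su Ux; have em := smooth_isd_pd m (se m) Ux.
have km := smooth_isd_pd m (smooth_kk r0_gt0 su u_gt0) Ux.
have cm := smooth_isd_pd m (smooth_cc r0_gt0 su u_gt0) Ux.
by isd; rewrite evE eqxx /=; ring.
Qed.

(** r^2 times the Laplacian of the sphere through x, that is, the Laplacian of the unit sphere at
    fixed radius. *)
Definition lapS (f : 'rV[R]_n -> R) x :=
  r2 x * lapl f x - bil (coo x) (coo x) (hs f x) - (n%:R - 1) * Euler f x.

Lemma ric_rad x : U x ->
  bil (coo x) (coo x) (fun i j => ricci u i j x) =
  (n%:R - 1) * (Euler u x / u x) - u x * lapS u x.
Proof.
move=> Ux; have u0x := u0 Ux; have s0x := s0 Ux.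
rewrite bil_ricci // div_B // div_e // Euler_c //.
rewrite (_ : \sum_l dpd l u x / u x * BB u l x = dp (grad u x) (B x) / u x); last first.
  by rewrite /dp mulr_suml; apply: eq_bigr => i _; rewrite /grad; ring.
rewrite (_ : \sum_l ee u l x * BB u l x = dp (e x) (B x)) //.
rewrite !dp_Ee // !dp_B // !dp_e // (dpC (e x)) (dpC (e x)) !dp_e //.
rewrite (dpC (grad u x) (coo x)) dp_grad dp_coo -/(g2 u u x) cE // Euler_k // /lapS /kk.
by field; rewrite ?u0x ?s0x.
Qed.

Lemma hess_sep x V i j : U x -> smooth_on U V -> hess u V i j x =
  hs V x i j + (- Euler V x) * (ee u i x * coo x j) + (- Euler V x) * (coo x i * ee u j x)
  + (- Euler V x * k x) * (i == j)%:R
  + (2^-1 * dp (grad V x) (B x)) * (coo x i * coo x j).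
Proof.
move=> Ux sV; rewrite /hess pdE (pd_comm i j oU sV Ux).
rewrite (eq_bigr (fun l => (dpd l V x * x ord0 l) * (ee u i x * x ord0 j + ee u j x * x ord0 i + kk u x * (i == j)%:R)
   + (dpd l V x * BB u l x) * (- 2^-1 * x ord0 i * x ord0 j))).
  by rewrite big_split /= -!mulr_suml -/(Euler V x) /dp /grad /coo /hs; ring.
by move=> l _; rewrite (christE r0_gt0 su u_gt0) //; ring.
Qed.

Lemma bil_hess x V a b : U x -> smooth_on U V -> bil a b (fun i j => hess u V i j x) =
  bil a b (hs V x) + (- Euler V x) * (dp a (e x) * dp b (coo x))
  + (- Euler V x) * (dp a (coo x) * dp b (e x)) + (- Euler V x * k x) * dp a b
  + (2^-1 * dp (grad V x) (B x)) * (dp a (coo x) * dp b (coo x)).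
Proof.
move=> Ux sV; rewrite (eq_bil _ _ (fun i j => hess_sep i j Ux sV)).
by rewrite !bilD !bilZ !bil_sep bil_delta.
Qed.

Lemma hess_tan x V a b : U x -> smooth_on U V -> dp a (coo x) = 0 -> dp b (coo x) = 0 ->
  bil a b (fun i j => hess u V i j x) =
  bil a b (hs V x) - dp a b * ((1 - u x ^- 2) / r2 x * Euler V x).
Proof.
move=> Ux sV ax bx; have u0x := u0 Ux; have s0x := s0 Ux.
by rewrite bil_hess // !dp_e // ax bx /kk; field; rewrite ?u0x ?s0x.
Qed.

Lemma hess_mix x V a : U x -> smooth_on U V -> dp a (coo x) = 0 ->
  bil a (coo x) (fun i j => hess u V i j x) =
  bil a (coo x) (hs V x) - dp a (grad u x) / u x * Euler V x.
Proof.
move=> Ux sV ax; have u0x := u0 Ux; have s0x := s0 Ux.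
by rewrite bil_hess // !dp_e // ax dp_coo; field; rewrite ?u0x ?s0x.
Qed.

(** The product of spherical gradients, normalized to the unit sphere. *)
Definition gamS (f g : 'rV[R]_n -> R) x := r2 x * g2 f g x - Euler f x * Euler g x.

Lemma hess_rad x V : U x -> smooth_on U V ->
  bil (coo x) (coo x) (fun i j => hess u V i j x) =
  bil (coo x) (coo x) (hs V x) - Euler u x / u x * Euler V x + u x * gamS u V x.
Proof.
move=> Ux sV; have u0x := u0 Ux; have s0x := s0 Ux.
rewrite bil_hess // dp_B // !dp_e // cE // (dpC (grad V x) (coo x)) !dp_grad dp_coo.
rewrite /gamS /g2 (dpC (grad u x) (grad V x)) /kk.
by field; rewrite ?u0x ?s0x.
Qed.

End Contractions.

(** * Gronwall's lemma *)

Section Gronwall.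
Context {R : realType}.
Implicit Types (f df : R -> R) (a b K : R).

Lemma isd_expM (f : R -> R) (d K x : R) : is_derive x (1 : R) f d ->
  is_derive x (1 : R) (fun t => f t * expR (K * t)) ((d + K * f x) * expR (K * x)).
Proof.
move=> fd.
have H : is_derive x (1 : R) (fun t => expR (K * t)) (expR (K * x) * K).
  have HK : is_derive x (1 : R) (fun t => K * t) K by isd; ring.
  exact: is_derive1_comp.
by isd; ring.
Qed.

(** Two-sided from the zero c: f exp(-Kx) is nonincreasing to the right of c and f exp(Kx) is
    nondecreasing to its left, while f is nonnegative. *)
Lemma gronwall f df a b K : (forall x, a <= x <= b -> is_derive x (1 : R) f (df x)) ->
  (forall x, a <= x <= b -> 0 <= f x) -> (forall x, a <= x <= b -> `|df x| <= K * f x) ->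
  forall c, a <= c <= b -> f c = 0 -> forall x, a <= x <= b -> f x = 0.
Proof.
move=> fd f0 fK c /andP [ac cb] fc x /andP [ax xb].
apply/eqP; rewrite eq_le f0 ?ax // andbT.
have [cx|xc] := leP c x.
  have H : 0 <= - (f x * expR (- K * x)).
    have -> : 0 = - (f c * expR (- K * c)) by rewrite fc mul0r oppr0.
    apply: (@isd_nondecr _ (fun t => - (f t * expR (- K * t)))
      (fun t => - ((df t + - K * f t) * expR (- K * t)))) => // y /andP [cy yx].
      by apply: isdN; apply: isd_expM; apply: fd; rewrite (le_trans ac cy) (le_trans yx xb).
    rewrite oppr_ge0 pmulr_lle0 ?expR_gt0 // mulNr subr_le0.
    apply: le_trans (ler_norm _) (fK _ _).
    by rewrite (le_trans ac cy) (le_trans yx xb).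
  by move: H; rewrite oppr_ge0 pmulr_lle0 ?expR_gt0.
have H : f x * expR (K * x) <= 0.
  have -> : 0 = f c * expR (K * c) by rewrite fc mul0r.
  apply: (@isd_nondecr _ (fun t => f t * expR (K * t))
      (fun t => (df t + K * f t) * expR (K * t))); first exact: ltW.
    move=> y /andP [xy yc].
    by apply: isd_expM; apply: fd; rewrite (le_trans ax xy) (le_trans yc cb).
  move=> y /andP [xy yc]; rewrite mulr_ge0 ?expR_ge0 //.
  have := fK y; rewrite (le_trans ax xy) (le_trans yc cb) => /(_ isT) H.
  by rewrite -lerBlDr sub0r; move: H; rewrite ler_norml => /andP [].
by move: H; rewrite pmulr_lle0 ?expR_gt0.
Qed.

Lemma continuous_bounded f a b : (forall x, a <= x <= b -> {for x, continuous f}) ->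
  exists K, forall x, a <= x <= b -> `|f x| <= K.
Proof.
move=> cf; have [ba|ab] := ltP b a.
  by exists 0 => x /andP [ax xb]; have := le_lt_trans (le_trans ax xb) ba; rewrite ltxx.
have cf' : {within `[a, b], continuous (fun x => `|f x|)}.
  apply: continuous_in_subspaceT => x; rewrite inE /= in_itv /= => xab.
  by apply: continuous_comp; [exact: cf|exact: norm_continuous].
have [c _ cmax] := EVT_max ab cf'.
by exists `|f c| => x xab; apply: cmax; rewrite in_itv.
Qed.

End Gronwall.

(** * Great circles *)

Section Arcs.
Context {R : realType} {n : nat}.
Implicit Types x y b : 'rV[R]_n.

(** For b orthogonal to x and of the same length this is the great circle through x with initial
    velocity b. *)
Definition gcirc x b (t : R) : 'rV[R]_n := cos t *: x + sin t *: b.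

Lemma gcirc_isd x b t k :
  is_derive t (1 : R) (fun t => gcirc x b t ord0 k) ((- sin t) * x ord0 k + cos t * b ord0 k).
Proof.
have -> : (fun t => gcirc x b t ord0 k) = (fun t => cos t * x ord0 k + sin t * b ord0 k).
  by apply/funext => s; rewrite !mxE.
have hc := is_derive_cos t; have hs := is_derive_sin t.
by isd; ring.
Qed.

Lemma r2_gcirc x b t : r2 b = r2 x -> dp (coo x) (coo b) = 0 -> r2 (gcirc x b t) = r2 x.
Proof.
move=> bx xb; rewrite /r2 (eq_bigr (fun i => (x ord0 i * x ord0 i) * cos t ^+ 2
  + ((coo x i * coo b i) * (2 * cos t * sin t) + (b ord0 i * b ord0 i) * sin t ^+ 2))).
  rewrite !big_split /= -!mulr_suml -/(r2 x) -/(r2 b) -/(dp (coo x) (coo b)) xb bx.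
  by rewrite mul0r add0r -mulrDr cos2Dsin2 mulr1.
by move=> i _; rewrite /coo !mxE; ring.
Qed.

Lemma gcirc0 x b : gcirc x b 0 = x.
Proof. by rewrite /gcirc cos0 sin0 scale0r addr0 scale1r. Qed.

Lemma r2_eq0 x : r2 x = 0 -> x = 0.
Proof.
move=> h; apply/rowP => i; rewrite mxE; apply/eqP; rewrite -sqrf_eq0 expr2.
have := h => /eqP; rewrite /r2 psumr_eq0 => [/allP /(_ i)|j _]; last by rewrite -expr2 sqr_ge0.
by rewrite mem_index_enum => /(_ isT).
Qed.

Lemma r2Z x t : r2 (t *: x) = t ^+ 2 * r2 x.
Proof. by rewrite /r2 mulr_sumr; apply: eq_bigr => i _; rewrite !mxE; ring. Qed.

Lemma orth_exists x : (2 <= n)%N -> 0 < r2 x ->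
  exists b, r2 b = r2 x /\ dp (coo x) (coo b) = 0.
Proof.
move=> n2 x0.
suff [w [w0 xw]] : exists w, 0 < r2 w /\ dp (coo x) (coo w) = 0.
  exists (Num.sqrt (r2 x / r2 w) *: w); split.
    by rewrite r2Z sqr_sqrtr ?divfK ?gt_eqF // divr_ge0 // ltW.
  rewrite /dp (eq_bigr (fun i => Num.sqrt (r2 x / r2 w) * (coo x i * coo w i))).
    by rewrite -mulr_sumr -/(dp _ _) xw mulr0.
  by move=> i _; rewrite /coo mxE; ring.
have [i xi] : exists i, x ord0 i != 0.
  apply: contrapT => H; move: x0; rewrite /r2 big1 ?ltxx // => i _.
  have [->|xi] := eqVneq (x ord0 i) 0; first by rewrite mulr0.
  by case: H; exists i.
have [j ij] : exists j : 'I_n, j != i.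
  have [i0|i0] := eqVneq (i : nat) 0%N.
    by exists (Ordinal n2); rewrite -val_eqE /= i0.
  by exists (Ordinal (ltnW n2)); rewrite -val_eqE /= eq_sym.
exists (x ord0 i *: ev j - x ord0 j *: ev i); split.
  rewrite /r2 (bigD1 j) //= ltr_pwDl ?sumr_ge0 // => [|k _]; last by rewrite -expr2 sqr_ge0.
  rewrite !mxE !eqxx (negbTE ij) /= mulr0 subr0 mulr1.
  by rewrite -expr2 exprn_even_gt0.
rewrite /dp (eq_bigr (fun k => (x ord0 k * x ord0 i) * (j == k)%:R + (- x ord0 k * x ord0 j) * (i == k)%:R)).
  by rewrite big_split /= !sum_deltar; ring.
by move=> k _; rewrite /coo !mxE eqxx /= [k == j]eq_sym [k == i]eq_sym; ring.
Qed.

Lemma gcirc_exists x y : (2 <= n)%N -> 0 < r2 x -> r2 y = r2 x ->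
  exists b t, [/\ r2 b = r2 x, dp (coo x) (coo b) = 0, 0 <= t <= pi & gcirc x b t = y].
Proof.
move=> n2 x0 yx; have x0' := lt0r_neq0 x0.
pose d := dp (coo x) (coo y) / r2 x.
pose w := y - d *: x.
have xw : dp (coo x) (coo w) = 0.
  rewrite /dp (eq_bigr (fun i => coo x i * coo y i + (x ord0 i * x ord0 i) * - d)).
    by rewrite big_split /= -mulr_suml -/(dp _ _) -/(r2 x) /d; field.
  by move=> i _; rewrite /w /coo !mxE; ring.
have wE : r2 w = r2 x * (1 - d ^+ 2).
  rewrite /r2 (eq_bigr (fun i => y ord0 i * y ord0 i + ((coo x i * coo y i) * (- 2 * d) + (x ord0 i * x ord0 i) * d ^+ 2))).
    rewrite !big_split /= -!mulr_suml -/(dp (coo x) (coo y)) -/(r2 x) -/(r2 y) yx.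
    have -> : dp (coo x) (coo y) = d * r2 x by rewrite /d divfK.
    by ring.
  by move=> i _; rewrite /w /coo !mxE; ring.
have d1 : 0 <= 1 - d ^+ 2 by have := r2_ge0 w; rewrite wE pmulr_rge0.
have dI : -1 <= d <= 1.
  by rewrite -ler_norml -(@ler_pXn2r _ 2) ?nnegrE // expr1n -normrX ger0_norm ?sqr_ge0 // -subr_ge0.
have cd : cos (acos d) = d by rewrite acosK // in_itv.
have sd : sin (acos d) = Num.sqrt (1 - d ^+ 2) by rewrite sin_acos.
(* In this case y is x or its antipode and determines no direction, so any orthogonal vector
   serves. *)
have [w0|w0] := eqVneq (1 - d ^+ 2) 0.
  have [b [bx xb]] := orth_exists n2 x0.
  exists b, (acos d); split=> //; first by rewrite acos_ge0 // acos_lepi.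
  rewrite /gcirc cd sd w0 sqrtr0 scale0r addr0.
  have : w = 0 by apply: r2_eq0; rewrite wE w0 mulr0.
  by move/eqP; rewrite subr_eq0 => /eqP.
have sq0 : Num.sqrt (1 - d ^+ 2) != 0 by rewrite sqrtr_eq0 -ltNge lt0r w0.
exists ((Num.sqrt (1 - d ^+ 2))^-1 *: w), (acos d); split.
- by rewrite r2Z exprVn sqr_sqrtr // wE mulrCA mulVf // mulr1.
- rewrite /dp (eq_bigr (fun i => (Num.sqrt (1 - d ^+ 2))^-1 * (coo x i * coo w i))).
    by rewrite -mulr_sumr -/(dp _ _) xw mulr0.
  by move=> i _; rewrite /coo mxE; ring.
- by rewrite acos_ge0 // acos_lepi.
- by rewrite /gcirc cd sd scalerA divff // scale1r addrC subrK.
Qed.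

End Arcs.

(** * Traces over the tangent space of a sphere *)

Section Trace.
Context {R : realType} {n : nat}.
Variables (x : 'rV[R]_n) (f : 'I_n -> 'I_n -> R).
Hypothesis x0 : r2 x != 0.

(** Row i is the orthogonal projection of the i-th basis vector to the tangent space. These n
    vectors form a Parseval frame there, so a tangential trace needs no choice of an orthonormal
    basis. *)
Definition tproj (x : 'rV[R]_n) (i k : 'I_n) : R := (i == k)%:R - x ord0 i * x ord0 k / r2 x.

Lemma tproj_coo i : dp (tproj x i) (coo x) = 0.
Proof.
rewrite /dp (eq_bigr (fun k => coo x k * (i == k)%:R + (x ord0 k * x ord0 k) * (- x ord0 i / r2 x))).
  by rewrite big_split /= sum_deltar -mulr_suml -/(r2 x) /coo; field.
by move=> k _; rewrite /tproj /coo; ring.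
Qed.

Lemma trace_tproj : \sum_i f i i = \sum_i bil (tproj x i) (tproj x i) f + bil (coo x) (coo x) f / r2 x.
Proof.
have bE i : bil (tproj x i) (tproj x i) f = f i i - (dp (coo x) (f i) * x ord0 i) / r2 x
    - (dp (coo x) (fun k => f k i) * x ord0 i) / r2 x
    + (x ord0 i * x ord0 i) * (bil (coo x) (coo x) f / r2 x ^+ 2).
  have dpE g : dp (tproj x i) g = g i - x ord0 i / r2 x * dp (coo x) g.
    rewrite /dp (eq_bigr (fun k => g k * (i == k)%:R + (coo x k * g k) * (- x ord0 i / r2 x))).
      by rewrite big_split /= sum_deltar -mulr_suml; ring.
    by move=> k _; rewrite /tproj /coo; ring.
  rewrite !bil_dp dpE dpE.
  rewrite (@eq_dp _ _ _ (fun k => dp (tproj x i) (f k)) (fun k => f k i + (- x ord0 i / r2 x) * dp (coo x) (f k))).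
    by rewrite dpD dpZ; field.
  by move=> k; rewrite dpE; ring.
rewrite (eq_bigr _ (fun i _ => bE i)) !big_split /= !sumrN -!mulr_suml -/(r2 x).
have -> : \sum_i dp (coo x) (f i) * x ord0 i = bil (coo x) (coo x) f.
  by rewrite bil_dp; apply: eq_bigr => i _; rewrite mulrC.
have -> : \sum_i dp (coo x) (fun k => f k i) * x ord0 i = bil (coo x) (coo x) f.
  by rewrite bilC bil_dp; apply: eq_bigr => i _; rewrite mulrC.
by field.
Qed.
End Trace.

(** * The static equations, split by direction, and their linear jet system *)

Section StaticEquations.
Context {R : realType} {n : nat} (r0 : R) (u V : 'rV[R]_n -> R).
Hypothesis n3 : (3 <= n)%N.
Hypothesis r0_gt0 : 0 < r0.
Let U : set 'rV[R]_n := exterior r0.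
Hypothesis su : smooth_on U u.
Hypothesis u_gt0 : forall x, U x -> 0 < u x.
Hypothesis sV : smooth_on U V.
Hypothesis hessE : forall x, U x -> forall i j : 'I_n, hess u V i j x = V x * ricci u i j x.
Hypothesis lapE : forall x, U x -> lap u V x = 0.
Implicit Types x : 'rV[R]_n.

Let oU : open U. Proof. exact: open_exterior (ltW r0_gt0). Qed.
Let u0 x : U x -> u x != 0. Proof. by move=> /u_gt0; exact: lt0r_neq0. Qed.
Let s0 x : U x -> r2 x != 0.
Proof. by move=> /(r2_gt0 (ltW r0_gt0)); exact: lt0r_neq0. Qed.

Lemma bil_hessE x a b : U x ->
  bil a b (fun i j => hess u V i j x) = V x * bil a b (fun i j => ricci u i j x).
Proof. by move=> Ux; rewrite -bilZ; apply: eq_bil => i j; exact: hessE. Qed.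

Definition tan_coef (d : R) (u V : 'rV[R]_n -> R) x :=
  ((u x - (u x)^-1) * Euler V x
   + V x * (d * (u x - (u x)^-1) + Euler u x * (1 + u x ^- 2))) / r2 x.

Lemma tan_eq x a b : U x -> dp a (coo x) = 0 -> dp b (coo x) = 0 ->
  u x * bil a b (hs V x) + V x * bil a b (hs u x) = dp a b * tan_coef (n%:R - 2) u V x.
Proof.
move=> Ux ax bx; have u0x := u0 Ux; have s0x := s0 Ux.
have := bil_hessE a b Ux; rewrite (hess_tan r0_gt0 su u_gt0) // (ric_tan r0_gt0 su u_gt0) //.
rewrite -/(hs V x) => /eqP; rewrite subr_eq => /eqP ->.
by rewrite /tan_coef; field; rewrite ?u0x ?s0x.
Qed.

Lemma mix_eq x a : U x -> dp a (coo x) = 0 ->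
  u x * bil a (coo x) (hs V x) = dp a (grad u x) * (Euler V x + (n%:R - 2) * V x).
Proof.
move=> Ux ax; have u0x := u0 Ux.
have := bil_hessE a (coo x) Ux; rewrite (hess_mix r0_gt0 su u_gt0) // (ric_mix r0_gt0 su u_gt0) //.
by move=> /eqP; rewrite subr_eq => /eqP ->; field; rewrite ?u0x.
Qed.

Lemma rad_eq x : U x ->
  bil (coo x) (coo x) (hs V x) - Euler u x / u x * Euler V x + u x * gamS u V x
  = V x * ((n%:R - 1) * (Euler u x / u x) - u x * lapS u x).
Proof.
move=> Ux; have := bil_hessE (coo x) (coo x) Ux.
by rewrite (hess_rad r0_gt0 su u_gt0) // (ric_rad r0_gt0 su u_gt0).
Qed.

(** Tracing Hess V = V Ric with g and using that V is harmonic gives V times the scalar curvature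
    equal to zero. The trace is then split into its tangential part, by [ric_tan], and its radial
    part, by [ric_rad]. *)
Lemma scal_eq x : U x -> V x != 0 ->
  (n%:R - 1) * (Euler u x / u x)
   = u x * lapS u x - 2^-1 * (n%:R - 1) * (n%:R - 2) * (u x ^+ 2 - 1).
Proof.
move=> Ux Vx; have u0x := u0 Ux; have s0x := s0 Ux.
pose ric i j := ricci u i j x.
have H1 : \sum_i ric i i - kk u x * bil (coo x) (coo x) ric = 0.
  apply: (mulfI Vx); rewrite mulr0 -[RHS](lapE Ux) /lap.
  under [RHS]eq_bigr => i _ do under eq_bigr => j _ do rewrite (ginvE r0_gt0 u_gt0) // hessE //.
  under [RHS]eq_bigr => i _.
    rewrite (eq_bigr (fun j => (V x * ric i j) * (i == j)%:R + (- kk u x * V x) * (coo x i * coo x j * ric i j))).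
      rewrite big_split /= sum_deltar -mulr_sumr; over.
    by move=> j _; rewrite /ric /coo; ring.
  by rewrite big_split /= -!mulr_sumr -/(bil (coo x) (coo x) ric); ring.
have H2 : \sum_i bil (tproj x i) (tproj x i) ric =
   (n%:R - 1) * (((n%:R - 2) * (1 - u x ^- 2) + Euler u x / u x * (1 + u x ^- 2)) / r2 x)
   - (lapl u x - bil (coo x) (coo x) (hs u x) / r2 x) / u x.
  rewrite (eq_bigr _ (fun i _ => ric_tan r0_gt0 su u_gt0 Ux (tproj_coo s0x i) (tproj_coo s0x i))).
  rewrite sumrB -!mulr_suml /lapl -/(hs u x); congr (_ * _ - _ / _).
    have := trace_tproj (fun i j => (i == j)%:R) s0x.
    rewrite [bil (coo x) _ _]bil_delta dp_coo divff // (eq_bigr (fun=> 1)) => [|i _].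
      rewrite sumr_const card_ord => ->; rewrite addrK.
      by apply: eq_bigr => i _; rewrite bil_delta.
    by rewrite eqxx.
  by rewrite [\sum_i dpd i (dpd i u) x](trace_tproj (hs u x) s0x) addrK.
have := H1; rewrite (trace_tproj ric s0x) H2 /ric (ric_rad r0_gt0 su u_gt0) // /kk /lapS => H3.
apply: (mulfI (x := 2 / u x ^+ 2 / r2 x)).
  by rewrite !mulf_neq0 ?invr_eq0 ?expf_neq0 // pnatr_eq0.
by apply/eqP; rewrite -subr_eq0; apply/eqP; rewrite -[RHS]H3; field; rewrite ?u0x ?s0x.
Qed.

Lemma smooth_christ l i j : smooth_on U (christ u l i j).
Proof.
have H := christE r0_gt0 su u_gt0.
apply: (smooth_eq oU (fun x Ux => esym (H x l i j Ux))).
have sk := smooth_kk r0_gt0 su u_gt0; have se := smooth_ee r0_gt0 su u_gt0.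
have sB := smooth_BB r0_gt0 su u_gt0.
by smt.
Qed.

Lemma smooth_ricci i j : smooth_on U (ricci u i j).
Proof. have sc := smooth_christ; by rewrite /ricci pdE; smt. Qed.

Definition jet0 x := V x * V x + \sum_j dpd j V x * dpd j V x.

(** Hess V = V Ric expresses the second derivatives of V linearly through its 1-jet. Since products
    of two components of the jet are at most [jet0], the derivative of [jet0] along a curve is
    bounded by a multiple of [jet0], and Gronwall's lemma applies. *)
Lemma uc_curve (c : R -> 'rV[R]_n) (dc : R -> 'I_n -> R) (a b : R) :
  (forall t, a <= t <= b -> U (c t)) ->
  (forall t k, a <= t <= b -> is_derive t (1 : R) (fun t => c t ord0 k) (dc t k)) ->
  (forall t k, a <= t <= b -> {for t, continuous (fun t => dc t k)}) ->
  forall t0 t1, a <= t0 <= b -> a <= t1 <= b -> jet0 (c t0) = 0 -> jet0 (c t1) = 0.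
Proof.
move=> cU cd dcc.
pose dj t := \sum_k dc t k * dpd k jet0 (c t).
have sj : smooth_on U jet0 by rewrite /jet0; smt.
have jd t : a <= t <= b -> is_derive t (1 : R) (fun t => jet0 (c t)) (dj t).
  by move=> tab; apply: curve_isd; [move=> k; exact: cd|apply: smooth_diff sj _; exact: cU].
have j0 x : 0 <= jet0 x.
  by rewrite /jet0 addr_ge0 ?sumr_ge0 // => [|i _]; rewrite -expr2 sqr_ge0.
pose co k x := 2 * (1 + \sum_j ((\sum_l `|christ u l k j x|) + `|ricci u k j x|)).
have jk x k : U x -> `|dpd k jet0 x| <= co k x * jet0 x.
  move=> Ux.
  have V2 : V x ^+ 2 <= jet0 x.
    by rewrite /jet0 expr2 lerDl sumr_ge0 // => i _; rewrite -expr2 sqr_ge0.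
  have P2 j : dpd j V x ^+ 2 <= jet0 x.
    rewrite /jet0 (bigD1 j) //= addrCA expr2 lerDl addr_ge0 -?expr2 ?sqr_ge0 //.
    by rewrite sumr_ge0 // => i _; rewrite -expr2 sqr_ge0.
  have AM p q : p ^+ 2 <= jet0 x -> q ^+ 2 <= jet0 x -> `|p * q| <= jet0 x.
    move=> hp hq; have := sqr_ge0 (p - q); have := sqr_ge0 (p + q).
    by rewrite ler_norml => h1 h2; apply/andP; split; nra.
  have dk : dpd k jet0 x = 2 * (V x * dpd k V x + \sum_j ((\sum_l christ u l k j x * (dpd l V x * dpd j V x))
      + ricci u k j x * (V x * dpd j V x))).
    have kj j := smooth_isd_pd k (smooth_pd j sV) Ux; have kV := smooth_isd_pd k sV Ux.
    transitivity (2 * (V x * dpd k V x) + \sum_j 2 * (dpd j V x * dpd k (dpd j V) x)).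
      apply: pd_isd; rewrite /jet0; isd.
      by congr (_ + _); [ring|apply: eq_bigr => j _; ring].
    rewrite mulrDr mulr_sumr; congr (_ + _); apply: eq_bigr => j _; congr (_ * _).
    have -> : dpd k (dpd j V) x = \sum_l christ u l k j x * dpd l V x + V x * ricci u k j x.
      by rewrite -hessE // /hess pdE; ring.
    rewrite mulrDr mulr_sumr; congr (_ + _); last by ring.
    by apply: eq_bigr => l _; ring.
  rewrite dk /co normrM ger0_norm // -mulrA ler_pM2l // mulrDl mul1r.
  apply: (le_trans (ler_normD _ _)); apply: lerD; first exact: AM.
  apply: (le_trans (ler_norm_sum _ _ _)); rewrite mulr_suml; apply: ler_sum => j _.
  apply: (le_trans (ler_normD _ _)); rewrite mulrDl; apply: lerD; last first.
    by rewrite normrM ler_wpM2l //; exact: AM.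
  apply: (le_trans (ler_norm_sum _ _ _)); rewrite mulr_suml; apply: ler_sum => l _.
  by rewrite normrM ler_wpM2l //; exact: AM.
have cc' t : a <= t <= b -> {for t, continuous c}.
  move=> tab; apply/differentiable_continuous/derivable1_diffP/derivable_mxP => i k.
  by rewrite (ord1 i); exact: (@ex_derive _ _ _ _ _ _ _ (cd t k tab)).
pose K t := \sum_k `|dc t k| * co k (c t).
have cK t : a <= t <= b -> {for t, continuous K}.
  move=> tab; have Uct := cU t tab.
  have nc (f : R -> R) : {for t, continuous f} -> {for t, continuous (fun t => `|f t|)}.
    by move=> cf; apply: continuous_comp; [exact: cf|exact: norm_continuous].
  have fc (f : 'rV[R]_n -> R) : smooth_on U f -> {for t, continuous (fun t => f (c t))}.
    by move=> sf; apply: continuous_comp; [exact: cc'|exact: smooth_continuous sf Uct].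
  have sumc (F : 'I_n -> R -> R) : (forall k, {for t, continuous (F k)}) ->
      {for t, continuous (fun t => \sum_k F k t)}.
    by move=> HF; apply: cvg_big => [|k _]; [exact: add_continuous|exact: HF].
  apply: (sumc) => k; apply: continuousM; first by apply: (nc); exact: dcc.
  rewrite /co; apply: continuousM; first exact: cst_continuous.
  apply: continuousD; first exact: cst_continuous.
  apply: (sumc) => j; apply: continuousD; last by apply: (nc); apply: (fc); exact: smooth_ricci.
  by apply: (sumc) => l; apply: (nc); apply: (fc); exact: smooth_christ.
have [K0 HK] := continuous_bounded cK.
move=> t0 t1 h0 h1 z0.
apply: (gronwall jd (K := K0) _ _ h0 z0) => // t tab.
apply: (@le_trans _ _ (K t * jet0 (c t))); last first.
  by rewrite ler_wpM2r //; apply: le_trans (ler_norm _) (HK t tab).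
apply: (le_trans (ler_norm_sum _ _ _)); rewrite mulr_suml; apply: ler_sum => k _.
by rewrite normrM -mulrA ler_wpM2l //; apply: jk; exact: cU.
Qed.

End StaticEquations.

(** * Derivative tests at a maximum *)

Section MaxTests.
Context {R : realType}.
Implicit Types f : R -> R.

Lemma isd_pos f (x d : R) : is_derive x (1 : R) f d -> 0 < d ->
  exists2 e, 0 < e & forall h, 0 < h -> h < e -> f x < f (x + h) /\ f (x - h) < f x.
Proof.
move=> fd d0.
have H : h^-1 *: (f (h *: (1 : R) + x) - f x) @[h --> (0 : R)^'] --> d.
  by rewrite -(@derive_val _ _ _ _ _ _ _ fd); exact: (@ex_derive _ _ _ _ _ _ _ fd).
have : \forall h \near (0 : R)^', 0 < h^-1 *: (f (h *: (1 : R) + x) - f x).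
  exact: (cvgr_gt d H).
rewrite near_withinE => /nbhs_ballP [e /= e0 He].
exists e => // h h0 he; split.
  have := He h; rewrite /ball /= sub0r normrN gtr0_norm // => /(_ he (lt0r_neq0 h0)).
  by rewrite pmulr_rgt0 ?invr_gt0 // subr_gt0 [h *: _]mulr1 addrC.
have := He (- h); rewrite /ball /= sub0r opprK gtr0_norm // => /(_ he).
rewrite oppr_eq0 => /(_ (lt0r_neq0 h0)).
by rewrite nmulr_rgt0 ?invr_lt0 ?oppr_lt0 // subr_lt0 [_ *: _]mulr1 addrC.
Qed.

Lemma isd_left_max f (x d e : R) : is_derive x (1 : R) f d -> 0 < e ->
  (forall h, 0 < h -> h < e -> f (x - h) <= f x) -> 0 <= d.
Proof.
move=> fd e0 fm; rewrite leNgt; apply/negP => d0.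
have nd : is_derive x (1 : R) (fun t => - f t) (- d) by exact: isdN.
have [|e' e'0 He] := isd_pos nd; first by rewrite oppr_gt0.
have m0 : 0 < Num.min e e' / 2 by rewrite divr_gt0 // lt_min e0.
have me : Num.min e e' / 2 < Num.min e e'.
  by rewrite ltr_pdivrMr // ltr_pMr ?ltr1n // lt_min e0.
move: (me); rewrite lt_min => /andP [m1 m2].
have [_ /=] := He _ m0 m2; rewrite ltrN2 => h1.
by have := lt_le_trans h1 (fm _ m0 m1); rewrite ltxx.
Qed.

Lemma isd_max0 f (x d : R) : is_derive x (1 : R) f d -> (forall t, f t <= f x) -> d = 0.
Proof.
move=> fd fm; apply/eqP; rewrite eq_le; apply/andP; split; last first.
  by apply: (isd_left_max fd ltr01) => h _ _.
rewrite leNgt; apply/negP => d0; have [e e0 He] := isd_pos fd d0.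
have e2 : 0 < e / 2 by rewrite divr_gt0.
have e2e : e / 2 < e by rewrite ltr_pdivrMr // ltr_pMr ?ltr1n.
by have [h1 _] := He _ e2 e2e; have := lt_le_trans h1 (fm _); rewrite ltxx.
Qed.

Lemma isd_max2 f (df : R -> R) (d : R) : (forall t, is_derive t (1 : R) f (df t)) ->
  is_derive (0 : R) (1 : R) df d -> (forall t, f t <= f 0) -> df 0 = 0 /\ d <= 0.
Proof.
move=> fd dfd fm; have d0 := isd_max0 (fd 0) fm; split=> //.
rewrite leNgt; apply/negP => dp; have [e e0 He] := isd_pos dfd dp.
have e2 : 0 < e / 2 by rewrite divr_gt0.
have [c [c0 ce fE]] := MVT_isd e2 (fun t _ => fd t).
have ce' : c < e by apply: lt_trans ce _; rewrite ltr_pdivrMr // ltr_pMr ?ltr1n.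
have [h1 _] := He c c0 ce'; move: h1; rewrite d0 add0r => h1.
have : 0 < f (e / 2) - f 0 by rewrite fE subr0 mulr_gt0.
by rewrite subr_gt0 => h2; have := lt_le_trans h2 (fm _); rewrite ltxx.
Qed.

End MaxTests.

(** * Maxima on spheres and annuli *)

Section SphereMax.
Context {R : realType} {n : nat}.
Implicit Types (x b : 'rV[R]_n) (f : 'rV[R]_n -> R) (U : set 'rV[R]_n).

Lemma r2_coo b : r2 b = dp (coo b) (coo b). Proof. by []. Qed.

Lemma gcirc_isdf f U x b t : smooth_on U f -> U (gcirc x b t) ->
  is_derive t (1 : R) (fun t => f (gcirc x b t))
    (\sum_k ((- sin t) * x ord0 k + cos t * b ord0 k) * dpd k f (gcirc x b t)).
Proof.
by move=> sf Ux; apply: curve_isd; [move=> k; exact: gcirc_isd|exact: smooth_diff sf Ux].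
Qed.

(** A great circle has acceleration -x at its start, which adds -[Euler f] to the Hessian term in
    the second derivative. *)
Lemma sphere_max U f x b : smooth_on U f ->
  (forall y, r2 y = r2 x -> U y) -> (forall y, r2 y = r2 x -> f y <= f x) ->
  r2 b = r2 x -> dp (coo x) (coo b) = 0 ->
  dp (coo b) (grad f x) = 0 /\ bil (coo b) (coo b) (hs f x) <= Euler f x.
Proof.
move=> sf HU fm bx xb.
have UA t : U (gcirc x b t) by apply: HU; exact: r2_gcirc.
pose df t := \sum_k ((- sin t) * x ord0 k + cos t * b ord0 k) * dpd k f (gcirc x b t).
have fd t : is_derive t (1 : R) (fun t => f (gcirc x b t)) (df t) by exact: gcirc_isdf sf (UA t).
have fm' t : f (gcirc x b t) <= f (gcirc x b 0) by rewrite gcirc0; apply: fm; exact: r2_gcirc.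
have dfd : is_derive (0 : R) (1 : R) df (bil (coo b) (coo b) (hs f x) - Euler f x).
  have hc := is_derive_cos (0 : R); have hsn := is_derive_sin (0 : R).
  have pk k : is_derive (0 : R) (1 : R) (fun t => dpd k f (gcirc x b t)) (dp (coo b) (hs f x k)).
    apply: isd_eq (gcirc_isdf (smooth_pd k sf) (UA 0)) _.
    rewrite gcirc0 /dp; apply: eq_bigr => l _; rewrite sin0 cos0 /hs /coo; ring.
  have sk k : is_derive (0 : R) (1 : R) (fun t => (- sin t) * x ord0 k + cos t * b ord0 k) (- x ord0 k).
    by isd; rewrite cos0 sin0; ring.
  have -> : bil (coo b) (coo b) (hs f x) - Euler f x =
      \sum_k (b ord0 k * dp (coo b) (hs f x k) + dpd k f x * - x ord0 k).
    rewrite bil_dp /dp /Euler -sumrB; apply: eq_bigr => k _; rewrite /coo; ring.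
  rewrite /df; apply: isd_sum => k.
  apply: isd_eq (isdM (sk k) (pk k)) _.
  by rewrite sin0 cos0 gcirc0; ring.
have [d0 d2] := isd_max2 fd dfd fm'.
split; last by rewrite -subr_le0.
rewrite -d0 /df /dp; apply: eq_bigr => k _; rewrite sin0 cos0 gcirc0 /coo /grad; ring.
Qed.

Lemma dpZl (t : R) (a c : 'I_n -> R) : dp (fun i => t * a i) c = t * dp a c.
Proof. by rewrite dpC dpZ dpC. Qed.

Lemma bilZl (t : R) (a : 'I_n -> R) (g : 'I_n -> 'I_n -> R) :
  bil (fun i => t * a i) (fun i => t * a i) g = t ^+ 2 * bil a a g.
Proof.
rewrite /bil mulr_sumr; apply: eq_bigr => i _; rewrite mulr_sumr; apply: eq_bigr => j _; ring.
Qed.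

Lemma sphere_max_vec U f x (a : 'I_n -> R) : smooth_on U f ->
  (forall y, r2 y = r2 x -> U y) -> (forall y, r2 y = r2 x -> f y <= f x) -> 0 < r2 x ->
  dp a (coo x) = 0 ->
  dp a (grad f x) = 0 /\ r2 x * bil a a (hs f x) <= dp a a * Euler f x.
Proof.
move=> sf HU fm x0 ax.
have [a0|a0] := eqVneq (dp a a) 0.
  have az i : a i = 0.
    have : r2 (\row_i a i) = 0 by rewrite -a0; apply: eq_bigr => j _; rewrite !mxE.
    by move=> /r2_eq0 /rowP /(_ i); rewrite !mxE.
  have dz c : dp a c = 0 by rewrite /dp big1 // => i _; rewrite az mul0r.
  by rewrite dz a0 bil_dp dz mulr0 mul0r.
have ap : 0 < dp a a.
  by rewrite lt0r a0 /= sumr_ge0 // => i _; rewrite -expr2 sqr_ge0.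
pose t := Num.sqrt (r2 x / dp a a).
have tp : 0 < t by rewrite sqrtr_gt0 divr_gt0.
have t2 : t ^+ 2 = r2 x / dp a a by rewrite sqr_sqrtr // divr_ge0 // ltW.
pose b := \row_i (t * a i).
have bE : coo b = (fun i => t * a i) by apply/funext => i; rewrite /coo mxE.
have bx : r2 b = r2 x.
  by rewrite r2_coo bE dpZ dpZl mulrA -expr2 t2 divfK.
have xb : dp (coo x) (coo b) = 0 by rewrite bE dpZ dpC ax mulr0.
have [] := sphere_max sf HU fm bx xb; rewrite bE dpZl bilZl => h1 h2; split.
  by move/eqP: h1; rewrite mulf_eq0 gt_eqF //= => /eqP.
by move: h2; rewrite t2 mulrAC ler_pdivrMr // [Euler f x * _]mulrC.
Qed.

(** Sum of [sphere_max_vec] over the projected basis vectors, whose squared lengths add up to n -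
    1. *)
Lemma sphere_max_lapS U f x : smooth_on U f ->
  (forall y, r2 y = r2 x -> U y) -> (forall y, r2 y = r2 x -> f y <= f x) -> 0 < r2 x ->
  lapS f x <= 0.
Proof.
move=> sf HU fm x0; have x0' := lt0r_neq0 x0.
have H i := (sphere_max_vec sf HU fm x0 (tproj_coo x0' i)).2.
rewrite /lapS /lapl (trace_tproj (hs f x) x0') mulrDr [r2 x * (_ / _)]mulrCA divff // mulr1 addrK.
have -> : n%:R - 1 = \sum_i dp (tproj x i) (tproj x i) :> R.
  have := trace_tproj (fun i j => (i == j)%:R) x0'.
  rewrite [bil (coo x) _ _]bil_delta dp_coo divff // (eq_bigr (fun=> 1)) => [|i _].
    rewrite sumr_const card_ord => ->; rewrite addrK.
    by apply: eq_bigr => i _; rewrite bil_delta.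
  by rewrite eqxx.
by rewrite mulr_sumr mulr_suml -sumrB; apply: sumr_le0 => i _; rewrite subr_le0.
Qed.

Definition annulus (a b : R) : set 'rV[R]_n := [set x | a <= r2 x <= b].

Lemma annulus_compact (a b : R) : compact (annulus a b).
Proof.
apply: bounded_closed_compact.
  exists (Num.sqrt b); split; first exact: num_real.
  move=> M bM x /= /andP [_ xb].
  rewrite /Num.Def.normr /= mx_normrE; apply: bigmax_le => [|[i j] _ /=].
    exact: le_trans (sqrtr_ge0 b) (ltW bM).
  rewrite (ord1 i); apply: le_trans (ltW bM).
  rewrite -sqrtr_sqr ler_sqrt; last first.
    exact: le_trans (r2_ge0 x) xb.
  apply: le_trans xb; rewrite /r2 (bigD1 j) //= expr2 lerDl sumr_ge0 // => k _.
  by rewrite -expr2 sqr_ge0.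
rewrite (_ : annulus a b = r2 @^-1` [set t | a <= t <= b]) //.
apply: closed_comp => [x _|]; first exact: r2_continuous.
rewrite (_ : [set t | a <= t <= b] = `[a, b]%classic); first exact: itv_closed.
by apply/seteqP; split => t /=; rewrite in_itv.
Qed.

Lemma annulus_max f (a b : R) x0 : annulus a b x0 -> (forall x, annulus a b x -> {for x, continuous f}) ->
  exists2 c, annulus a b c & forall x, annulus a b x -> f x <= f c.
Proof.
move=> ax cf.
have [|||c] := @EVT_max_rV R n f (annulus a b); first by exists x0.
- exact: annulus_compact.
- by apply: continuous_in_subspaceT => x; rewrite inE; exact: cf.
- by rewrite inE => ac fm; exists c => // x xa; apply: fm; rewrite inE.
Qed.

Lemma ray_isd f U x s : smooth_on U f -> U (s *: x) ->
  is_derive s (1 : R) (fun t => f (t *: x)) (\sum_k x ord0 k * dpd k f (s *: x)).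
Proof.
move=> sf Ux; apply: curve_isd; last exact: smooth_diff sf Ux.
move=> k; have -> : (fun t : R => (t *: x) ord0 k) = (fun t => t * x ord0 k).
  by apply/funext => t; rewrite mxE.
by isd; ring.
Qed.

(** The maximum may lie on the outer sphere, so it is compared only with points further in. This
    gives the one-sided sign that a parabolic maximum principle uses, with the radius as time. *)
Lemma annulus_max_Euler f U (a b : R) x : smooth_on U f -> U x -> 0 <= a -> a < r2 x -> r2 x <= b ->
  (forall y, annulus a b y -> f y <= f x) -> 0 <= Euler f x.
Proof.
move=> sf Ux a0 ax xb fm; have x0 : 0 < r2 x := le_lt_trans a0 ax.
have fd : is_derive (1 : R) (1 : R) (fun t => f (t *: x)) (Euler f x).
  have U1 : U (1 *: x) by rewrite scale1r.
  apply: isd_eq (ray_isd sf U1) _.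
  by rewrite scale1r /Euler; apply: eq_bigr => k _; rewrite mulrC.
pose q := Num.sqrt (a / r2 x).
have q2 : q ^+ 2 = a / r2 x by rewrite sqr_sqrtr // divr_ge0 // ltW.
have q1 : q < 1 by rewrite -sqrtr1 ltr_sqrt // ltr_pdivrMr // mul1r.
apply: (isd_left_max fd (e := 1 - q)); first by rewrite subr_gt0.
move=> h h0 hq; rewrite scale1r; apply: fm; rewrite /annulus /= r2Z.
have q0 : 0 <= q := sqrtr_ge0 _.
have h1 : q <= 1 - h by lra.
apply/andP; split.
  by rewrite -(@divfK _ (r2 x) _ a) ?gt_eqF // -q2 ler_pM2r // ler_pXn2r ?nnegrE //; lra.
apply: le_trans xb; rewrite ler_piMl ?(ltW x0) // expr_le1 //; lra.
Qed.

End SphereMax.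

(** * Unique continuation for V and the scalar curvature equation *)

Section UniqueContinuation.
Context {R : realType} {n : nat} (r0 : R) (u V : 'rV[R]_n -> R).
Hypothesis n3 : (3 <= n)%N.
Hypothesis r0_gt0 : 0 < r0.
Let U : set 'rV[R]_n := exterior r0.
Hypothesis su : smooth_on U u.
Hypothesis u_gt0 : forall x, U x -> 0 < u x.
Hypothesis sV : smooth_on U V.
Hypothesis hessE : forall x, U x -> forall i j : 'I_n, hess u V i j x = V x * ricci u i j x.
Hypothesis lapE : forall x, U x -> lap u V x = 0.
Implicit Types x : 'rV[R]_n.

Let oU : open U. Proof. exact: open_exterior (ltW r0_gt0). Qed.

Lemma UE x : U x <-> r0 ^+ 2 < r2 x.
Proof. exact: exteriorE (ltW r0_gt0). Qed.

Lemma jet0_eq0 x : jet0 V x = 0 -> V x = 0.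
Proof.
move=> j0; apply/eqP; rewrite -sqrf_eq0 eq_le sqr_ge0 andbT -j0 /jet0 expr2 lerDl.
by rewrite sumr_ge0 // => i _; rewrite -expr2 sqr_ge0.
Qed.

(** Inside the domain, x and y are joined by a radial segment followed by an arc of a great
    circle. *)
Lemma static_uc x y : U x -> U y -> jet0 V x = 0 -> jet0 V y = 0.
Proof.
move=> Ux Uy jx.
have x0 : 0 < r2 x := r2_gt0 (ltW r0_gt0) Ux.
have y0 : 0 < r2 y := r2_gt0 (ltW r0_gt0) Uy.
pose l := Num.sqrt (r2 y / r2 x).
have l2 : l ^+ 2 = r2 y / r2 x by rewrite sqr_sqrtr // divr_ge0 // ltW.
have l0 : 0 < l by rewrite sqrtr_gt0 divr_gt0.
have rl : r2 (l *: x) = r2 y by rewrite r2Z l2 divfK ?gt_eqF.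
have Ul t : Num.min 1 l <= t -> U (t *: x).
  move=> ht; apply/UE; rewrite r2Z.
  have m0 : 0 < Num.min 1 l by rewrite lt_min ltr01.
  apply: (@lt_le_trans _ _ (Num.min 1 l ^+ 2 * r2 x)).
    rewrite minEle; case: ifP => _; first by rewrite expr1n mul1r; apply/UE.
    by rewrite l2 divfK ?gt_eqF //; apply/UE.
  by rewrite ler_pM2r // ler_pXn2r ?nnegrE ?(ltW m0) // (le_trans (ltW m0)).
have j1 : jet0 V (l *: x) = 0.
  apply: (@uc_curve _ _ r0 u V r0_gt0 su u_gt0 sV hessE (fun t => t *: x) (fun t k => x ord0 k)
    (Num.min 1 l) (Num.max 1 l) _ _ _ 1 l).
  - by move=> t /andP [+ _]; exact: Ul.
  - move=> t k _; have -> : (fun t : R => (t *: x) ord0 k) = (fun t => t * x ord0 k).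
      by apply/funext => s; rewrite mxE.
    by isd; ring.
  - by move=> t k _; exact: cst_continuous.
  - by rewrite ge_min lexx le_max lexx.
  - by rewrite ge_min lexx orbT le_max lexx orbT.
  - by rewrite scale1r.
have n2 : (2 <= n)%N by exact: ltnW.
have rl0 : 0 < r2 (l *: x) by rewrite rl.
have [b [t [bl xb /andP [t0 tp] <-]]] := gcirc_exists n2 rl0 (esym rl).
apply: (@uc_curve _ _ r0 u V r0_gt0 su u_gt0 sV hessE (gcirc (l *: x) b)
   (fun t k => (- sin t) * (l *: x) ord0 k + cos t * b ord0 k) 0 pi _ _ _ 0 t).
- by move=> s _; apply/UE; rewrite r2_gcirc // rl; apply/UE.
- by move=> s k _; exact: gcirc_isd.
- move=> s k _; apply: continuousD; (apply: continuousM; last exact: cst_continuous).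
    by apply: continuousN; exact: continuous_sin.
  exact: continuous_cos.
- by rewrite lexx pi_ge0.
- by rewrite t0.
- by rewrite gcirc0.
Qed.

Hypothesis V_neq0 : exists x, U x /\ V x != 0.

Lemma near0_absurd x : U x -> (\near x, V x = 0) -> False.
Proof.
move=> Ux Vx; have [y [Uy]] := V_neq0; apply/negP; rewrite negbK; apply/eqP/jet0_eq0.
apply: static_uc Ux Uy _; rewrite /jet0 (nbhs_singleton Vx) mul0r add0r big1 // => i _.
rewrite (@pd_near _ _ V (fun=> 0) x i) // (_ : dpd i (fun=> 0) x = 0) ?mul0r //.
by apply: pd_isd; exact: isd_cst.
Qed.

Lemma smooth_Euler f : smooth_on U f -> smooth_on U (Euler f).
Proof. by move=> sf; rewrite /Euler; smt. Qed.

Lemma smooth_lapS f : smooth_on U f -> smooth_on U (lapS f).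
Proof.
move=> sf; rewrite /lapS /lapl /bil /hs /coo; smt; try exact: smooth_r2.
exact: smooth_Euler.
Qed.

(** [scal_eq] holds off the zeros of V. These contain no open set by unique continuation, and both
    sides are continuous. *)
Lemma scal_all x : U x ->
  (n%:R - 1) * (Euler u x / u x)
   = u x * lapS u x - 2^-1 * (n%:R - 1) * (n%:R - 2) * (u x ^+ 2 - 1).
Proof.
move=> Ux.
pose S z := (n%:R - 1) * (Euler u z / u z) -
   (u z * lapS u z - 2^-1 * (n%:R - 1) * (n%:R - 2) * (u z * u z - 1)).
have u0 z : U z -> u z != 0 by move=> /u_gt0; exact: lt0r_neq0.
have sS : smooth_on U S.
  have sE := smooth_Euler su; have sL := smooth_lapS su.
  by rewrite /S; smt.
suff : S x = 0 by rewrite /S -expr2 => /eqP; rewrite subr_eq0 => /eqP.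
apply/eqP/negP => /negP Sx; apply: (near0_absurd Ux).
have cS : \forall z \near x, S z != 0.
  have cS := smooth_continuous sS Ux.
  by apply: (cvgr_neq0 _ cS).
near=> z; apply/eqP/negP => /negP Vz.
have Uz : U z by near: z; exact: open_nbhs_nbhs.
have : S z != 0 by near: z.
have H := scal_eq r0_gt0 su u_gt0 hessE lapE Uz Vz.
by rewrite /S H expr2 subrr eqxx.
Unshelve. all: by end_near. Qed.

Lemma rad_all x : U x ->
  bil (coo x) (coo x) (hs V x) - Euler u x / u x * Euler V x + u x * gamS u V x
  = - (2^-1 * (n%:R - 1) * (n%:R - 2)) * (u x ^+ 2 - 1) * V x.
Proof.
by move=> Ux; rewrite (rad_eq r0_gt0 su u_gt0) // scal_all //; ring.
Qed.

End UniqueContinuation.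

(** * Rotation fields and spherical operators *)

Section Rotations.
Context {R : realType} {n : nat} (U : set 'rV[R]_n).
Hypothesis oU : open U.
Implicit Types (x : 'rV[R]_n) (f g : 'rV[R]_n -> R) (p : 'I_n * 'I_n).

(** The infinitesimal rotations are globally defined, span the tangent spaces of the spheres and
    commute with [Euler] and [lapS], so they replace a moving frame. Sums run over all ordered
    pairs, hence the factors 1/2 below. *)
Definition rv p x : 'rV[R]_n := x ord0 p.1 *: ev p.2 - x ord0 p.2 *: ev p.1.
Definition rotd p f x := x ord0 p.1 * dpd p.2 f x - x ord0 p.2 * dpd p.1 f x.

Lemma isd_rot f x p : smooth_on U f -> U x -> is_derive x (rv p x) f (rotd p f x).
Proof.
move=> sf Ux; apply: isd_eq (smooth_isd (rv p x) sf Ux) _.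
rewrite (eq_bigr (fun k => (x ord0 p.1 * dpd k f x) * (p.2 == k)%:R + (- x ord0 p.2 * dpd k f x) * (p.1 == k)%:R)).
  by rewrite big_split /= !sum_deltar /rotd; ring.
by move=> k _; rewrite /rv !mxE eqxx /= [k == p.2]eq_sym [k == p.1]eq_sym; ring.
Qed.

Lemma rot_isd f x p d : smooth_on U f -> U x -> is_derive x (rv p x) f d -> rotd p f x = d.
Proof.
move=> sf Ux fd; rewrite -(@derive_val _ _ _ _ _ _ _ fd).
by rewrite (@derive_val _ _ _ _ _ _ _ (isd_rot p sf Ux)).
Qed.

Lemma isd_Euler f x : smooth_on U f -> U x -> is_derive x x f (Euler f x).
Proof.
move=> sf Ux; apply: isd_eq (smooth_isd x sf Ux) _.
by apply: eq_bigr => k _; rewrite mulrC.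
Qed.

Lemma Euler_isd f x d : smooth_on U f -> U x -> is_derive x x f d -> Euler f x = d.
Proof.
move=> sf Ux fd; rewrite -(@derive_val _ _ _ _ _ _ _ fd).
by rewrite (@derive_val _ _ _ _ _ _ _ (isd_Euler sf Ux)).
Qed.

Lemma smooth_rot f p : smooth_on U f -> smooth_on U (rotd p f).
Proof. by move=> sf; rewrite /rotd; smt. Qed.

Lemma r2_isd_rot x p : is_derive x (rv p x) r2 0.
Proof.
apply: isd_eq (r2_isd _ _) _.
rewrite (eq_bigr (fun k => (x ord0 k * x ord0 p.1) * (p.2 == k)%:R + (x ord0 k * - x ord0 p.2) * (p.1 == k)%:R)).
  by rewrite big_split /= !sum_deltar; ring.
by move=> k _; rewrite /rv !mxE eqxx /= [k == p.2]eq_sym [k == p.1]eq_sym; ring.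
Qed.

Lemma r2_isd_Euler x : is_derive x x r2 (2 * r2 x).
Proof. by apply: isd_eq (r2_isd _ _) _. Qed.

Lemma rot_eq_on f g x p : (forall y, U y -> f y = g y) -> U x -> rotd p f x = rotd p g x.
Proof. by move=> fg Ux; rewrite /rotd !(pd_eq_on oU _ fg Ux). Qed.

Lemma Euler_eq_on f g x : (forall y, U y -> f y = g y) -> U x -> Euler f x = Euler g x.
Proof. by move=> fg Ux; apply: eq_bigr => i _; rewrite (pd_eq_on oU _ fg Ux). Qed.

Lemma sum_pair (F : 'I_n -> 'I_n -> R) : \sum_p F p.1 p.2 = \sum_i \sum_j F i j.
Proof. by rewrite -(pair_bigA _ F). Qed.

Lemma gamS_rot f g x : gamS f g x = 2^-1 * \sum_p rotd p f x * rotd p g x.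
Proof.
rewrite (sum_pair (fun i j => (x ord0 i * dpd j f x - x ord0 j * dpd i f x) * (x ord0 i * dpd j g x - x ord0 j * dpd i g x))).
have H i : \sum_j (x ord0 i * dpd j f x - x ord0 j * dpd i f x) * (x ord0 i * dpd j g x - x ord0 j * dpd i g x)
   = (x ord0 i * x ord0 i) * g2 f g x + (grad f x i * grad g x i) * r2 x
     - (dpd i g x * x ord0 i) * Euler f x - (dpd i f x * x ord0 i) * Euler g x.
  rewrite (eq_bigr (fun j => (grad f x j * grad g x j) * (x ord0 i * x ord0 i) + ((x ord0 j * x ord0 j) * (dpd i f x * dpd i g x)
    + ((dpd j f x * x ord0 j) * - (dpd i g x * x ord0 i) + (dpd j g x * x ord0 j) * - (dpd i f x * x ord0 i))))).
    by rewrite !big_split /= -!mulr_suml -/(r2 x) -/(dp (grad f x) (grad g x)) -/(Euler f x) -/(Euler g x) /g2 /grad; ring.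
  by move=> j _; rewrite /grad; ring.
rewrite (eq_bigr _ (fun i _ => H i)) !big_split /= !sumrN -!mulr_suml -/(r2 x) -/(Euler f x) -/(Euler g x).
by rewrite -/(dp (grad f x) (grad g x)) -/(g2 f g x) /gamS; field.
Qed.

Lemma pd_rot f x p m : smooth_on U f -> U x -> dpd m (rotd p f) x =
  (m == p.1)%:R * dpd p.2 f x + x ord0 p.1 * dpd m (dpd p.2 f) x
  - (m == p.2)%:R * dpd p.1 f x - x ord0 p.2 * dpd m (dpd p.1 f) x.
Proof.
move=> sf Ux; have h1 := smooth_isd_pd m (smooth_pd p.1 sf) Ux.
have h2 := smooth_isd_pd m (smooth_pd p.2 sf) Ux.
by apply: pd_isd; rewrite /rotd; isd; rewrite !evE; ring.
Qed.

(** The spherical Laplacian is the Casimir operator of the rotation group. *)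
Lemma lapS_rot f x : smooth_on U f -> U x ->
  lapS f x = 2^-1 * \sum_p rotd p (rotd p f) x.
Proof.
move=> sf Ux.
have H i : \sum_j rotd (i, j) (rotd (i, j) f) x =
    (x ord0 i * x ord0 i) * lapl f x + hs f x i i * r2 x + 2 * (dpd i f x * x ord0 i)
    - Euler f x - n%:R * (dpd i f x * x ord0 i) - 2 * (coo x i * dp (coo x) (hs f x i)).
  rewrite (eq_bigr (fun j => dpd j (dpd j f) x * (x ord0 i * x ord0 i) + ((x ord0 j * x ord0 j) * hs f x i i
    + ((x ord0 i * dpd j f x) * (i == j)%:R + ((x ord0 j * dpd i f x) * (i == j)%:R
    + ((- (dpd i f x * x ord0 i)) + ((dpd j f x * x ord0 j) * - 1 + (coo x j * hs f x i j) * (- 2 * coo x i)))))))).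
    rewrite !big_split /= !sum_deltar -!mulr_suml sumr_const card_ord -/(r2 x) -/(Euler f x) -/(lapl f x).
    by rewrite -/(dp (coo x) (hs f x i)) -[_ *+ n]mulr_natl; ring.
  move=> j _; rewrite {1}/rotd !pd_rot //= !eqxx /= (pd_comm i j oU sf Ux) [j == i]eq_sym /hs /coo; ring.
have -> : \sum_p rotd p (rotd p f) x = \sum_i \sum_j rotd (i, j) (rotd (i, j) f) x.
  by rewrite -(sum_pair (fun i j => rotd (i, j) (rotd (i, j) f) x)); apply: eq_bigr => -[].
rewrite (eq_bigr _ (fun i _ => H i)) !big_split /= !sumrN -!mulr_suml -!mulr_sumr sumr_const card_ord.
rewrite -/(r2 x) -/(Euler f x) -/(lapl f x) /lapS bil_dp -/(dp (coo x) (fun i => dp (coo x) (hs f x i))).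
by rewrite -[_ *+ n]mulr_natl; field.
Qed.

Lemma rot_Euler f x p : smooth_on U f -> U x -> Euler (rotd p f) x = rotd p (Euler f) x.
Proof.
move=> sf Ux.
have pE m : dpd m (Euler f) x = dpd m f x + \sum_k dpd m (dpd k f) x * x ord0 k.
  have mk k := smooth_isd_pd m (smooth_pd k sf) Ux.
  transitivity (\sum_k (dpd k f x * (m == k)%:R + x ord0 k * dpd m (dpd k f) x)).
    by apply: pd_isd; rewrite /Euler; apply: isd_sum => k; have mkk := mk k; isd; rewrite evE.
  by rewrite big_split /= sum_deltar; congr (_ + _); apply: eq_bigr => k _; rewrite mulrC.
rewrite {2}/rotd !pE /Euler (eq_bigr (fun m => (x ord0 m * dpd p.2 f x) * (m == p.1)%:R
  + ((dpd p.2 (dpd m f) x * x ord0 m) * x ord0 p.1 + ((- x ord0 m * dpd p.1 f x) * (m == p.2)%:R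
  + (dpd p.1 (dpd m f) x * x ord0 m) * - x ord0 p.2)))).
  by rewrite !big_split /= !sum_delta -!mulr_suml; ring.
by move=> m _; rewrite pd_rot // (pd_comm m p.2 oU sf Ux) (pd_comm m p.1 oU sf Ux); ring.
Qed.

(** Here [lapS] is written with operators that commute with rotations one by one; [rot_lapS] follows
    from this form. *)
Lemma lapS_Euler f x : smooth_on U f -> U x ->
  lapS f x = r2 x * lapl f x - Euler (Euler f) x - (n%:R - 2) * Euler f x.
Proof.
move=> sf Ux; rewrite /lapS.
suff -> : Euler (Euler f) x = bil (coo x) (coo x) (hs f x) + Euler f x by ring.
have mk k := isd_Euler (smooth_pd k sf) Ux.
have sE : smooth_on U (Euler f) by rewrite /Euler; smt.
apply: (Euler_isd sE Ux); rewrite /Euler.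
have H : is_derive x x (Euler f) (\sum_k (dpd k f x * x ord0 k + x ord0 k * Euler (dpd k f) x)).
  by rewrite /Euler; apply: isd_sum => k; have mkk := mk k; isd.
apply: isd_eq H _; rewrite big_split /= addrC; congr (_ + _).
rewrite bil_dp; apply: eq_bigr => k _; congr (_ * _).
by apply: eq_bigr => m _; rewrite mulrC.
Qed.

Lemma rot_lapl f x p : smooth_on U f -> U x -> lapl (rotd p f) x = rotd p (lapl f) x.
Proof.
move=> sf Ux.
have pl m : dpd m (lapl f) x = \sum_k dpd m (dpd k (dpd k f)) x.
  by apply: pd_isd; rewrite /lapl; apply: isd_sum => k;
    apply: smooth_isd_pd (smooth_pd k (smooth_pd k sf)) Ux.
have comm3 m k : dpd k (dpd k (dpd m f)) x = dpd m (dpd k (dpd k f)) x.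
  rewrite (pd_comm m k oU (smooth_pd k sf) Ux); apply: (pd_eq_on oU _ _ Ux) => y Uy.
  exact: pd_comm oU sf Uy.
rewrite {2}/rotd !pl /lapl (eq_bigr (fun m => (2 * dpd m (dpd p.2 f) x) * (m == p.1)%:R
  + (dpd p.2 (dpd m (dpd m f)) x * x ord0 p.1 + ((- 2 * dpd m (dpd p.1 f) x) * (m == p.2)%:R
  + dpd p.1 (dpd m (dpd m f)) x * - x ord0 p.2)))).
  by rewrite !big_split /= !sum_delta -!mulr_suml (pd_comm p.1 p.2 oU sf Ux); ring.
move=> m _; rewrite -!comm3.
have h1 := smooth_isd_pd m (smooth_pd p.1 sf) Ux.
have h2 := smooth_isd_pd m (smooth_pd p.2 sf) Ux.
have h3 := smooth_isd_pd m (smooth_pd m (smooth_pd p.1 sf)) Ux.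
have h4 := smooth_isd_pd m (smooth_pd m (smooth_pd p.2 sf)) Ux.
rewrite (pd_eq_on oU _ (fun y Uy => pd_rot p m sf Uy) Ux).
by apply: pd_isd; isd; rewrite !evE; ring.
Qed.

Lemma rot_lapS f x p : smooth_on U f -> U x -> lapS (rotd p f) x = rotd p (lapS f) x.
Proof.
move=> sf Ux; have sr := smooth_rot p sf.
have sE : smooth_on U (Euler f) by rewrite /Euler; smt.
have sEE : smooth_on U (Euler (Euler f)) by rewrite {1}/Euler; smt.
have sl : smooth_on U (lapl f) by rewrite /lapl; smt.
have sr2 : smooth_on U r2 by exact: smooth_r2.
rewrite lapS_Euler // (rot_eq_on p (fun y Uy => lapS_Euler sf Uy) Ux).
rewrite (Euler_eq_on (fun y Uy => rot_Euler p sf Uy) Ux) !rot_Euler // rot_lapl //.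
have h1 := isd_rot p sE Ux; have h2 := isd_rot p sEE Ux; have h3 := isd_rot p sl Ux.
have h4 := r2_isd_rot x p.
by apply/esym; notypeclasses refine (rot_isd _ Ux _); [smt|isd; ring].
Qed.

Lemma sum_lin3 (I : finType) (F G H : I -> R) (a b c : R) :
  \sum_i (F i * a + (G i * b + H i * c)) =
  (\sum_i F i) * a + ((\sum_i G i) * b + (\sum_i H i) * c).
Proof. by rewrite !big_split /= -!mulr_suml. Qed.

Lemma rotM f g x p : smooth_on U f -> smooth_on U g -> U x ->
  rotd p (fun y => f y * g y) x = f x * rotd p g x + g x * rotd p f x.
Proof.
move=> sf sg Ux; have h1 := isd_rot p sf Ux; have h2 := isd_rot p sg Ux.
by notypeclasses refine (rot_isd _ Ux _); [smt|isd].
Qed.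

Lemma lapSM f g x : smooth_on U f -> smooth_on U g -> U x ->
  lapS (fun y => f y * g y) x = f x * lapS g x + g x * lapS f x + 2 * gamS f g x.
Proof.
move=> sf sg Ux; have sfg : smooth_on U (fun y => f y * g y) by smt.
rewrite !lapS_rot // gamS_rot (eq_bigr (fun p => rotd p (rotd p g) x * f x + (rotd p (rotd p f) x * g x
   + (rotd p f x * rotd p g x) * 2))).
  by rewrite sum_lin3; field.
move=> p _; rewrite (rot_eq_on p (fun y Uy => rotM p sf sg Uy) Ux).
have srf := smooth_rot p sf; have srg := smooth_rot p sg.
have h1 := isd_rot p sf Ux; have h2 := isd_rot p sg Ux.
have h3 := isd_rot p srf Ux; have h4 := isd_rot p srg Ux.
by notypeclasses refine (rot_isd _ Ux _); [smt|isd; ring].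
Qed.

Lemma lapSD f g x : smooth_on U f -> smooth_on U g -> U x ->
  lapS (fun y => f y + g y) x = lapS f x + lapS g x.
Proof.
move=> sf sg Ux; have sfg : smooth_on U (fun y => f y + g y) by smt.
rewrite !lapS_rot // -mulrDr -big_split /=; congr (_ * _); apply: eq_bigr => p _.
have rD y : U y -> rotd p (fun y => f y + g y) y = rotd p f y + rotd p g y.
  move=> Uy; have h1 := isd_rot p sf Uy; have h2 := isd_rot p sg Uy.
  by notypeclasses refine (rot_isd _ Uy _) => //; isd.
rewrite (rot_eq_on p rD Ux).
have srf := smooth_rot p sf; have srg := smooth_rot p sg.
have h3 := isd_rot p srf Ux; have h4 := isd_rot p srg Ux.
by notypeclasses refine (rot_isd _ Ux _); [smt|isd].
Qed.

Lemma lapS_cst (a : R) x : U x -> lapS (fun=> a) x = 0.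
Proof.
move=> Ux; have sa : smooth_on U (fun=> a) by smt.
rewrite lapS_rot // big1 ?mulr0 // => p _.
have r0 y : U y -> rotd p (fun=> a) y = 0 by move=> Uy; notypeclasses refine (rot_isd _ Uy _) => //; isd.
by rewrite (rot_eq_on p r0 Ux); notypeclasses refine (rot_isd _ Ux _); [smt|isd].
Qed.

Lemma lapS_radM f g x : smooth_on U f -> smooth_on U g -> (forall y p, U y -> rotd p f y = 0) ->
  U x -> lapS (fun y => f y * g y) x = f x * lapS g x.
Proof.
move=> sf sg f0 Ux; rewrite lapSM // (lapS_rot sf) // gamS_rot big1 => [|p _].
  by rewrite big1 => [|p _]; [ring|rewrite f0 ?mul0r].
rewrite (rot_eq_on p (fun y Uy => f0 y p Uy) Ux).
by notypeclasses refine (rot_isd _ Ux _); [smt|isd].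
Qed.

Lemma rot_r2X k x p : U x -> rotd p (fun y => r2 y ^+ k) x = 0.
Proof.
move=> Ux; have sr2 : smooth_on U r2 by exact: smooth_r2.
have h := r2_isd_rot x p; case: k => [|k]; (notypeclasses refine (rot_isd _ Ux _); [smt|]).
  by under eq_fun do rewrite expr0; isd.
by isd; ring.
Qed.

End Rotations.

(** * Inequalities for the Bernstein estimate *)

Section SumSquares.
Context {R : realFieldType} {I : finType}.

Lemma sum_sqr_le (F : I -> R) : (\sum_i F i) ^+ 2 <= #|I|%:R * \sum_i F i ^+ 2.
Proof.
have H : 0 <= \sum_i \sum_j (F i - F j) ^+ 2.
  by apply: sumr_ge0 => i _; apply: sumr_ge0 => j _; exact: sqr_ge0.
rewrite (eq_bigr (fun i => #|I|%:R * F i ^+ 2 + (F i * (- 2 * \sum_j F j) + \sum_j F j ^+ 2))) in H.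
  rewrite !big_split /= -mulr_sumr -mulr_suml sumr_const -[(\sum_j _) *+ _]mulr_natl in H.
  by rewrite -subr_ge0; nra.
move=> i _; rewrite (eq_bigr (fun j => F i ^+ 2 + (F j * (- 2 * F i) + F j ^+ 2))); last by move=> j _; ring.
rewrite !big_split /= sumr_const -[F i ^+ 2 *+ _]mulr_natl -[in LHS]mulr_suml; ring.
Qed.
End SumSquares.

(** After [gv] absorbs the second derivatives [B], what is left is G times (N + 6) G v^2 - 3 g y v -
    2 g. The largeness of the weight k bounds the first term by 32/49 g, and |y| <= 1/8 bounds the
    second by 3/7 g, so -2 g wins. *)
Lemma maximum_contra (F : realFieldType) (k y G L v B g K N : F) :
  0 < g -> 0 < G -> 1 <= K -> 0 <= N -> 0 < v -> v * (1 - y) = 1 -> y ^+ 2 <= 1 / 64 ->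
  2 * (N + 6) * K <= k -> k * G <= g * K -> 2 * G * L * v - B <= N * G ^+ 2 * v ^+ 2 ->
  0 <= - B + 2 * G * L * v - 3 * g * y * G * v + 6 * G ^+ 2 * v ^+ 2 - 2 * g * G -> False.
Proof.
move=> g0 G0 K1 N0 v0 v1 y8 kK GW gv key0.
have /andP [y1 y2] : - (1 / 8) <= y <= 1 / 8.
  by move: y8; clear => ?; apply/andP; split; nra.
have v87 : v <= 8 / 7 by move: v1 y2 v0; clear; nra.
have Nk : 2 * (N + 6) * G <= g.
  have h3 : 2 * (N + 6) * K * G <= g * K by apply: le_trans GW; rewrite ler_wpM2r // ltW.
  by rewrite -(ler_pM2r (lt_le_trans ltr01 K1)); move: h3; clear; lra.
have v2 : v ^+ 2 <= 64 / 49 by move: v0 v87; clear; nra.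
have h1 : (N + 6) * G * v ^+ 2 <= g / 2 * (64 / 49).
  apply: ler_pM => //; [|exact: sqr_ge0|by move: Nk; clear; lra].
  by rewrite mulr_ge0 ?addr_ge0 ?(ltW G0) ?ler0n.
have h2 : - y * v <= (1 / 8) * (8 / 7).
  apply: (@le_trans _ _ ((1 / 8) * v)); last by rewrite ler_wpM2l.
  by rewrite ler_wpM2r ?(ltW v0) //; move: y1; clear; lra.
have h3 := ler_wpM2l (ltW g0) h2.
have : G * ((N + 6) * G * v ^+ 2 - 3 * g * y * v - 2 * g) < 0.
  by rewrite pmulr_rlt0 //; move: h1 h3 g0; clear; lra.
move: gv key0; clear; lra.
Qed.

(** * Weighted maximum principles for the parabolic equation *)

Section Bernstein.
Context {R : realType} {n d : nat} (r0 : R) (y : 'rV[R]_n -> R).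
Hypothesis nd : n = d.+3.
Hypothesis r0_gt0 : 0 < r0.
Let U : set 'rV[R]_n := exterior r0.
Hypothesis sy : smooth_on U y.
Hypothesis y_lt1 : forall x, U x -> y x < 1.
Hypothesis pdeE : forall x, U x -> (n%:R - 1) * Euler y x =
  - ((n%:R - 1) * (n%:R - 2)) * y x + lapS y x / (1 - y x) + 3 / 2 * gamS y y x / (1 - y x) ^+ 2.
Implicit Types (x : 'rV[R]_n) (p : 'I_n * 'I_n).

Let oU : open U. Proof. exact: open_exterior (ltW r0_gt0). Qed.
Let UE x : U x <-> r0 ^+ 2 < r2 x. Proof. exact: exteriorE (ltW r0_gt0). Qed.
Let U_r2 x z : U x -> r2 z = r2 x -> U z.
Proof. by move=> /UE h zx; apply/UE; rewrite zx. Qed.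

(** This is r^(2(n-2)), as n = d + 3. The equation damps y like r^(2-n), and the weight cancels
    exactly this zero order term in [Qf] and [Wf]. *)
Definition kw (x : 'rV[R]_n) : R := r2 x ^+ d.+1.
Definition Qf x := kw x * (y x * y x).
Definition Wf x := kw x * gamS y y x.
Let srot p : smooth_on U (rotd p y). Proof. exact: smooth_rot. Qed.
Let sr2 : smooth_on U r2. Proof. exact: smooth_r2. Qed.
Let skw : smooth_on U kw. Proof. by rewrite /kw; smt. Qed.
Let sL : smooth_on U (lapS y). Proof. exact: smooth_lapS r0_gt0 _ sy. Qed.
Let sE : smooth_on U (Euler y). Proof. exact: smooth_Euler r0_gt0 _ sy. Qed.
Let gE x : gamS y y x = 2^-1 * \sum_p rotd p y x * rotd p y x. Proof. exact: gamS_rot. Qed.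
Let sg : smooth_on U (gamS y y).
Proof. by apply: (smooth_eq oU (fun x _ => esym (gE x))); smt. Qed.
Let sQ : smooth_on U Qf. Proof. by rewrite /Qf; smt. Qed.
Let sW : smooth_on U Wf. Proof. by rewrite /Wf; smt. Qed.
Let n2 : n%:R - 2 = d.+1%:R :> R. Proof. by rewrite nd -[d.+3]addn2 natrD addrK. Qed.
Let r2p x : U x -> 0 < r2 x. Proof. exact: r2_gt0 (ltW r0_gt0). Qed.
Let kp x : U x -> 0 < kw x. Proof. by move=> Ux; rewrite exprn_gt0 // r2p. Qed.

Lemma gamS_ge0 x : 0 <= gamS y y x.
Proof. by rewrite gE mulr_ge0 // sumr_ge0 // => p _; rewrite -expr2 sqr_ge0. Qed.

Lemma rot_kw x p : U x -> rotd p kw x = 0.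
Proof. exact: (rot_r2X oU). Qed.

Lemma Euler_kw x : U x -> Euler kw x = 2 * d.+1%:R * kw x.
Proof.
move=> Ux; have h := r2_isd_Euler x.
notypeclasses refine (Euler_isd skw Ux _); rewrite /kw; isd.
by rewrite exprS; ring.
Qed.

Lemma Euler_Q x : U x -> Euler Qf x = 2 * d.+1%:R * Qf x + 2 * kw x * y x * Euler y x.
Proof.
move=> Ux; have h := isd_Euler skw Ux; have h' := isd_Euler sy Ux.
notypeclasses refine (Euler_isd sQ Ux _); rewrite /Qf; isd.
by rewrite Euler_kw //; ring.
Qed.

Lemma rot_Q x p : U x -> rotd p Qf x = 2 * kw x * y x * rotd p y x.
Proof.
move=> Ux; have h := isd_rot p skw Ux; have h' := isd_rot p sy Ux.
notypeclasses refine (rot_isd sQ Ux _); rewrite /Qf; isd.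
by rewrite rot_kw //; ring.
Qed.

Lemma rot_W x p : U x -> rotd p Wf x = kw x * rotd p (gamS y y) x.
Proof.
move=> Ux; have h := isd_rot p skw Ux; have h' := isd_rot p sg Ux.
notypeclasses refine (rot_isd sW Ux _); rewrite /Wf; isd.
by rewrite rot_kw //; ring.
Qed.

Lemma lapS_Q x : U x -> lapS Qf x = kw x * (2 * y x * lapS y x + 2 * gamS y y x).
Proof.
move=> Ux; have syy : smooth_on U (fun x => y x * y x) by smt.
rewrite /Qf (lapS_radM oU skw syy (fun z p Uz => rot_kw p Uz) Ux).
by rewrite (lapSM oU) //; ring.
Qed.

Lemma Euler_W x : U x ->
  Euler Wf x = 2 * d.+1%:R * Wf x + kw x * \sum_p rotd p y x * rotd p (Euler y) x.
Proof.
move=> Ux; have h := isd_Euler skw Ux.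
have h' p : is_derive x x (rotd p y) (rotd p (Euler y) x).
  by apply: isd_eq (isd_Euler (srot p) Ux) _; exact: (rot_Euler oU).
have hg : is_derive x x (gamS y y) (\sum_p rotd p y x * rotd p (Euler y) x).
  have -> : gamS y y = (fun x => 2^-1 * \sum_p rotd p y x * rotd p y x) by apply/funext.
  isd; rewrite mulr0 addr0 mulr_sumr; apply: eq_bigr => p _; by field.
notypeclasses refine (Euler_isd sW Ux _); rewrite /Wf; isd.
by rewrite Euler_kw //; ring.
Qed.

Lemma lapS_sum (I : finType) (F : I -> 'rV[R]_n -> R) x : (forall i, smooth_on U (F i)) -> U x ->
  lapS (fun x => \sum_i F i x) x = \sum_i lapS (F i) x.
Proof.
move=> sF Ux.
suff H s : lapS (fun x => \sum_(i <- s) F i x) x = \sum_(i <- s) lapS (F i) x by exact: H.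
elim: s => [|i s IH].
  rewrite [RHS]big_nil; transitivity (lapS (fun=> 0 : R) x); last exact: (lapS_cst oU).
  by congr (lapS _ _); apply/funext => z; rewrite big_nil.
rewrite [RHS]big_cons -IH -(lapSD oU (sF i)) //; last by smt.
by congr (lapS _ _); apply/funext => z; rewrite big_cons.
Qed.

Lemma lapS_W x : U x -> lapS Wf x =
  kw x * (\sum_p rotd p y x * rotd p (lapS y) x + \sum_p gamS (rotd p y) (rotd p y) x).
Proof.
move=> Ux; rewrite /Wf (lapS_radM oU skw sg (fun z p Uz => rot_kw p Uz) Ux); congr (_ * _).
have -> : gamS y y = (fun x => 2^-1 * \sum_p rotd p y x * rotd p y x) by apply/funext.
have sc : smooth_on U (fun=> 2^-1 : R) by smt.
have ss : smooth_on U (fun x => \sum_p rotd p y x * rotd p y x) by smt.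
rewrite (lapS_radM oU sc ss) //; last first.
  by move=> z p Uz; notypeclasses refine (rot_isd _ Uz _); [smt|isd].
rewrite (lapS_sum (F := fun p x => rotd p y x * rotd p y x)) //; last by move=> p; smt.
rewrite mulr_sumr -big_split /=; apply: eq_bigr => p _.
by rewrite (lapSM oU) // (rot_lapS oU) //; field.
Qed.

Lemma rot_Euler_y x p : U x -> (n%:R - 1) * rotd p (Euler y) x =
  - ((n%:R - 1) * (n%:R - 2)) * rotd p y x + rotd p (lapS y) x / (1 - y x)
  + lapS y x * rotd p y x / (1 - y x) ^+ 2
  + 3 / 2 * (rotd p (gamS y y) x / (1 - y x) ^+ 2 + 2 * gamS y y x * rotd p y x / (1 - y x) ^+ 3).
Proof.
move=> Ux; have y1 z : U z -> 1 - y z != 0 by move=> Uz; rewrite subr_eq0 gt_eqF // y_lt1.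
have y1x := y1 _ Ux.
have h1 := isd_rot p sE Ux; have h2 := isd_rot p sy Ux; have h3 := isd_rot p sL Ux.
have h4 := isd_rot p sg Ux.
have sl : smooth_on U (fun x => (n%:R - 1) * Euler y x) by smt.
transitivity (rotd p (fun x => (n%:R - 1) * Euler y x) x).
  by apply/esym; notypeclasses refine (rot_isd sl Ux _); isd; ring.
rewrite (rot_eq_on oU p pdeE Ux).
have y2 z : U z -> (1 - y z) ^+ 2 != 0 by move=> Uz; rewrite expf_neq0 // y1.
have y2x := y2 _ Ux.
by notypeclasses refine (rot_isd _ Ux _); [smt|isd; field].
Qed.

Lemma max_rot f x p : smooth_on U f -> U x -> (forall z, r2 z = r2 x -> f z <= f x) ->
  rotd p f x = 0.
Proof.
move=> sf Ux fm; pose a := coo (rv p x).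
have rE (g : 'I_n -> R) : dp a g = x ord0 p.1 * g p.2 - x ord0 p.2 * g p.1.
  rewrite /dp (eq_bigr (fun k => (x ord0 p.1 * g k) * (p.2 == k)%:R + (- x ord0 p.2 * g k) * (p.1 == k)%:R)).
    by rewrite big_split /= !sum_deltar; ring.
  by move=> k _; rewrite /a /coo /rv !mxE eqxx /= [k == p.2]eq_sym [k == p.1]eq_sym; ring.
have ax : dp a (coo x) = 0 by rewrite rE /coo; ring.
have [+ _] := sphere_max_vec sf (fun z zx => U_r2 Ux zx) fm (r2p Ux) ax.
by rewrite rE /grad /rotd.
Qed.

Lemma max_lapS f x : smooth_on U f -> U x -> (forall z, r2 z = r2 x -> f z <= f x) ->
  lapS f x <= 0.
Proof. move=> sf Ux fm; exact: sphere_max_lapS sf (fun z zx => U_r2 Ux zx) fm (r2p Ux). Qed.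

Lemma annulus_U a b x : r0 ^+ 2 < a -> annulus a b x -> U x.
Proof. by move=> ra /andP [ax _]; apply/UE; exact: lt_le_trans ax. Qed.

(** At a maximum of Q off the inner sphere with y nonzero, the rotations of y vanish and y [lapS] y
    <= 0, so the equation forbids a positive radial derivative of Q. The bound comes from the inner
    sphere and is independent of the outer radius. *)
Lemma Q_bounded a : r0 ^+ 2 < a -> exists C, forall x, a <= r2 x -> Qf x <= C.
Proof.
move=> ra; have a0 : 0 < a by apply: le_lt_trans ra; exact: sqr_ge0.
(* If the inner sphere had no point, scaling shows that nothing lies beyond it either, and any
   constant is a bound. *)
have [[x1 x1a]|none] := pselect (exists x : 'rV[R]_n, annulus a a x); last first.
  exists 0 => x ax; case: none; exists (Num.sqrt (a / r2 x) *: x).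
  have xp : 0 < r2 x by exact: lt_le_trans ax.
  by rewrite /annulus /= r2Z sqr_sqrtr ?divfK ?gt_eqF ?lexx // divr_ge0 // ltW.
have cQ b x : annulus a b x -> {for x, continuous Qf}.
  by move=> ab; apply: smooth_continuous sQ _; exact: annulus_U ab.
have [c0 _ c0m] := annulus_max x1a (cQ a).
exists (Qf c0) => x ax; apply/ler_addgt0Pl => e e0.
pose eta := e / (r2 x + 1).
have r1 : 0 < r2 x + 1 by rewrite ltr_wpDl ?r2_ge0.
have eta0 : 0 < eta by rewrite divr_gt0.
(* The small penalty forces a strictly positive radial derivative of [Qf] at a maximum of [f] off
   the inner sphere; [eta] is chosen so that its cost at [x] is at most [e]. *)
pose f z := Qf z + (- eta) * r2 z.
have sf : smooth_on U f by rewrite /f; smt.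
have xa : annulus a (r2 x) x by rewrite /annulus /= ax lexx.
have x1a' : annulus a (r2 x) x1.
  by move: x1a => /andP [h1 h2]; rewrite /annulus /= h1 (le_trans h2 ax).
have [c ca cm] := annulus_max xa (fun z zb => smooth_continuous sf (annulus_U ra zb)).
have Uc := annulus_U ra ca; move: (ca) => /andP [ac cx].
have [cE|cE] := eqVneq (r2 c) a.
  have h1 : Qf c <= Qf c0 by apply: c0m; rewrite /annulus /= cE lexx.
  have := cm x xa; rewrite /f cE => h2.
  have h3 : eta * r2 x <= e.
    by rewrite /eta mulrAC ler_pdivrMr // ler_wpM2l ?(ltW e0) // lerDl.
  have : 0 <= eta * a by rewrite mulr_ge0 // ltW.
  lra.
have ac' : a < r2 c by rewrite lt_neqAle eq_sym cE ac.
have fm z : r2 z = r2 c -> f z <= f c by move=> zc; apply: cm; rewrite /annulus /= zc.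
have Qm z : r2 z = r2 c -> Qf z <= Qf c.
  by move=> zc; have := fm z zc; rewrite /f zc lerD2r.
have fE : 0 <= Euler f c by apply: (annulus_max_Euler sf Uc (ltW a0) ac' cx).
have : Euler f c = Euler Qf c + (- eta) * (2 * r2 c).
  have h1 := isd_Euler sQ Uc; have h2 := r2_isd_Euler c.
  by notypeclasses refine (Euler_isd sf Uc _); rewrite /f; isd; ring.
move=> fE'; move: fE; rewrite {}fE' => fE.
have cp := r2p Uc.
have EQ0 : 0 < Euler Qf c by have : 0 < eta * r2 c by [rewrite mulr_gt0]; lra.
have [yc|yc] := eqVneq (y c) 0.
  by move: EQ0; rewrite Euler_Q // /Qf yc; rewrite !(mul0r, mulr0, addr0) ltxx.
have ryc p : rotd p y c = 0.
  have := max_rot p sQ Uc Qm; rewrite rot_Q // => /eqP.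
  by rewrite !mulf_eq0 (negbTE yc) pnatr_eq0 (gt_eqF (kp Uc)) /= => /eqP.
have gc : gamS y y c = 0 by rewrite gE big1 ?mulr0 // => p _; rewrite ryc mul0r.
have := max_lapS sQ Uc Qm; rewrite lapS_Q // gc mulr0 addr0 => lQ.
have y1 : 0 < 1 - y c by rewrite subr_gt0 y_lt1.
have EQ : (n%:R - 1) * Euler Qf c = kw c * (2 * y c * lapS y c) / (1 - y c).
  rewrite Euler_Q // mulrDr [_ * (_ * Euler y c)]mulrCA pdeE // gc n2 /Qf.
  by field; rewrite gt_eqF.
have n1 : 0 < n%:R - 1 :> R by rewrite nd subr_gt0 ltr1n.
have : 0 < (n%:R - 1) * Euler Qf c by rewrite mulr_gt0.
by rewrite EQ pmulr_lgt0 ?invr_gt0 // ltNge lQ.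
Qed.

(** The analogue of bounding a squared trace by the squared norm of the Hessian. It lets the good
    term [B] absorb the Laplacian in the Bernstein argument. *)
Lemma lapS_sqr_le x : U x ->
  lapS y x ^+ 2 <= 2^-1 * (n * n)%:R * \sum_p gamS (rotd p y) (rotd p y) x.
Proof.
move=> Ux; rewrite (lapS_rot oU) //.
have H : (\sum_p rotd p (rotd p y) x) ^+ 2 <= (n * n)%:R * \sum_p rotd p (rotd p y) x ^+ 2.
  by have := sum_sqr_le (fun p => rotd p (rotd p y) x); rewrite card_prod card_ord.
have H2 : \sum_p rotd p (rotd p y) x ^+ 2 <= 2 * \sum_p gamS (rotd p y) (rotd p y) x.
  rewrite mulr_sumr; apply: ler_sum => p _; rewrite gamS_rot mulrA divff // mul1r (bigD1 p) //=.
  by rewrite expr2 lerDl sumr_ge0 // => q _; rewrite -expr2 sqr_ge0.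
have nn : 0 <= (n * n)%:R :> R by [].
move: H H2 nn; move: (\sum_p rotd p (rotd p y) x) (\sum_p rotd p (rotd p y) x ^+ 2) => s t.
by move: (\sum_p _) (n * n)%:R => B N; nra.
Qed.

(** Bernstein's trick: W is divided by K - Q. The gradient term produced by Q enters with the sign
    that yields -2 [g0] [gamS], and this beats the positive square of [gamS] coming from the
    nonlinearity, because at a maximum [gamS] is at most [g0] K over the large weight. *)
Lemma W_bounded : exists C b, r0 ^+ 2 < b /\ forall x, b <= r2 x -> Wf x <= C.
Proof.
pose a1 := (r0 + 1) ^+ 2.
have ra1 : r0 ^+ 2 < a1 by have h := r0_gt0; rewrite -subr_gt0 (_ : a1 - _ = 2 * r0 + 1) /a1; [lra|ring].
have [C0 HC0] := Q_bounded ra1.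
pose K := `|C0| + 1.
have K1 : 1 <= K by rewrite /K lerDr.
have HK x : a1 <= r2 x -> Qf x <= K - 1.
  by move=> /HC0 h; rewrite /K addrK; apply: le_trans h (ler_norm _).
pose N : R := 2^-1 * (n * n)%:R.
have N0 : 0 <= N by rewrite mulr_ge0.
(* Since the weight is at least [r2], beyond this radius it exceeds 64 K, whence y^2 <= 1/64, and
   also 2 (N + 6) K: both are needed in [maximum_contra]. *)
pose a := a1 + 64 * K + 2 * (N + 6) * K.
have a0 : 0 <= a1 by apply: ltW; apply: le_lt_trans ra1; exact: sqr_ge0.
have NK : 0 <= N * K by rewrite mulr_ge0 //; lra.
have aa1 : a1 <= a by rewrite /a; nra.
have ra : r0 ^+ 2 < a by exact: lt_le_trans aa1.
have a1' : 1 <= a by rewrite /a; nra.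
have ap : 0 < a by lra.
have [[x1 x1a]|none] := pselect (exists x : 'rV[R]_n, annulus a a x); last first.
  exists 0, a; split=> // x ax; case: none; exists (Num.sqrt (a / r2 x) *: x).
  have xp : 0 < r2 x by exact: lt_le_trans ax.
  by rewrite /annulus /= r2Z sqr_sqrtr ?divfK ?gt_eqF ?lexx // divr_ge0 // ltW.
pose G x := Wf x * (K - Qf x)^-1.
have KQ b x : annulus a b x -> 1 <= K - Qf x.
  by move=> /andP [ax _]; have := HK x (le_trans aa1 ax); lra.
have cG b x : annulus a b x -> {for x, continuous G}.
  move=> ab; have Ux := annulus_U ra ab; apply: continuousM; first exact: smooth_continuous sW Ux.
  apply: continuousV; first by have := KQ b x ab => h; apply: lt0r_neq0; lra.
  by apply: continuousB; [exact: cst_continuous|exact: smooth_continuous sQ Ux].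
have [c0 _ c0m] := annulus_max x1a (cG a).
have W0 x : U x -> 0 <= Wf x by move=> Ux; rewrite mulr_ge0 ?(ltW (kp Ux)) ?gamS_ge0.
exists (`|G c0| * K), a; split=> // x ax.
have xa : annulus a (r2 x) x by rewrite /annulus /= ax lexx.
have [c ca cm] := annulus_max xa (cG (r2 x)).
suff Gc : G c <= `|G c0|.
  have h1 := KQ _ _ xa; have h2 := cm x xa.
  have -> : Wf x = G x * (K - Qf x) by rewrite /G divfK // lt0r_neq0 //; lra.
  have Q0 : 0 <= Qf x.
    by rewrite /Qf mulr_ge0 ?(ltW (kp (annulus_U ra xa))) // -expr2 sqr_ge0.
  apply: (@le_trans _ _ (`|G c0| * (K - Qf x))).
    by rewrite ler_wpM2r ?(le_trans h2 Gc) //; lra.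
  by rewrite ler_wpM2l //; lra.
have Uc := annulus_U ra ca; move: (ca) => /andP [ac cx].
have [cE|cE] := eqVneq (r2 c) a.
  by apply: le_trans (ler_norm _); apply: c0m; rewrite /annulus /= cE lexx.
have ac' : a < r2 c by rewrite lt_neqAle eq_sym cE ac.
have [G0|g0p] := leP (G c) 0; first exact: le_trans G0 (normr_ge0 _).
exfalso.
set g0 := G c in g0p cm.
have WE z b : annulus a b z -> Wf z = G z * (K - Qf z).
  by move=> zb; rewrite /G divfK // lt0r_neq0 //; have := KQ _ _ zb; lra.
(* Where the quotient [G] attains its maximum [g0], [H] attains its maximum [g0] K; differentiating
   [H] avoids derivatives of a quotient. *)
pose H z := Wf z + g0 * Qf z.
have sH : smooth_on U H by rewrite /H; smt.
have Hc : H c = g0 * K by rewrite /H (WE _ _ ca) -/g0; ring.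
have Hm z : annulus a (r2 x) z -> H z <= H c.
  move=> za; rewrite Hc /H (WE _ _ za).
  have : G z * (K - Qf z) <= g0 * (K - Qf z).
    by rewrite ler_wpM2r ?cm //; have := KQ _ _ za; lra.
  lra.
have Hs z : r2 z = r2 c -> H z <= H c by move=> zc; apply: Hm; rewrite /annulus /= zc.
have EH : 0 <= Euler H c by apply: (annulus_max_Euler sH Uc (ltW ap) ac' cx).
have LH := max_lapS sH Uc Hs.
have y1 : 0 < 1 - y c by rewrite subr_gt0 y_lt1.
have kc := kp Uc.
have rg p : rotd p (gamS y y) c = - 2 * g0 * y c * rotd p y c.
  have := max_rot p sH Uc Hs.
  have h1 := isd_rot p sW Uc; have h2 := isd_rot p sQ Uc.
  have -> : rotd p H c = rotd p Wf c + g0 * rotd p Qf c.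
    by notypeclasses refine (rot_isd sH Uc _); rewrite /H; isd; ring.
  rewrite rot_W // rot_Q // => h.
  apply: (mulfI (lt0r_neq0 kc)); apply/eqP; rewrite -subr_eq0; apply/eqP.
  by rewrite -[RHS]h; ring.
have EHE : Euler H c = Euler Wf c + g0 * Euler Qf c.
  have h1 := isd_Euler sW Uc; have h2 := isd_Euler sQ Uc.
  by notypeclasses refine (Euler_isd sH Uc _); rewrite /H; isd; ring.
have LHE : lapS H c = lapS Wf c + g0 * lapS Qf c.
  have s1 : smooth_on U (fun z => g0 * Qf z) by smt.
  have s2 : smooth_on U (fun=> g0) by smt.
  rewrite /H (lapSD oU) // (lapS_radM oU s2 sQ) // => z p Uz.
  by notypeclasses refine (rot_isd s2 Uz _); isd.
have n1 : 0 < n%:R - 1 :> R by rewrite nd subr_gt0 ltr1n.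
pose B := \sum_p gamS (rotd p y) (rotd p y) c.
pose v := (1 - y c)^-1.
have v0 : 0 < v by rewrite invr_gt0.
(* In this combination the third order terms cancel, and [rg], the vanishing of the rotations of
   [H], replaces the derivatives of the squared gradient. *)
have key : (n%:R - 1) * Euler H c - lapS H c * v =
    kw c * v * (- B + 2 * gamS y y c * lapS y c * v - 3 * g0 * y c * gamS y y c * v
      + 6 * gamS y y c ^+ 2 * v ^+ 2 - 2 * g0 * gamS y y c).
  rewrite EHE LHE lapS_W // lapS_Q // Euler_W // Euler_Q //.
  have S1 : (n%:R - 1) * \sum_p rotd p y c * rotd p (Euler y) c =
     (- ((n%:R - 1) * (n%:R - 2))) * (2 * gamS y y c) + (\sum_p rotd p y c * rotd p (lapS y) c) * v
     + lapS y c * v ^+ 2 * (2 * gamS y y c) + 3 / 2 * (- 2 * g0 * y c * v ^+ 2 * (2 * gamS y y c)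
        + 2 * gamS y y c * v ^+ 3 * (2 * gamS y y c)).
    rewrite mulr_sumr (eq_bigr (fun p => (rotd p y c * rotd p (lapS y) c) * v + ((rotd p y c * rotd p y c) *
      (- ((n%:R - 1) * (n%:R - 2)) + lapS y c * v ^+ 2 + 3 / 2 * (- 2 * g0 * y c * v ^+ 2 + 2 * gamS y y c * v ^+ 3))
      + 0 * 0))).
      rewrite sum_lin3 (_ : \sum_p rotd p y c * rotd p y c = 2 * gamS y y c); first by field.
      by rewrite gE; field.
    move=> p _; rewrite mulrCA rot_Euler_y // rg /v; field; exact: lt0r_neq0.
  have S2 := pdeE Uc.
  transitivity (2 * (n%:R - 1) * d.+1%:R * Wf c + kw c * ((n%:R - 1) * \sum_p rotd p y c * rotd p (Euler y) c)
    + g0 * (2 * (n%:R - 1) * d.+1%:R * Qf c + 2 * kw c * y c * ((n%:R - 1) * Euler y c))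
    - (kw c * (\sum_p rotd p y c * rotd p (lapS y) c + B) + g0 * (kw c * (2 * y c * lapS y c + 2 * gamS y y c))) * v).
    by rewrite /B; ring.
  rewrite S1 S2 n2 /Wf /Qf /v; field; exact: lt0r_neq0.
have key0 : 0 <= - B + 2 * gamS y y c * lapS y c * v - 3 * g0 * y c * gamS y y c * v
      + 6 * gamS y y c ^+ 2 * v ^+ 2 - 2 * g0 * gamS y y c.
  have kv : 0 < kw c * v by rewrite mulr_gt0.
  rewrite -(pmulr_rge0 _ kv) -key subr_ge0; apply: le_trans (mulr_ge0 (ltW n1) EH).
  exact: mulr_le0_ge0 LH (ltW v0).
have Ga := gamS_ge0 c.
have Gp : 0 < gamS y y c.
  rewrite lt0r Ga andbT; apply/negP => /eqP gc0.
  by move: g0p; rewrite /g0 /G /Wf gc0 mulr0 mul0r ltxx.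
have LB := lapS_sqr_le Uc; rewrite -/B -/N in LB.
have rc1 : 1 <= r2 c by lra.
have kr : r2 c <= kw c by rewrite /kw exprS ler_peMr ?exprn_ege1 //; lra.
have kQ := KQ _ _ ca.
have Q0 : 0 <= Qf c by rewrite /Qf mulr_ge0 ?(ltW kc) // -expr2 sqr_ge0.
have GW : kw c * gamS y y c <= g0 * K.
  rewrite -/(Wf c) (WE _ _ ca) -/g0 ler_wpM2l ?(ltW g0p) //; lra.
have y8 : y c ^+ 2 <= 1 / 64.
  have h1 : kw c * y c ^+ 2 <= K by move: kQ; rewrite /Qf -expr2; lra.
  have h2 : 64 * K <= kw c by rewrite /a in ac; lra.
  have h3 := sqr_ge0 (y c); nra.
have v1 : v * (1 - y c) = 1 by rewrite mulVf ?lt0r_neq0.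
have Nk : 2 * (N + 6) * K <= kw c by rewrite /a in ac; lra.
have N1 : 0 < N by rewrite mulr_gt0 // ltr0n muln_gt0 nd.
have gv : 2 * gamS y y c * lapS y c * v - B <= N * gamS y y c ^+ 2 * v ^+ 2.
  have [B0|B0] := leP B 0; last first.
    rewrite -(ler_pM2l N1).
    have := sqr_ge0 (lapS y c - N * gamS y y c * v); nra.
  have L0 : lapS y c = 0.
    by apply/eqP; rewrite -sqrf_eq0 eq_le sqr_ge0 andbT; apply: le_trans LB _; rewrite mulr_ge0_le0.
  have B0' : 0 <= B by apply: sumr_ge0 => p _; rewrite gamS_rot mulr_ge0 // sumr_ge0 // => q _; rewrite -expr2 sqr_ge0.
  have -> : B = 0 by apply/eqP; rewrite eq_le B0 B0'.
  rewrite L0 mulr0 mul0r subr0; apply: mulr_ge0; last exact: sqr_ge0.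
  by apply: mulr_ge0 => //; exact: sqr_ge0.
exfalso; exact: (maximum_contra g0p Gp K1 (ltW N1) v0 v1 y8 Nk GW gv key0).
Qed.
End Bernstein.

(** * Decay of u - 1 and of the spherical gradient of u *)

Section Decay.
Context {R : realType} {n : nat} (r0 : R) (u V : 'rV[R]_n -> R).
Hypothesis n2 : (2 < n)%N.
Hypothesis r0_gt0 : 0 < r0.
Let U : set 'rV[R]_n := exterior r0.
Hypothesis su : smooth_on U u.
Hypothesis u_gt0 : forall x, U x -> 0 < u x.
Hypothesis scalE : forall x, U x -> (n%:R - 1) * (Euler u x / u x) =
  u x * lapS u x - 2^-1 * (n%:R - 1) * (n%:R - 2) * (u x ^+ 2 - 1).
Implicit Types (x : 'rV[R]_n).

Let oU : open U. Proof. exact: open_exterior (ltW r0_gt0). Qed.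
Let UE x : U x <-> r0 ^+ 2 < r2 x. Proof. exact: exteriorE (ltW r0_gt0). Qed.
Let un0 x : U x -> u x != 0. Proof. by move=> Ux; rewrite gt_eqF // u_gt0. Qed.

(** In y = 1 - u^-2 the zero order term of the scalar curvature equation becomes linear, and
    positivity of u reads y < 1. For Schwarzschild y is 2m r^(2-n). *)
Definition yf x : R := 1 - (u x)^-1 * (u x)^-1.

Let sw : smooth_on U (fun x => (u x)^-1). Proof. by smt. Qed.
Let sww : smooth_on U (fun x => (u x)^-1 * (u x)^-1). Proof. by smt. Qed.
Lemma smooth_yf : smooth_on U yf. Proof. by rewrite /yf; smt. Qed.

Lemma rot_inv x p : U x -> rotd p (fun z => (u z)^-1) x = - (u x) ^- 2 * rotd p u x.
Proof.
move=> Ux; have h := isd_rot p su Ux; have u0 := un0 Ux.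
by notypeclasses refine (rot_isd sw Ux _); isd; field.
Qed.

Lemma rot_yf x p : U x -> rotd p yf x = 2 * (u x) ^- 3 * rotd p u x.
Proof.
move=> Ux; have h := isd_rot p su Ux; have u0 := un0 Ux.
by notypeclasses refine (rot_isd smooth_yf Ux _); rewrite /yf; isd; field.
Qed.

Lemma Euler_yf x : U x -> Euler yf x = 2 * (u x) ^- 3 * Euler u x.
Proof.
move=> Ux; have h := isd_Euler su Ux; have u0 := un0 Ux.
by notypeclasses refine (Euler_isd smooth_yf Ux _); rewrite /yf; isd; field.
Qed.

Lemma gamS_yf x : U x -> gamS yf yf x = 4 * (u x) ^- 6 * gamS u u x.
Proof.
move=> Ux; have u0 := un0 Ux; rewrite !gamS_rot [in RHS]mulrCA; congr (_ * _).
by rewrite mulr_sumr; apply: eq_bigr => p _; rewrite rot_yf //; field.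
Qed.

Lemma lapS_yf x : U x -> lapS yf x = 2 * (u x) ^- 3 * lapS u x - 6 * (u x) ^- 4 * gamS u u x.
Proof.
move=> Ux; have u0 := un0 Ux.
have g1 : gamS u (fun z => (u z)^-1) x = - (u x) ^- 2 * gamS u u x.
  rewrite !gamS_rot mulrCA; congr (_ * _); rewrite mulr_sumr; apply: eq_bigr => p _.
  by rewrite rot_inv //; ring.
have g2 : gamS (fun z => (u z)^-1) (fun z => (u z)^-1) x = (u x) ^- 4 * gamS u u x.
  rewrite !gamS_rot mulrCA; congr (_ * _); rewrite mulr_sumr; apply: eq_bigr => p _.
  by rewrite rot_inv //; field.
have s1 : smooth_on U (fun=> 1 : R) by smt.
have sm1 : smooth_on U (fun=> - 1 : R) by smt.
have lw : u x * lapS (fun z => (u z)^-1) x = - ((u x)^-1 * lapS u x - 2 * ((u x) ^- 2 * gamS u u x)).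
  have l1 : lapS (fun z => u z * (u z)^-1) x = 0.
    rewrite -(lapS_cst oU 1 Ux) (lapS_rot oU) ?(lapS_rot oU) //; last by smt.
    congr (_ * _); apply: eq_bigr => p _; apply: (rot_eq_on oU) => // z Uz.
    by apply: (rot_eq_on oU) => // z' Uz'; rewrite divff // un0.
  by have := lapSM oU su sw Ux; rewrite l1 g1; lra.
have -> : lapS yf x = - lapS (fun z => (u z)^-1 * (u z)^-1) x.
  transitivity (lapS (fun z => 1 + (- 1) * ((u z)^-1 * (u z)^-1)) x).
    by congr (lapS _ _); apply/funext => z; rewrite /yf mulN1r.
  have sm : smooth_on U (fun z => (- 1) * ((u z)^-1 * (u z)^-1)) by smt.
  rewrite (lapSD oU s1 sm) // (lapS_cst oU) // add0r (lapS_radM oU sm1 sww) ?mulN1r //.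
  by move=> z p Uz; notypeclasses refine (rot_isd sm1 Uz _); isd.
rewrite (lapSM oU sw sw) // g2.
have -> : lapS (fun z => (u z)^-1) x = (u x)^-1 * (- ((u x)^-1 * lapS u x - 2 * ((u x) ^- 2 * gamS u u x))).
  by rewrite -lw mulKf.
by field.
Qed.

Lemma yf_lt1 x : U x -> yf x < 1.
Proof. by move=> Ux; rewrite /yf ltrBlDr ltrDl mulr_gt0 // invr_gt0 u_gt0. Qed.

Lemma pde_yf x : U x -> (n%:R - 1) * Euler yf x =
  - ((n%:R - 1) * (n%:R - 2)) * yf x + lapS yf x / (1 - yf x) + 3 / 2 * gamS yf yf x / (1 - yf x) ^+ 2.
Proof.
move=> Ux; have u0 := un0 Ux; have := scalE Ux.
rewrite Euler_yf // lapS_yf // gamS_yf // => h.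
have -> : (n%:R - 1) * (2 * (u x) ^- 3 * Euler u x) = 2 * (u x) ^- 2 * ((n%:R - 1) * (Euler u x / u x)) by field.
rewrite h /yf; field; rewrite u0 /=.
by rewrite opprB addrC subrK oner_neq0.
Qed.

Lemma u_decay : exists C b : R, [/\ 0 <= C, 1 <= b, r0 ^+ 2 < b & forall x, b <= r2 x ->
  [/\ 1 / 2 <= u x <= 2, (u x - 1) ^+ 2 * r2 x <= C & gamS u u x * r2 x <= C]].
Proof.
have [d nd] : exists d, n = d.+3 by move: n2; case: (n) => [|[|[|d]]] // _; exists d.
have [C1 [b1 [rb1 H1]]] := W_bounded nd r0_gt0 smooth_yf yf_lt1 pde_yf.
have [C2 H2] := Q_bounded nd r0_gt0 smooth_yf yf_lt1 pde_yf rb1.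
pose C := 64 * (`|C1| + `|C2|).
have C10 := normr_ge0 C1; have C20 := normr_ge0 C2.
have C1n := ler_norm C1; have C2n := ler_norm C2.
have C0 : 0 <= C by rewrite /C; lra.
have b10 : 0 <= b1 by apply: ltW; apply: le_lt_trans rb1; exact: sqr_ge0.
(* Beyond this radius the bound on the weighted square of y gives y^2 <= 1/64, which puts u between
   1/2 and 2. *)
exists C, (b1 + C + 1); split=> //; [lra|lra|] => x bx.
have b1x : b1 <= r2 x by lra.
have Ux : U x by apply/UE; lra.
have up := u_gt0 Ux; have u0 := un0 Ux.
(* As n >= 3, the weight r^(2(n-2)) is at least r^2 where r >= 1; this weaker rate is all that is
   kept. *)
have kr : r2 x <= @kw _ _ d x by rewrite /kw exprS ler_peMr ?exprn_ege1 //; lra.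
have Q1 : yf x ^+ 2 * r2 x <= `|C2|.
  apply: (@le_trans _ _ (@Qf _ _ d yf x)); last exact: le_trans (H2 x b1x) C2n.
  by rewrite /Qf -expr2 mulrC ler_wpM2r // sqr_ge0.
have W1 : gamS yf yf x * r2 x <= `|C1|.
  apply: (@le_trans _ _ (@Wf _ _ d yf x)); last exact: le_trans (H1 x b1x) C1n.
  by rewrite /Wf mulrC ler_wpM2r // gamS_ge0.
set w := (u x)^-1; have wu : w * u x = 1 by rewrite mulVf.
have wp : 0 < w by rewrite invr_gt0.
have y4 : yf x ^+ 2 <= 1 / 64 by have := sqr_ge0 (yf x); rewrite /C in bx; nra.
have yE : yf x = 1 - w * w by [].
have w1 : 7 / 8 <= w * w <= 9 / 8 by rewrite yE in y4; apply/andP; split; nra.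
have w2 : 7 / 8 <= w <= 9 / 8 by apply/andP; split; nra.
have ub : 1 / 2 <= u x <= 2 by apply/andP; split; nra.
split => //.
  have wp1 : 0 < 1 + w by rewrite addr_gt0.
  have -> : u x - 1 = u x / (1 + w) * yf x.
    rewrite yE (_ : 1 - w * w = (1 + w) * (1 - w)); last by ring.
    by rewrite mulrA divfK ?gt_eqF // mulrBr mulr1 [u x * w]mulrC wu.
  have : u x / (1 + w) <= 2 by rewrite ler_pdivrMr; nra.
  have : 0 <= u x / (1 + w) by rewrite divr_ge0 // ltW // addr_gt0.
  move: (u x / (1 + w)) => z z0 z2.
  have : z ^+ 2 <= 4 by nra.
  rewrite exprMn -mulrA => z4; apply: (@le_trans _ _ (4 * `|C2|)); last by rewrite /C; lra.
  apply: ler_pM => //; first exact: sqr_ge0.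
  by apply: mulr_ge0; [exact: sqr_ge0|exact: r2_ge0].
have -> : gamS u u x = u x ^+ 6 / 4 * gamS yf yf x by rewrite gamS_yf //; field.
have : u x ^+ 6 <= 64 by rewrite (_ : 64 = 2 ^+ 6); [apply: lerXn2r; rewrite ?nnegrE; lra|ring].
rewrite -mulrA => u6; apply: (@le_trans _ _ (16 * `|C1|)); last by rewrite /C; lra.
apply: ler_pM => //; [apply: divr_ge0 => //; apply: exprn_ge0; lra|by rewrite mulr_ge0 ?gamS_ge0 ?r2_ge0|lra].
Qed.

End Decay.

(* Section variables must stay: [lra] does not work once they are cleared. *)
Ltac clear_from K :=
  lazymatch goal with
  | H : _ |- _ => tryif constr_eq H K then idtac
      else first [clear H; clear_from K | revert H; clear_from K; intro H]
  end.

(** * Stability of a vector under an integrable perturbation along a ray *)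

Section RayStability.
Context {R : realType} {I : finType}.

Lemma sum_CS (a b : I -> R) : (\sum_i a i * b i) ^+ 2 <= (\sum_i a i ^+ 2) * (\sum_i b i ^+ 2).
Proof.
have H : 0 <= \sum_i \sum_j (a i * b j - a j * b i) ^+ 2.
  by apply: sumr_ge0 => i _; apply: sumr_ge0 => j _; exact: sqr_ge0.
rewrite (eq_bigr (fun i => a i ^+ 2 * \sum_j b j ^+ 2 + (b i ^+ 2 * (\sum_j a j ^+ 2) +
   (a i * b i) * (- 2 * \sum_j a j * b j)))) in H.
  rewrite !big_split /= -!mulr_suml in H.
  by rewrite -subr_ge0; nra.
move=> i _; rewrite (eq_bigr (fun j => b j ^+ 2 * a i ^+ 2 + (a j ^+ 2 * b i ^+ 2 + (a j * b j) * (- 2 * (a i * b i))))); last by move=> j _; ring.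
by rewrite !big_split /= -!mulr_suml; ring.
Qed.

Lemma sqr_le_abs (A B : R) : 0 <= B -> A ^+ 2 <= B ^+ 2 -> - B <= A <= B.
Proof. by move=> B0 AB; apply/andP; split; nra. Qed.

(** A rate k/s^2 is integrable. With F the sum of squares plus d, F (1 + 4k/s) is nonincreasing, and
    k <= 1/4 keeps the factor between 1 and 2. A linear functional of the vector then moves by at
    most the integral of L/s^2, that is, by at most L. *)
Lemma ray_stable (e de : I -> R -> R) (d k T : R) :
  (forall i s, 1 <= s <= T -> is_derive s (1 : R) (e i) (de i s)) -> 0 <= d -> 0 <= k <= 1 / 4 ->
  (forall s, 1 <= s <= T -> \sum_i de i s ^+ 2 <= (k / s ^+ 2) ^+ 2 * (\sum_i e i s ^+ 2 + d)) ->
  forall s, 1 <= s <= T -> \sum_i e i s ^+ 2 + d <= 2 * (\sum_i e i 1 ^+ 2 + d) /\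
   forall (w : I -> R) (L : R), 0 <= L -> k ^+ 2 * (\sum_i w i ^+ 2) * (2 * (\sum_i e i 1 ^+ 2 + d)) <= L ^+ 2 ->
     \sum_i w i * e i 1 - L <= \sum_i w i * e i s.
Proof.
move=> he d0 /andP [k0 k4] hde.
pose F s := \sum_i e i s ^+ 2 + d.
have F0 s : 0 <= F s by rewrite addr_ge0 // sumr_ge0 // => i _; exact: sqr_ge0.
have hinv s : 1 <= s <= T -> 0 < s /\ is_derive s (1 : R) (fun t => t^-1) (- s ^- 2).
  move=> /andP [s1 _]; have s0 : 0 < s by lra.
  by split=> //; isd; [rewrite gt_eqF|field; rewrite gt_eqF].
have F2 s : 1 <= s <= T -> F s <= 2 * F 1.
  move=> /andP [s1 sT].
  pose g t : R := - (F t * (1 + 4 * k * t^-1)).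
  have hg t : 1 <= t <= s -> is_derive t (1 : R) g
      (- ((\sum_i 2 * (e i t * de i t)) * (1 + 4 * k * t^-1) - F t * (4 * k * t ^- 2))).
    move=> /andP [t1 ts]; have tT : 1 <= t <= T by rewrite t1 (le_trans ts sT).
    have [t0 ht] := hinv t tT; have tn0 := lt0r_neq0 t0; have hei i := he i t tT.
    have hF : is_derive t (1 : R) F (\sum_i 2 * (e i t * de i t)).
      by rewrite /F; isd; rewrite addr0; apply: eq_bigr => i _; ring.
    by rewrite /g; isd; ring.
  have gd t : 1 <= t <= s ->
      0 <= - ((\sum_i 2 * (e i t * de i t)) * (1 + 4 * k * t^-1) - F t * (4 * k * t ^- 2)).
    move=> /andP [t1 ts]; have tT : 1 <= t <= T by rewrite t1 (le_trans ts sT).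
    have [t0 _] := hinv t tT.
    set z := t^-1; have z1 : 0 < z <= 1 by rewrite invr_gt0 t0 invf_le1.
    have zE : t ^- 2 = z ^+ 2 by rewrite exprVn.
    have h1 : (\sum_i e i t * de i t) ^+ 2 <= (k * z ^+ 2 * F t) ^+ 2.
      apply: le_trans (sum_CS _ _) _; have := hde t tT; rewrite zE -/(F t) => h.
      have eF : \sum_i e i t ^+ 2 <= F t by rewrite /F lerDl.
      apply: (@le_trans _ _ (F t * ((k * z ^+ 2) ^+ 2 * F t))); last by rewrite exprMn; lra.
      by apply: ler_pM => //; apply: sumr_ge0 => i _; exact: sqr_ge0.
    have zz : 0 <= k * z ^+ 2 * F t by apply: mulr_ge0; [apply: mulr_ge0 => //; exact: sqr_ge0|exact: F0].
    have /andP [_ h2] := sqr_le_abs zz h1.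
    rewrite -mulr_sumr zE; move: z1 => /andP [z0 z1].
    have h3 : 1 + 4 * k * z <= 2 by nra.
    have h4 : 0 <= 1 + 4 * k * z by rewrite addr_ge0 // !mulr_ge0 // ltW.
    have h5 : (\sum_i e i t * de i t) * (1 + 4 * k * z) <= k * z ^+ 2 * F t * 2.
      by apply: le_trans (ler_wpM2r h4 h2) _; rewrite ler_wpM2l.
    lra.
  have := isd_nondecr s1 hg gd; rewrite /g lerN2 invr1 => h.
  have : 0 <= F s * (4 * k * s^-1) by rewrite !mulr_ge0 // invr_ge0; lra.
  have := F0 1; nra.
move=> s sT; split; first exact: F2.
move=> w L L0 wL; move: (sT) => /andP [s1 sT'].
pose g t : R := \sum_i w i * e i t + - (L * t^-1).
have hg t : 1 <= t <= s -> is_derive t (1 : R) g (\sum_i w i * de i t + L * t ^- 2).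
  move=> /andP [t1 ts]; have tT : 1 <= t <= T by rewrite t1 (le_trans ts sT').
  have [t0 ht] := hinv t tT; have tn0 := lt0r_neq0 t0; have hei i := he i t tT.
  rewrite /g; isd; congr (_ + _); last by ring.
  by apply: eq_bigr => i _; ring.
have gd t : 1 <= t <= s -> 0 <= \sum_i w i * de i t + L * t ^- 2.
  move=> /andP [t1 ts]; have tT : 1 <= t <= T by rewrite t1 (le_trans ts sT').
  have z0 : 0 <= t ^- 2 by rewrite invr_ge0 exprn_ge0 //; lra.
  have h : (\sum_i w i * de i t) ^+ 2 <= (L * t ^- 2) ^+ 2.
    apply: le_trans (sum_CS _ _) _; rewrite [leRHS]exprMn.
    have h1 := hde t tT; have h2 := F2 t tT; have z2 := sqr_ge0 (t ^- 2).
    have w0 : 0 <= \sum_i w i ^+ 2 by apply: sumr_ge0 => i _; exact: sqr_ge0.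
    apply: le_trans (ler_wpM2l w0 h1) _; rewrite exprMn.
    apply: le_trans (ler_wpM2r z2 wL).
    rewrite (_ : _ * (_ * _ * _) = k ^+ 2 * (\sum_i w i ^+ 2) * (F t) * t ^- 2 ^+ 2); last by rewrite /F; ring.
    by rewrite ler_wpM2r // ler_wpM2l // mulr_ge0 // sqr_ge0.
  by have /andP [] := sqr_le_abs (mulr_ge0 L0 z0) h; lra.
have := isd_nondecr s1 hg gd; rewrite /g invr1.
have : 0 <= L * s^-1 by rewrite mulr_ge0 // invr_ge0; lra.
lra.
Qed.
End RayStability.

(** Arithmetic of [Euler_egrad_bound]: A2 and B2 are the squared tangential and radial coefficients
    of the variation of [egrad], g and z are the decaying quantities [gamS u u] and (u - 1)^2, and S
    is [egrad2]. *)
Lemma dist_arith (R : realFieldType) (c1 c2 C r A2 B2 g gV S P v M z : R) : 0 <= C -> 1 <= r -> 0 <= g -> g * r <= C ->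
   0 <= gV -> 0 <= P -> S * r = gV + P -> 0 <= v -> v <= M -> 
   A2 <= 2 * P + 8 * c1 ^+ 2 * v -> 0 <= z -> z * r <= C ->
   B2 <= 2 * (g * gV) + 72 * c2 ^+ 2 * z * v ->
   g / r * A2 + B2 / r <= C * (4 + 8 * c1 ^+ 2 + 72 * c2 ^+ 2) * (S / r + M / r ^+ 2).
Proof.
move=> C0' r1 g0 gr gV0 P0 Sr v0 vM hA z0 zr hB.
have rr : 0 < r by lra.
have c10 := sqr_ge0 c1; have c20 := sqr_ge0 c2.
have M0 : 0 <= M by lra.
have S0 : 0 <= S by rewrite -(pmulr_lge0 _ rr) Sr addr_ge0.
set q := r^-1; have q0 : 0 < q by rewrite invr_gt0.
have gq : g <= C * q by rewrite ler_pdivlMr.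
have zq : z <= C * q by rewrite ler_pdivlMr.
have Sq : gV + P = S * r by [].
have hP : P <= S * r by lra.
have hV : gV <= S * r by lra.
have e1 : g * A2 <= C * q * (2 * (S * r) + 8 * c1 ^+ 2 * M).
  have h : A2 <= 2 * (S * r) + 8 * c1 ^+ 2 * M.
    apply: le_trans hA _; apply: lerD; first by rewrite ler_wpM2l.
    by rewrite ler_wpM2l // mulr_ge0.
  have h0 : 0 <= 2 * (S * r) + 8 * c1 ^+ 2 * M.
    by apply: addr_ge0; apply: mulr_ge0 => //; apply: mulr_ge0 => //; exact: ltW.
  by apply: le_trans (ler_wpM2l g0 h) _; rewrite ler_wpM2r.
have e2 : B2 <= C * q * (2 * (S * r) + 72 * c2 ^+ 2 * M).
  apply: le_trans hB _.
  have -> : C * q * (2 * (S * r) + 72 * c2 ^+ 2 * M) = 2 * (C * q * (S * r)) + 72 * c2 ^+ 2 * (C * q) * M by ring.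
  apply: lerD; first by rewrite ler_wpM2l //; apply: ler_pM.
  have c2z : z * v <= C * q * M by apply: ler_pM.
  have c72 : 0 <= 72 * c2 ^+ 2 by rewrite mulr_ge0.
  by have := ler_wpM2l c72 c2z; lra.
have -> : C * (4 + 8 * c1 ^+ 2 + 72 * c2 ^+ 2) * (S / r + M / r ^+ 2) =
  q * (C * q * (2 * (S * r) + 8 * c1 ^+ 2 * M)) + q * (C * q * (2 * (S * r) + 72 * c2 ^+ 2 * M))
   + C * (8 * c1 ^+ 2 + 72 * c2 ^+ 2) * S * q + 4 * C * M * q ^+ 2.
  by rewrite /q; field; rewrite gt_eqF.
have t1 : 0 <= C * (8 * c1 ^+ 2 + 72 * c2 ^+ 2) * S * q.
  by rewrite !mulr_ge0 // ?(ltW q0) // addr_ge0 // mulr_ge0.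
have t2 : 0 <= 4 * C * M * q ^+ 2 by apply: mulr_ge0; [rewrite !mulr_ge0|exact: sqr_ge0].
have t3 : g * q * A2 <= q * (C * q * (2 * (S * r) + 8 * c1 ^+ 2 * M)).
  by rewrite mulrAC mulrC ler_wpM2l // ltW.
have t4 : B2 * q <= q * (C * q * (2 * (S * r) + 72 * c2 ^+ 2 * M)).
  by rewrite mulrC ler_wpM2l // ltW.
lra.
Qed.

(** * Decay of the gradient of V *)

Section Gradient.
Context {R : realType} {n : nat} (r0 : R) (u V : 'rV[R]_n -> R).
Hypothesis n2 : (2 < n)%N.
Hypothesis r0_gt0 : 0 < r0.
Let U : set 'rV[R]_n := exterior r0.
Hypothesis su : smooth_on U u.
Hypothesis u_gt0 : forall x, U x -> 0 < u x.
Hypothesis sV : smooth_on U V.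
Hypothesis mixE : forall x a, U x -> dp a (coo x) = 0 ->
  u x * bil a (coo x) (hs V x) = dp a (grad u x) * (Euler V x + (n%:R - 2) * V x).
Hypothesis radE : forall x, U x ->
  bil (coo x) (coo x) (hs V x) - Euler u x / u x * Euler V x + u x * gamS u V x =
       - (2^-1 * (n%:R - 1) * (n%:R - 2)) * (u x ^+ 2 - 1) * V x.
Implicit Types (x : 'rV[R]_n).

Let oU : open U. Proof. exact: open_exterior (ltW r0_gt0). Qed.
Let UE x : U x <-> r0 ^+ 2 < r2 x. Proof. exact: exteriorE (ltW r0_gt0). Qed.
Let un0 x : U x -> u x != 0. Proof. by move=> Ux; rewrite gt_eqF // u_gt0. Qed.
Let rn0 x : U x -> r2 x != 0. Proof. by move=> Ux; rewrite gt_eqF // (r2_gt0 (ltW r0_gt0)). Qed.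
Let rp x : U x -> 0 < r2 x. Proof. exact: r2_gt0 (ltW r0_gt0). Qed.
Let sr2 : smooth_on U r2. Proof. exact: smooth_r2. Qed.
Let sEV : smooth_on U (Euler V). Proof. exact: smooth_Euler r0_gt0 _ sV. Qed.

Definition tgrad (f : 'rV[R]_n -> R) i x : R := dpd i f x - x ord0 i * Euler f x / r2 x.

(* The radial part is taken with respect to [g]: in the Euclidean parallel
   frame along a ray its variation involves only the decaying quantities [tgrad u] and [u - 1]. *)
Definition egrad i x : R := dpd i V x - (1 - (u x)^-1) * Euler V x * x ord0 i * (r2 x)^-1.

Lemma smooth_egrad i : smooth_on U (egrad i). Proof. by rewrite /egrad; smt. Qed.

Lemma EEuler f x : smooth_on U f -> U x ->
  Euler (Euler f) x = bil (coo x) (coo x) (hs f x) + Euler f x.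
Proof. by move=> sf Ux; have := lapS_Euler oU sf Ux; rewrite /lapS; lra. Qed.

Lemma bil_tproj f x i : U x ->
  bil (tproj x i) (coo x) (hs f x) = Euler (dpd i f) x - x ord0 i * bil (coo x) (coo x) (hs f x) / r2 x.
Proof.
move=> Ux; rewrite !bil_dp.
have dE k : dp (coo x) (hs f x k) = Euler (dpd k f) x.
  by rewrite /Euler; apply: eq_bigr => m _; rewrite mulrC.
rewrite {1}/dp (eq_bigr (fun k => dp (coo x) (hs f x k) * (i == k)%:R
  + (coo x k * dp (coo x) (hs f x k)) * (- x ord0 i / r2 x))).
  by rewrite big_split /= sum_deltar -mulr_suml -/(dp (coo x) (fun i => dp (coo x) (hs f x i))) dE; ring.
by move=> k _; rewrite /tproj /coo; ring.
Qed.

Lemma dp_tproj f x i : U x -> dp (tproj x i) (grad f x) = tgrad f i x.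
Proof.
move=> Ux; rewrite /dp (eq_bigr (fun k => grad f x k * (i == k)%:R + (dpd k f x * x ord0 k) * (- x ord0 i / r2 x))).
  by rewrite big_split /= sum_deltar -mulr_suml -/(Euler f x) /tgrad /grad; ring.
by move=> k _; rewrite /tproj /grad; ring.
Qed.

(** The mixed equation controls the tangential part of the derivative of the gradient and the radial
    equation its radial part. The latter contains [Euler u], which cancels against the derivative of
    the factor 1/u in [egrad]. *)
Lemma Euler_egrad i x : U x -> Euler (egrad i) x =
  tgrad u i x * (Euler V x / u x + (n%:R - 2) * V x / u x)
  - x ord0 i / r2 x * (gamS u V x + 2^-1 * (n%:R - 1) * (n%:R - 2) * (u x - (u x)^-1) * V x).
Proof.
move=> Ux; have h1 := isd_Euler su Ux; have h2 := isd_Euler sEV Ux; have h3 := r2_isd_Euler x.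
have h4 := isd_Euler (smooth_pd i sV) Ux.
have u0 := un0 Ux; have rx := rn0 Ux.
have mx := mixE Ux (tproj_coo rx i); rewrite bil_tproj // dp_tproj // in mx.
have rd := radE Ux; rewrite EEuler // in h2.
set B := bil _ _ _ in h2 mx rd.
have h4E : Euler (dpd i V) x = x ord0 i * B / r2 x + tgrad u i x * (Euler V x + (n%:R - 2) * V x) / u x.
  by apply: (mulfI u0); rewrite mulrDr [X in _ + X]mulrC divfK // -mx; ring.
have BE : B = Euler u x / u x * Euler V x - u x * gamS u V x
   - (2^-1 * (n%:R - 1) * (n%:R - 2)) * (u x ^+ 2 - 1) * V x by rewrite -(addrK (u x * gamS u V x) B); lra.
notypeclasses refine (Euler_isd (smooth_egrad i) Ux _); rewrite /egrad; isd.
rewrite h4E BE; field; by rewrite u0 rx.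
Qed.

Lemma tgrad_coo f x : U x -> \sum_i x ord0 i * tgrad f i x = 0.
Proof.
move=> Ux; rewrite (eq_bigr (fun i => dpd i f x * x ord0 i + (x ord0 i * x ord0 i) * (- Euler f x / r2 x))).
  by rewrite big_split /= -mulr_suml -/(Euler f x) -/(r2 x) mulNr mulrN mulrC divfK ?subrr // rn0.
by move=> i _; rewrite /tgrad; ring.
Qed.

Lemma sum_tgrad f g x : U x -> \sum_i tgrad f i x * tgrad g i x = gamS f g x / r2 x.
Proof.
move=> Ux; have rx := rn0 Ux.
rewrite (eq_bigr (fun i => (grad f x i * grad g x i) * 1 + ((x ord0 i * tgrad g i x) * (- Euler f x / r2 x)
   + (dpd i f x * x ord0 i) * (- Euler g x / r2 x)))).
  by rewrite sum_lin3 tgrad_coo // -/(Euler f x) -/(dp (grad f x) (grad g x)) -/(g2 f g x) /gamS; field.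
by move=> i _; rewrite /tgrad /grad; ring.
Qed.

Definition egrad2 x : R := \sum_i egrad i x ^+ 2.

(** So [egrad2] is the squared length of the gradient of V with respect to g. *)
Lemma egrad2E x : U x -> egrad2 x = (gamS V V x + (Euler V x / u x) ^+ 2) / r2 x.
Proof.
move=> Ux; have u0 := un0 Ux; have rx := rn0 Ux.
rewrite /egrad2 (eq_bigr (fun i => (tgrad V i x * tgrad V i x) * 1 + ((x ord0 i * tgrad V i x) * (2 * Euler V x / u x / r2 x)
  + (x ord0 i * x ord0 i) * (Euler V x / u x / r2 x) ^+ 2))).
  by rewrite sum_lin3 tgrad_coo // sum_tgrad // -/(r2 x); field; rewrite u0 rx.
by move=> i _; rewrite /tgrad /egrad; field; rewrite u0 rx.
Qed.

Lemma gamS_CS f g x : gamS f g x ^+ 2 <= gamS f f x * gamS g g x.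
Proof.
rewrite !gamS_rot; have := sum_CS (fun p => rotd p f x) (fun p => rotd p g x).
have e h : \sum_p rotd p h x ^+ 2 = \sum_p rotd p h x * rotd p h x by apply: eq_bigr => p _; rewrite expr2.
rewrite !e; nra.
Qed.

Section Bounds.
Context (C b : R).
Hypothesis C0 : 0 <= C.
Hypothesis b1 : 1 <= b.
Hypothesis rb : r0 ^+ 2 < b.
Hypothesis uD : forall x, b <= r2 x ->
  [/\ 1 / 2 <= u x <= 2, (u x - 1) ^+ 2 * r2 x <= C & gamS u u x * r2 x <= C].

Definition Kg : R := C * (4 + 8 * (n%:R - 2) ^+ 2 + 72 * (2^-1 * (n%:R - 1) * (n%:R - 2)) ^+ 2).

Lemma Kg_ge0 : 0 <= Kg.
Proof. by rewrite /Kg mulr_ge0 // !addr_ge0 // mulr_ge0 // sqr_ge0. Qed.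

Lemma b_U x : b <= r2 x -> U x. Proof. by move=> bx; apply/UE; exact: lt_le_trans bx. Qed.

Lemma Euler_egrad_bound x M : b <= r2 x -> `|V x| <= M ->
  \sum_i Euler (egrad i) x ^+ 2 <= Kg * (egrad2 x / r2 x + M ^+ 2 / r2 x ^+ 2).
Proof.
move=> bx VM; have Ux := b_U bx; have u0 := un0 Ux; have rx := rn0 Ux; have [ub uC gC] := uD bx.
set A := Euler V x / u x + (n%:R - 2) * V x / u x.
set B := gamS u V x + 2^-1 * (n%:R - 1) * (n%:R - 2) * (u x - (u x)^-1) * V x.
have -> : \sum_i Euler (egrad i) x ^+ 2 = gamS u u x / r2 x * A ^+ 2 + B ^+ 2 / r2 x.
  rewrite (eq_bigr (fun i => (tgrad u i x * tgrad u i x) * A ^+ 2 + ((x ord0 i * tgrad u i x) * (- 2 * A * B / r2 x)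
    + (x ord0 i * x ord0 i) * (B / r2 x) ^+ 2))).
    by rewrite sum_lin3 tgrad_coo // sum_tgrad // -/(r2 x); field.
  by move=> i _; rewrite Euler_egrad // -/A -/B; field.
have r1 : 1 <= r2 x by exact: le_trans b1 bx.
move: ub => /andP [ub1 ub2].
have w2 : (u x)^-1 <= 2 by rewrite invf_ple ?posrE //; lra.
have w0 : 0 < (u x)^-1 by rewrite invr_gt0; lra.
have V2 : V x ^+ 2 <= M ^+ 2 by rewrite -(real_normK (num_real (V x))) lerXn2r ?nnegrE ?(le_trans _ VM).
have ww : (u x)^-1 ^+ 2 <= 4 by nra.
apply: (@dist_arith _ (n%:R - 2) (2^-1 * (n%:R - 1) * (n%:R - 2)) C (r2 x) (A ^+ 2) (B ^+ 2) (gamS u u x)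
  (gamS V V x) (egrad2 x) ((Euler V x / u x) ^+ 2) (V x ^+ 2) (M ^+ 2) ((u x - 1) ^+ 2)) => //.
- exact: gamS_ge0.
- exact: gamS_ge0.
- exact: sqr_ge0.
- by rewrite egrad2E // divfK.
- exact: sqr_ge0.
- rewrite /A; set p := Euler V x / u x; set c := (n%:R - 2); set w := (u x)^-1.
  have h1 : (c * V x * w) ^+ 2 <= 4 * c ^+ 2 * V x ^+ 2.
    have -> : 4 * c ^+ 2 * V x ^+ 2 = (c * V x) ^+ 2 * 4 by ring.
    by rewrite exprMn ler_wpM2l // sqr_ge0.
  have -> : (p + c * V x * w) ^+ 2 = 2 * p ^+ 2 + 2 * (c * V x * w) ^+ 2 - (p - c * V x * w) ^+ 2 by ring.
  have := sqr_ge0 (p - c * V x * w); lra.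
- exact: sqr_ge0.
rewrite /B; set c := 2^-1 * _ * _; set w := (u x)^-1; have := gamS_CS u V x; set g := gamS u V x => gg.
have wu : w * u x = 1 by rewrite mulVf.
have h1 : (c * (u x - w) * V x) ^+ 2 <= 36 * c ^+ 2 * (u x - 1) ^+ 2 * V x ^+ 2.
  have -> : u x - w = (u x - 1) * (1 + w) by rewrite mulrDr mulr1 mulrBl mul1r [u x * w]mulrC wu; ring.
  have h2 : (1 + w) ^+ 2 <= 36 by have h3 : w <= 2 by []; have h4 : 0 < w by []; nra.
  have -> : 36 * c ^+ 2 * (u x - 1) ^+ 2 * V x ^+ 2 = (c * (u x - 1) * V x) ^+ 2 * 36 by ring.
  rewrite (_ : _ ^+ 2 = (c * (u x - 1) * V x) ^+ 2 * (1 + w) ^+ 2); last by ring.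
  by rewrite ler_wpM2l // sqr_ge0.
have -> : (g + c * (u x - w) * V x) ^+ 2 = 2 * g ^+ 2 + 2 * (c * (u x - w) * V x) ^+ 2
  - (g - c * (u x - w) * V x) ^+ 2 by ring.
have := sqr_ge0 (g - c * (u x - w) * V x); lra.
Qed.

Lemma egrad_ray x i s : U (s *: x) -> s != 0 ->
  is_derive s (1 : R) (fun t => egrad i (t *: x)) (s^-1 * Euler (egrad i) (s *: x)).
Proof.
move=> Us s0; apply: isd_eq (ray_isd (smooth_egrad i) Us) _.
by rewrite /Euler mulr_sumr; apply: eq_bigr => k _; rewrite mxE; field.
Qed.

Lemma continuous_egrad2 x : U x -> {for x, continuous egrad2}.
Proof.
move=> Ux; apply: smooth_continuous Ux; rewrite /egrad2.
by have se i := smooth_egrad i; smt.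
Qed.

Lemma line_near (x w : 'rV[R]_n) (P : 'rV[R]_n -> Prop) : (\forall y \near x, P y) ->
  exists2 h : R, 0 < h & forall t, 0 <= t <= h -> P (x + t *: w).
Proof.
move=> nP; have cl : {for (0 : R), continuous (fun t : R => x + t *: w)}.
  by apply: cvgD; [exact: cvg_cst|apply: cvgZr_tmp; exact: cvg_id].
have : \forall t \near (0 : R), P (x + t *: w).
  by apply: cl; rewrite scale0r addr0.
move=> /nbhs_ballP [h /= h0 hP]; exists (h / 2); first by rewrite divr_gt0.
move=> t /andP [t0 th]; apply: hP; rewrite /ball /= sub0r normrN ger0_norm //.
by apply: le_lt_trans th _; rewrite ltr_pdivrMr // ltr_pMr // ltr1n.
Qed.

Definition Lg : R := 256 * (Kg + C).

Lemma Lg_ge0 : 0 <= Lg.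
Proof. by rewrite /Lg mulr_ge0 // addr_ge0 // Kg_ge0. Qed.

(** [ray_stable] along the ray through x, with k^2 = [Kg] / [r2 x] and d = M^2 / [r2 x]; the
    condition on 16 [Kg] says k <= 1/4. *)
Lemma egrad2_ray (M a : R) x s : b <= a -> (forall y, a <= r2 y -> `|V y| <= M) -> a <= r2 x ->
    16 * Kg <= r2 x -> 1 <= s ->
  egrad2 (s *: x) <= 2 * (egrad2 x + M ^+ 2 / r2 x) /\
  forall w L, 0 <= L -> Kg / r2 x * (\sum_i w i ^+ 2) * (2 * (egrad2 x + M ^+ 2 / r2 x)) <= L ^+ 2 ->
   \sum_i w i * egrad i x - L <= \sum_i w i * egrad i (s *: x).
Proof.
move=> ba VM ax Kx s1.
have xp : 0 < r2 x by apply: lt_le_trans (le_trans ba ax); apply: lt_le_trans b1.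
pose k := Num.sqrt (Kg / r2 x).
have kk0 : 0 <= Kg / r2 x by rewrite divr_ge0 // ?Kg_ge0 // ltW.
have k2 : k ^+ 2 = Kg / r2 x by rewrite sqr_sqrtr.
have k4 : 0 <= k <= 1 / 4.
  have k0 : 0 <= k by exact: sqrtr_ge0.
  have : k ^+ 2 <= 1 / 16 by rewrite k2 ler_pdivrMr //; lra.
  by move=> h; rewrite k0 /=; nra.
have far t : 1 <= t -> a <= r2 (t *: x).
  by move=> t1; rewrite r2Z; apply: le_trans ax _; rewrite ler_peMl ?(ltW xp) // exprn_ege1.
have d0 : 0 <= M ^+ 2 / r2 x by rewrite divr_ge0 // ?sqr_ge0 // ltW.
have hd i t : 1 <= t <= s -> is_derive t (1 : R) (fun t => egrad i (t *: x)) (t^-1 * Euler (egrad i) (t *: x)).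
  move=> /andP [t1 _]; apply: egrad_ray; first by apply: b_U; exact: le_trans ba (far t t1).
  by apply: lt0r_neq0; exact: lt_le_trans t1.
have hb t : 1 <= t <= s -> \sum_i (t^-1 * Euler (egrad i) (t *: x)) ^+ 2 <=
    (k / t ^+ 2) ^+ 2 * (\sum_i egrad i (t *: x) ^+ 2 + M ^+ 2 / r2 x).
  move=> /andP [t1 _]; have t0 : 0 < t by exact: lt_le_trans t1.
  have ft := far t t1.
  rewrite (eq_bigr (fun i => Euler (egrad i) (t *: x) ^+ 2 * (t^-1) ^+ 2)) => [|i _]; last by rewrite exprMn mulrC.
  rewrite -mulr_suml; have t2 : 0 <= (t^-1) ^+ 2 by exact: sqr_ge0.
  apply: le_trans (ler_wpM2r t2 (Euler_egrad_bound (le_trans ba ft) (VM _ ft))) _.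
  rewrite -/(egrad2 (t *: x)) exprMn k2 r2Z.
  set S := egrad2 _; set z := t^-1; set q := (r2 x)^-1.
  have -> : Kg * (S / (t ^+ 2 * r2 x) + M ^+ 2 / (t ^+ 2 * r2 x) ^+ 2) * z ^+ 2 =
    Kg * q * z ^+ 4 * (S + (M ^+ 2 * q) * z ^+ 2) by rewrite /z /q; field; rewrite !gt_eqF.
  have -> : Kg / r2 x * (t ^- 2) ^+ 2 = Kg * q * z ^+ 4 by rewrite /z /q; field; rewrite !gt_eqF.
  have z0 : 0 < z by rewrite invr_gt0.
  have q0 : 0 < q by rewrite invr_gt0.
  have c0 : 0 <= Kg * q * z ^+ 4.
    by apply: mulr_ge0; [apply: mulr_ge0; [exact: Kg_ge0|exact: ltW]|exact/exprn_ge0/ltW].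
  have z1 : z <= 1 by rewrite invf_le1.
  have z2 : z ^+ 2 <= 1 by rewrite expr_le1 // ltW.
  apply: ler_wpM2l => //; rewrite lerD2l; apply: ler_piMr => //.
have s1s : 1 <= s <= s by rewrite s1 lexx.
have [h1 h2] := ray_stable hd d0 k4 hb s1s.
move: h1 h2; rewrite scale1r -/(egrad2 x) -/(egrad2 (s *: x)) k2 => h1 h2; split=> //.
by apply: le_trans h1; rewrite lerDl.
Qed.

(** If the gradient w at x were larger, the derivative of V in direction w would stay at least W/4
    on all rays issuing from a short segment x + t w. Dilating the segment by s multiplies its
    length by s, so V would vary by an arbitrarily large amount. *)
Lemma egrad2_decay (M a : R) x : b <= a -> 2 * Lg <= a -> (forall y, a <= r2 y -> `|V y| <= M) -> a < r2 x ->
  egrad2 x * r2 x ^+ 2 <= Lg * M ^+ 2.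
Proof.
move=> ba La VM ax; rewrite leNgt; apply/negP => big.
have Ux := b_U (le_trans ba (ltW ax)).
have xp := rp Ux; have L0 := Lg_ge0; have K0 := Kg_ge0.
have KL : 256 * Kg <= Lg by rewrite /Lg; have := C0; lra.
have CL : 256 * C <= Lg by rewrite /Lg; lra.
pose r := r2 x; pose W := egrad2 x; pose w i := egrad i x; pose m := M ^+ 2.
have m0 : 0 <= m by exact: sqr_ge0.
have rp' : 0 < r by [].
have W0 : 0 < W.
  have h : 0 < egrad2 x * r2 x ^+ 2 by apply: le_lt_trans big; rewrite mulr_ge0 ?sqr_ge0.
  by move: h; rewrite pmulr_lgt0 // exprn_gt0.
have M0 : 0 <= M by apply: le_trans (normr_ge0 _) (VM x (ltW ax)).
have wW : \sum_i w i ^+ 2 = W by [].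
pose wv : 'rV[R]_n := \row_i w i.
have cS : {for x, continuous (fun y => \sum_i w i * egrad i y)}.
  by apply: smooth_continuous Ux; by have se i := smooth_egrad i; smt.
have wx : \sum_i w i * egrad i x = W by apply: eq_bigr => i _; rewrite expr2.
have near1 : \forall y \near x, [/\ a <= r2 y, r / 2 <= r2 y, egrad2 y <= 2 * W & 3 / 4 * W <= \sum_i w i * egrad i y].
  have n1 : \forall y \near x, a <= r2 y.
    have := @r2_continuous R n x; move=> /cvgr_gt /(_ a ax) h; near=> y; apply: ltW; near: y; exact: h.
  have n2' : \forall y \near x, r / 2 <= r2 y.
    have rr : r / 2 < r2 x by rewrite ltr_pdivrMr // ltr_pMr // ltr1n.
    have := @r2_continuous R n x; move=> /cvgr_gt /(_ (r / 2) rr) h; near=> y; apply: ltW; near: y; exact: h.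
  have n3 : \forall y \near x, egrad2 y <= 2 * W.
    have rr : egrad2 x < 2 * W by rewrite -/W; lra.
    have := continuous_egrad2 Ux; move=> /cvgr_lt /(_ _ rr) h; near=> y; apply: ltW; near: y; exact: h.
  have n4 : \forall y \near x, 3 / 4 * W <= \sum_i w i * egrad i y.
    have rr : 3 / 4 * W < \sum_i w i * egrad i x by rewrite wx; lra.
    move: cS => /cvgr_gt /(_ _ rr) h; near=> y; apply: ltW; near: y; exact: h.
  by near=> y; split; near: y.
have [h h0 hP] := line_near wv near1.
have mW : 0 <= m / r by rewrite divr_ge0 // ltW.
have mLW : Lg * (m / r) <= W * r.
  by rewrite mulrA ler_pdivrMr // (_ : W * r * r = W * r ^+ 2); [exact: ltW|ring].
have Lr : 2 * Lg <= r by exact: le_trans La (ltW ax).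
(* Uniform in the dilation s: this is the persistence along the cone of rays. *)
have key t s : 0 <= t <= h -> 1 <= s -> W / 4 <= \sum_i w i * dpd i V (s *: (x + t *: wv)).
  move=> /hP [ay ry Sy wy] s1; set y := x + t *: wv in ay ry Sy wy *.
  have yp : 0 < r2 y by apply: lt_le_trans ry; rewrite divr_gt0.
  have qy : (r2 y)^-1 <= 2 / r by rewrite invf_ple ?posrE ?divr_gt0 // invf_div.
  have q0 : 0 < (r2 y)^-1 by rewrite invr_gt0.
  have Kr : 16 * Kg <= r2 y by lra.
  have [S2 wL] := egrad2_ray ba VM ay Kr s1.
  have my : M ^+ 2 / r2 y <= 2 * (m / r).
    by have := ler_wpM2l m0 qy; rewrite -/m; clear_from rp'; lra.
  have Ssy : egrad2 (s *: y) <= 4 * W + 4 * (m / r) by move: S2 my Sy; clear_from rp'; lra.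
  have wsy : W / 2 <= \sum_i w i * egrad i (s *: y).
    have hL : Kg / r2 y * (\sum_i w i ^+ 2) * (2 * (egrad2 y + M ^+ 2 / r2 y)) <= (W / 4) ^+ 2.
      have t1 : Kg / r2 y <= 2 * (Kg / r) by have := ler_wpM2l K0 qy; clear_from rp'; lra.
      rewrite wW; have t2 : 2 * (egrad2 y + M ^+ 2 / r2 y) <= 4 * W + 4 * (m / r) by lra.
      have t3 : 2 * (Kg / r) * (4 * W + 4 * (m / r)) <= W / 16.
        have -> : 2 * (Kg / r) * (4 * W + 4 * (m / r)) = (8 * Kg * W + 8 * Kg * (m / r)) / r by ring.
        rewrite ler_pdivrMr //.
        have h1 : 256 * Kg * W <= r * W by rewrite ler_pM2r //; apply: le_trans KL _; lra.
        have h2 : 256 * Kg * (m / r) <= Lg * (m / r) by rewrite ler_wpM2r.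
        by move: h1 h2 mLW; clear_from rp'; lra.
      have t4 : 0 <= 2 * (egrad2 y + M ^+ 2 / r2 y).
        rewrite mulr_ge0 // addr_ge0 // ?mulr_ge0 ?(ltW q0) // sumr_ge0 // => i _; exact: sqr_ge0.
      have t5 : Kg / r2 y * (2 * (egrad2 y + M ^+ 2 / r2 y)) <= W / 16.
        by apply: le_trans t3; apply: ler_pM => //; rewrite mulr_ge0 // ltW.
      by have := ler_wpM2l (ltW W0) t5; clear_from rp'; lra.
    have W4 : 0 <= W / 4 by move: W0; clear_from rp'; lra.
    by move: (wL w (W / 4) W4 hL) wy; clear_from rp'; lra.
  set z := s *: y in S2 wL Ssy wsy *.
  have rz : r2 y <= r2 z by rewrite /z r2Z ler_peMl ?(ltW yp) // exprn_ege1.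
  have bz : b <= r2 z by apply: le_trans ba (le_trans ay rz).
  have Uz := b_U bz; have uz0 := un0 Uz; have rz0 := rn0 Uz; have rzp := rp Uz.
  pose P := Euler V z / u z.
  pose wz := \sum_i w i * z ord0 i.
  (* Passing from [egrad] back to the Euclidean gradient costs a radial term with the factor u - 1,
     which decay makes smaller than W/4. *)
  have -> : \sum_i w i * dpd i V z = \sum_i w i * egrad i z + (u z - 1) * P * wz / r2 z.
    rewrite /wz (eq_bigr (fun i => w i * egrad i z + (w i * z ord0 i) * ((u z - 1) * P / r2 z))).
      by rewrite big_split /= -mulr_suml; ring.
    by move=> i _; rewrite /egrad /P; field; rewrite uz0 rz0.
  have [_ uC _] := uD bz.
  have wz2 : wz ^+ 2 <= W * r2 z.
    have := sum_CS w (fun i => z ord0 i); rewrite -/wz wW.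
    by rewrite /r2 (eq_bigr (fun i => z ord0 i * z ord0 i)) // => i _; rewrite expr2.
  have P2 : P ^+ 2 <= egrad2 z * r2 z by rewrite egrad2E // divfK // lerDr gamS_ge0.
  have Sz0 : 0 <= egrad2 z by apply: sumr_ge0 => i _; exact: sqr_ge0.
  have e1 : ((u z - 1) * P * wz / r2 z) ^+ 2 <= (W / 4) ^+ 2.
    have qz : (r2 z)^-1 <= 2 / r by apply: le_trans qy; rewrite lef_pV2 ?posrE.
    have qz0 : 0 < (r2 z)^-1 by rewrite invr_gt0.
    have a1 : (u z - 1) ^+ 2 <= C * (r2 z)^-1 by rewrite ler_pdivlMr.
    have a2 : P ^+ 2 * wz ^+ 2 <= (egrad2 z * r2 z) * (W * r2 z) by apply: ler_pM => //; exact: sqr_ge0.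
    have a3 : (u z - 1) ^+ 2 * (P ^+ 2 * wz ^+ 2) <= (C * (r2 z)^-1) * ((egrad2 z * r2 z) * (W * r2 z)).
      by apply: ler_pM => //; rewrite ?sqr_ge0 // mulr_ge0 // sqr_ge0.
    have -> : ((u z - 1) * P * wz / r2 z) ^+ 2 = (u z - 1) ^+ 2 * (P ^+ 2 * wz ^+ 2) * (r2 z)^-1 ^+ 2 by ring.
    apply: le_trans (ler_wpM2r (sqr_ge0 _) a3) _.
    have -> : C * (r2 z)^-1 * (egrad2 z * r2 z * (W * r2 z)) * (r2 z)^-1 ^+ 2 = C * (egrad2 z * (r2 z)^-1) * W by field.
    have a4 : egrad2 z * (r2 z)^-1 <= (4 * W + 4 * (m / r)) * (2 / r) by apply: ler_pM => //; exact: ltW.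
    have a5 : C * ((4 * W + 4 * (m / r)) * (2 / r)) <= W / 16.
      have -> : C * ((4 * W + 4 * (m / r)) * (2 / r)) = (8 * C * W + 8 * C * (m / r)) / r by ring.
      rewrite ler_pdivrMr //.
      have h1 : 256 * C * W <= r * W by rewrite ler_pM2r //; apply: le_trans CL _; lra.
      have h2 : 256 * C * (m / r) <= Lg * (m / r) by rewrite ler_wpM2r.
      by move: h1 h2 mLW; clear_from rp'; lra.
    have a6 : C * (egrad2 z * (r2 z)^-1) <= W / 16 by apply: le_trans a5; rewrite ler_wpM2l.
    by have := ler_wpM2r (ltW W0) a6; clear_from rp'; lra.
  have W4 : 0 <= W / 4 by move: W0; clear_from rp'; lra.
  have /andP [e2 _] := sqr_le_abs W4 e1; move: e2 wsy; clear_from rp'; lra.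
(* With this dilation V grows by at least hW/4 + 3M, more than the 2M that the bound allows. *)
pose s := 1 + 12 * M / (h * W).
have hW : 0 < h * W by rewrite mulr_gt0.
have s1 : 1 <= s by rewrite lerDl divr_ge0 ?(ltW hW) // mulr_ge0.
pose f t := V (s *: (x + t *: wv)).
have ff t : 0 <= t <= h -> is_derive t (1 : R) f (s * \sum_i w i * dpd i V (s *: (x + t *: wv))).
  move=> th; have [ay _ _ _] := hP t th.
  have fy : a <= r2 (s *: (x + t *: wv)).
    by rewrite r2Z; apply: le_trans ay _; rewrite ler_peMl ?r2_ge0 // exprn_ege1.
  rewrite mulr_sumr; under eq_bigr do rewrite mulrA.
  apply: curve_isd; last by apply: smooth_diff sV _; apply: b_U; exact: le_trans fy.
  move=> k; have -> : (fun t : R => (s *: (x + t *: wv)) ord0 k) = (fun t => s * (x ord0 k + t * w k)).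
    by apply/funext => t'; rewrite !mxE.
  by isd; ring.
have [c [c0 ch fc]] := MVT_isd h0 ff.
have ch' : 0 <= c <= h by rewrite !ltW.
have kc := key c s ch' s1.
have Vb t : 0 <= t <= h -> `|f t| <= M.
  move=> /hP [ay _ _ _]; apply: VM; rewrite r2Z; apply: le_trans ay _.
  by rewrite ler_peMl ?r2_ge0 // exprn_ege1.
have h00 : 0 <= (0 : R) <= h by apply/andP; split => //; exact: ltW.
have hh : 0 <= h <= h by apply/andP; split => //; exact: ltW.
have := Vb 0 h00; have := Vb h hh; rewrite !ler_norml => /andP [_ v1] /andP [v2 _].
have fh : f h - f 0 <= 2 * M by move: v1 v2; clear_from rp'; lra.
have : s * (W / 4) * h <= f h - f 0.
  by rewrite fc subr0 ler_wpM2r ?(ltW h0) // ler_wpM2l // (le_trans ler01 s1).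
have -> : s * (W / 4) * h = h * W / 4 + 3 * M by rewrite /s; field; rewrite !gt_eqF.
move: fh hW M0; clear_from rp'; lra.
Unshelve. all: by end_near.
Qed.
End Bounds.
End Gradient.

(** * V stays away from zero far out *)

Section Lower.
Context {R : realType} {n : nat} (r0 : R) (u V : 'rV[R]_n -> R).
Hypothesis n2 : (2 < n)%N.
Hypothesis r0_gt0 : 0 < r0.
Let U : set 'rV[R]_n := exterior r0.
Hypothesis su : smooth_on U u.
Hypothesis u_gt0 : forall x, U x -> 0 < u x.
Hypothesis sV : smooth_on U V.
Hypothesis mixE : forall x a, U x -> dp a (coo x) = 0 ->
  u x * bil a (coo x) (hs V x) = dp a (grad u x) * (Euler V x + (n%:R - 2) * V x).
Hypothesis radE : forall x, U x ->
  bil (coo x) (coo x) (hs V x) - Euler u x / u x * Euler V x + u x * gamS u V x =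
       - (2^-1 * (n%:R - 1) * (n%:R - 2)) * (u x ^+ 2 - 1) * V x.
Context (C b : R).
Hypothesis C0 : 0 <= C.
Hypothesis b1 : 1 <= b.
Hypothesis rb : r0 ^+ 2 < b.
Hypothesis uD : forall x, b <= r2 x ->
  [/\ 1 / 2 <= u x <= 2, (u x - 1) ^+ 2 * r2 x <= C & gamS u u x * r2 x <= C].
Implicit Types (x : 'rV[R]_n).

Let L : R := @Lg R n C.
Let L0 : 0 <= L. Proof. exact: Lg_ge0. Qed.
Let bU x : b <= r2 x -> U x.
Proof. by move=> bx; apply/(exteriorE _ (ltW r0_gt0)); exact: lt_le_trans bx. Qed.

Lemma isd_bound (f df : R -> R) (s t K : R) : s <= t ->
  (forall z, s <= z <= t -> is_derive z (1 : R) f (df z)) ->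
  (forall z, s <= z <= t -> `|df z| <= K) -> `|f t - f s| <= K * (t - s).
Proof.
rewrite le_eqVlt => /orP [/eqP -> _ _|st fd dK]; first by rewrite !subrr normr0 mulr0.
have [c [c1 c2 ->]] := MVT_isd st fd.
by rewrite normrM [`|t - s|]gtr0_norm ?subr_gt0 // ler_wpM2r ?subr_ge0 ?(ltW st) // dK // !ltW.
Qed.

(** The inner sphere is included by continuity, moving slightly outwards along the ray. *)
Lemma egrad2_decay_le (M a : R) x : b <= a -> 2 * L <= a -> (forall y, a <= r2 y -> `|V y| <= M) ->
  a <= r2 x -> egrad2 u V x * r2 x ^+ 2 <= L * M ^+ 2.
Proof.
move=> ba La VM ax; rewrite leNgt; apply/negP => big.
have xp : 0 < r2 x by apply: lt_le_trans (le_trans ba ax); apply: lt_le_trans b1.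
have Ux := bU (le_trans ba ax).
have cc : {for x, continuous (fun y => egrad2 u V y * r2 y ^+ 2)}.
  have oU : open U by exact: open_exterior (ltW r0_gt0).
  apply: (smooth_continuous (U := U) _ Ux).
  have sr : smooth_on U r2 by exact: smooth_r2.
  by have se i := smooth_egrad r0_gt0 su u_gt0 sV i; rewrite /egrad2; smt.
have nb : \forall y \near x, L * M ^+ 2 < egrad2 u V y * r2 y ^+ 2.
  by move: cc => /cvgr_gt /(_ _ big).
have [h h0 hP] := line_near x nb.
have hh : 0 <= h <= h by apply/andP; split => //; exact: ltW.
have := hP h hh; rewrite ltNge => /negP; apply; apply: (egrad2_decay r0_gt0 su u_gt0 sV mixE radE C0 b1 rb uD ba La VM).
rewrite -[X in X + _]scale1r -scalerDl r2Z; apply: le_lt_trans ax _.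
by rewrite ltr_pMl // exprn_egt1 // ltrDl.
Qed.

Section Slab.
Context (M a : R).
Hypothesis ba : b <= a.
Hypothesis La : 256 * L + 1 <= a.
Hypothesis VM : forall y, a <= r2 y -> `|V y| <= M.

Lemma decay_bounds x : a <= r2 x ->
  gamS V V x * r2 x <= L * M ^+ 2 /\ Euler V x ^+ 2 * r2 x <= 4 * L * M ^+ 2.
Proof.
move=> ax; have Ux := bU (le_trans ba ax).
have xp : 0 < r2 x := r2_gt0 (ltW r0_gt0) Ux.
have La' : 2 * L <= a by have := L0; have := La; lra.
have := egrad2_decay_le ba La' VM ax.
rewrite (@egrad2E R n r0 u V r0_gt0) // (_ : _ / _ * _ = (gamS V V x + (Euler V x / u x) ^+ 2) * r2 x); last by field; rewrite !gt_eqF ?u_gt0.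
rewrite mulrDl => h.
have g0 := gamS_ge0 V x; have p0 := sqr_ge0 (Euler V x / u x).
have h1 : 0 <= gamS V V x * r2 x by rewrite mulr_ge0 // ltW.
have h2 : 0 <= (Euler V x / u x) ^+ 2 * r2 x by rewrite mulr_ge0 // ltW.
split; first by lra.
have [/andP [u1 u2] _ _] := uD (le_trans ba ax).
have -> : Euler V x ^+ 2 = u x ^+ 2 * (Euler V x / u x) ^+ 2.
  by rewrite -exprMn mulrC divfK // gt_eqF // u_gt0.
have u4 : u x ^+ 2 <= 4 by nra.
rewrite -mulrA -[leRHS]mulrA; apply: ler_pM => //; first exact: sqr_ge0.
lra.
Qed.

Lemma M_ge0 x : a <= r2 x -> 0 <= M.
Proof. by move=> /VM; apply: le_trans. Qed.

(** By [La] the derivative of V along the ray is at most (M/8) z^-2, whose integral from 1 is at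
    most M/8. The integration is done through the monotone functions V - M/(8z) and -V - M/(8z). *)
Lemma ray_osc x t : a <= r2 x -> 1 <= t -> `|V (t *: x) - V x| <= M / 8.
Proof.
move=> ax t1; have M0 := M_ge0 ax.
have far z : 1 <= z -> a <= r2 (z *: x).
  by move=> z1; rewrite r2Z; apply: le_trans ax _; rewrite ler_peMl ?r2_ge0 // exprn_ege1.
have fd z : 1 <= z <= t -> is_derive z (1 : R) (fun z => V (z *: x)) (z^-1 * Euler V (z *: x)).
  move=> /andP [z1 _]; apply: isd_eq (ray_isd sV (bU (le_trans ba (far z z1)))) _.
  rewrite /Euler mulr_sumr; apply: eq_bigr => k _; rewrite mxE; field.
  by apply: lt0r_neq0; exact: lt_le_trans z1.
have fb z : 1 <= z <= t -> - (M / 8 * z ^- 2) <= z^-1 * Euler V (z *: x) <= M / 8 * z ^- 2.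
  move=> /andP [z1 _]; have z0 : 0 < z by exact: lt_le_trans z1.
  apply: sqr_le_abs; first by rewrite mulr_ge0 ?divr_ge0 // invr_ge0 exprn_ge0 // ltW.
  have [_ h] := decay_bounds (far z z1); rewrite r2Z in h.
  have : Euler V (z *: x) ^+ 2 * (z ^+ 2) * a <= a * (M / 8) ^+ 2.
    apply: (@le_trans _ _ (4 * L * M ^+ 2)).
      apply: le_trans h; rewrite [leRHS]mulrA; apply: ler_wpM2l => //.
      by rewrite mulr_ge0 // sqr_ge0.
    have -> : a * (M / 8) ^+ 2 = a / 64 * M ^+ 2 by field.
    by rewrite ler_wpM2r ?sqr_ge0 //; have := La; lra.
  have a0 : 0 < a by apply: lt_le_trans ba; apply: lt_le_trans b1.
  rewrite [leLHS]mulrC ler_pM2l // => h2.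
  rewrite !exprMn -(ler_pM2r (exprn_gt0 4 z0)).
  rewrite (_ : _ * z ^+ 4 = Euler V (z *: x) ^+ 2 * z ^+ 2); last by field; rewrite gt_eqF.
  by rewrite (_ : _ * z ^+ 4 = (M / 8) ^+ 2) //; field; rewrite gt_eqF.
have zn0 z : 1 <= z <= t -> z != 0 by move=> /andP [z1 _]; apply: lt0r_neq0; exact: lt_le_trans z1.
have t0 : 0 <= t^-1 by rewrite invr_ge0 (le_trans ler01 t1).
have n1 : V x + M / 8 * 1^-1 * -1 <= V (t *: x) + M / 8 * t^-1 * -1.
  rewrite -{1}[x]scale1r; apply: (isd_nondecr (f := fun z => V (z *: x) + M / 8 * z^-1 * -1)
     (df := fun z => z^-1 * Euler V (z *: x) + M / 8 * z ^- 2) t1) => z zt.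
    by have h1 := fd z zt; have z0 := zn0 z zt; isd; field.
  by have /andP [h _] := fb z zt; lra.
have n3 : - V x + M / 8 * 1^-1 * -1 <= - V (t *: x) + M / 8 * t^-1 * -1.
  rewrite -{1}[x]scale1r; apply: (isd_nondecr (f := fun z => - V (z *: x) + M / 8 * z^-1 * -1)
     (df := fun z => - (z^-1 * Euler V (z *: x)) + M / 8 * z ^- 2) t1) => z zt.
    by have h1 := fd z zt; have z0 := zn0 z zt; isd; field.
  by have /andP [_ h] := fb z zt; lra.
have t8 : 0 <= M / 8 * t^-1 by rewrite mulr_ge0 // divr_ge0.
by rewrite invr1 mulr1 in n1 n3; rewrite ler_norml; apply/andP; split; lra.
Qed.

(** [La] bounds the derivative along a great circle by M/16, and the parameter runs over at most pi
    <= 4. *)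
Lemma sphere_osc x y : a <= r2 x -> r2 y = r2 x -> `|V y - V x| <= M / 4.
Proof.
move=> ax yx; have M0 := M_ge0 ax.
have xp : 0 < r2 x := r2_gt0 (ltW r0_gt0) (bU (le_trans ba ax)).
have [w [t [wx xw /andP [t0 tpi] <-]]] := gcirc_exists (ltnW n2) xp yx.
have r2c s : r2 (gcirc x w s) = r2 x by exact: r2_gcirc.
have ac s : a <= r2 (gcirc x w s) by rewrite r2c.
pose dc s k : R := - sin s * x ord0 k + cos s * w ord0 k.
have fd s : is_derive s (1 : R) (fun s => V (gcirc x w s)) (\sum_k dc s k * dpd k V (gcirc x w s)).
  apply: curve_isd; last by apply: smooth_diff sV _; apply: bU; exact: le_trans ba (ac s).
  by move=> k; exact: gcirc_isd.
have fb s : `|\sum_k dc s k * dpd k V (gcirc x w s)| <= M / 16.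
  rewrite ler_norml; apply: sqr_le_abs; first by rewrite divr_ge0.
  set z := gcirc x w s; have zp : 0 < r2 z by rewrite r2c.
  have Uz : U z by apply: bU; exact: le_trans ba (ac s).
  have zk k : z ord0 k = cos s * x ord0 k + sin s * w ord0 k by rewrite /z /gcirc !mxE.
  have cs : cos s ^+ 2 + sin s ^+ 2 = 1 :> R by exact: cos2Dsin2.
  have sc (p q : R) (f g : 'I_n -> R) : \sum_k (p * x ord0 k + q * w ord0 k) * (f k * x ord0 k + g k * w ord0 k) =
     \sum_k (p * f k * (x ord0 k * x ord0 k) + (q * g k * (w ord0 k * w ord0 k) + (p * g k + q * f k) * (x ord0 k * w ord0 k))).
    by apply: eq_bigr => k _; ring.
  have xw' : \sum_k x ord0 k * w ord0 k = 0 by [].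
  have dz : \sum_k dc s k * z ord0 k = 0.
    under eq_bigr do rewrite zk /dc.
    rewrite (sc _ _ (fun=> cos s) (fun=> sin s)) !big_split /= -!mulr_sumr -/(r2 x) -/(r2 w) xw' wx.
    by ring.
  have dd : \sum_k dc s k ^+ 2 = r2 x.
    under eq_bigr do rewrite expr2 {1}/dc /dc.
    rewrite (sc _ _ (fun=> - sin s) (fun=> cos s)) !big_split /= -!mulr_sumr -/(r2 x) -/(r2 w) xw' wx.
    by transitivity ((cos s ^+ 2 + sin s ^+ 2) * r2 x); [ring|rewrite cs mul1r].
  have -> : \sum_k dc s k * dpd k V z = \sum_k dc s k * tgrad V k z + (\sum_k dc s k * z ord0 k) * (Euler V z / r2 z).
    by rewrite mulr_suml -big_split /=; apply: eq_bigr => k _; rewrite /tgrad; ring.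
  rewrite dz mul0r addr0.
  apply: le_trans (sum_CS _ _) _; rewrite dd.
  under eq_bigr do rewrite expr2.
  rewrite (sum_tgrad r0_gt0) // -(r2c s) -/z mulrC divfK ?gt_eqF //.
  have [h _] := decay_bounds (ac s); rewrite -/z in h.
  rewrite -(ler_pM2r zp); apply: le_trans h _.
  have -> : (M / 16) ^+ 2 * r2 z = r2 z / 256 * M ^+ 2 by field.
  rewrite ler_wpM2r ?sqr_ge0 //; have := ac s; rewrite -/z; have := La; lra.
have := isd_bound t0 (fun s _ => fd s) (fun s _ => fb s); rewrite gcirc0 subr0 => h; apply: le_trans h _.
have p4 : pi <= 4 :> R by by have := @pihalf_lt2 R; lra.
by have -> : M / 4 = M / 16 * 4 by [field]; rewrite ler_wpM2l ?divr_ge0 // (le_trans tpi).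
Qed.

Lemma slab_osc x y : a <= r2 x -> a <= r2 y -> `|V y - V x| <= 3 / 8 * M.
Proof.
wlog xy : x y / r2 x <= r2 y.
  by move=> H ax ay; have [xy|/ltW yx] := leP (r2 x) (r2 y); [exact: H|rewrite distrC; exact: H].
move=> ax ay; have xp : 0 < r2 x := r2_gt0 (ltW r0_gt0) (bU (le_trans ba ax)).
pose t := Num.sqrt (r2 y / r2 x).
have yx1 : 1 <= r2 y / r2 x by rewrite ler_pdivlMr // mul1r.
have t1 : 1 <= t by rewrite -sqrtr1 ler_wsqrtr.
have ty : r2 (t *: x) = r2 y by rewrite r2Z sqr_sqrtr ?divfK ?gt_eqF // (le_trans ler01).
have h1 := ray_osc ax t1.
have atx : a <= r2 (t *: x) by rewrite ty.
have h2 := sphere_osc atx (esym ty).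
have -> : V y - V x = (V y - V (t *: x)) + (V (t *: x) - V x) by ring.
by apply: le_trans (ler_normD _ _) _; lra.
Qed.
End Slab.

(** M is the supremum of |V| beyond a, positive by unique continuation. Some value exceeds M/2, and
    the oscillation is at most 3M/8, so M/8 remains everywhere. This works because the gradient
    estimate is relative to M. *)
Lemma V_lower : (exists CV, forall x, U x -> `|V x| <= CV) ->
  (forall x, U x -> (\near x, V x = 0) -> False) ->
  exists a M, [/\ b <= a, 0 < M & forall x, a <= r2 x ->
    [/\ M / 8 <= `|V x|, gamS V V x * r2 x <= L * M ^+ 2 & Euler V x ^+ 2 * r2 x <= 4 * L * M ^+ 2]].
Proof.
move=> [CV VC] Vn0; pose a := b + 256 * L + 1.
have ba : b <= a by rewrite /a; have := L0; lra.
have La : 256 * L + 1 <= a by rewrite /a; have := b1; lra.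
pose E : set R := [set z | exists2 x, a <= r2 x & z = `|V x|].
have [x0 ax0] : exists x0 : 'rV[R]_n, a < r2 x0.
  have i0 : 'I_n by apply: (@Ordinal n 0); exact: ltn_trans n2.
  exists ((a + 1) *: ev i0); rewrite r2Z /r2 (eq_bigr (fun i => ev i0 ord0 i * (i0 == i)%:R)).
    rewrite sum_deltar evE eqxx mulr1; have : 1 <= a := le_trans b1 ba; nra.
  by move=> i _; rewrite !evE eq_sym.
have supE : has_sup E.
  split; first by exists `|V x0|; exists x0 => //; exact: ltW.
  by exists CV => _ [x ax ->]; apply: VC; apply: bU; exact: le_trans ax.
pose M := sup E.
have VM y : a <= r2 y -> `|V y| <= M by move=> ay; apply: ub_le_sup; [exact: supE.2|exists y].
have M0 : 0 < M.
  rewrite ltNge; apply/negP => M0; apply: (Vn0 x0); first by apply: bU; exact: le_trans (ltW ax0).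
  have := @r2_continuous R n x0; move=> /cvgr_gt /(_ a ax0) h; near=> y.
  apply/eqP; rewrite -normr_le0; apply: le_trans (VM y _) M0; apply: ltW; near: y; exact: h.
exists a, M; split=> // x ax; have [h1 h2] := decay_bounds ba La VM ax; split=> //.
have M2 : 0 < M / 2 by rewrite divr_gt0.
have [_ [y ay ->] hy] := sup_adherent M2 supE.
have := slab_osc ba La VM ay ax; rewrite distrC => h.
have : `|V y| <= `|V x| + `|V y - V x| by have := ler_normD (V x) (V y - V x); rewrite addrCA subrr addr0.
move: hy; rewrite -/M; lra.
Unshelve. all: by end_near.
Qed.
End Lower.

(** * Derivatives along vector fields *)

Section VectorFields.
Context {R : realType} {n : nat} (U : set 'rV[R]_n).
Hypothesis oU : open U.
Implicit Types (g h : 'rV[R]_n -> R) (x : 'rV[R]_n) (W Z : 'rV[R]_n -> 'rV[R]_n).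

Definition vf W g x : R := \sum_k W x ord0 k * dpd k g x.

Lemma isd_vf g x W : smooth_on U g -> U x -> is_derive x (W x) g (vf W g x).
Proof. exact: smooth_isd. Qed.

Lemma vf_isd g x W d : smooth_on U g -> U x -> is_derive x (W x) g d -> vf W g x = d.
Proof.
move=> sg Ux gd; rewrite -(@derive_val _ _ _ _ _ _ _ gd).
by rewrite (@derive_val _ _ _ _ _ _ _ (isd_vf W sg Ux)).
Qed.

Lemma vf_eq_on g h x W : (forall y, U y -> g y = h y) -> U x -> vf W g x = vf W h x.
Proof. by move=> gh Ux; apply: eq_bigr => k _; rewrite (pd_eq_on oU _ gh Ux). Qed.

Lemma smooth_vf g W : (forall k, smooth_on U (fun x => W x ord0 k)) -> smooth_on U g -> smooth_on U (vf W g).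
Proof. by move=> sW sg; rewrite /vf; smt. Qed.

Lemma vf_Euler g x : vf id g x = Euler g x.
Proof. by apply: eq_bigr => k _; rewrite mulrC. Qed.

Lemma vf_vf g x W Z dz : smooth_on U g -> U x -> (forall k, smooth_on U (fun x => Z x ord0 k)) ->
  (forall k, is_derive x (W x) (fun y => Z y ord0 k) (dz k)) ->
  vf W (vf Z g) x = bil (coo (W x)) (coo (Z x)) (hs g x) + \sum_k dz k * dpd k g x.
Proof.
move=> sg Ux sZ hZ.
have sp k : smooth_on U (dpd k g) by smt.
have hp k := isd_vf W (sp k) Ux.
have H : is_derive x (W x) (vf Z g) (\sum_k (dz k * dpd k g x + Z x ord0 k * vf W (dpd k g) x)).
  by rewrite /vf; apply: isd_sum => k; have h1 := hZ k; have h2 := hp k; isd; rewrite addrC [_ * dz k]mulrC.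
rewrite (vf_isd (smooth_vf sZ sg) Ux H) big_split /= addrC; congr (_ + _).
rewrite bilC bil_dp; apply: eq_bigr => k _; congr (_ * _).
by apply: eq_bigr => j _; rewrite /hs (pd_comm j k oU sg Ux).
Qed.
End VectorFields.

(** * Smoothness of logarithms *)

Section Ln.
Context {R : realType} {n : nat} (U : set 'rV[R]_n).
Hypothesis oU : open U.

Lemma smooth_of_pd (g : 'rV[R]_n -> R) : (forall x, U x -> differentiable g x) ->
  (forall i, smooth_on U (dpd i g)) -> smooth_on U g.
Proof.
move=> dg sg; elim/last_ind => [|s i _] x Ux; first exact: dg.
have -> : pds (rcons s i) g = pds s (dpd i g).
  by elim: s => [|j s IH] /=; [rewrite pdE|rewrite IH].
exact: sg.
Qed.

Lemma ln_pd (g : 'rV[R]_n -> R) i x : smooth_on U g -> U x -> 0 < g x ->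
  differentiable (fun y => ln (g y)) x /\ dpd i (fun y => ln (g y)) x = dpd i g x / g x.
Proof.
move=> sg Ux gx; have dg := smooth_diff sg Ux.
have dl : differentiable (@ln R) (g x) by apply/derivable1_diffP; apply: ex_derive; apply: is_derive1_ln; auto.
have dc : differentiable (fun y => ln (g y)) x by exact: (differentiable_comp dg dl).
split=> //.
apply: pd_isd; apply: DeriveDef; first exact: diff_derivable.
have [hl1 hl2] := is_derive1_ln gx.
rewrite deriveE // (_ : (fun y => ln (g y)) = @ln R \o g) // diff_comp //=.
have -> : 'd g x (ev i) = dpd i g x by rewrite -pdE /pd deriveE.
rewrite -[dpd i g x]mulr1 -[_ * 1]/(dpd i g x *: (1 : R)) linearZ /= -deriveE // hl2.
exact: (congr1 (fun z => z * (g x)^-1) (esym (mulr1 _))).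
Qed.

Lemma smooth_ln (g : 'rV[R]_n -> R) : smooth_on U g -> (forall x, U x -> 0 < g x) ->
  smooth_on U (fun y => ln (g y)).
Proof.
move=> sg gp; apply: smooth_of_pd => [x Ux|i].
  (* [ln_pd] needs an index, so the case n = 0 is treated directly. *)
  have i0 : 'I_n + (forall i : 'I_n, False).
    by case: (n) => [|m]; [right=> -[]|left; exact: ord0].
  case: i0 => [i|no]; first by have [] := ln_pd i sg Ux (gp x Ux).
  have dl : differentiable (@ln R) (g x) by apply/derivable1_diffP; apply: ex_derive; apply: is_derive1_ln; auto.
  exact: (differentiable_comp (smooth_diff sg Ux) dl).
have g0 x : U x -> g x != 0 by move=> Ux; rewrite gt_eqF // gp.
apply: (smooth_eq oU (f := fun x => dpd i g x * (g x)^-1)); last by smt.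
by move=> x Ux; have [_ ->] := ln_pd i sg Ux (gp x Ux).
Qed.
End Ln.

(** * The ray system: estimates near its rest point *)

Section Arithmetic.
Context {R : realFieldType}.
Implicit Types (p e X Y q v c W x y : R).

Lemma normM_le x y a b : `|x| <= a -> `|y| <= b -> `|x * y| <= a * b.
Proof. by move=> h1 h2; rewrite normrM; apply: ler_pM. Qed.

(** For X and Y the derivatives of f and w along the rotation towards a, v = [Euler w], q = 1/E and
    p = n - 1, these are s X' and s Y' along a ray. The constant c is the ratio of the second
    derivatives in direction b to these first derivatives. At v = 0, q = 1 the linear part is -pX
    and Y + (p - 1)X. *)
Definition dX p c v q X Y := X * (v + p - 1 - (2 * p - 1) * q) + Y * (1 - v - q)
  + c * q * (X ^+ 2 + 2 * X * Y - Y ^+ 2).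
Definition dY p v X Y := (1 - v) * Y + (v + p - 1) * X.

Lemma dX_bound p e c v q X Y : 2 <= p -> 0 < e -> `|v| <= e -> `|q - 1| <= e ->
  `|c * q * X| <= e -> `|c * q * Y| <= e ->
  `|dX p c v q X Y + p * X| <= e * ((2 * p + 3) * `|X| + 3 * `|Y|).
Proof.
move=> p2 e0 v0 q0 X0 Y0.
have -> : dX p c v q X Y + p * X = v * X - (2 * p - 1) * ((q - 1) * X) - v * Y - (q - 1) * Y
  + (c * q * X) * X + 2 * ((c * q * Y) * X) - (c * q * Y) * Y by rewrite /dX; ring.
have a1 := normM_le v0 (lexx `|X|); have a2 := normM_le q0 (lexx `|X|).
have a3 := normM_le v0 (lexx `|Y|); have a4 := normM_le q0 (lexx `|Y|).
have a5 := normM_le X0 (lexx `|X|); have a6 := normM_le Y0 (lexx `|X|).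
have a7 := normM_le Y0 (lexx `|Y|).
have a8 : `|(2 * p - 1) * ((q - 1) * X)| <= (2 * p - 1) * (e * `|X|).
  by rewrite normrM ger0_norm ?ler_wpM2l //; lra.
have a9 : `|2 * ((c * q * Y) * X)| <= 2 * (e * `|X|) by rewrite normrM ger0_norm ?ler_wpM2l.
move: a1 a3 a4 a5 a7 a8 a9; rewrite !ler_norml.
move: (v * X) (v * Y) ((q - 1) * Y) (c * q * X * X) (c * q * Y * Y) ((2 * p - 1) * ((q - 1) * X)) (2 * ((c * q * Y) * X)).
move=> z1 z2 z3 z4 z5 z6 z7.
by do 7!move=> /andP [? ?]; apply/andP; split; lra.
Qed.

(** For the unperturbed saddle s X' = -pX, s W' = W the expression is W^2 + p (p + 1)^-2 X^2; the
    smallness of e absorbs the remainders. It is, up to a positive factor, the derivative of W^2 -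
    (p + 1)^-2 X^2. *)
Lemma cone_arith p e X W r1 r2' : 2 <= p -> 0 < e -> 100 * p ^+ 2 * e <= 1 ->
  `|r1| <= e * ((2 * p + 6) * `|X| + 3 * `|W|) -> `|r2'| <= e * ((2 * p + 8) * `|X| + 4 * `|W|) ->
  0 <= W * (W + r2') - (p + 1) ^- 2 * (X * (- p * X + r1)).
Proof.
move=> p2 e0 pe h1 h2.
have pp : 0 < (p + 1) ^+ 2 by rewrite exprn_gt0 //; lra.
have pe1 : p * e <= 1 / 200 by nra.
have e1 : e <= 1 / 400 by nra.
rewrite -(pmulr_rge0 _ pp).
have -> : (p + 1) ^+ 2 * (W * (W + r2') - (p + 1) ^- 2 * (X * (- p * X + r1))) =
  (p + 1) ^+ 2 * (W * W + W * r2') + p * (X * X) - X * r1 by field; rewrite gt_eqF //; lra.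
have W2 : W * W = `|W| * `|W| by rewrite -!expr2 real_normK // num_real.
have X2 : X * X = `|X| * `|X| by rewrite -!expr2 real_normK // num_real.
have b1 : X * r1 <= `|X| * (e * ((2 * p + 6) * `|X| + 3 * `|W|)).
  by apply: le_trans (ler_norm _) _; rewrite normrM ler_wpM2l.
have b2 : - (`|W| * (e * ((2 * p + 8) * `|X| + 4 * `|W|))) <= W * r2'.
  by apply: lerNnormlW; rewrite normrM ler_wpM2l.
rewrite W2 X2; move: (normr_ge0 X) (normr_ge0 W) b1 b2.
set x := `|X|; set y := `|W|; move: (X * r1) (W * r2') => z1 z2 x0 y0 b1 b2.
pose T := (p + 1) * y; have T0 : 0 <= T by rewrite mulr_ge0 //; lra.
have c1 : (p + 1) ^+ 2 * (y * y + z2) >= T * T - (p + 1) ^+ 2 * (y * (e * ((2 * p + 8) * x + 4 * y))).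
  by have := ler_wpM2l (ltW pp) b2; rewrite /T; lra.
have c2 : (p + 1) ^+ 2 * (y * (e * ((2 * p + 8) * x + 4 * y))) <= (9 / 100) * (T * x) + (1 / 100) * (T * T).
  have -> : (p + 1) ^+ 2 * (y * (e * ((2 * p + 8) * x + 4 * y))) =
     ((2 * p + 8) * (p + 1) * e) * (T * x) + (4 * e) * (T * T) by rewrite /T; ring.
  apply: lerD; (apply: ler_wpM2r; first exact: mulr_ge0); last by lra.
  have : (2 * p + 8) * (p + 1) <= 9 * p ^+ 2 by nra.
  by move=> h; have := ler_wpM2r (ltW e0) h; lra.
have c3 : x * (e * ((2 * p + 6) * x + 3 * y)) <= (3 / 100) * (x * x) + (1 / 100) * (T * x).
  have -> : x * (e * ((2 * p + 6) * x + 3 * y)) = ((2 * p + 6) * e) * (x * x) + 3 * e * (y * x) by ring.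
  apply: lerD; first by apply: ler_wpM2r; [rewrite mulr_ge0|nra].
  have yT : y <= T by rewrite /T; nra.
  have : y * x <= T * x by rewrite ler_wpM2r.
  have : 0 <= y * x by rewrite mulr_ge0.
  nra.
have := sqr_ge0 (x - T); have := mulr_ge0 x0 x0; have := mulr_ge0 T0 T0; nra.
Qed.

(** Coefficients of the second order constraint z [kO] + [qO] = 0 derived in [O4_alg], with z = A A
    w - c A w + (A w)^2. *)
Definition kO p c v q Y := 2 - p - 2 * v + (p - 1) * q - 2 * c * q * Y.
Definition qO p c v q X Y := p * X * Y + q * (- (3 * p - 1) * X ^+ 2 - 3 * X * Y + Y ^+ 2)
  + (X - Y) * dY p v X Y + c * q * (X ^+ 3 + 3 * X ^+ 2 * Y - 3 * X * Y ^+ 2 + Y ^+ 3).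

(** To leading order the constraint reads z / X^2 = 2p + Y/X, so a bound on Y/X encloses z / X^2
    between positive constants. *)
Lemma zeta_arith p e c v q X y z : 2 <= p -> 0 < e -> 100 * p ^+ 2 * e <= 1 -> X != 0 ->
  `|v| <= e -> `|q - 1| <= e -> `|c * q * X| <= e -> `|c * q * (X * y)| <= e -> `|y| <= 5 / 4 ->
  z * kO p c v q (X * y) + qO p c v q X (X * y) = 0 ->
  2 <= z / X ^+ 2 <= 4 * p + 4.
Proof.
move=> p2 e0 pe X0 v0 q0 cX cY y54 H.
have pe1 : p * e <= 1 / 200 by nra.
have e1 : e <= 1 / 400 by nra.
have X2 : 0 < X ^+ 2 by rewrite lt0r sqrf_eq0 X0 sqr_ge0.
set k := kO p c v q (X * y) in H.
have hk : 9 / 10 <= k <= 11 / 10.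
  have -> : k = 1 - 2 * v + (p - 1) * (q - 1) - 2 * (c * q * (X * y)) by rewrite /k /kO; ring.
  have a1 : `|(p - 1) * (q - 1)| <= (p - 1) * e by rewrite normrM ger0_norm ?ler_wpM2l //; lra.
  move: v0 cY a1; rewrite !ler_norml => /andP [? ?] /andP [? ?].
  by move: ((p - 1) * (q - 1)) => w /andP [? ?]; apply/andP; split; lra.
set zt := z / X ^+ 2; have zE : z = zt * X ^+ 2 by rewrite divfK // gt_eqF.
pose r := (q - 1) * (- (3 * p - 1) - 3 * y + y ^+ 2) + v * (1 - y) ^+ 2
  + (c * q * X) * (1 + 3 * y) + (c * q * (X * y)) * (- 3 * y + y ^+ 2).
have rE : zt * k = 2 * p + y - r.
  apply: (mulIf (lt0r_neq0 X2)); apply/eqP; rewrite -subr_eq0; apply/eqP; rewrite -[RHS]H zE /r /qO /dY.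
  ring.
have y2 : 0 <= y ^+ 2 <= 25 / 16 by move: y54; rewrite ler_norml => /andP [? ?]; apply/andP; split; nra.
have hr : `|r| <= 1 / 4.
  have a1 : `|(q - 1) * (- (3 * p - 1) - 3 * y + y ^+ 2)| <= e * (3 * p + 7).
    apply: normM_le => //; move: y54 y2 p2; rewrite !ler_norml; clear; move=> /andP [? ?] /andP [? ?] ?.
    by apply/andP; split; lra.
  have a2 : `|v * (1 - y) ^+ 2| <= e * 6.
    by apply: normM_le => //; move: y54 y2; rewrite !ler_norml; clear; move=> /andP [? ?] /andP [? ?]; apply/andP; split; nra.
  have a3 : `|(c * q * X) * (1 + 3 * y)| <= e * 5.
    by apply: normM_le => //; move: y54; rewrite !ler_norml; clear; move=> /andP [? ?]; apply/andP; split; lra.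
  have a4 : `|(c * q * (X * y)) * (- 3 * y + y ^+ 2)| <= e * 6.
    apply: normM_le => //; move: y54 y2 p2; rewrite !ler_norml; clear; move=> /andP [? ?] /andP [? ?] ?.
    by apply/andP; split; lra.
  apply: le_trans (ler_normD _ _) _; apply: le_trans (lerD (ler_normD _ _) a4) _.
  apply: le_trans (lerD (lerD (ler_normD _ _) a3) (lexx _)) _.
  apply: le_trans (lerD (lerD (lerD a1 a2) (lexx _)) (lexx _)) _; lra.
move: hr y54 hk; rewrite !ler_norml => /andP [? ?] /andP [? ?] /andP [? ?].
by apply/andP; split; nra.
Qed.

(** To leading order the expression is (p + 1) z / X^2 + p Y/X, positive because z / X^2 >= 2. It
    says that z / X^2 grows at least linearly in the radius. *)
Lemma dzeta_arith p e v y zt r : 2 <= p -> 0 < e -> 100 * p ^+ 2 * e <= 1 -> `|v| <= e -> `|y| <= 5 / 4 ->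
  2 <= zt -> `|r| <= 1 / 8 ->
  0 <= (2 - p - 2 * v) * zt + p * y - 2 * zt * (- p + r) - zt.
Proof.
move=> p2 e0 pe; have pe1 : p * e <= 1 / 200 by nra.
have e1 : e <= 1 / 400 by nra.
rewrite !ler_norml => /andP [? ?] /andP [? ?] z2 /andP [? ?].
have -> : (2 - p - 2 * v) * zt + p * y - 2 * zt * (- p + r) - zt = zt * (p + 1 - 2 * v - 2 * r) + p * y by ring.
have : zt * (p + 1 / 2) <= zt * (p + 1 - 2 * v - 2 * r) by rewrite ler_wpM2l //; lra.
have : 2 * (p + 1 / 2) <= zt * (p + 1 / 2) by rewrite ler_wpM2r //; lra.
have : p * (- (5 / 4)) <= p * y by rewrite ler_wpM2l //; lra.
lra.
Qed.
End Arithmetic.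

(** * No nonzero decaying solution of the ray system *)

Section Contradiction.
Context {R : realType} (p c s0 : R) (X Y v q z : R -> R).
Hypothesis p2 : 2 <= p.
Hypothesis s0p : 0 < s0.
Hypothesis hX : forall s, s0 <= s -> is_derive s (1 : R) X (s^-1 * dX p c (v s) (q s) (X s) (Y s)).
Hypothesis hY : forall s, s0 <= s -> is_derive s (1 : R) Y (s^-1 * dY p (v s) (X s) (Y s)).
Hypothesis hz : forall s, s0 <= s ->
  is_derive s (1 : R) z (s^-1 * ((2 - p - 2 * v s) * z s + p * X s * Y s)).
Hypothesis hO : forall s, s0 <= s -> X s + Y s != 0 ->
  z s * kO p c (v s) (q s) (Y s) + qO p c (v s) (q s) (X s) (Y s) = 0.
Hypothesis hdec : forall e : R, 0 < e -> exists2 s1, s0 <= s1 & forall s, s1 <= s ->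
  [/\ `|X s| <= e, `|Y s| <= e, `|v s| <= e & `|q s - 1| <= e].
Hypothesis hne : forall s, s0 <= s -> X s = 0 -> Y s = 0 -> False.

(** Decay forces the solution into the cone around the stable direction, where |Y/X| <= 5/4. There
    the constraint bounds z / X^2 from both sides, while its differential equation makes it grow at
    least linearly. *)
Lemma static_ode_absurd : False.
Proof.
have p2' := p2.
pose e := (100 * p ^+ 2)^-1.
have pp : 0 < 100 * p ^+ 2 by rewrite mulr_gt0 // exprn_gt0 //; lra.
have e0 : 0 < e by rewrite invr_gt0.
have pe : 100 * p ^+ 2 * e <= 1 by rewrite mulfV ?gt_eqF.
(* Small enough that c q X and c q Y are also at most e, using |q| <= 2. *)
pose e' := e / (2 * (`|c| + 1)).
have c1 : 0 < 2 * (`|c| + 1) by rewrite mulr_gt0 // ltr_wpDl.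
have e'0 : 0 < e' by rewrite divr_gt0.
have eE : 2 * (`|c| + 1) * e' = e by rewrite /e' mulrC divfK // gt_eqF.
have e'e : e' <= e by rewrite /e' ler_pdivrMr // ler_peMr ?(ltW e0) //; have := normr_ge0 c; lra.
have [s1 s01 H] := hdec e'0.
have sp s : s1 <= s -> 0 < s by move=> h; apply: lt_le_trans (le_trans s01 h).
have ss s : s1 <= s -> s0 <= s by exact: le_trans.
have pe1 : p * e <= 1 / 200 by have h1 := pe; have h2 := p2; nra.
have e1 : e <= 1 / 400 by have h2 := p2; nra.
have small s : s1 <= s -> [/\ `|v s| <= e, `|q s - 1| <= e, `|c * q s * X s| <= e & `|c * q s * Y s| <= e].
  move=> /H [hx hy hv hq]; split; [exact: le_trans hv e'e|exact: le_trans hq e'e| |];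
    (have q2 : `|q s| <= 2 by move: (le_trans hq e'e) e1; rewrite !ler_norml; clear_from e0; move=> /andP [? ?] ?; apply/andP; split; lra);
    (have ce : `|c| * 2 * e' <= e by have h := eE; have h' := e'0; lra).
    by apply: le_trans ce; apply: normM_le => //; exact: normM_le.
  by apply: le_trans ce; apply: normM_le => //; exact: normM_le.
(* The linear part has eigenvalues -p and 1; W = Y + nu X vanishes on the stable direction and
   satisfies s W' = W to leading order. *)
pose nu := (p - 1) / (p + 1).
have p1 : 0 < p + 1 by lra.
have nu01 : 0 <= nu <= 1 by rewrite divr_ge0 /= ?ler_pdivrMr; move: p1 p2; clear_from e0; lra.
pose W s := Y s + nu * X s.
have YW s : `|Y s| <= `|W s| + `|X s|.
  have -> : Y s = W s - nu * X s by rewrite /W; ring.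
  apply: le_trans (ler_normB _ _) _; rewrite lerD2l normrM ler_piMl ?normr_ge0 // ger0_norm; move: nu01 => /andP [] //.
pose r1 s := dX p c (v s) (q s) (X s) (Y s) + p * X s.
have hr1 s : s1 <= s -> `|r1 s| <= e * ((2 * p + 6) * `|X s| + 3 * `|W s|).
  move=> /small [h1 h2 h3 h4]; apply: le_trans (dX_bound p2 e0 h1 h2 h3 h4) _.
  by rewrite ler_pM2l //; have := YW s; lra.
pose r2' s := v s * (X s - Y s) + nu * r1 s.
have hr2 s : s1 <= s -> `|r2' s| <= e * ((2 * p + 8) * `|X s| + 4 * `|W s|).
  move=> s1s; have [h1 h2 h3 h4] := small s s1s; have h5 := dX_bound p2 e0 h1 h2 h3 h4.
  apply: le_trans (ler_normD _ _) _.
  have a1 : `|v s * (X s - Y s)| <= e * (`|X s| + `|Y s|) by apply: normM_le => //; exact: ler_normB.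
  have a2 : `|nu * r1 s| <= `|r1 s|.
    by rewrite normrM ler_piMl ?normr_ge0 // ger0_norm; move: nu01 => /andP [].
  rewrite -/(r1 s) in h5.
  have a3 : e * `|Y s| <= e * (`|W s| + `|X s|) by rewrite ler_wpM2l // ltW.
  by move: h5 a1 a2 a3; clear_from e0; lra.
pose Phi s := W s ^+ 2 + (- (p + 1) ^- 2) * X s ^+ 2.
have dPhi s : s1 <= s -> is_derive s (1 : R) Phi
    (2 * s^-1 * (W s * (W s + r2' s) - (p + 1) ^- 2 * (X s * (- p * X s + r1 s)))).
  move=> s1s; have h1 := hX (ss s s1s); have h2 := hY (ss s s1s).
  have sn := lt0r_neq0 (sp s s1s); have pn := lt0r_neq0 p1.
  by rewrite /Phi /W; isd; rewrite /r2' /r1 /dY /nu; field; rewrite ?sn ?pn.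
have Phi_ndecr x y : s1 <= x -> x <= y -> Phi x <= Phi y.
  move=> s1x xy; apply: (isd_nondecr xy (fun z zz => dPhi z (le_trans s1x (proj1 (andP zz))))) => s /andP [xs _].
  have s1s := le_trans s1x xs.
  apply: mulr_ge0; first by rewrite mulr_ge0 // invr_ge0 ltW // sp.
  exact: cone_arith p2 e0 pe (hr1 s s1s) (hr2 s s1s).
(* [Phi] is nondecreasing and becomes arbitrarily small together with X and Y, so it cannot be
   positive. *)
have Phi0 s : s1 <= s -> Phi s <= 0.
  move=> s1s; rewrite leNgt; apply/negP => P0.
  pose d := Num.min 1 (Phi s / 8); have d0 : 0 < d by rewrite lt_min ltr01 divr_gt0.
  have [s2 s02 H2] := hdec d0; pose m := Num.max s s2.
  have sm : s <= m by rewrite le_max lexx.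
  have s2m : s2 <= m by rewrite le_max lexx orbT.
  have [hx hy _ _] := H2 m s2m.
  have := Phi_ndecr s m s1s sm.
  have hW : `|W m| <= 2 * d.
    apply: le_trans (ler_normD _ _) _; have : `|nu * X m| <= d.
      apply: le_trans hx; rewrite normrM ler_piMl ?normr_ge0 // ger0_norm; move: nu01 => /andP [] //.
    by move: hy; clear_from e0; lra.
  have d1 : d <= 1 by rewrite ge_min lexx.
  have d8 : d <= Phi s / 8 by rewrite ge_min lexx orbT.
  have : Phi m <= W m ^+ 2 by rewrite /Phi gerDl mulr_le0_ge0 ?sqr_ge0 // oppr_le0 invr_ge0 sqr_ge0.
  have : W m ^+ 2 <= 4 * d.
    by move: hW d1 d0; rewrite ler_norml; clear_from e0; move=> /andP [? ?] ? ?; nra.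
  by move: d8 P0; clear_from e0; lra.
have cone s : s1 <= s -> [/\ X s != 0, `|W s| <= (p + 1)^-1 * `|X s| & X s + Y s != 0].
  move=> s1s; have P0 := Phi0 s s1s.
  have WX : `|W s| <= (p + 1)^-1 * `|X s|.
    rewrite -(@ler_pXn2r _ 2) ?nnegrE ?mulr_ge0 ?invr_ge0 ?(ltW p1) //.
    rewrite exprMn !real_normK ?num_real // exprVn; move: P0; rewrite /Phi; lra.
  have X0 : X s != 0.
    apply/negP => /eqP X0; apply: (hne (ss s s1s) X0).
    by move: WX; rewrite X0 normr0 mulr0 normr_le0 /W X0 mulr0 addr0 => /eqP.
  split=> //; apply/negP => /eqP S0.
  have WE : W s = - ((1 - nu) * X s).
    by transitivity (X s + Y s - (1 - nu) * X s); [rewrite /W; ring|rewrite S0 sub0r].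
  move: WX; rewrite WE normrN normrM ler_pM2r ?normr_gt0 // (_ : 1 - nu = 2 * (p + 1)^-1); last first.
    by rewrite /nu; field; rewrite gt_eqF.
  by have : 0 < (p + 1)^-1 by [rewrite invr_gt0]; move=> h; rewrite ger0_norm; move: h; clear_from e0; lra.
have yb s : s1 <= s -> `|Y s / X s| <= 5 / 4.
  move=> s1s; have [X0 WX _] := cone s s1s; rewrite normrM normfV ler_pdivrMr ?normr_gt0 //.
  have -> : Y s = W s - nu * X s by rewrite /W; ring.
  apply: le_trans (ler_normB _ _) _; rewrite normrM.
  have : (p + 1)^-1 + `|nu| <= 5 / 4.
    rewrite ger0_norm; last by move: nu01 => /andP [].
    have -> : (p + 1)^-1 + nu = p / (p + 1) by rewrite /nu; field; rewrite gt_eqF.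
    by rewrite ler_pdivrMr //; move: p1 p2; clear_from e0; lra.
  by move=> h; move: (ler_wpM2r (normr_ge0 (X s)) h) WX; clear_from e0; lra.
have XYE s : s1 <= s -> X s * (Y s / X s) = Y s.
  by move=> s1s; have [X0 _ _] := cone s s1s; rewrite mulrC divfK.
have zb s : s1 <= s -> 2 <= z s / X s ^+ 2 <= 4 * p + 4.
  move=> s1s; have [X0 _ S0] := cone s s1s; have [h1 h2 h3 h4] := small s s1s.
  apply: (zeta_arith (e := e) (c := c) (v := v s) (q := q s) (y := Y s / X s)) => //; rewrite ?XYE //.
    exact: yb.
  exact: (hO (ss s s1s)).
pose psi s := z s * X s ^- 2 * s^-1.
have dpsi s : s1 <= s -> is_derive s (1 : R) psi (s ^- 2 * ((2 - p - 2 * v s) * (z s / X s ^+ 2) + p * (Y s / X s)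
   - 2 * (z s / X s ^+ 2) * (- p + r1 s / X s) - z s / X s ^+ 2)).
  move=> s1s; have [X0 _ _] := cone s s1s; have h1 := hX (ss s s1s); have h2 := hz (ss s s1s).
  have sn0 := lt0r_neq0 (sp s s1s); have X2 : X s ^+ 2 != 0 by rewrite expf_neq0.
  by rewrite /psi; isd; rewrite /r1; field; rewrite X0 sn0.
have psi_nd x y : s1 <= x -> x <= y -> psi x <= psi y.
  move=> s1x xy; apply: (isd_nondecr xy (fun z zz => dpsi z (le_trans s1x (proj1 (andP zz))))) => s /andP [xs _].
  have s1s := le_trans s1x xs; have [X0 _ _] := cone s s1s; have [h1 h2 h3 h4] := small s s1s.
  apply: mulr_ge0; first by rewrite invr_ge0 exprn_ge0 // ltW // sp.
  apply: (dzeta_arith p2 e0 pe h1 (yb s s1s)); first by have /andP [] := zb s s1s.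
  rewrite normrM normfV ler_pdivrMr ?normr_gt0 //.
  apply: le_trans (dX_bound p2 e0 h1 h2 h3 h4) _.
  have := yb s s1s; rewrite normrM normfV ler_pdivrMr ?normr_gt0 // => h.
  have a1 := ler_wpM2l (ltW e0) h; have a2 := ler_wpM2r (normr_ge0 (X s)) pe1.
  have a3 := ler_wpM2r (normr_ge0 (X s)) e1; have a4 := normr_ge0 (X s); move: a1 a2 a3 a4; clear_from e0; lra.
have s1p := sp s1 (lexx _).
(* Between [s1] and [s2] linear growth would raise z / X^2 from at least 2 to at least 4p + 6,
   beyond the bound 4p + 4. *)
pose s2 := s1 * (2 * p + 3).
have s12 : s1 <= s2 by rewrite /s2 ler_peMr ?(ltW s1p) //; lra.
have := psi_nd s1 s2 (lexx _) s12; rewrite /psi ler_pdivrMr // => h.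
have /andP [z1 _] := zb s1 (lexx _); have /andP [_ z2] := zb s2 s12.
have s2p := sp s2 s12.
have h2 : 2 * s2 <= (4 * p + 4) * s1.
  move: h; rewrite mulrAC ler_pdivlMr // => h.
  apply: (@le_trans _ _ (z s1 / X s1 ^+ 2 * s2)); first by rewrite ler_wpM2r // ltW.
  by apply: le_trans h _; rewrite ler_wpM2r // ltW.
have : 2 * s2 = (4 * p + 4) * s1 + 2 * s1 by rewrite /s2; ring.
move: h2 s1p; clear_from e0; lra.
Qed.
End Contradiction.

(** * Elimination behind the ray system *)

Section RayAlgebra.
Context {R : realFieldType}.
Implicit Types (p c v q E X Y : R).

(** [h] equates two expressions for the derivative of [lamE] towards a, and [lE] eliminates tau =
    [Euler f], for which no estimate is available. *)
Lemma O1_alg p c v q E X Y tau DX DY : E != 0 -> q = E^-1 -> E * (tau - v) + (p - 1) * (1 - E) = c * (X + Y) ->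
  DY = dY p v X Y ->
  E * (DX - DY) - 2 * E * X * (tau - v - (p - 1)) = - (X + Y) - Y * (c * Y) - X * (c * X) ->
  DX = dX p c v q X Y.
Proof.
move=> E0 qE lE hY h; have K : tau - v - (p - 1) = q * (c * (X + Y)) - (p - 1) * q.
  by rewrite -lE qE; field.
have -> : DX = DY + 2 * X * (tau - v - (p - 1)) + q * (- (X + Y) - Y * (c * Y) - X * (c * X)).
  by rewrite -h qE; field.
by rewrite K hY /dX /dY; ring.
Qed.

(** Explains the choice of z: this combination obeys a linear equation along the ray with the source
    pXY, once z1 is eliminated by the tangential equation. *)
Lemma O3_alg p c v X Y z1 z2 DY : DY = dY p v X Y -> z2 + Y ^+ 2 + (z1 + X ^+ 2) = c * (X + Y) ->
  ((1 - v) * z2 + (v + p - 1) * z1 + DY * (X - Y)) - c * DY + 2 * Y * DY =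
  (2 - p - 2 * v) * (z2 - c * Y + Y ^+ 2) + p * X * Y.
Proof.
move=> hY h; have -> : z1 = c * (X + Y) - X ^+ 2 - Y ^+ 2 - z2 by rewrite -h; ring.
by rewrite hY /dY; ring.
Qed.

(** [m1] and [m2] form a linear system for the mixed third derivatives mf and mw with determinant X
    + Y up to sign. Inserting them in [l1] and comparing with [l2], two expressions for the second
    derivative of [lamE], eliminates every higher derivative except z2. *)
Lemma O4_alg p c v q E X Y tau DX DY z1 z2 Dz1 Dz2 mf mw AAl : E != 0 -> q = E^-1 -> X + Y != 0 ->
  E * (tau - v) + (p - 1) * (1 - E) = c * (X + Y) ->
  DY = dY p v X Y -> DX = dX p c v q X Y -> z2 + Y ^+ 2 + (z1 + X ^+ 2) = c * (X + Y) ->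
  Dz2 = (1 - v) * z2 + (v + p - 1) * z1 + DY * (X - Y) ->
  Dz2 + 2 * Y * DY + (Dz1 + 2 * X * DX) = c * (DX + DY) ->
  mw + mf = - (X + Y) - Y * (c * Y) - X * (c * X) ->
  z1 * (c * Y) + X * mw = mf * Y + (c * X) * z2 ->
  AAl = - (z1 + z2) - z2 * (c * Y) - Y * mw - z1 * (c * X) - X * mf ->
  AAl = E * (Dz1 - Dz2) - 4 * E * X * (DX - DY) + (4 * E * X ^+ 2 - 2 * E * z1) * (tau - v - (p - 1)) ->
  (z2 - c * Y + Y ^+ 2) * kO p c v q Y + qO p c v q X Y = 0.
Proof.
move=> E0 qE S0 lE hY hX hS hz2 hsum m1 m2 l1 l2.
have K : tau - v - (p - 1) = q * (c * (X + Y)) - (p - 1) * q by rewrite -lE qE; field.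
have z1E : z1 = c * (X + Y) - X ^+ 2 - Y ^+ 2 - z2 by rewrite -hS; ring.
have mfE : mf = c * z1 - (1 + c ^+ 2) * X.
  apply: (mulfI S0); have -> : (X + Y) * mf = X * mf + mf * Y by ring.
  have -> : mf * Y = z1 * (c * Y) + X * mw - (c * X) * z2 by rewrite m2; ring.
  have -> : mw = - (X + Y) - Y * (c * Y) - X * (c * X) - mf by rewrite -m1; ring.
  by rewrite z1E; ring.
have mwE : mw = c * z2 - (1 + c ^+ 2) * Y.
  have -> : mw = - (X + Y) - Y * (c * Y) - X * (c * X) - mf by rewrite -m1; ring.
  by rewrite mfE z1E; ring.
have Dz1E : Dz1 = Dz2 + q * AAl + 4 * X * (DX - DY) - (4 * X ^+ 2 - 2 * z1) * (tau - v - (p - 1)).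
  by rewrite l2 qE; field.
have two : (2 : R) != 0 by [].
apply: (mulfI two); rewrite mulr0.
have -> : 0 = Dz2 + 2 * Y * DY + (Dz1 + 2 * X * DX) - c * (DX + DY) by rewrite hsum subrr.
rewrite Dz1E K l1 mfE mwE hz2 hX z1E hY /kO /qO /dX /dY; ring.
Qed.
End RayAlgebra.

(** * Propagation of proportionality along a ray *)

Section Wronskian.
Context {R : realType}.

Lemma isd_zero (h : R -> R) (s0 s d : R) : (forall t, s0 <= t -> h t = 0) -> s0 < s ->
  is_derive s (1 : R) h d -> d = 0.
Proof.
move=> h0 ss hd; have n0 : \forall t \near s, h t = (cst 0) t.
  by near=> t; apply: h0; apply: ltW; near: t; exact: lt_nbhsr.
have := near_eq_derive (1 : R) n0.
by rewrite derive_cst (@derive_val _ _ _ _ _ _ _ hd).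
Unshelve. all: by end_near.
Qed.

(** No equation for x1 and x2 is assumed. Differentiating x1 v2 = x2 v1 gives dx1 v2 = dx2 v1, since
    the k and g terms cancel, and then dx1 x2 = dx2 x1. Hence the two vectors (x_i, v_i) stay in a
    constant ratio, and the second stays zero. *)
Lemma wronskian (x1 v1 x2 v2 dx1 dx2 k g : R -> R) (s0 : R) :
  (forall s, s0 <= s -> is_derive s (1 : R) x1 (dx1 s)) ->
  (forall s, s0 <= s -> is_derive s (1 : R) x2 (dx2 s)) ->
  (forall s, s0 <= s -> is_derive s (1 : R) v1 (k s * v1 s + g s * x1 s)) ->
  (forall s, s0 <= s -> is_derive s (1 : R) v2 (k s * v2 s + g s * x2 s)) ->
  (forall s, s0 <= s -> exists d, is_derive s (1 : R) dx1 d) ->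
  (forall s, s0 <= s -> exists d, is_derive s (1 : R) dx2 d) ->
  (forall s, s0 <= s -> x1 s * v2 s = x2 s * v1 s) ->
  (forall s, s0 <= s -> g s != 0) ->
  (forall s, s0 <= s -> x1 s ^+ 2 + v1 s ^+ 2 + (x2 s ^+ 2 + v2 s ^+ 2) != 0) ->
  x2 s0 = 0 -> v2 s0 = 0 -> forall s, s0 <= s -> x2 s = 0 /\ v2 s = 0.
Proof.
move=> hx1 hx2 hv1 hv2 ddx1 ddx2 J g0 N0 x20 v20.
have E1 s : s0 < s -> dx1 s * v2 s = dx2 s * v1 s.
  move=> ss; have s0s := ltW ss; have h1 := hx1 s s0s; have h2 := hx2 s s0s; have h3 := hv1 s s0s; have h4 := hv2 s s0s.
  have H : is_derive s (1 : R) (fun t => x1 t * v2 t + - (x2 t * v1 t)) (dx1 s * v2 s - dx2 s * v1 s).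
    isd; have := J s s0s => Js.
    transitivity (dx1 s * v2 s - dx2 s * v1 s + k s * (x1 s * v2 s - x2 s * v1 s)); first by ring.
    by rewrite Js subrr mulr0 addr0.
  by apply/eqP; rewrite -subr_eq0 (isd_zero _ ss H) // => t st; rewrite J // subrr.
have E2 s : s0 < s -> dx1 s * x2 s = dx2 s * x1 s.
  move=> ss; have s0s := ltW ss.
  have [v1n|v1n] := eqVneq (v1 s) 0; last first.
    apply: (mulfI v1n).
    transitivity (dx1 s * (x2 s * v1 s)); first by ring.
    rewrite -J //; transitivity (x1 s * (dx1 s * v2 s)); first by ring.
    by rewrite E1 //; ring.
  have [v2n|v2n] := eqVneq (v2 s) 0; last first.
    apply: (mulfI v2n); transitivity (x2 s * (dx1 s * v2 s)); first by ring.
    rewrite E1 //; transitivity (dx2 s * (x2 s * v1 s)); first by ring.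
    by rewrite -J //; ring.
  (* Where v1 = v2 = 0 the relation [E1] is differentiated once more, and g != 0 gives the claim. *)
  have [d1 h1] := ddx1 s s0s; have [d2 h2] := ddx2 s s0s; have h3 := hv1 s s0s; have h4 := hv2 s s0s.
  have [e e0 ee] : exists2 e, s0 < e & e < s by exists ((s0 + s) / 2); lra.
  have H : is_derive s (1 : R) (fun t => dx1 t * v2 t + - (dx2 t * v1 t)) (g s * (dx1 s * x2 s - dx2 s * x1 s)).
    by isd; rewrite v1n v2n; ring.
  have : g s * (dx1 s * x2 s - dx2 s * x1 s) = 0.
    by apply: (isd_zero _ ee H) => t et; rewrite E1 ?subrr // (lt_le_trans e0 et).
  by move=> /eqP; rewrite mulf_eq0 (negbTE (g0 s s0s)) /= subr_eq0 => /eqP.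
pose N s := x1 s ^+ 2 + v1 s ^+ 2 + (x2 s ^+ 2 + v2 s ^+ 2).
(* The share of the second vector in the total square length; its derivative vanishes by the
   relations above. *)
pose P s := (x2 s ^+ 2 + v2 s ^+ 2) * (N s)^-1.
pose T s := (x2 s * dx2 s + v2 s * (k s * v2 s + g s * x2 s)) * (x1 s ^+ 2 + v1 s ^+ 2)
  - (x2 s ^+ 2 + v2 s ^+ 2) * (x1 s * dx1 s + v1 s * (k s * v1 s + g s * x1 s)).
have hP s : s0 <= s -> is_derive s (1 : R) P (2 * T s / N s ^+ 2).
  move=> s0s; have h1 := hx1 s s0s; have h2 := hx2 s s0s; have h3 := hv1 s s0s; have h4 := hv2 s s0s.
  have Ns := N0 s s0s; rewrite -/(N s) in Ns.
  have hN : is_derive s (1 : R) N (2 * (x1 s * dx1 s + v1 s * (k s * v1 s + g s * x1 s)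
     + (x2 s * dx2 s + v2 s * (k s * v2 s + g s * x2 s)))) by rewrite /N; isd; ring.
  rewrite /P; isd; rewrite /T; move: Ns; rewrite /N => Ns; field; exact: Ns.
have T0 s : s0 < s -> T s = 0.
  move=> ss; have Js := J s (ltW ss); have e1 := E1 s ss; have e2 := E2 s ss; rewrite /T.
  transitivity (x1 s * x2 s * (dx2 s * x1 s - dx1 s * x2 s) + ((dx2 s * v1 s) * (x2 s * v1 s) - (x1 s * v2 s) * (dx1 s * v2 s))
    + k s * ((x1 s * v2 s) ^+ 2 - (x2 s * v1 s) ^+ 2) + g s * ((x1 s * v2 s - x2 s * v1 s) * (x1 s * x2 s - v1 s * v2 s))).
    by ring.
  by rewrite e1 e2 Js; ring.
move=> s; rewrite le_eqVlt => /orP [/eqP <-|ss]; first by split.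
have hP' t : s0 <= t <= s -> is_derive t (1 : R) P (2 * T t / N t ^+ 2) by move=> /andP [+ _]; exact: hP.
have [m [m1 m2]] := MVT_isd ss hP'.
rewrite T0 // mulr0 !mul0r {2}/P x20 v20 expr0n /= addr0 mul0r subr0 /P => /eqP.
rewrite mulf_eq0 invr_eq0 (negbTE (N0 s (ltW ss))) orbF paddr_eq0 ?sqr_ge0 // !sqrf_eq0.
by move=> /andP [/eqP -> /eqP ->].
Unshelve. all: by [].
Qed.
End Wronskian.

(** * Linear forms on Euclidean space *)

Section LinearForm.
Context {R : realType} {n : nat}.
Implicit Types (v x y : 'rV[R]_n).
Definition lf v x : R := \sum_k x ord0 k * v ord0 k.
Lemma lfC v x : lf v x = lf x v. Proof. by apply: eq_bigr => k _; rewrite mulrC. Qed.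
Lemma lfD v x y : lf v (x + y) = lf v x + lf v y.
Proof. by rewrite /lf -big_split /=; apply: eq_bigr => k _; rewrite mxE mulrDl. Qed.
Lemma lfZ v s x : lf v (s *: x) = s * lf v x.
Proof. by rewrite /lf mulr_sumr; apply: eq_bigr => k _; rewrite mxE mulrA. Qed.
Lemma lfN v x : lf v (- x) = - lf v x.
Proof. by rewrite /lf -sumrN; apply: eq_bigr => k _; rewrite mxE mulNr. Qed.
Lemma lf_isd v x d : is_derive x d (lf v) (lf v d).
Proof. by rewrite /lf; apply: isd_sum => k; isd; ring. Qed.
Lemma r2_lf x : r2 x = lf x x. Proof. by []. Qed.
Lemma r2_isd_lf x d : is_derive x d r2 (2 * lf d x).
Proof. exact: isd_eq (r2_isd x d) _. Qed.
Lemma smooth_lf (U : set 'rV[R]_n) v : open U -> smooth_on U (lf v).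
Proof. by move=> oU; rewrite /lf; smt. Qed.
Lemma sum_vf (g : 'rV[R]_n -> R) (W : 'rV[R]_n -> 'rV[R]_n) x (c : R) (z : 'I_n -> R) :
  (forall k, z k = c * W x ord0 k) -> \sum_k z k * dpd k g x = c * vf W g x.
Proof. by move=> zE; rewrite /vf mulr_sumr; apply: eq_bigr => k _; rewrite zE mulrA. Qed.
End LinearForm.

(** * The static equations in logarithmic form *)

Section LogStaticDef.
Context {R : realType} {n : nat}.

(** What remains of the tangential right side once the radial derivatives due to the curvature of
    the spheres are split off. It vanishes for radial solutions, see [lam0]. *)
Definition lamE (f w E : 'rV[R]_n -> R) (p : R) (x : 'rV[R]_n) : R :=
  E x * (Euler f x - Euler w x) + (p - 1) * (1 - E x).

(* The static equations for [f = ln u], [w = ln |V|] and [E = u^-2] on vectors tangent to the spheres. *)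
Record log_static (U : set 'rV[R]_n) (f w E : 'rV[R]_n -> R) (p : R) : Prop := LogStatic {
  ls_open : open U;
  ls_r2 : forall x, U x -> 0 < r2 x;
  ls_f : smooth_on U f;
  ls_w : smooth_on U w;
  ls_E : smooth_on U E;
  ls_Ep : forall x, U x -> 0 < E x;
  ls_dE : forall x i, U x -> dpd i E x = - 2 * E x * dpd i f x;
  ls_p : p != 0;
  ls_mix : forall x v, U x -> dp v (coo x) = 0 -> bil v (coo x) (hs w x) =
    dp v (grad f x) * (Euler w x + p - 1) - dp v (grad w x) * Euler w x;
  ls_tan : forall x v z, U x -> dp v (coo x) = 0 -> dp z (coo x) = 0 ->
    bil v z (hs w x) + dp v (grad w x) * dp z (grad w x)
     + (bil v z (hs f x) + dp v (grad f x) * dp z (grad f x))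
    = dp v z * ((lamE f w E p x + Euler w x + Euler f x) / r2 x) }.

(** t is the direction of a ray and a, b are tangent to the spheres along it; being constant, they
    are parallel along the ray. *)
Record frame (t a b : 'rV[R]_n) : Prop := Frame {
  fr_tt : lf t t = 1; fr_aa : lf a a = 1; fr_bb : lf b b = 1;
  fr_ta : lf t a = 0; fr_tb : lf t b = 0; fr_ab : lf a b = 0 }.

Lemma frame_swap t a b : frame t a b -> frame t b a.
Proof. by case=> h1 h2 h3 h4 h5 h6; split=> //; rewrite lfC. Qed.
End LogStaticDef.

(** * Commutation relations and integrability conditions on the spheres *)

Section LogStatic.
Context {R : realType} {n : nat} (U : set 'rV[R]_n) (f w E : 'rV[R]_n -> R) (p : R) (t a b : 'rV[R]_n).
Hypothesis H : log_static U f w E p.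
Hypothesis F : frame t a b.
Local Notation lam := (lamE f w E p).
Let oU := ls_open H. Let r2p := ls_r2 H. Let sf := ls_f H. Let sw := ls_w H. Let sE := ls_E H.
Let Ep := ls_Ep H. Let dE := ls_dE H. Let p0 := ls_p H. Let eM := ls_mix H. Let eT := ls_tan H.
Let tt := fr_tt F. Let aa := fr_aa F. Let bb := fr_bb F.
Let ta := fr_ta F. Let tb := fr_tb F. Let ab := fr_ab F.
Implicit Types (x : 'rV[R]_n) (g : 'rV[R]_n -> R).

Let at' : lf a t = 0. Proof. by rewrite lfC. Qed.
Let bt : lf b t = 0. Proof. by rewrite lfC. Qed.
Let ba : lf b a = 0. Proof. by rewrite lfC. Qed.
Let rn0 x : U x -> r2 x != 0. Proof. by move=> Ux; rewrite gt_eqF // r2p. Qed.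

Definition kap x : R := lf b x / r2 x.
(** [Aw] is the rotation in the plane of t and a, and [Bw] is the tangential part of the constant
    field b. They commute because b is orthogonal to that plane; at s t they equal s a and b. *)
Definition Aw x : 'rV[R]_n := lf t x *: a - lf a x *: t.
Definition Bw x : 'rV[R]_n := b - kap x *: x.
Definition Av g := vf Aw g.
Definition Bv g := vf Bw g.

Let sr2 : smooth_on U r2. Proof. exact: smooth_r2. Qed.
Let slf v : smooth_on U (lf v). Proof. exact: smooth_lf. Qed.
Let skap : smooth_on U kap. Proof. by rewrite /kap; smt. Qed.
Let sAw k : smooth_on U (fun x => Aw x ord0 k).
Proof.
apply: (smooth_eq oU (f := fun x => lf t x * a ord0 k + - (lf a x * t ord0 k))); last by smt.
by move=> x _; rewrite /Aw !mxE.
Qed.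
Let sBw k : smooth_on U (fun x => Bw x ord0 k).
Proof.
apply: (smooth_eq oU (f := fun x => b ord0 k + - (kap x * x ord0 k))); last by smt.
by move=> x _; rewrite /Bw !mxE.
Qed.
Let sid k : smooth_on U (fun x => x ord0 k). Proof. exact: smooth_coord. Qed.

Lemma sA g : smooth_on U g -> smooth_on U (Av g). Proof. exact: smooth_vf. Qed.
Lemma sB g : smooth_on U g -> smooth_on U (Bv g). Proof. exact: smooth_vf. Qed.
Lemma sD g : smooth_on U g -> smooth_on U (Euler g). Proof. by move=> sg; rewrite /Euler; smt. Qed.

Lemma isdA g x : smooth_on U g -> U x -> is_derive x (Aw x) g (Av g x). Proof. exact: isd_vf. Qed.
Lemma isdB g x : smooth_on U g -> U x -> is_derive x (Bw x) g (Bv g x). Proof. exact: isd_vf. Qed.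
Lemma A_isd g x d : smooth_on U g -> U x -> is_derive x (Aw x) g d -> Av g x = d.
Proof. exact: vf_isd. Qed.
Lemma B_isd g x d : smooth_on U g -> U x -> is_derive x (Bw x) g d -> Bv g x = d.
Proof. exact: vf_isd. Qed.

Lemma lf_Aw v x : lf v (Aw x) = lf t x * lf v a - lf a x * lf v t.
Proof. by rewrite /Aw lfD lfN !lfZ. Qed.
Lemma lf_Bw v x : lf v (Bw x) = lf v b - kap x * lf v x.
Proof. by rewrite /Bw lfD lfN lfZ. Qed.

Lemma Aw_tan x : lf x (Aw x) = 0.
Proof. by rewrite lf_Aw [lf x a]lfC [lf x t]lfC; ring. Qed.
Lemma Bw_tan x : U x -> lf x (Bw x) = 0.
Proof. by move=> Ux; rewrite lf_Bw lfC /kap -r2_lf divfK ?subrr // rn0. Qed.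

Lemma kap_A x : U x -> is_derive x (Aw x) kap 0.
Proof.
move=> Ux; have rx := rn0 Ux; have h1 := lf_isd b x (Aw x); have h2 := r2_isd_lf x (Aw x).
by rewrite /kap; isd; rewrite [lf (Aw x) x]lfC Aw_tan lf_Aw ba bt; ring.
Qed.
Lemma kap_B x : U x -> is_derive x (Bw x) kap ((1 - kap x * lf b x) / r2 x).
Proof.
move=> Ux; have rx := rn0 Ux; have h1 := lf_isd b x (Bw x); have h2 := r2_isd_lf x (Bw x).
by rewrite {1}/kap; isd; rewrite [lf (Bw x) x]lfC Bw_tan // lf_Bw bb; ring.
Qed.
Lemma kap_D x : U x -> is_derive x x kap (- kap x).
Proof.
move=> Ux; have rx := rn0 Ux; have h1 := lf_isd b x x; have h2 := r2_isd_lf x x.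
by rewrite {1}/kap; isd; rewrite /kap -r2_lf; field.
Qed.

Let dAw x d k : is_derive x d (fun y => Aw y ord0 k) (lf t d * a ord0 k - lf a d * t ord0 k).
Proof.
have h1 := lf_isd t x d; have h2 := lf_isd a x d.
rewrite (_ : (fun y => _) = (fun y => lf t y * a ord0 k + - (lf a y * t ord0 k))); first by isd; ring.
by apply/funext => y; rewrite /Aw !mxE.
Qed.
Let dBw x d k c : is_derive x d kap c -> is_derive x d (fun y => Bw y ord0 k) (- (c * x ord0 k) - kap x * d ord0 k).
Proof.
move=> h; rewrite (_ : (fun y => _) = (fun y => b ord0 k + - (kap y * y ord0 k))); first by isd; ring.
by apply/funext => y; rewrite /Bw !mxE.
Qed.

Lemma bilhC g x v z : smooth_on U g -> U x -> bil v z (hs g x) = bil z v (hs g x).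
Proof. by move=> sg Ux; rewrite bilC; apply: eq_bil => i j; rewrite /hs (pd_comm i j oU sg Ux). Qed.

Lemma EulerA g x : smooth_on U g -> U x -> Euler (Av g) x = bil (coo (Aw x)) (coo x) (hs g x) + Av g x.
Proof.
move=> sg Ux; rewrite -vf_Euler (vf_vf oU sg Ux sAw (fun k => dAw x x k)) bilhC //; congr (_ + _).
rewrite (@sum_vf _ _ g Aw x (1) _) ?mul1r // => k.
by rewrite /Aw !mxE; ring.
Qed.

Lemma AEuler g x : smooth_on U g -> U x -> Av (Euler g) x = Euler (Av g) x.
Proof.
move=> sg Ux; rewrite EulerA // /Av -(vf_eq_on oU _ (fun y _ => vf_Euler g y) Ux).
rewrite (vf_vf oU sg Ux sid (fun k => isd_coord x (Aw x) k)); congr (_ + _).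
Qed.

Lemma EulerB g x : smooth_on U g -> U x -> Euler (Bv g) x = bil (coo (Bw x)) (coo x) (hs g x).
Proof.
move=> sg Ux; rewrite -vf_Euler (vf_vf oU sg Ux sBw (fun k => dBw k (kap_D Ux))) bilhC //.
by rewrite big1 ?addr0 // => k _; rewrite /id; ring.
Qed.

Lemma BEuler g x : smooth_on U g -> U x -> Bv (Euler g) x = Euler (Bv g) x + Bv g x.
Proof.
move=> sg Ux; rewrite EulerB // /Bv -(vf_eq_on oU _ (fun y _ => vf_Euler g y) Ux).
rewrite (vf_vf oU sg Ux sid (fun k => isd_coord x (Bw x) k)); congr (_ + _).
Qed.

Lemma AB g x : smooth_on U g -> U x -> Av (Bv g) x = bil (coo (Aw x)) (coo (Bw x)) (hs g x) - kap x * Av g x.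
Proof.
move=> sg Ux; rewrite /Av /Bv (vf_vf oU sg Ux sBw (fun k => dBw k (kap_A Ux))); congr (_ + _).
by rewrite (@sum_vf _ _ g Aw x (- kap x) _) ?mulNr // => k; ring.
Qed.

Lemma BA g x : smooth_on U g -> U x -> Bv (Av g) x = Av (Bv g) x.
Proof.
move=> sg Ux; rewrite AB // /Av /Bv (vf_vf oU sg Ux sAw (fun k => dAw x (Bw x) k)) bilhC //; congr (_ + _).
rewrite (@sum_vf _ _ g Aw x (- kap x) _) ?mulNr // => k.
by rewrite !lf_Bw tb ab /Aw !mxE; ring.
Qed.

Lemma BB' g x : smooth_on U g -> U x -> Bv (Bv g) x =
  bil (coo (Bw x)) (coo (Bw x)) (hs g x) - (1 - kap x * lf b x) / r2 x * Euler g x - kap x * Bv g x.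
Proof.
move=> sg Ux; rewrite /Bv (vf_vf oU sg Ux sBw (fun k => dBw k (kap_B Ux))) -addrA; congr (_ + _).
rewrite /Euler /vf !mulr_sumr -!sumrN -big_split /=; apply: eq_bigr => k _; ring.
Qed.

Lemma AA' g x : smooth_on U g -> U x -> lf b x = 0 -> x = lf t x *: t + lf a x *: a ->
  Av (Av g) x = bil (coo (Aw x)) (coo (Aw x)) (hs g x) - Euler g x.
Proof.
move=> sg Ux _ xE; rewrite /Av (vf_vf oU sg Ux sAw (fun k => dAw x (Aw x) k)); congr (_ + _).
rewrite -vf_Euler -mulN1r; apply: (@sum_vf _ _ g id x (-1) _) => k.
have xk : x ord0 k = lf t x * t ord0 k + lf a x * a ord0 k by rewrite {1}xE !mxE.
rewrite !lf_Aw tt aa ta at' /id; lra.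
Qed.

Lemma dp_grad_vf g x (W : 'rV[R]_n -> 'rV[R]_n) : dp (coo (W x)) (grad g x) = vf W g x.
Proof. by []. Qed.
Let tanA x : dp (coo (Aw x)) (coo x) = 0.
Proof. by rewrite -[RHS](Aw_tan x). Qed.
Let tanB x : U x -> dp (coo (Bw x)) (coo x) = 0.
Proof. by move=> Ux; rewrite -[RHS](Bw_tan Ux). Qed.

Lemma eMA x : U x -> Euler (Av w) x =
  (1 - Euler w x) * Av w x + (Euler w x + p - 1) * Av f x.
Proof. by move=> Ux; rewrite EulerA // eM // !dp_grad_vf -!/(Av _); ring. Qed.

Lemma eMB x : U x -> Euler (Bv w) x = (Euler w x + p - 1) * Bv f x - Euler w x * Bv w x.
Proof. by move=> Ux; rewrite EulerB // eM ?tanB // !dp_grad_vf -!/(Bv _); ring. Qed.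

Lemma eTAB x : U x -> Av (Bv w) x + kap x * Av w x + Av w x * Bv w x
  + (Av (Bv f) x + kap x * Av f x + Av f x * Bv f x) = 0.
Proof.
move=> Ux; rewrite !AB // !subrK; have := eT Ux (tanA x) (tanB Ux); rewrite !dp_grad_vf -!/(Av _) -!/(Bv _) => ->.
rewrite (_ : dp _ _ = lf (Bw x) (Aw x)) // lfC lf_Bw [lf (Aw x) b]lfC [lf (Aw x) x]lfC Aw_tan lf_Aw ba bt.
by ring.
Qed.

(** The squared length of [Bw]. *)
Definition sig x : R := 1 - kap x * lf b x.

Lemma eTBB x : U x -> Bv (Bv w) x + kap x * Bv w x + Bv w x ^+ 2
  + (Bv (Bv f) x + kap x * Bv f x + Bv f x ^+ 2) = sig x * lam x * (r2 x)^-1.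
Proof.
move=> Ux; have rx := rn0 Ux.
have := eT Ux (tanB Ux) (tanB Ux); rewrite !BB' // !dp_grad_vf -!/(Bv _) -/(sig x).
have -> : dp (coo (Bw x)) (coo (Bw x)) = sig x.
  by transitivity (lf (Bw x) (Bw x)); rewrite // lf_Bw [lf (Bw x) b]lfC lf_Bw bb [lf (Bw x) x]lfC Bw_tan // mulr0 subr0.
move: (bil _ _ (hs w x)) (bil _ _ (hs f x)) => h1 h2 h.
transitivity (h1 + Bv w x * Bv w x + (h2 + Bv f x * Bv f x) - sig x * (Euler w x + Euler f x) / r2 x); first by field.
by rewrite h; field.
Qed.

Lemma eTAA x : U x -> lf b x = 0 -> x = lf t x *: t + lf a x *: a ->
  Av (Av w) x + Av w x ^+ 2 + (Av (Av f) x + Av f x ^+ 2) = lam x.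
Proof.
move=> Ux bx xE; have rx := rn0 Ux.
have := eT Ux (tanA x) (tanA x); rewrite !AA' // !dp_grad_vf -!/(Av _).
have -> : dp (coo (Aw x)) (coo (Aw x)) = r2 x.
  transitivity (lf (Aw x) (Aw x)); first by [].
  rewrite lf_Aw ![lf (Aw x) _]lfC !lf_Aw aa at' ta tt r2_lf.
  transitivity (lf x (lf t x *: t + lf a x *: a)); last by rewrite -xE.
  by rewrite lfD !lfZ ![lf x _]lfC; ring.
move: (bil _ _ (hs w x)) (bil _ _ (hs f x)) => h1 h2 h.
transitivity (h1 + Av w x * Av w x + (h2 + Av f x * Av f x) - (Euler w x + Euler f x)); first by ring.
by rewrite h; field.
Qed.

Lemma vfE x W : U x -> vf W E x = - 2 * E x * vf W f x.
Proof. by move=> Ux; rewrite /vf mulr_sumr; apply: eq_bigr => k _; rewrite dE //; ring. Qed.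

Lemma slam : smooth_on U lam.
Proof. have h1 := sD sf; have h2 := sD sw; rewrite /lamE; smt. Qed.

Lemma A_lam x : U x -> Av lam x = E x * (Euler (Av f) x - Euler (Av w) x)
  - 2 * E x * Av f x * (Euler f x - Euler w x - (p - 1)).
Proof.
move=> Ux; have h1 := isdA (sD sf) Ux; have h2 := isdA (sD sw) Ux; have h3 := isdA sE Ux.
rewrite !AEuler // in h1 h2; rewrite /Av vfE // -/(Av f) in h3.
by apply: (A_isd slam Ux); rewrite /lamE; isd; ring.
Qed.

Lemma sig_A x : U x -> is_derive x (Aw x) sig 0.
Proof.
move=> Ux; have h1 := kap_A Ux; have h2 := lf_isd b x (Aw x).
by rewrite /sig; isd; rewrite lf_Aw ba bt; ring.
Qed.

(* The curl of the mixed equation on the spheres. *)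
Lemma eJ x : U x -> Av f x * Bv w x = Bv f x * Av w x.
Proof.
move=> Ux.
have h1 := isdB (sA sw) Ux; have h2 := isdB (sA sf) Ux; have h3 := isdB (sD sw) Ux.
have k1 := isdA (sB sw) Ux; have k2 := isdA (sB sf) Ux; have k3 := isdA (sD sw) Ux.
rewrite !BA // in h1 h2; rewrite BEuler // eMB // in h3; rewrite AEuler // eMA // in k3.
have sY : smooth_on U (fun x => (1 - Euler w x) * Av w x + (Euler w x + p - 1) * Av f x).
  by have := sD sw; have := sA sw; have := sA sf => *; smt.
have sZ : smooth_on U (fun x => (Euler w x + p - 1) * Bv f x - Euler w x * Bv w x).
  by have := sD sw; have := sB sw; have := sB sf => *; smt.
have sa := sA sw; have sb := sB sw.
have e1 : Euler (Av (Bv w)) x + Av (Bv w) x = Bv (fun x => (1 - Euler w x) * Av w x + (Euler w x + p - 1) * Av f x) x.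
  rewrite -(Euler_eq_on oU (fun y Uy => BA sw Uy) Ux) -BA // -BEuler //.
  exact: (vf_eq_on oU Bw eMA Ux).
have e2 : Euler (Av (Bv w)) x = Av (fun x => (Euler w x + p - 1) * Bv f x - Euler w x * Bv w x) x.
  by rewrite -AEuler //; exact: (vf_eq_on oU Aw eMB Ux).
move: e1; rewrite e2.
have -> : Av (fun x => (Euler w x + p - 1) * Bv f x - Euler w x * Bv w x) x =
  Bv f x * ((1 - Euler w x) * Av w x + (Euler w x + p - 1) * Av f x) + (Euler w x + p - 1) * Av (Bv f) x
   - Bv w x * ((1 - Euler w x) * Av w x + (Euler w x + p - 1) * Av f x) - Euler w x * Av (Bv w) x.
  by notypeclasses refine (A_isd sZ Ux _); isd; ring.
have -> : Bv (fun x => (1 - Euler w x) * Av w x + (Euler w x + p - 1) * Av f x) x =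
  (Av f x - Av w x) * ((Euler w x + p - 1) * Bv f x - Euler w x * Bv w x + Bv w x)
   + (1 - Euler w x) * Av (Bv w) x + (Euler w x + p - 1) * Av (Bv f) x.
  by notypeclasses refine (B_isd sY Ux _); isd; ring.
move=> h; apply: (mulfI p0); apply/eqP; rewrite -subr_eq0; apply/eqP.
by move/eqP: h; rewrite -subr_eq0 => /eqP h; rewrite -[RHS]oppr0 -h; ring.
Qed.

Lemma eAJ x : U x -> Av (Av f) x * Bv w x + Av f x * Av (Bv w) x =
  Av (Bv f) x * Av w x + Bv f x * Av (Av w) x.
Proof.
move=> Ux; have h1 := isdA (sA sw) Ux; have h2 := isdA (sA sf) Ux.
have h3 := isdA (sB sw) Ux; have h4 := isdA (sB sf) Ux.
have := sA sw; have := sA sf; have := sB sw; have := sB sf => s1 s2 s3 s4.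
transitivity (Av (fun x => Av f x * Bv w x) x).
  by apply/esym; notypeclasses refine (A_isd _ Ux _); [smt|isd; ring].
transitivity (Av (fun x => Bv f x * Av w x) x); first exact: (vf_eq_on oU Aw eJ Ux).
by notypeclasses refine (A_isd _ Ux _); [smt|isd; ring].
Qed.

Lemma eBJ x : U x -> Av (Bv f) x * Bv w x + Av f x * Bv (Bv w) x =
  Bv (Bv f) x * Av w x + Bv f x * Av (Bv w) x.
Proof.
move=> Ux; have h1 := isdB (sA sw) Ux; have h2 := isdB (sA sf) Ux.
have h3 := isdB (sB sw) Ux; have h4 := isdB (sB sf) Ux.
have := sA sw; have := sA sf; have := sB sw; have := sB sf => s1 s2 s3 s4.
rewrite !BA // in h1 h2.
transitivity (Bv (fun x => Av f x * Bv w x) x).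
  by apply/esym; notypeclasses refine (B_isd _ Ux _); [smt|isd; ring].
transitivity (Bv (fun x => Bv f x * Av w x) x); first exact: (vf_eq_on oU Bw eJ Ux).
by notypeclasses refine (B_isd _ Ux _); [smt|isd; ring].
Qed.

Lemma eABJ x : U x -> Bv w x = 0 -> Bv f x = 0 ->
  Av (Av f) x * Bv (Bv w) x + Av f x * Av (Bv (Bv w)) x =
  Av (Bv (Bv f)) x * Av w x + Bv (Bv f) x * Av (Av w) x.
Proof.
move=> Ux w0 f0.
have := sA sw; have := sA sf; have := sB sw; have := sB sf => s1 s2 s3 s4.
have := sA s1; have := sA s2; have := sB s1; have := sB s2 => s5 s6 s7 s8.
have h1 := isdA s7 Ux; have h2 := isdA s8 Ux; have h3 := isdA s2 Ux; have h4 := isdA s1 Ux.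
have h5 := isdA s3 Ux; have h6 := isdA s4 Ux.
have h7 := isdA s6 Ux; have h8 := isdA s5 Ux.
have HH : Av (fun x => Av (Bv f) x * Bv w x + Av f x * Bv (Bv w) x) x =
   Av (fun x => Bv (Bv f) x * Av w x + Bv f x * Av (Bv w) x) x.
  exact: (vf_eq_on oU Aw eBJ Ux).
move: HH.
have -> : Av (fun x => Av (Bv f) x * Bv w x + Av f x * Bv (Bv w) x) x =
   Av (Bv f) x * Av (Bv w) x + (Av (Av f) x * Bv (Bv w) x + Av f x * Av (Bv (Bv w)) x).
  by notypeclasses refine (A_isd _ Ux _); [smt|isd; rewrite w0; ring].
have -> : Av (fun x => Bv (Bv f) x * Av w x + Bv f x * Av (Bv w) x) x =
   Av (Bv f) x * Av (Bv w) x + (Av (Bv (Bv f)) x * Av w x + Bv (Bv f) x * Av (Av w) x).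
  by notypeclasses refine (A_isd _ Ux _); [smt|isd; rewrite f0; ring].
by move/addrI.
Qed.

Lemma eBTAB x : U x -> Av (Bv (Bv w)) x + sig x / r2 x * Av w x + kap x * Av (Bv w) x
    + Av (Bv w) x * Bv w x + Av w x * Bv (Bv w) x
  + (Av (Bv (Bv f)) x + sig x / r2 x * Av f x + kap x * Av (Bv f) x
    + Av (Bv f) x * Bv f x + Av f x * Bv (Bv f) x) = 0.
Proof.
move=> Ux; have s1 := sA sw; have s2 := sA sf; have s3 := sB sw; have s4 := sB sf.
have s5 := sA s3; have s6 := sA s4.
have h1 := isdB s3 Ux; have h2 := isdB s4 Ux; have h7 := kap_B Ux; rewrite -/(sig x) in h7.
have k1 := isdB s1 Ux; have k2 := isdB s2 Ux; have k3 := isdB s5 Ux; have k4 := isdB s6 Ux.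
rewrite !BA // in k1 k2 k3 k4.
have sz : smooth_on U (fun x => 0 : R) by smt.
have := vf_eq_on oU Bw eTAB Ux; rewrite -!/(Bv _) (B_isd sz Ux (isd_cst _ _ _)) => <-; apply/esym.
by notypeclasses refine (B_isd _ Ux _); [smt|isd; ring].
Qed.

Lemma eATBB x : U x -> Av (Bv (Bv w)) x + kap x * Av (Bv w) x + 2 * Bv w x * Av (Bv w) x
  + (Av (Bv (Bv f)) x + kap x * Av (Bv f) x + 2 * Bv f x * Av (Bv f) x) = sig x * Av lam x / r2 x.
Proof.
move=> Ux; have s1 := sA sw; have s2 := sA sf; have s3 := sB sw; have s4 := sB sf.
have s5 := sB s3; have s6 := sB s4.
have h1 := isdA s3 Ux; have h2 := isdA s4 Ux; have h3 := isdA s5 Ux; have h4 := isdA s6 Ux.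
have h5 := isdA slam Ux; have h6 := kap_A Ux; have h7 := sig_A Ux.
have h8 := r2_isd_lf x (Aw x); rewrite lfC Aw_tan mulr0 in h8; have rx := rn0 Ux.
have ssig : smooth_on U sig by rewrite /sig; smt.
have slm := slam.
transitivity (Av (fun x => Bv (Bv w) x + kap x * Bv w x + Bv w x ^+ 2
    + (Bv (Bv f) x + kap x * Bv f x + Bv f x ^+ 2)) x).
  by apply/esym; notypeclasses refine (A_isd _ Ux _); [smt|isd; ring].
rewrite /Av (vf_eq_on oU Aw eTBB Ux) -!/(Av _).
by notypeclasses refine (A_isd _ Ux _); [smt|isd; ring].
Qed.

(** A Codazzi type condition: the A-derivative of [eTBB] and the B-derivative of [eTAB] contain the
    same third derivatives, because A and B commute, so these cancel and only the derivative of
    [lamE] remains. *)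
Lemma eP4 x : U x -> sig x * Av lam x = - sig x * (Av f x + Av w x)
  + r2 x * (Bv w x * Av (Bv w) x + Bv f x * Av (Bv f) x - Av w x * Bv (Bv w) x - Av f x * Bv (Bv f) x).
Proof.
move=> Ux; have rx := rn0 Ux; have h1 := eATBB Ux; have h2 := eBTAB Ux.
rewrite [sig x * Av lam x / _]mulrAC in h1; move: h1 h2; set q := sig x / r2 x => h1 h2.
have -> : sig x = q * r2 x by rewrite divfK.
have := congr1 (fun z => r2 x * z) h1; have := congr1 (fun z => r2 x * z) h2; lra.
Qed.

Lemma eAP4 x : U x -> lf b x = 0 -> Bv w x = 0 -> Bv f x = 0 ->
  Av (Av lam) x = - (Av (Av f) x + Av (Av w) x) + r2 x * (Av (Bv w) x ^+ 2 + Av (Bv f) x ^+ 2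
   - Av (Av w) x * Bv (Bv w) x - Av w x * Av (Bv (Bv w)) x
   - Av (Av f) x * Bv (Bv f) x - Av f x * Av (Bv (Bv f)) x).
Proof.
move=> Ux bx w0 f0; have s1 := sA sw; have s2 := sA sf; have s3 := sB sw; have s4 := sB sf.
have s5 := sB s3; have s6 := sB s4; have s7 := sA s3; have s8 := sA s4.
have h1 := isdA s1 Ux; have h2 := isdA s2 Ux; have h3 := isdA s3 Ux; have h4 := isdA s4 Ux.
have h5 := isdA s5 Ux; have h6 := isdA s6 Ux; have h7 := isdA s7 Ux; have h8 := isdA s8 Ux.
have h9 := isdA (sA slam) Ux; have h10 := sig_A Ux.
have h11 := r2_isd_lf x (Aw x); rewrite lfC Aw_tan mulr0 in h11.
have ssig : smooth_on U sig by rewrite /sig; smt.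
have slm := sA slam.
have s1' : sig x = 1 by rewrite /sig bx mulr0 subr0.
transitivity (Av (fun x => sig x * Av lam x) x).
  by apply/esym; notypeclasses refine (A_isd _ Ux _); [smt|isd; rewrite s1'; ring].
rewrite /Av (vf_eq_on oU Aw eP4 Ux) -!/(Av _).
by notypeclasses refine (A_isd _ Ux _); [smt|isd; rewrite s1' w0 f0; ring].
Qed.

Lemma AA_lam x : U x -> Av (Av lam) x = E x * (Euler (Av (Av f)) x - Euler (Av (Av w)) x)
  - 4 * E x * Av f x * (Euler (Av f) x - Euler (Av w) x)
  + (4 * E x * Av f x ^+ 2 - 2 * E x * Av (Av f) x) * (Euler f x - Euler w x - (p - 1)).
Proof.
move=> Ux; have s1 := sA sw; have s2 := sA sf; have s3 := sD sf; have s4 := sD sw.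
have s5 := sD s1; have s6 := sD s2.
have h1 := isdA s5 Ux; have h2 := isdA s6 Ux; have h3 := isdA s2 Ux.
have h4 := isdA s3 Ux; have h5 := isdA s4 Ux; have h6 := isdA sE Ux.
rewrite !AEuler // in h1 h2 h4 h5; rewrite /Av vfE // -/(Av f) in h6.
rewrite {1}/Av (vf_eq_on oU Aw A_lam Ux) -!/(Av _).
by notypeclasses refine (A_isd _ Ux _); [smt|isd; ring].
Qed.

Lemma DBB x : U x -> Bv w x = 0 -> Bv f x = 0 ->
  Euler (Bv (Bv w)) x = (Euler w x + p - 1) * Bv (Bv f) x - (1 + Euler w x) * Bv (Bv w) x.
Proof.
move=> Ux w0 f0; have s1 := sB sw; have s2 := sB sf; have s3 := sD sw.
have h1 := isdB s1 Ux; have h2 := isdB s2 Ux; have h3 := isdB s3 Ux.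
have h4 := BEuler s1 Ux; have := vf_eq_on oU Bw eMB Ux; rewrite -!/(Bv _) h4 => h.
rewrite BEuler // in h3.
apply: (addIr (Bv (Bv w) x)); rewrite h.
by notypeclasses refine (B_isd _ Ux _); [smt|isd; rewrite w0 f0; ring].
Qed.

Lemma DAA x : U x -> Euler (Av (Av w)) x = (1 - Euler w x) * Av (Av w) x
   + (Euler w x + p - 1) * Av (Av f) x + Euler (Av w) x * (Av f x - Av w x).
Proof.
move=> Ux; have s1 := sA sw; have s2 := sA sf; have s3 := sD sw.
have h1 := isdA s1 Ux; have h2 := isdA s2 Ux; have h3 := isdA s3 Ux.
rewrite AEuler // in h3; rewrite -AEuler // {1}/Av (vf_eq_on oU Aw eMA Ux) -!/(Av _).
by notypeclasses refine (A_isd _ Ux _); [smt|isd; ring].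
Qed.
End LogStatic.

(** * Gronwall's lemma for four functions *)

Section Gronwall4.
Context {R : realType}.

Lemma sqr_sum4 (x y z t : R) : (x + y + z + t) ^+ 2 <= 4 * (x ^+ 2 + y ^+ 2 + (z ^+ 2 + t ^+ 2)).
Proof.
rewrite -subr_ge0 (_ : _ - _ = (x - y) ^+ 2 + (x - z) ^+ 2 + (x - t) ^+ 2 + ((y - z) ^+ 2 + (y - t) ^+ 2 + (z - t) ^+ 2)); last by ring.
by rewrite !addr_ge0 // sqr_ge0.
Qed.

Lemma gronwall4 (X Y P Q dX dY dP dQ : R -> R) (al be K c : R) :
  (forall s, al <= s <= be -> is_derive s (1 : R) X (dX s)) ->
  (forall s, al <= s <= be -> is_derive s (1 : R) Y (dY s)) ->
  (forall s, al <= s <= be -> is_derive s (1 : R) P (dP s)) ->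
  (forall s, al <= s <= be -> is_derive s (1 : R) Q (dQ s)) ->
  (forall s, al <= s <= be -> let m := `|X s| + `|Y s| + `|P s| + `|Q s| in
     [/\ `|dX s| <= K * m, `|dY s| <= K * m, `|dP s| <= K * m & `|dQ s| <= K * m]) ->
  0 <= K -> al <= c <= be -> X c ^+ 2 + Y c ^+ 2 + (P c ^+ 2 + Q c ^+ 2) = 0 ->
  forall s, al <= s <= be -> X s ^+ 2 + Y s ^+ 2 + (P s ^+ 2 + Q s ^+ 2) = 0.
Proof.
move=> hX hY hP hQ hK K0 hc N0.
apply: (gronwall (df := fun s => 2 * (X s * dX s + Y s * dY s + (P s * dP s + Q s * dQ s))) (K := 8 * K)) hc N0.
- by move=> s hs; have h1 := hX s hs; have h2 := hY s hs; have h3 := hP s hs; have h4 := hQ s hs; isd; ring.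
- by move=> s _; rewrite !addr_ge0 // sqr_ge0.
move=> s hs; have [k1 k2 k3 k4] := hK s hs.
set m := _ + `|Q s| in k1 k2 k3 k4.
have b (u du : R) : `|du| <= K * m -> `|u * du| <= `|u| * (K * m) by move=> h; rewrite normrM ler_wpM2l.
have c1 := b (X s) _ k1; have c2 := b (Y s) _ k2; have c3 := b (P s) _ k3; have c4 := b (Q s) _ k4.
rewrite normrM ger0_norm //.
have : `|X s * dX s + Y s * dY s + (P s * dP s + Q s * dQ s)| <= m * (K * m).
  apply: le_trans (ler_normD _ _) _; apply: le_trans (lerD (ler_normD _ _) (ler_normD _ _)) _.
  apply: le_trans (lerD (lerD c1 c2) (lerD c3 c4)) _.
  by rewrite -!mulrDl /m !addrA.
have mm : m ^+ 2 <= 4 * (X s ^+ 2 + Y s ^+ 2 + (P s ^+ 2 + Q s ^+ 2)).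
  have n2 (u : R) : u ^+ 2 = `|u| ^+ 2 by rewrite real_normK // num_real.
  by rewrite (n2 (X s)) (n2 (Y s)) (n2 (P s)) (n2 (Q s)); exact: sqr_sum4.
move=> h1; have h2 := ler_wpM2l K0 mm.
rewrite (_ : 8 * K * _ = 2 * (K * (4 * (X s ^+ 2 + Y s ^+ 2 + (P s ^+ 2 + Q s ^+ 2))))); last by ring.
by rewrite ler_pM2l //; apply: le_trans h1 (le_trans _ h2); rewrite expr2 mulrCA.
Qed.
End Gronwall4.

(** * The equations restricted to a ray *)

Section Ray.
Context {R : realType} {n : nat} (U : set 'rV[R]_n) (f w E : 'rV[R]_n -> R) (p : R) (t a b : 'rV[R]_n).
Hypothesis H : log_static U f w E p.
Hypothesis F : frame t a b.
Context (ra : R).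
Hypothesis ra0 : 0 < ra.
Hypothesis UE : forall x, U x <-> ra ^+ 2 < r2 x.
Let sf := ls_f H. Let sw := ls_w H. Let sE := ls_E H. Let oU := ls_open H.
Let sr2 : smooth_on U r2. Proof. exact: smooth_r2. Qed.

Section RayPoint.
Context (s : R).
Hypothesis rs : ra < s.
Let x := s *: t.
Let sp : 0 < s. Proof. exact: lt_trans rs. Qed.

Lemma r2_ray : r2 (s *: t) = s ^+ 2.
Proof. by rewrite r2Z r2_lf (fr_tt F) mulr1. Qed.
Lemma U_ray : U (s *: t).
Proof. by apply/UE; rewrite r2_ray ltr_pXn2r ?nnegrE ?ltW. Qed.
Let Ux : U x := U_ray.
Lemma lft_ray : lf t x = s. Proof. by rewrite /x lfZ (fr_tt F) mulr1. Qed.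
Lemma lfa_ray : lf a x = 0. Proof. by rewrite /x lfZ lfC (fr_ta F) mulr0. Qed.
Lemma lfb_ray : lf b x = 0. Proof. by rewrite /x lfZ lfC (fr_tb F) mulr0. Qed.
Lemma kap_ray : kap b x = 0. Proof. by rewrite /kap lfb_ray mul0r. Qed.
Lemma sig_ray : sig b x = 1. Proof. by rewrite /sig lfb_ray mulr0 subr0. Qed.
Lemma plane_ray : x = lf t x *: t + lf a x *: a.
Proof. by rewrite lft_ray lfa_ray scale0r addr0. Qed.

(** Connects the two roles of b: on the ray the rotation towards b is s times the tangential part of
    b. Hence the frame with a and b exchanged gives information on the same derivatives. *)
Lemma swap_ray g : Av t b g x = s * Bv b g x.
Proof.
rewrite /Av /Bv /vf mulr_sumr; apply: eq_bigr => k _.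
by rewrite /Aw /Bw kap_ray lft_ray lfb_ray !scale0r !subr0 mxE mulrA.
Qed.

Lemma ray_der g : smooth_on U g -> is_derive s (1 : R) (fun s => g (s *: t)) (s^-1 * Euler g x).
Proof.
move=> sg; apply: isd_eq (ray_isd sg Ux) _.
by rewrite /Euler mulr_sumr; apply: eq_bigr => k _; rewrite /x mxE; field; rewrite gt_eqF.
Qed.

Lemma ray_der2 g : smooth_on U g -> exists d, is_derive s (1 : R) (fun s => s^-1 * Euler g (s *: t)) d.
Proof.
move=> sg; have h := ray_der (sD H sg); have s0 := lt0r_neq0 sp.
by eexists; notypeclasses refine (isdM _ _); [notypeclasses refine (isdV s0 (is_derive_id _ _))|exact: h].
Qed.

Let e1 : lamE f w E p x = E x * (Euler f x - Euler w x) + (p - 1) * (1 - E x). Proof. by []. Qed.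

(** [eP4] solved for the radial derivative of A f: linear in the four first derivatives towards a
    and b, with coefficients continuous along the ray, which is the form Gronwall's lemma needs. *)
Lemma DX_ray : Euler (Av t a f) x =
   ((Euler w x + p - 1) + 2 * (Euler f x - Euler w x - (p - 1)) - (E x)^-1 * (1 + r2 x * Bv b (Bv b f) x)) * Av t a f x
  + ((1 - Euler w x) - (E x)^-1 * (1 + r2 x * Bv b (Bv b w) x)) * Av t a w x
  + ((E x)^-1 * lf t x * Av t a (Bv b f) x) * Av t b f x
  + ((E x)^-1 * lf t x * Av t a (Bv b w) x) * Av t b w x.
Proof.
have := eP4 H F Ux; rewrite sig_ray mul1r (A_lam t a H Ux) (eMA t a H Ux) !swap_ray lft_ray /x r2_ray => h.
have E0 : E (s *: t) != 0 by rewrite gt_eqF // (ls_Ep H).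
apply: (mulfI E0); apply/eqP; rewrite -subr_eq0; apply/eqP.
rewrite -[RHS](subrr (- 1 * (Av t a f (s *: t) + Av t a w (s *: t)) + s ^+ 2 *
  (Bv b w (s *: t) * Av t a (Bv b w) (s *: t) + Bv b f (s *: t) * Av t a (Bv b f) (s *: t) -
   Av t a w (s *: t) * Bv b (Bv b w) (s *: t) - Av t a f (s *: t) * Bv b (Bv b f) (s *: t)))) -{1}h.
by field.
Qed.

Lemma J_ray : Av t a f x * Av t b w x = Av t b f x * Av t a w x.
Proof. by rewrite !swap_ray mulrCA (eJ H F Ux); ring. Qed.

Hypothesis f2 : Av t b f x = 0.
Hypothesis w2 : Av t b w x = 0.
Let Bf0 : Bv b f x = 0.
Proof. by move: f2; rewrite swap_ray => /eqP; rewrite mulf_eq0 gt_eqF //= => /eqP. Qed.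
Let Bw0 : Bv b w x = 0.
Proof. by move: w2; rewrite swap_ray => /eqP; rewrite mulf_eq0 gt_eqF //= => /eqP. Qed.

Lemma BJ_ray : Av t a f x * Bv b (Bv b w) x = Bv b (Bv b f) x * Av t a w x.
Proof. by have := eBJ H F Ux; rewrite Bf0 Bw0 mulr0 mul0r add0r addr0. Qed.

Lemma DBB_ray : Euler (fun x => r2 x * Bv b (Bv b w) x) x =
  (1 - Euler w x) * (r2 x * Bv b (Bv b w) x) + (Euler w x + p - 1) * (r2 x * Bv b (Bv b f) x).
Proof.
have s1 := sB b H (sB b H sw); have h1 := isd_Euler s1 Ux; have h2 := r2_isd_Euler x.
rewrite (DBB H Ux Bw0 Bf0) in h1.
by notypeclasses refine (Euler_isd _ Ux _); [smt|isd; ring].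
Qed.

Context (c : R).
Hypothesis cf : r2 x * Bv b (Bv b f) x = c * Av t a f x.
Hypothesis cw : r2 x * Bv b (Bv b w) x = c * Av t a w x.

Lemma lam_ray : lamE f w E p x = c * (Av t a f x + Av t a w x).
Proof.
have := eTBB H F Ux; rewrite Bf0 Bw0 kap_ray sig_ray !mul0r expr0n /= !addr0 mul1r => h.
by rewrite mulrDr -cf -cw -mulrDr [X in _ * X]addrC h mulrC divfK // gt_eqF // (ls_r2 H).
Qed.

Let E0 : E x != 0. Proof. by rewrite gt_eqF // (ls_Ep H). Qed.

Lemma hX_ray : Euler (Av t a f) x = dX p c (Euler w x) (E x)^-1 (Av t a f x) (Av t a w x).
Proof.
apply: (O1_alg (E := E x) (tau := Euler f x) (DY := Euler (Av t a w) x)) => //; first by rewrite -lam_ray.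
  by rewrite (eMA t a H Ux) /dY.
have := eP4 H F Ux; rewrite sig_ray mul1r (A_lam t a H Ux) Bf0 Bw0 !mul0r addr0 sub0r -cf -cw => h.
by rewrite h; ring.
Qed.

Lemma TAA_ray : Av t a (Av t a w) x + Av t a w x ^+ 2 + (Av t a (Av t a f) x + Av t a f x ^+ 2) =
  c * (Av t a f x + Av t a w x).
Proof. by rewrite (eTAA H F Ux lfb_ray plane_ray) lam_ray. Qed.

Hypothesis S0 : Av t a f x + Av t a w x != 0.

Lemma hO_ray : Euler (Av t a (Av t a w)) x + 2 * Av t a w x * Euler (Av t a w) x
   + (Euler (Av t a (Av t a f)) x + 2 * Av t a f x * Euler (Av t a f) x)
   = c * (Euler (Av t a f) x + Euler (Av t a w) x) ->
  (Av t a (Av t a w) x - c * Av t a w x + Av t a w x ^+ 2) * kO p c (Euler w x) (E x)^-1 (Av t a w x)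
   + qO p c (Euler w x) (E x)^-1 (Av t a f x) (Av t a w x) = 0.
Proof.
move=> hD.
(* The tangential equation in the directions a, b and the differentiated curl relation form a
   homogeneous system for the two mixed derivatives, with determinant X + Y up to sign. *)
have ABs : Av t a (Bv b w) x + Av t a (Bv b f) x = 0.
  by have := eTAB H F Ux; rewrite kap_ray Bf0 Bw0 !(mul0r, mulr0, addr0).
have ABj : Av t a f x * Av t a (Bv b w) x = Av t a (Bv b f) x * Av t a w x.
  by have := eAJ H F Ux; rewrite Bf0 Bw0 mulr0 mul0r add0r addr0.
have ABw : Av t a (Bv b w) x = 0.
  apply: (mulfI S0); rewrite mulr0 mulrDl ABj (_ : _ + _ = Av t a w x * (Av t a (Bv b w) x + Av t a (Bv b f) x)); last by ring.
  by rewrite ABs mulr0.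
have ABf : Av t a (Bv b f) x = 0 by move: ABs; rewrite ABw add0r.
apply: (O4_alg (E := E x) (tau := Euler f x) (DY := Euler (Av t a w) x) (DX := Euler (Av t a f) x)
  (z1 := Av t a (Av t a f) x) (Dz1 := Euler (Av t a (Av t a f)) x) (Dz2 := Euler (Av t a (Av t a w)) x)
  (mf := r2 x * Av t a (Bv b (Bv b f)) x) (mw := r2 x * Av t a (Bv b (Bv b w)) x)
  (AAl := Av t a (Av t a (lamE f w E p)) x)) => //.
- by rewrite -lam_ray.
- by rewrite (eMA t a H Ux) /dY.
- exact: hX_ray.
- exact: TAA_ray.
- by rewrite (DAA t a H Ux).
- have := eBTAB H F Ux; rewrite kap_ray sig_ray ABw ABf !(mul0r, mulr0, addr0) -cf -cw => h.
  have rn : r2 x != 0 by rewrite gt_eqF // (ls_r2 H).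
  have h' := congr1 (fun z => r2 x * z) h; rewrite mulr0 in h'.
  by apply/eqP; rewrite -subr_eq0; apply/eqP; rewrite -[RHS]h'; field.
- have := eABJ H F Ux Bw0 Bf0; rewrite -cf -cw => h.
  have := congr1 (fun z => r2 x * z) h; rewrite !mulrDr => h'.
  by rewrite [_ * (r2 x * _)]mulrCA [Av t a f x * _]mulrCA h'; ring.
- by rewrite (eAP4 H F Ux lfb_ray Bw0 Bf0) ABw ABf -cf -cw; ring.
- by rewrite (AA_lam t a H Ux).
Qed.
End RayPoint.
End Ray.

(** * Bounds along a compact piece of a ray *)

Section RayBound.
Context {R : realType} {n : nat} (U : set 'rV[R]_n) (f w E : 'rV[R]_n -> R) (p : R) (t a b : 'rV[R]_n).
Hypothesis H : log_static U f w E p.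
Hypothesis F : frame t a b.
Context (ra : R).
Hypothesis ra0 : 0 < ra.
Hypothesis UE : forall x, U x <-> ra ^+ 2 < r2 x.
Let sf := ls_f H. Let sw := ls_w H. Let sE := ls_E H. Let oU := ls_open H.
Let sr2 : smooth_on U r2. Proof. exact: smooth_r2. Qed.

Lemma ray_bounded g al be : ra < al -> smooth_on U g ->
  exists2 M, 0 <= M & forall s, al <= s <= be -> `|g (s *: t)| <= M.
Proof.
move=> ral sg; have [K hK] := @continuous_bounded R (fun s => g (s *: t)) al be (fun s hs =>
  isd_continuous (ray_der F ra0 UE (lt_le_trans ral (proj1 (andP hs))) sg)).
by exists `|K| => // s hs; apply: le_trans (hK s hs) (ler_norm _).
Qed.

Lemma lin4_bound (i j k1 k2 k3 k4 M x y z v : R) : 0 <= i <= j -> 0 <= M ->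
  `|k1| <= M -> `|k2| <= M -> `|k3| <= M -> `|k4| <= M ->
  `|i * (k1 * x + k2 * y + k3 * z + k4 * v)| <= j * M * (`|x| + `|y| + `|z| + `|v|).
Proof.
move=> /andP [i0 ij] M0 h1 h2 h3 h4; rewrite normrM ger0_norm // -mulrA; apply: ler_pM => //.
have bd k q : `|k| <= M -> `|k * q| <= M * `|q| by move=> h; rewrite normrM ler_wpM2r.
apply: le_trans (ler_normD _ _) _; rewrite mulrDr; apply: lerD; last exact: bd.
apply: le_trans (ler_normD _ _) _; rewrite mulrDr; apply: lerD; last exact: bd.
by apply: le_trans (ler_normD _ _) _; rewrite mulrDr; apply: lerD; exact: bd.
Qed.

Lemma DX_ray_bound al be : ra < al -> exists2 K, 0 <= K & forall s, al <= s <= be ->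
  let m := `|Av t a f (s *: t)| + `|Av t a w (s *: t)| + `|Av t b f (s *: t)| + `|Av t b w (s *: t)| in
  `|s^-1 * Euler (Av t a f) (s *: t)| <= K * m /\ `|s^-1 * Euler (Av t a w) (s *: t)| <= K * m.
Proof.
move=> ral; have al0 : 0 < al by exact: lt_trans ral.
have E0 x : U x -> E x != 0 by move=> Ux; rewrite gt_eqF // (ls_Ep H).
have s1 := sD H sf; have s2 := sD H sw; have s3 := sB b H sf; have s4 := sB b H sw.
have s5 := sB b H s3; have s6 := sB b H s4; have s7 := sA t a H s3; have s8 := sA t a H s4.
have s9 : smooth_on U (lf t) by exact: smooth_lf.
have [M1 p1 h1] := @ray_bounded (fun x => (Euler w x + p - 1) + 2 * (Euler f x - Euler w x - (p - 1))
   - (E x)^-1 * (1 + r2 x * Bv b (Bv b f) x)) al be ral ltac:(smt).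
have [M2 p2 h2] := @ray_bounded (fun x => (1 - Euler w x) - (E x)^-1 * (1 + r2 x * Bv b (Bv b w) x)) al be ral ltac:(smt).
have [M3 p3 h3] := @ray_bounded (fun x => (E x)^-1 * lf t x * Av t a (Bv b f) x) al be ral ltac:(smt).
have [M4 p4 h4] := @ray_bounded (fun x => (E x)^-1 * lf t x * Av t a (Bv b w) x) al be ral ltac:(smt).
have [M5 p5 h5] := @ray_bounded (fun x => 1 - Euler w x) al be ral ltac:(smt).
have [M6 p6 h6] := @ray_bounded (fun x => Euler w x + p - 1) al be ral ltac:(smt).
pose M := M1 + M2 + M3 + M4 + M5 + M6.
have M0 : 0 <= M by rewrite !addr_ge0.
have le M' : M' \in [:: M1; M2; M3; M4; M5; M6] -> M' <= M.
  by rewrite !inE /M; do !(case/orP=> [/eqP ->|]; first lra); move=> /eqP ->; lra.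
exists (al^-1 * M); first by rewrite mulr_ge0 // invr_ge0 ltW.
move=> s hs m; have /andP [als _] := hs; have rs := lt_le_trans ral als.
have sp : 0 < s := lt_le_trans al0 als.
have i1 : 0 <= s^-1 <= al^-1 by rewrite invr_ge0 (ltW sp) lef_pV2.
split.
  rewrite (DX_ray H F ra0 UE rs); apply: lin4_bound => //;
    [apply: le_trans (h1 s hs) _|apply: le_trans (h2 s hs) _|apply: le_trans (h3 s hs) _|apply: le_trans (h4 s hs) _];
    by apply: le; rewrite !inE eqxx ?orbT.
rewrite (eMA t a H (U_ray F ra0 UE rs)).
have -> : (1 - Euler w (s *: t)) * Av t a w (s *: t) + (Euler w (s *: t) + p - 1) * Av t a f (s *: t) =
   (Euler w (s *: t) + p - 1) * Av t a f (s *: t) + (1 - Euler w (s *: t)) * Av t a w (s *: t)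
   + 0 * Av t b f (s *: t) + 0 * Av t b w (s *: t) by ring.
apply: lin4_bound; rewrite ?normr0 //.
  by apply: le_trans (h6 s hs) _; apply: le; rewrite !inE eqxx ?orbT.
by apply: le_trans (h5 s hs) _; apply: le; rewrite !inE eqxx ?orbT.
Qed.

Lemma Av_gamS g s : ra < s -> Av t a g (s *: t) ^+ 2 <= gamS g g (s *: t).
Proof.
move=> rs; set x := s *: t; have Ux : U x := U_ray F ra0 UE rs.
have ex : exterior ra x by apply/(exteriorE _ (ltW ra0)); exact/UE.
have rx : r2 x != 0 by rewrite gt_eqF // (ls_r2 H).
have -> : Av t a g x = \sum_k Aw t a x ord0 k * tgrad g k x.
  transitivity (\sum_k Aw t a x ord0 k * tgrad g k x + lf x (Aw t a x) * (Euler g x / r2 x)); last by rewrite Aw_tan mul0r addr0.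
  by rewrite /lf mulr_suml -big_split /=; apply: eq_bigr => k _; rewrite /tgrad; ring.
apply: le_trans (sum_CS _ _) _.
rewrite (eq_bigr (fun k => tgrad g k x * tgrad g k x) (fun k _ => expr2 _)) (sum_tgrad ra0 _ _ ex).
have -> : \sum_k Aw t a x ord0 k ^+ 2 = r2 x.
  transitivity (lf (Aw t a x) (Aw t a x)); first by apply: eq_bigr => k _; rewrite expr2.
  rewrite lf_Aw (lft_ray F) (lfa_ray F) mul0r subr0 lfC lf_Aw (lft_ray F) (lfa_ray F) mul0r subr0 (fr_aa F) (r2_ray F).
  by rewrite mulr1 expr2.
by rewrite mulrC divfK.
Qed.
End RayBound.

(** * Propagation of a vanishing spherical gradient along a ray *)

Section RayZero.
Context {R : realType} {n : nat} (U : set 'rV[R]_n) (f w E : 'rV[R]_n -> R) (p : R) (t a b : 'rV[R]_n).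
Hypothesis H : log_static U f w E p.
Hypothesis F : frame t a b.
Context (ra : R).
Hypothesis ra0 : 0 < ra.
Hypothesis UE : forall x, U x <-> ra ^+ 2 < r2 x.

(** The derivatives towards a and b satisfy together a homogeneous linear system: [DX_ray_bound] for
    the frame and for the frame with a and b exchanged. *)
Lemma ray_zero s s1 : ra < s -> ra < s1 ->
  Av t a f (s *: t) ^+ 2 + Av t a w (s *: t) ^+ 2 + (Av t b f (s *: t) ^+ 2 + Av t b w (s *: t) ^+ 2) = 0 ->
  Av t a f (s1 *: t) ^+ 2 + Av t a w (s1 *: t) ^+ 2 + (Av t b f (s1 *: t) ^+ 2 + Av t b w (s1 *: t) ^+ 2) = 0.
Proof.
move=> rs r1 N0; pose al := Num.min s s1; pose be := Num.max s s1.
have ral : ra < al by rewrite lt_min rs r1.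
have [K1 K10 hK1] := DX_ray_bound H F ra0 UE be ral.
have [K2 K20 hK2] := DX_ray_bound H (frame_swap F) ra0 UE be ral.
have dr g (sg : smooth_on U g) z (hz : al <= z <= be) := ray_der F ra0 UE (lt_le_trans ral (proj1 (andP hz))) sg.
have hs : al <= s <= be by rewrite ge_min le_max lexx.
have h1 : al <= s1 <= be by rewrite ge_min le_max lexx !orbT.
apply: (@gronwall4 R (fun s => Av t a f (s *: t)) (fun s => Av t a w (s *: t)) (fun s => Av t b f (s *: t))
    (fun s => Av t b w (s *: t)) _ _ _ _ al be (K1 + K2) s
    (dr _ (sA t a H (ls_f H))) (dr _ (sA t a H (ls_w H))) (dr _ (sA t b H (ls_f H))) (dr _ (sA t b H (ls_w H)))
    _ (addr_ge0 K10 K20) hs N0 s1 h1).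
move=> z hz; set m := _ + `|Av t b w (z *: t)|; have [a1 a2] := hK1 z hz; have [a3 a4] := hK2 z hz.
have m0 : 0 <= m by rewrite /m !addr_ge0.
have e2 : `|Av t b f (z *: t)| + `|Av t b w (z *: t)| + `|Av t a f (z *: t)| + `|Av t a w (z *: t)| = m by rewrite /m; ring.
rewrite e2 in a3 a4; rewrite -/m in a1 a2.
have k1 : K1 * m <= (K1 + K2) * m by rewrite ler_wpM2r // lerDl.
have k2 : K2 * m <= (K1 + K2) * m by rewrite ler_wpM2r // lerDr.
by split; [exact: le_trans a1 k1|exact: le_trans a2 k1|exact: le_trans a3 k2|exact: le_trans a4 k2].
Qed.
End RayZero.

(** * A nonzero spherical gradient contradicts decay *)

Section RayAbsurd.
Context {R : realType} {n : nat} (U : set 'rV[R]_n) (f w E : 'rV[R]_n -> R) (p : R) (t a b : 'rV[R]_n).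
Hypothesis H : log_static U f w E p.
Hypothesis F : frame t a b.
Hypothesis p2 : 2 <= p.
Context (ra : R).
Hypothesis ra0 : 0 < ra.
Hypothesis UE : forall x, U x <-> ra ^+ 2 < r2 x.
Hypothesis v12 : forall x, U x -> `|Euler w x| <= 1 / 2.
Hypothesis dec : forall e : R, 0 < e -> exists b0, forall x, b0 <= r2 x ->
  [/\ gamS f f x <= e ^+ 2, gamS w w x <= e ^+ 2, `|Euler w x| <= e & `|(E x)^-1 - 1| <= e].
Let sf := ls_f H. Let sw := ls_w H. Let sE := ls_E H. Let oU := ls_open H.
Let sr2 : smooth_on U r2. Proof. exact: smooth_r2. Qed.

(** Starting from a point where the derivatives towards b vanish, two uses of [wronskian] reduce the
    equations along the ray to the closed system excluded by [static_ode_absurd]. *)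
Lemma ray_absurd s1 : ra < s1 -> Av t b f (s1 *: t) = 0 -> Av t b w (s1 *: t) = 0 ->
  (Av t a f (s1 *: t) = 0 -> Av t a w (s1 *: t) = 0 -> False) -> False.
Proof.
move=> r1 f20 w20 n0.
have rs s : s1 <= s -> ra < s by exact: lt_le_trans.
have Us s (h : s1 <= s) : U (s *: t) := U_ray F ra0 UE (rs s h).
have sp s : s1 <= s -> 0 < s by move=> /rs; exact: lt_trans.
have dr g s (sg : smooth_on U g) (h : s1 <= s) := ray_der F ra0 UE (rs s h) sg.
have sX1 := sA t a H sf; have sY1 := sA t a H sw; have sX2 := sA t b H sf; have sY2 := sA t b H sw.
have gn s : s1 <= s -> Euler w (s *: t) + p - 1 != 0.
  by move=> h; have := v12 (Us s h); have hp := p2; rewrite ler_norml => /andP [? ?]; rewrite gt_eqF //; lra.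
have N0 s : s1 <= s -> Av t a f (s *: t) ^+ 2 + Av t a w (s *: t) ^+ 2
    + (Av t b f (s *: t) ^+ 2 + Av t b w (s *: t) ^+ 2) != 0.
  move=> h; apply/negP => /eqP N0.
  have := ray_zero H F ra0 UE (rs s h) r1 N0; rewrite f20 w20 expr0n /= !addr0 => G.
  move/eqP: G; rewrite paddr_eq0 ?sqr_ge0 // !sqrf_eq0 => /andP [/eqP h1 /eqP h2].
  exact: n0.
pose k s := s^-1 * (1 - Euler w (s *: t)).
pose g s := s^-1 * (Euler w (s *: t) + p - 1).
have g0 s : s1 <= s -> g s != 0 by move=> h; rewrite mulf_neq0 ?gn // invr_eq0 gt_eqF // sp.
(* The mixed equation has the same coefficients in every tangent direction, and the curl relation
   [J_ray] provides the proportionality. *)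
have Z2 s : s1 <= s -> Av t b f (s *: t) = 0 /\ Av t b w (s *: t) = 0.
  move=> h; apply: (@wronskian R (fun s => Av t a f (s *: t)) (fun s => Av t a w (s *: t))
    (fun s => Av t b f (s *: t)) (fun s => Av t b w (s *: t)) (fun s => s^-1 * Euler (Av t a f) (s *: t))
    (fun s => s^-1 * Euler (Av t b f) (s *: t)) k g s1 _ _ _ _ _ _ _ g0 N0 f20 w20 s h) => z hz.
  - exact: dr.
  - exact: dr.
  - by apply: isd_eq (dr _ z sY1 hz) _; rewrite (eMA t a H (Us z hz)) /k /g; ring.
  - by apply: isd_eq (dr _ z sY2 hz) _; rewrite (eMA t b H (Us z hz)) /k /g; ring.
  - exact: (ray_der2 H F ra0 UE (rs z hz) sX1).
  - exact: (ray_der2 H F ra0 UE (rs z hz) sX2).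
  - exact: (J_ray H F ra0 UE (rs z hz)).
have N1 s : s1 <= s -> Av t a f (s *: t) ^+ 2 + Av t a w (s *: t) ^+ 2 != 0.
  by move=> h; have := N0 s h; have [-> ->] := Z2 s h; rewrite expr0n /= !addr0.
pose bf x := r2 x * Bv b (Bv b f) x; pose bw x := r2 x * Bv b (Bv b w) x.
have l1 : s1 <= s1 by [].
(* At [s1] the vector (bf, bw) is parallel to the nonzero vector of derivatives towards a, by [BJ];
   c is the factor, computed by projection. A second use of [wronskian] keeps it constant along the
   ray. *)
pose c := (bf (s1 *: t) * Av t a f (s1 *: t) + bw (s1 *: t) * Av t a w (s1 *: t))
  / (Av t a f (s1 *: t) ^+ 2 + Av t a w (s1 *: t) ^+ 2).
pose zf x := bf x - c * Av t a f x; pose zw x := bw x - c * Av t a w x.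
have s3 := sB b H (sB b H sf); have s4 := sB b H (sB b H sw).
have szf : smooth_on U zf by rewrite /zf /bf; smt.
have szw : smooth_on U zw by rewrite /zw /bw; smt.
have sbw : smooth_on U bw by rewrite /bw; smt.
have BJ s : s1 <= s -> Av t a f (s *: t) * bw (s *: t) = bf (s *: t) * Av t a w (s *: t).
  move=> h; have [h1 h2] := Z2 s h; have := BJ_ray H F ra0 UE (rs s h) h1 h2; rewrite /bf /bw => e.
  by rewrite mulrCA e; ring.
have Zc s : s1 <= s -> zf (s *: t) = 0 /\ zw (s *: t) = 0.
  move=> h; apply: (@wronskian R (fun s => Av t a f (s *: t)) (fun s => Av t a w (s *: t))
    (fun s => zf (s *: t)) (fun s => zw (s *: t)) (fun s => s^-1 * Euler (Av t a f) (s *: t))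
    (fun s => s^-1 * Euler zf (s *: t)) k g s1 _ _ _ _ _ _ _ g0 _ _ _ s h) => [z hz|z hz|z hz|z hz|z hz|z hz|z hz|z hz||].
  - exact: dr.
  - exact: dr.
  - by apply: isd_eq (dr _ z sY1 hz) _; rewrite (eMA t a H (Us z hz)) /k /g; ring.
  - apply: isd_eq (dr _ z szw hz) _; have [q1 q2] := Z2 z hz.
    have -> : Euler zw (z *: t) = Euler bw (z *: t) - c * Euler (Av t a w) (z *: t).
      have d1 := isd_Euler sbw (Us z hz); have d2 := isd_Euler sY1 (Us z hz).
      by apply: (Euler_isd szw (Us z hz)); rewrite /zw; isd; ring.
    rewrite (DBB_ray H F ra0 UE (rs z hz) q1 q2) (eMA t a H (Us z hz)) /k /g /zw /zf -/(bf _) -/(bw _) /bf /bw; ring.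
  - exact: (ray_der2 H F ra0 UE (rs z hz) sX1).
  - exact: (ray_der2 H F ra0 UE (rs z hz) szf).
  - by have := BJ z hz; rewrite /zf /zw; lra.
  - have := N1 z hz; rewrite paddr_eq0 ?sqr_ge0 // => hN; rewrite paddr_eq0 ?addr_ge0 ?sqr_ge0 //.
    by rewrite paddr_eq0 ?sqr_ge0 // negb_and hN.
  - rewrite /zf /c; have := BJ s1 l1; have := N1 s1 l1.
    move: (Av t a f _) (Av t a w _) (bf _) (bw _) => X Y u v N e; apply: (mulfI N); rewrite mulr0.
    transitivity (Y * (u * Y - X * v)); first by field.
    by rewrite e subrr mulr0.
  rewrite /zw /c; have := BJ s1 l1; have := N1 s1 l1.
  move: (Av t a f _) (Av t a w _) (bf _) (bw _) => X Y u v N e; apply: (mulfI N); rewrite mulr0.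
  transitivity (X * (X * v - u * Y)); first by field.
  by rewrite e subrr mulr0.
have cf s : s1 <= s -> r2 (s *: t) * Bv b (Bv b f) (s *: t) = c * Av t a f (s *: t).
  by move=> h; have [+ _] := Zc s h; rewrite /zf /bf => /eqP; rewrite subr_eq0 => /eqP.
have cw s : s1 <= s -> r2 (s *: t) * Bv b (Bv b w) (s *: t) = c * Av t a w (s *: t).
  by move=> h; have [_ +] := Zc s h; rewrite /zw /bw => /eqP; rewrite subr_eq0 => /eqP.
have s5 := sA t a H sX1; have s6 := sA t a H sY1.
have s1lt s : s1 + 1 <= s -> s1 < s by apply: lt_le_trans; rewrite ltrDl.
have s1le s : s1 + 1 <= s -> s1 <= s by move=> /s1lt; exact: ltW.
have taa s (h : s1 <= s) := TAA_ray H F ra0 UE (rs s h) (proj1 (Z2 s h)) (proj2 (Z2 s h)) (cf s h) (cw s h).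
have hXr s (h : s1 <= s) := hX_ray H F ra0 UE (rs s h) (proj1 (Z2 s h)) (proj2 (Z2 s h)) (cf s h) (cw s h).
(* The tangential relation is differentiated through [isd_zero], which needs points strictly beyond
   [s1], hence the shifted start. *)
apply: (@static_ode_absurd R p c (s1 + 1) (fun s => Av t a f (s *: t)) (fun s => Av t a w (s *: t))
   (fun s => Euler w (s *: t)) (fun s => (E (s *: t))^-1)
   (fun s => Av t a (Av t a w) (s *: t) - c * Av t a w (s *: t) + Av t a w (s *: t) ^+ 2)) => //.
- by apply: sp; exact: s1le.
- by move=> s h; apply: isd_eq (dr _ s sX1 (s1le s h)) _; rewrite hXr // s1le.
- by move=> s h; apply: isd_eq (dr _ s sY1 (s1le s h)) _; rewrite (eMA t a H (Us s (s1le s h))).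
- move=> s /s1le h; have d1 := dr _ s sY1 h; have d2 := dr _ s s6 h.
  isd; rewrite -(O3_alg (z1 := Av t a (Av t a f) (s *: t)) (DY := Euler (Av t a w) (s *: t)) _ (taa s h)).
    by rewrite (DAA t a H (Us s h)); ring.
  by rewrite (eMA t a H (Us s h)) /dY.
- move=> s h' S0; have h := s1le s h'; have [q1 q2] := Z2 s h.
  apply: (hO_ray H F ra0 UE (rs s h) q1 q2 (cf s h) (cw s h) S0).
  have d1 := dr _ s sY1 h; have d2 := dr _ s s6 h; have d3 := dr _ s sX1 h; have d4 := dr _ s s5 h.
  have hz : is_derive s (1 : R) (fun s => Av t a (Av t a w) (s *: t) + Av t a w (s *: t) ^+ 2
     + (Av t a (Av t a f) (s *: t) + Av t a f (s *: t) ^+ 2) + - (c * (Av t a f (s *: t) + Av t a w (s *: t))))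
    (s^-1 * (Euler (Av t a (Av t a w)) (s *: t) + 2 * Av t a w (s *: t) * Euler (Av t a w) (s *: t)
   + (Euler (Av t a (Av t a f)) (s *: t) + 2 * Av t a f (s *: t) * Euler (Av t a f) (s *: t))
   - c * (Euler (Av t a f) (s *: t) + Euler (Av t a w) (s *: t)))) by isd; ring.
  have z0 z : s1 <= z -> Av t a (Av t a w) (z *: t) + Av t a w (z *: t) ^+ 2
     + (Av t a (Av t a f) (z *: t) + Av t a f (z *: t) ^+ 2) + - (c * (Av t a f (z *: t) + Av t a w (z *: t))) = 0.
    by move=> zh; rewrite taa // subrr.
  have /eqP := isd_zero z0 (s1lt s h') hz.
  by rewrite mulf_eq0 invr_eq0 gt_eqF ?sp //= subr_eq0 => /eqP.
- move=> e e0; have [b0 hb] := dec e0.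
  pose s2 := Num.max (s1 + 1) (Num.max b0 1).
  exists s2; first by rewrite le_max lexx.
  move=> s h; have hs : s1 + 1 <= s by apply: le_trans h; rewrite le_max lexx.
  have h1 : 1 <= s by apply: le_trans h; rewrite !le_max lexx !orbT.
  have hb0 : b0 <= s by apply: le_trans h; rewrite !le_max lexx !orbT.
  have br : b0 <= r2 (s *: t) by rewrite (r2_ray F) expr2; apply: le_trans hb0 _; rewrite ler_peMl // (le_trans ler01).
  have [k1 k2 k3 k4] := hb _ br; have rss := rs s (s1le s hs).
  have ab (y : R) (q : R) : y ^+ 2 <= q -> q <= e ^+ 2 -> `|y| <= e.
    move=> y1 y2; rewrite ler_norml; apply: sqr_le_abs; first exact: ltW.
    exact: le_trans y1 y2.
  split=> //; [exact: ab (Av_gamS H F ra0 UE f rss) k1|exact: ab (Av_gamS H F ra0 UE w rss) k2].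
move=> s /s1le h x0 y0; have := N1 s h; rewrite x0 y0 expr0n /= addr0 eqxx //.
Qed.
End RayAbsurd.

(** * Adapted frames and radial symmetry far out *)

Section Radial.
Context {R : realType} {n : nat}.

Lemma orth2_exists (t a : 'rV[R]_n) : (2 < n)%N -> exists2 b : 'rV[R]_n, lf b b = 1 & lf t b = 0 /\ lf a b = 0.
Proof.
move=> n2; pose M : 'M[R]_(n, 1 + 1) := row_mx (trmx t) (trmx a).
have k0 : kermx M != 0.
  rewrite -mxrank_eq0 mxrank_ker subn_eq0 -ltnNge.
  exact: leq_ltn_trans (rank_leq_col M) n2.
pose v := nz_row (kermx M).
have vM : v *m M = 0 by apply/sub_kermxP; exact: nz_row_sub.
have lfv c : v *m trmx c = 0 -> lf c v = 0.
  move=> h; have := congr1 (fun A : 'M[R]_(1, 1) => A ord0 ord0) h; rewrite !mxE => h'.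
  by rewrite -[RHS]h'; apply: eq_bigr => k _; rewrite mxE.
move: vM; rewrite mul_mx_row -[RHS]row_mx0 => /eq_row_mx [vt va].
have v0 : 0 < r2 v.
  by rewrite lt0r r2_ge0 andbT; apply/negP => /eqP /r2_eq0 /eqP; rewrite nz_row_eq0 (negbTE k0).
pose z := (Num.sqrt (r2 v))^-1.
exists (z *: v); last by rewrite !lfZ !lfv // mulr0.
rewrite lfZ lfC lfZ -r2_lf mulrA -expr2 /z exprVn sqr_sqrtr ?ltW // mulVf // gt_eqF //.
Qed.

Lemma unit_exists (x : 'rV[R]_n) : 0 < r2 x -> exists s t, [/\ 0 < s, lf t t = 1 & x = s *: t].
Proof.
move=> x0; exists (Num.sqrt (r2 x)), ((Num.sqrt (r2 x))^-1 *: x); have s0 : 0 < Num.sqrt (r2 x) by rewrite sqrtr_gt0.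
split=> //; last by rewrite scalerA mulfV ?gt_eqF // scale1r.
by rewrite lfZ lfC lfZ -r2_lf mulrA -expr2 exprVn sqr_sqrtr ?ltW // mulVf // gt_eqF.
Qed.

Context (U : set 'rV[R]_n) (f w E : 'rV[R]_n -> R) (p : R).
Hypothesis H : log_static U f w E p.
Hypothesis n2 : (2 < n)%N.
Context (ra : R).
Hypothesis ra0 : 0 < ra.
Hypothesis UE : forall x, U x <-> ra ^+ 2 < r2 x.

Definition dirv (v : 'rV[R]_n) (g : 'rV[R]_n -> R) x : R := \sum_k v ord0 k * dpd k g x.

Lemma Av_dirv t a g s : lf t t = 1 -> lf t a = 0 -> Av t a g (s *: t) = s * dirv a g (s *: t).
Proof.
move=> tt ta; rewrite /Av /vf /dirv mulr_sumr; apply: eq_bigr => k _.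
by rewrite /Aw !lfZ tt [lf a t]lfC ta mulr0 scale0r subr0 mulr1 mxE mulrA.
Qed.

Lemma ray_U s t : lf t t = 1 -> 0 < s -> U (s *: t) -> ra < s.
Proof. by move=> tt s0 /UE; rewrite r2Z r2_lf tt mulr1 ltr_pXn2r ?nnegrE ?ltW. Qed.

Lemma frame_exists t (v : 'rV[R]_n) : lf t t = 1 -> lf t v = 0 -> v != 0 ->
  exists z a b, [/\ 0 < z, v = z *: a & frame t a b].
Proof.
move=> tt tv v0.
have v1 : 0 < r2 v by rewrite lt0r r2_ge0 andbT; apply/negP => /eqP /r2_eq0 /eqP; rewrite (negbTE v0).
have [z [a [z0 aa vE]]] := unit_exists v1.
have [b bb [tb ab]] := orth2_exists t a n2.
exists z, a, b; split=> //; split=> //.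
by move/eqP: tv; rewrite vE lfZ mulf_eq0 gt_eqF //= => /eqP.
Qed.

(** Works in both directions along the ray; the inward direction is what extends radial symmetry
    from infinity. *)
Lemma tangential_ray t s s1 : lf t t = 1 -> ra < s -> ra < s1 ->
  (forall v, lf t v = 0 -> dirv v f (s *: t) = 0 /\ dirv v w (s *: t) = 0) ->
  forall v, lf t v = 0 -> dirv v f (s1 *: t) = 0 /\ dirv v w (s1 *: t) = 0.
Proof.
move=> tt rs r1 h v tv; have [->|v0] := eqVneq v 0.
  by rewrite /dirv; split; rewrite big1 // => k _; rewrite mxE mul0r.
have [z [a [b [z0 -> F]]]] := frame_exists tt tv v0.
have [fa wa] := h a (fr_ta F); have [fb wb] := h b (fr_tb F).
have := ray_zero H F ra0 UE rs r1.
rewrite !(Av_dirv _ _ (fr_tt F) (fr_ta F)) !(Av_dirv _ _ (fr_tt F) (fr_tb F)) fa wa fb wb !mulr0 expr0n /= !addr0.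
move=> /(_ erefl) /eqP; rewrite paddr_eq0 ?addr_ge0 ?sqr_ge0 // => /andP [+ _].
rewrite paddr_eq0 ?sqr_ge0 // !sqrf_eq0 !mulf_eq0 !(gt_eqF (lt_trans ra0 r1)) /= => /andP [/eqP f0 /eqP w0].
have dz g : dirv (z *: a) g (s1 *: t) = z * dirv a g (s1 *: t).
  by rewrite /dirv mulr_sumr; apply: eq_bigr => k _; rewrite mxE mulrA.
by rewrite !dz f0 w0 mulr0.
Qed.

Hypothesis p2 : 2 <= p.
Hypothesis v12 : forall x, U x -> `|Euler w x| <= 1 / 2.
Hypothesis dec : forall e : R, 0 < e -> exists b0, forall x, b0 <= r2 x ->
  [/\ gamS f f x <= e ^+ 2, gamS w w x <= e ^+ 2, `|Euler w x| <= e & `|(E x)^-1 - 1| <= e].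

Definition tvec (g : 'rV[R]_n -> R) x : 'rV[R]_n := \row_i tgrad g i x.

Lemma lf_tvec v g x : U x -> lf x v = 0 -> lf v (tvec g x) = dirv v g x.
Proof.
move=> Ux xv; have rx : r2 x != 0 by rewrite gt_eqF // (ls_r2 H).
transitivity (dirv v g x - lf x v * (Euler g x / r2 x)); last by rewrite xv mul0r subr0.
rewrite /lf /dirv mulr_suml -sumrN -big_split /=; apply: eq_bigr => k _.
by rewrite mxE /tgrad; ring.
Qed.

Lemma tvec_x g x : U x -> lf x (tvec g x) = 0.
Proof.
move=> Ux; have ex : exterior ra x by apply/(exteriorE _ (ltW ra0)); exact/UE.
rewrite -(tgrad_coo ra0 g ex); apply: eq_bigr => k _; by rewrite mxE mulrC.
Qed.

(** The frame is adapted to h: a points along the tangential gradient of h, so the derivative of h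
    towards b vanishes and the one towards a does not. *)
Lemma tangential_absurd x (h : 'rV[R]_n -> R) : U x -> tvec h x != 0 ->
  (forall t a b s, frame t a b -> ra < s -> x = s *: t -> dirv b h x = 0 -> dirv a h x != 0 ->
    [/\ dirv b f x = 0, dirv b w x = 0 & (dirv a f x = 0 -> dirv a w x = 0 -> False)]) -> False.
Proof.
move=> Ux h0 hyp; have [s [t [s0 tt xE]]] := unit_exists (ls_r2 H Ux).
have rs : ra < s by apply: ray_U tt s0 _; rewrite -xE.
have tv : lf t (tvec h x) = 0.
  have := tvec_x h Ux; rewrite {1}xE lfC lfZ => /eqP; rewrite mulf_eq0 gt_eqF //= => /eqP.
  by rewrite lfC.
have [z [a [b [z0 vE F]]]] := frame_exists tt tv h0.
have xa : lf x a = 0 by rewrite xE lfC lfZ lfC (fr_ta F) mulr0.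
have xb : lf x b = 0 by rewrite xE lfC lfZ lfC (fr_tb F) mulr0.
have bh : dirv b h x = 0 by rewrite -lf_tvec // vE lfZ lfC (fr_ab F) mulr0.
have ah : dirv a h x != 0 by rewrite -lf_tvec // vE lfZ (fr_aa F) mulr1 gt_eqF.
have [bf bw aN] := hyp t a b s F rs xE bh ah.
apply: (ray_absurd H F p2 ra0 UE v12 dec rs).
- by rewrite (Av_dirv _ _ tt (fr_tb F)) -xE bf mulr0.
- by rewrite (Av_dirv _ _ tt (fr_tb F)) -xE bw mulr0.
rewrite !(Av_dirv _ _ tt (fr_ta F)) -xE => /eqP; rewrite mulf_eq0 gt_eqF //= => /eqP f0 /eqP.
by rewrite mulf_eq0 gt_eqF //= => /eqP; exact: aN.
Qed.

(** First h = f: where the derivative of f towards a is nonzero, the curl relation kills the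
    derivative of w towards b. Once f is radial, h = w meets the hypotheses at once. *)
Lemma log_radial x v : U x -> lf x v = 0 -> dirv v f x = 0 /\ dirv v w x = 0.
Proof.
have Tf y : U y -> tvec f y = 0.
  move=> Uy; apply/eqP; apply: contraT => f0; exfalso.
  apply: (tangential_absurd Uy f0) => t a b s F rs yE bf af; split=> //; last by move=> /eqP; rewrite (negbTE af).
  have := J_ray H F ra0 UE rs.
  rewrite !(Av_dirv _ _ (fr_tt F) (fr_ta F)) !(Av_dirv _ _ (fr_tt F) (fr_tb F)) -yE bf mulr0 mul0r => /eqP.
  by rewrite !mulf_eq0 !(gt_eqF (lt_trans ra0 rs)) (negbTE af) /= => /eqP.
move=> Ux xv; have f0 u : lf x u = 0 -> dirv u f x = 0.
  by move=> xu; rewrite -lf_tvec // Tf // /lf big1 // => k _; rewrite mxE mul0r.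
split; first exact: f0.
have [w0|w0] := eqVneq (tvec w x) 0.
  by rewrite -lf_tvec // w0 /lf big1 // => k _; rewrite mxE mul0r.
exfalso; apply: (tangential_absurd Ux w0) => t a b s F rs xE bw aw; split=> //.
  by apply: f0; rewrite xE lfC lfZ lfC (fr_tb F) mulr0.
by move=> _ /eqP; rewrite (negbTE aw).
Qed.
End Radial.

(** * Logarithmic form of the equations for u and V *)

Section LogOfStatic.
Context {R : realType} {n : nat} (r0 ra : R) (u V : 'rV[R]_n -> R).
Hypothesis r0_gt0 : 0 < r0.
Hypothesis r0ra : r0 <= ra.
Hypothesis n2 : (2 < n)%N.
Hypothesis su0 : smooth_on (exterior r0) u.
Hypothesis u_gt0 : forall x, exterior r0 x -> 0 < u x.
Hypothesis sV0 : smooth_on (exterior r0) V.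
Hypothesis hessE : forall x, exterior r0 x -> forall i j : 'I_n, hess u V i j x = V x * ricci u i j x.
Let U : set 'rV[R]_n := exterior ra.
Hypothesis Vn0 : forall x, U x -> V x != 0.

Let ra0 : 0 < ra. Proof. exact: lt_le_trans r0ra. Qed.
Let oU : open U. Proof. exact: open_exterior (ltW ra0). Qed.
Lemma exterior_sub x : U x -> exterior r0 x.
Proof. exact: le_lt_trans. Qed.
Let su : smooth_on U u. Proof. by move=> s x Ux; apply: su0; exact: exterior_sub. Qed.
Let sV : smooth_on U V. Proof. by move=> s x Ux; apply: sV0; exact: exterior_sub. Qed.
Let up x : U x -> 0 < u x. Proof. by move=> Ux; apply: u_gt0; exact: exterior_sub. Qed.
Let un0 x : U x -> u x != 0. Proof. by move=> Ux; rewrite gt_eqF // up. Qed.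
Let rn0 x : U x -> r2 x != 0. Proof. by move=> Ux; rewrite gt_eqF // (r2_gt0 (ltW ra0)). Qed.

Definition lnu x : R := ln (u x).
(** ln |V| without the absolute value, so that smoothness follows from that of V^2 whatever the sign
    of V. *)
Definition lnabs x : R := 2^-1 * ln (V x * V x).
Definition Eu x : R := (u x)^-1 * (u x)^-1.

Let VV x : U x -> 0 < V x * V x.
Proof. by move=> Ux; rewrite -expr2 lt0r sqrf_eq0 Vn0 // sqr_ge0. Qed.
Let sVV : smooth_on U (fun x => V x * V x). Proof. by smt. Qed.
Let sf : smooth_on U lnu. Proof. exact: smooth_ln. Qed.
Let slv : smooth_on U (fun x => ln (V x * V x)). Proof. exact: (smooth_ln oU sVV VV). Qed.
Let sw : smooth_on U lnabs. Proof. by rewrite /lnabs; smt. Qed.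
Let sE : smooth_on U Eu. Proof. by rewrite /Eu; smt. Qed.

Lemma pd_lnu i x : U x -> dpd i lnu x = dpd i u x * (u x)^-1.
Proof. by move=> Ux; have [_ ->] := ln_pd i su Ux (up Ux). Qed.

Lemma pd_lnabs i x : U x -> dpd i lnabs x = dpd i V x * (V x)^-1.
Proof.
move=> Ux; have V0 := Vn0 Ux; have h := smooth_isd_pd i sV Ux.
have h1 := smooth_isd_pd i slv Ux; have [_ h2] := ln_pd i sVV Ux (VV Ux).
have h3 : dpd i (fun x => V x * V x) x = 2 * V x * dpd i V x by apply: pd_isd; isd; ring.
rewrite h2 h3 in h1.
by apply: pd_isd; rewrite /lnabs; isd; field.
Qed.

Lemma hs_lnu i j x : U x -> hs lnu x i j = hs u x i j * (u x)^-1 - (dpd i u x * (u x)^-1) * (dpd j u x * (u x)^-1).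
Proof.
move=> Ux; have u0 := un0 Ux; rewrite /hs (pd_eq_on oU j (pd_lnu i) Ux).
have h1 := smooth_isd_pd j su Ux; have h2 := smooth_isd_pd j (smooth_pd i su) Ux.
by apply: pd_isd; isd; field.
Qed.

Lemma hs_lnabs i j x : U x -> hs lnabs x i j = hs V x i j * (V x)^-1 - (dpd i V x * (V x)^-1) * (dpd j V x * (V x)^-1).
Proof.
move=> Ux; have u0 := Vn0 Ux; rewrite /hs (pd_eq_on oU j (pd_lnabs i) Ux).
have h1 := smooth_isd_pd j sV Ux; have h2 := smooth_isd_pd j (smooth_pd i sV) Ux.
by apply: pd_isd; isd; field.
Qed.

Lemma bil_ln (g h : 'rV[R]_n -> R) x (c : R) (v z : 'I_n -> R) :
  (forall i j, hs h x i j = hs g x i j * c - (dpd i g x * c) * (dpd j g x * c)) ->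
  bil v z (hs h x) = bil v z (hs g x) * c - (dp v (grad g x) * c) * (dp z (grad g x) * c).
Proof.
move=> hE; rewrite (eq_bil _ _ (g := fun i j => c * hs g x i j + - ((c * c) * (grad g x i * grad g x j)))); last first.
  by move=> i j; rewrite hE /grad; ring.
by rewrite bilD bilN !bilZ bil_sep; ring.
Qed.

Lemma dp_ln (g h : 'rV[R]_n -> R) x (c : R) (v : 'I_n -> R) :
  (forall i, dpd i h x = dpd i g x * c) -> dp v (grad h x) = dp v (grad g x) * c.
Proof. by move=> hE; rewrite /dp mulr_suml; apply: eq_bigr => i _; rewrite /grad hE mulrA. Qed.

Lemma Euler_ln (g h : 'rV[R]_n -> R) x (c : R) :
  (forall i, dpd i h x = dpd i g x * c) -> Euler h x = Euler g x * c.
Proof. by move=> hE; rewrite /Euler mulr_suml; apply: eq_bigr => i _; rewrite hE; ring. Qed.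

Lemma log_static_uV : log_static U lnu lnabs Eu (n%:R - 1).
Proof.
have n1 : (1 : R) < n%:R by rewrite ltr1n; exact: ltn_trans n2.
split=> //.
- by move=> x Ux; exact: r2_gt0 (ltW ra0) Ux.
- by move=> x Ux; rewrite mulr_gt0 // invr_gt0 up.
- move=> x i Ux; have u0 := un0 Ux; have h := smooth_isd_pd i su Ux; rewrite pd_lnu //.
  by apply: pd_isd; rewrite /Eu; isd; field.
- by rewrite subr_eq0 gt_eqF.
- move=> x v Ux vx; have u0 := un0 Ux; have V0 := Vn0 Ux.
  rewrite (bil_ln v (coo x) (fun i j => hs_lnabs i j Ux)) (dp_ln v (fun i => pd_lnabs i Ux)).
  rewrite (dp_ln v (fun i => pd_lnu i Ux)) (Euler_ln (fun i => pd_lnabs i Ux)) dp_grad.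
  have := mix_eq r0_gt0 su0 u_gt0 sV0 hessE (exterior_sub Ux) vx => h.
  have -> : bil v (coo x) (hs V x) = dp v (grad u x) * (Euler V x + (n%:R - 2) * V x) / u x.
    by rewrite -h mulrC mulKf.
  by field; rewrite u0 V0.
move=> x v z Ux vx zx; have u0 := un0 Ux; have V0 := Vn0 Ux; have rx := rn0 Ux.
rewrite (bil_ln v z (fun i j => hs_lnabs i j Ux)) (bil_ln v z (fun i j => hs_lnu i j Ux)).
rewrite !(dp_ln _ (fun i => pd_lnabs i Ux)) !(dp_ln _ (fun i => pd_lnu i Ux)).
rewrite /lamE (Euler_ln (fun i => pd_lnabs i Ux)) (Euler_ln (fun i => pd_lnu i Ux)).
have := tan_eq r0_gt0 su0 u_gt0 sV0 hessE (exterior_sub Ux) vx zx => h.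
transitivity ((u x * bil v z (hs V x) + V x * bil v z (hs u x)) / (u x * V x)).
  by field; rewrite u0 V0.
by rewrite h /tan_coef /Eu; field; rewrite u0 V0 rx.
Qed.
End LogOfStatic.

(** * Integration of the radial equations *)

Section Formula.
Context {R : realType} {n : nat} (r0 ra : R) (u V : 'rV[R]_n -> R).
Hypothesis r0_gt0 : 0 < r0.
Hypothesis r0ra : r0 <= ra.
Hypothesis n2 : (2 < n)%N.
Hypothesis su0 : smooth_on (exterior r0) u.
Hypothesis u_gt0 : forall x, exterior r0 x -> 0 < u x.
Hypothesis sV0 : smooth_on (exterior r0) V.
Hypothesis hessE : forall x, exterior r0 x -> forall i j : 'I_n, hess u V i j x = V x * ricci u i j x.
Hypothesis scalE : forall x, exterior r0 x -> (n%:R - 1) * (Euler u x / u x) =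
  u x * lapS u x - 2^-1 * (n%:R - 1) * (n%:R - 2) * (u x ^+ 2 - 1).
Let U : set 'rV[R]_n := exterior ra.
Hypothesis Vn0 : forall x, U x -> V x != 0.
Hypothesis tg : forall x v, U x -> lf x v = 0 -> dirv v u x = 0 /\ dirv v V x = 0.

Let ra0 : 0 < ra. Proof. exact: lt_le_trans r0ra. Qed.
Let oU : open U. Proof. exact: open_exterior (ltW ra0). Qed.
Let sub x : U x -> exterior r0 x. Proof. exact: le_lt_trans. Qed.
Let su : smooth_on U u. Proof. by move=> s x Ux; apply: su0; exact: sub. Qed.
Let sV : smooth_on U V. Proof. by move=> s x Ux; apply: sV0; exact: sub. Qed.
Let un0 x : U x -> u x != 0. Proof. by move=> Ux; rewrite gt_eqF // u_gt0 //; exact: sub. Qed.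
Let UE x : U x <-> ra ^+ 2 < r2 x. Proof. exact: exteriorE (ltW ra0). Qed.
Let H : log_static U (lnu u) (lnabs V) (Eu u) (n%:R - 1).
Proof. exact: (log_static_uV r0_gt0 r0ra n2 su0 u_gt0 sV0 hessE Vn0). Qed.

Lemma U_unit (s : R) (t : 'rV[R]_n) : lf t t = 1 -> ra < s -> U (s *: t).
Proof. by move=> tt rs; apply/UE; rewrite r2Z r2_lf tt mulr1 ltr_pXn2r ?nnegrE ?ltW // (lt_trans ra0). Qed.

Lemma lapS_u0 x : U x -> lapS u x = 0.
Proof.
move=> Ux; have r0' p y : U y -> rotd p u y = 0.
  move=> Uy; rewrite (rot_isd su Uy (@isd_vf R n U u y (rv p) su Uy)).
  suff hv : lf y (rv p y) = 0 by have [h _] := tg Uy hv; exact: h.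
  rewrite /lf (eq_bigr (fun k => (y ord0 p.1 * y ord0 k) * (p.2 == k)%:R + (- y ord0 p.2 * y ord0 k) * (p.1 == k)%:R)).
    by rewrite big_split /= !sum_deltar; ring.
  by move=> k _; rewrite /rv !mxE eqxx /= [k == p.2]eq_sym [k == p.1]eq_sym; ring.
have s0 : smooth_on U (fun=> 0 : R) by smt.
rewrite (lapS_rot oU su Ux) big1 ?mulr0 // => p _.
rewrite (rot_eq_on oU p (fun y Uy => r0' p y Uy) Ux).
by notypeclasses refine (rot_isd s0 Ux _); isd.
Qed.

Lemma tg_ln x v : U x -> lf x v = 0 -> dirv v (lnu u) x = 0 /\ dirv v (lnabs V) x = 0.
Proof.
move=> Ux xv; have [h1 h2] := tg Ux xv; split.
  rewrite /dirv (eq_bigr (fun k => (v ord0 k * dpd k u x) * (u x)^-1)) => [|k _]; first by rewrite -mulr_suml -/(dirv v u x) h1 mul0r.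
  by rewrite (pd_lnu r0ra su0 u_gt0) // mulrA.
rewrite /dirv (eq_bigr (fun k => (v ord0 k * dpd k V x) * (V x)^-1)) => [|k _]; first by rewrite -mulr_suml -/(dirv v V x) h2 mul0r.
by rewrite (pd_lnabs r0_gt0 r0ra sV0 Vn0) // mulrA.
Qed.

(** For radial functions the left side of the tangential equation in direction b is zero, while its
    right side is a nonzero multiple of [lamE]. *)
Lemma lam0 x : U x -> lamE (lnu u) (lnabs V) (Eu u) (n%:R - 1) x = 0.
Proof.
move=> Ux; have [s [t [s0 tt xE]]] := unit_exists (ls_r2 H Ux).
have [a aa [ta _]] := orth2_exists t t n2.
have [b bb [tb ab]] := orth2_exists t a n2.
have F : frame t a b by split.
have rs : ra < s by apply: (ray_U ra0 UE tt s0); rewrite -xE.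
have B0 y : U y -> Bv b (lnu u) y = 0 /\ Bv b (lnabs V) y = 0.
  by move=> Uy; have [h1 h2] := tg_ln Uy (Bw_tan b H Uy).
have c0 : smooth_on U (fun=> 0 : R) by smt.
have BB0 g : (forall y, U y -> Bv b g y = 0) -> Bv b (Bv b g) x = 0.
  move=> h; rewrite {1}/Bv (vf_eq_on oU (Bw b) h Ux).
  by notypeclasses refine (vf_isd c0 Ux _); isd.
have := eTBB H F Ux; rewrite !BB0; try by move=> y /B0 [].
have [-> ->] := B0 x Ux; rewrite xE (kap_ray F) (sig_ray F) mul0r expr0n /= !addr0 mul1r => /esym /eqP.
by rewrite -xE mulf_eq0 invr_eq0 (gt_eqF (ls_r2 H Ux)) orbF => /eqP.
Qed.

(** The first rate is the scalar curvature equation without its spherical Laplacian; inserted in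
    [lamE] = 0 it gives the second. *)
Lemma Euler_rates x : U x -> Euler u x / u x = - (2^-1 * (n%:R - 2) * (u x ^+ 2 - 1)) /\
  Euler V x / V x = - (Euler u x / u x).
Proof.
move=> Ux; have u0 := un0 Ux; have V0 := Vn0 Ux.
have n1 : n%:R - 1 != 0 :> R by rewrite subr_eq0 gt_eqF // ltr1n; exact: ltn_trans n2.
have e1 : Euler u x / u x = - (2^-1 * (n%:R - 2) * (u x ^+ 2 - 1)).
  by apply: (mulfI n1); rewrite scalE ?lapS_u0 //; [ring|exact: sub].
split=> //; have := lam0 Ux; rewrite /lamE (Euler_ln (fun i => pd_lnu r0ra su0 u_gt0 i Ux)).
rewrite (Euler_ln (fun i => pd_lnabs r0_gt0 r0ra sV0 Vn0 i Ux)) /Eu => h.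
have E0 : (u x)^-1 * (u x)^-1 != 0 by rewrite mulf_neq0 // invr_eq0.
apply: (mulfI E0); apply/eqP; rewrite -subr_eq0; apply/eqP.
rewrite -[RHS]oppr0 -[in RHS]h e1; field; by rewrite u0 V0.
Qed.

Lemma Euler_uV x : U x -> Euler (fun x => u x * V x) x = 0.
Proof.
move=> Ux; have u0 := un0 Ux; have V0 := Vn0 Ux; have [h1 h2] := Euler_rates Ux.
have d1 := isd_Euler su Ux; have d2 := isd_Euler sV Ux.
have -> : Euler (fun x => u x * V x) x = u x * V x * (Euler u x / u x + Euler V x / V x).
  by notypeclasses refine (Euler_isd _ Ux _); [smt|isd; field; rewrite u0 V0].
by rewrite h2 subrr mulr0.
Qed.

Lemma sphere_const g : smooth_on U g -> (forall x v, U x -> lf x v = 0 -> dirv v g x = 0) ->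
  forall x y, U x -> r2 y = r2 x -> g y = g x.
Proof.
move=> sg g0 x y Ux yx; have xp := ls_r2 H Ux.
have [w [t [wx xw /andP [t0 tpi] <-]]] := gcirc_exists (ltnW n2) xp yx.
have Uc s : U (gcirc x w s) by apply/UE; rewrite r2_gcirc //; apply/UE.
have fd s : is_derive s (1 : R) (fun s => g (gcirc x w s)) 0.
  pose v : 'rV[R]_n := - sin s *: x + cos s *: w.
  have := g0 _ v (Uc s) _; rewrite /dirv => <-; last first.
    rewrite /v lfD !lfZ [lf _ x]lfC [lf _ w]lfC /gcirc !lfD !lfZ -!r2_lf wx.
    have xw' : lf w x = 0 by rewrite -xw.
    by rewrite xw' [lf x w]lfC xw'; ring.
  apply: curve_isd; last exact: smooth_diff sg (Uc s).
  by move=> k; rewrite /v !mxE; exact: gcirc_isd.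
have := isd_bound (K := 0) t0 (fun s _ => fd s); rewrite gcirc0 mul0r => h.
by apply/eqP; rewrite -subr_eq0 -normr_le0; apply: h => z _; rewrite normr0.
Qed.

Lemma const_isd (h : R -> R) : (forall s, ra < s -> is_derive s (1 : R) h 0) ->
  forall s s', ra < s -> ra < s' -> h s = h s'.
Proof.
move=> hd s s'; wlog ss : s s' / s <= s'.
  by move=> W h1 h2; have [ss|/ltW ss] := leP s s'; [exact: W|apply/esym; exact: W].
move=> rs rs'; have := isd_bound (K := 0) ss (fun z hz => hd z (lt_le_trans rs (proj1 (andP hz)))).
by rewrite mul0r => h'; apply/esym/eqP; rewrite -subr_eq0 -normr_le0; apply: h' => z _; rewrite normr0.
Qed.

Lemma spread (G : 'rV[R]_n -> R) : (forall x y, U x -> r2 y = r2 x -> G y = G x) ->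
  (forall t, lf t t = 1 -> forall s, ra < s -> is_derive s (1 : R) (fun s => G (s *: t)) 0) ->
  forall x y, U x -> U y -> G x = G y.
Proof.
move=> Gs Gr x y Ux Uy.
have [s [t [s0 tt xE]]] := unit_exists (ls_r2 H Ux).
have [s' [t' [s'0 tt' yE]]] := unit_exists (ls_r2 H Uy).
have rs : ra < s by apply: (ray_U ra0 UE tt s0); rewrite -xE.
have rs' : ra < s' by apply: (ray_U ra0 UE tt' s'0); rewrite -yE.
rewrite xE (const_isd (Gr t tt) rs rs'); apply: Gs => //.
by rewrite yE !r2Z !r2_lf tt tt'.
Qed.

Lemma ray_isd_Euler g s t : smooth_on U g -> lf t t = 1 -> ra < s ->
  is_derive s (1 : R) (fun s => g (s *: t)) (s^-1 * Euler g (s *: t)).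
Proof.
move=> sg tt rs; apply: isd_eq (ray_isd sg (U_unit tt rs)) _.
by rewrite /Euler mulr_sumr; apply: eq_bigr => k _; rewrite mxE; field; rewrite gt_eqF // (lt_trans ra0).
Qed.

Lemma uV_const x y : U x -> U y -> u x * V x = u y * V y.
Proof.
apply: (spread (G := fun x => u x * V x)) => [x' y' Ux yx|t tt s rs].
  by rewrite (sphere_const su (fun x v Ux xv => proj1 (tg Ux xv)) Ux yx) (sphere_const sV (fun x v Ux xv => proj2 (tg Ux xv)) Ux yx).
have suV : smooth_on U (fun x => u x * V x) by smt.
by apply: isd_eq (ray_isd_Euler suV tt rs) _; rewrite Euler_uV ?mulr0 //; exact: U_unit.
Qed.

(** The constant is twice the mass; its radial derivative vanishes by the first rate in
    [Euler_rates]. *)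
Lemma mass_const x y : U x -> U y ->
  (1 - Eu u x) * eradius x ^+ (n - 2) = (1 - Eu u y) * eradius y ^+ (n - 2).
Proof.
have [d nd] : exists d, (n - 2 = d.+1)%N by exists (n - 3)%N; rewrite -subSn.
apply: (spread (G := fun x => (1 - Eu u x) * eradius x ^+ (n - 2))) => [x' y' Ux yx|t tt s rs].
  by rewrite /Eu (sphere_const su (fun x v Ux xv => proj1 (tg Ux xv)) Ux yx) !eradius_r2 yx.
have Us := U_unit tt rs; have u0 := un0 Us; have s0 := lt_trans ra0 rs; have sn := lt0r_neq0 s0.
have E0 z : 0 < z -> (1 - Eu u (z *: t)) * z ^+ d.+1 = (1 - Eu u (z *: t)) * eradius (z *: t) ^+ (n - 2).
  by move=> z0; rewrite nd eradius_r2 r2Z r2_lf tt mulr1 sqrtr_sqr gtr0_norm.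
have E1 : \forall z \near s, (1 - Eu u (z *: t)) * z ^+ d.+1 = (1 - Eu u (z *: t)) * eradius (z *: t) ^+ (n - 2).
  have : \forall z \near s, 0 < z by exact: lt_nbhsr.
  by apply: filterS => z; exact: E0.
apply: (near_eq_is_derive E1).
have h := ray_isd_Euler su tt rs; have [e _] := Euler_rates Us.
have n2' : n%:R - 2 = d.+1%:R :> R by rewrite -nd natrB // ltnW.
rewrite n2' in e.
have eE : Euler u (s *: t) = - (2^-1 * d.+1%:R * (u (s *: t) ^+ 2 - 1)) * u (s *: t) by rewrite -e divfK.
rewrite /Eu; isd; rewrite eE; rewrite exprS; field; by rewrite u0 sn.
Qed.
End Formula.

(** * From infinity to the whole domain *)

Section Rigidity.
Context {R : realType} {n : nat} (r0 : R) (u V : 'rV[R]_n -> R).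
Hypothesis n2 : (2 < n)%N.
Hypothesis r0_gt0 : 0 < r0.
Hypothesis su : smooth_on (exterior r0) u.
Hypothesis u_gt0 : forall x, exterior r0 x -> 0 < u x.
Hypothesis sV : smooth_on (exterior r0) V.
Hypothesis bV : exists C : R, forall x, exterior r0 x -> `|V x| <= C.
Hypothesis V_nz : exists x, exterior r0 x /\ V x != 0.
Hypothesis hessE : forall x, exterior r0 x -> forall i j : 'I_n, hess u V i j x = V x * ricci u i j x.
Hypothesis lapE : forall x, exterior r0 x -> lap u V x = 0.

Let scalE := scal_all n2 r0_gt0 su u_gt0 sV hessE lapE V_nz.
Let radE := rad_all n2 r0_gt0 su u_gt0 sV hessE lapE V_nz.
Let mixE := mix_eq r0_gt0 su u_gt0 sV hessE.

Lemma dirv_ln (g h : 'rV[R]_n -> R) x (c : R) v :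
  (forall i, dpd i h x = dpd i g x * c) -> dirv v h x = dirv v g x * c.
Proof. by move=> hE; rewrite /dirv mulr_suml; apply: eq_bigr => i _; rewrite hE mulrA. Qed.

Lemma gamS_ln (g h : 'rV[R]_n -> R) x (c : R) :
  (forall i, dpd i h x = dpd i g x * c) -> gamS h h x = gamS g g x * c ^+ 2.
Proof.
move=> hE; rewrite /gamS /g2 !(dp_ln _ hE) (Euler_ln hE) dpC (dp_ln _ hE); ring.
Qed.

Definition radial_beyond (ra : R) : Prop := [/\ r0 <= ra, forall x, exterior ra x -> V x != 0 &
  forall x v, exterior ra x -> lf x v = 0 -> dirv v u x = 0 /\ dirv v V x = 0].

Lemma radial_of_log ra x v : r0 <= ra -> (forall x, exterior ra x -> V x != 0) -> exterior ra x ->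
  dirv v (lnu u) x = 0 -> dirv v (lnabs V) x = 0 -> dirv v u x = 0 /\ dirv v V x = 0.
Proof.
move=> r0ra Vn0 Ux.
rewrite (dirv_ln v (fun i => pd_lnu r0ra su u_gt0 i Ux)) (dirv_ln v (fun i => pd_lnabs r0_gt0 r0ra sV Vn0 i Ux)).
move=> /eqP; rewrite mulf_eq0 invr_eq0 (gt_eqF (u_gt0 (exterior_sub r0ra Ux))) orbF => /eqP -> /eqP; rewrite mulf_eq0 invr_eq0 (negbTE (Vn0 _ Ux)) orbF => /eqP ->.
by split.
Qed.

Lemma le_of_decay (q Q e r : R) : 0 < r -> q * r <= Q -> Q <= e * r -> q <= e.
Proof. by move=> r0' h1 h2; rewrite -(ler_pM2r r0'); exact: le_trans h2. Qed.

(** Collects the estimates: beyond a large radius V does not vanish, and ln u, ln |V| satisfy the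
    decay hypotheses of [log_radial]. *)
Lemma radial_far : exists ra, radial_beyond ra.
Proof.
have [C [b [C0 b1 rb uD]]] := u_decay n2 r0_gt0 su u_gt0 scalE.
have [a [M [ba M0 VD]]] := V_lower n2 r0_gt0 su u_gt0 sV mixE radE C0 b1 rb uD bV
  (near0_absurd n2 r0_gt0 su u_gt0 sV hessE V_nz).
pose L : R := @Lg R n C; have L0 : 0 <= L by exact: Lg_ge0.
rewrite -/L in VD.
(* [V_lower] gives ([Euler] ln |V|)^2 [r2] <= 256 L, so 1024 L makes |[Euler] ln |V|| at most 1/2.
   Adding [r0] keeps the region inside the domain. *)
pose ra := a + 1024 * L + r0.
have a1 : 1 <= a := le_trans b1 ba.
have r0p := r0_gt0.
have r0ra : r0 <= ra by rewrite /ra; lra.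
have ra1 : 1 <= ra by rewrite /ra; lra.
have ra0 : 0 < ra by lra.
have raa : ra <= ra ^+ 2 by rewrite expr2 ler_peMr // ltW.
have UE (x : 'rV[R]_n) : exterior ra x <-> ra ^+ 2 < r2 x by exact: exteriorE (ltW ra0).
have far (x : 'rV[R]_n) : exterior ra x -> [/\ a <= r2 x, b <= r2 x, 1024 * L <= r2 x & 0 < r2 x].
  by move=> /UE h; split; rewrite /ra in raa ra1 h; move: raa ra1 h a1 ba b1 L0 r0p; clear_from r0ra; lra.
have V8 (x : 'rV[R]_n) : exterior ra x -> 0 < V x ^+ 2 /\ M ^+ 2 <= 64 * V x ^+ 2.
  move=> /far [ax _ _ _]; have [h _ _] := VD x ax.
  have -> : V x ^+ 2 = `|V x| ^+ 2 by rewrite real_normK // num_real.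
  by split; [rewrite exprn_gt0 //; lra|nra].
have Vn0 (x : 'rV[R]_n) : exterior ra x -> V x != 0.
  by move=> /V8 [h _]; move: h; rewrite lt0r sqrf_eq0 => /andP [].
have H := log_static_uV r0_gt0 r0ra n2 su u_gt0 sV hessE Vn0.
have Elnabs (x : 'rV[R]_n) : exterior ra x -> Euler (lnabs V) x = Euler V x * (V x)^-1.
  by move=> Ux; rewrite (Euler_ln (fun i => pd_lnabs r0_gt0 r0ra sV Vn0 i Ux)).
have piD (x : 'rV[R]_n) : exterior ra x -> Euler (lnabs V) x ^+ 2 * r2 x <= 256 * L.
  move=> Ux; have [ax _ _ _] := far x Ux; have [_ _ h] := VD x ax; have [v0 v8] := V8 x Ux.
  rewrite Elnabs // exprMn exprVn mulrAC ler_pdivrMr //; apply: le_trans h _.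
  have := ler_wpM2l L0 v8; lra.
have v12 (x : 'rV[R]_n) : exterior ra x -> `|Euler (lnabs V) x| <= 1 / 2.
  move=> Ux; have [_ _ l4 rp] := far x Ux; have h := piD x Ux.
  rewrite ler_norml; apply: sqr_le_abs; first by lra.
  apply: (le_of_decay rp h); lra.
have dec e : 0 < e -> exists b0, forall x, b0 <= r2 x ->
  [/\ gamS (lnu u) (lnu u) x <= e ^+ 2, gamS (lnabs V) (lnabs V) x <= e ^+ 2,
      `|Euler (lnabs V) x| <= e & `|(Eu u x)^-1 - 1| <= e].
  move=> e0; have e2 : 0 < e ^+ 2 by rewrite exprn_gt0.
  pose Q := 256 * L + 16 * C; have Q0 : 0 <= Q by rewrite /Q; lra.
  exists (ra ^+ 2 + 1 + Q / e ^+ 2) => x hx.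
  have q0 : 0 <= Q / e ^+ 2 by rewrite divr_ge0 // ltW.
  have Ux : exterior ra x by apply/UE; lra.
  have [ax bx l4 rp] := far x Ux; have un : u x != 0 by rewrite gt_eqF // u_gt0 //; exact: (exterior_sub r0ra Ux).
  have Qr : Q <= e ^+ 2 * r2 x by rewrite mulrC -ler_pdivrMr //; have := sqr_ge0 ra; lra.
  have [/andP [u1 u2] uC gC] := uD x bx; have [_ gV _] := VD x ax; have [v0 v8] := V8 x Ux.
  have small q : q * r2 x <= Q -> q <= e ^+ 2 by move=> h; exact: le_of_decay rp h Qr.
  split.
  - apply: small; rewrite (gamS_ln (fun i => pd_lnu r0ra su u_gt0 i Ux)) exprVn mulrAC ler_pdivrMr ?exprn_gt0 //; last by lra.
    have u4 : 1 <= 4 * u x ^+ 2 by move: u1; clear_from r0ra; nra.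
    apply: le_trans gC _; have := ler_wpM2l C0 u4; have : 0 <= L * u x ^+ 2 by rewrite mulr_ge0 // sqr_ge0.
    have : 0 <= C * u x ^+ 2 by rewrite mulr_ge0 // sqr_ge0.
    by rewrite /Q; clear_from r0ra; lra.
  - apply: small; rewrite (gamS_ln (fun i => pd_lnabs r0_gt0 r0ra sV Vn0 i Ux)) exprVn mulrAC ler_pdivrMr //.
    apply: le_trans gV _; have := ler_wpM2l L0 v8; have : 0 <= L * V x ^+ 2 by rewrite mulr_ge0 // ltW.
    have : 0 <= C * V x ^+ 2 by rewrite mulr_ge0 // ltW.
    by rewrite /Q; clear_from r0ra; lra.
  - rewrite ler_norml; apply: sqr_le_abs; first exact: ltW.
    by apply: small; apply: le_trans (piD x Ux) _; rewrite /Q; move: C0; clear_from r0ra; lra.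
  rewrite ler_norml; apply: sqr_le_abs; first exact: ltW.
  apply: small; have -> : (Eu u x)^-1 - 1 = (u x - 1) * (u x + 1) by rewrite /Eu; field.
  rewrite exprMn mulrAC; have u9 : (u x + 1) ^+ 2 <= 16 by move: u1 u2; clear_from r0ra; nra.
  apply: (@le_trans _ _ (C * 16)); last by rewrite /Q; move: L0; clear_from r0ra; lra.
  by apply: ler_pM => //; [apply: mulr_ge0; [exact: sqr_ge0|exact: ltW]|exact: sqr_ge0].
exists ra; split=> // x v Ux xv.
have p2 : 2 <= n%:R - 1 :> R by have : 3%:R <= n%:R :> R by [rewrite ler_nat]; lra.
have [h1 h2] := log_radial H n2 ra0 UE p2 v12 dec Ux xv.
exact: (radial_of_log r0ra Vn0 Ux h1 h2).
Qed.

(** On the sphere of radius ga the product uV equals the nonzero constant it has outside, so by a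
    uniform derivative bound V stays nonzero on a slightly larger region. There the logarithmic
    equations hold, and radial symmetry moves inwards along rays. *)
Lemma radial_step ga : radial_beyond ga -> r0 < ga -> exists2 si, si < ga & radial_beyond si.
Proof.
move=> [r0ga Vn tg] rg; have r0p := r0_gt0; have ga0 : 0 < ga by lra.
pose h x := u x * V x; have sh : smooth_on (exterior r0) h.
  by have oU : open (exterior r0 : set 'rV[R]_n) by [exact: open_exterior (ltW r0_gt0)]; rewrite /h; smt.
have sEh := smooth_Euler r0_gt0 sh.
pose ga' := (r0 + ga) / 2; have g1 : r0 < ga' by rewrite /ga'; lra.
have g2 : ga' < ga by rewrite /ga'; lra.
have ga'0 : 0 < ga' by lra.
have Ust s (t : 'rV[R]_n) : lf t t = 1 -> r0 < s -> exterior r0 (s *: t).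
  by move=> tt rs; exact: (U_unit r0_gt0 (lexx r0) tt rs).
have i0 : 'I_n by apply: (@Ordinal n 0); exact: ltn_trans n2.
have [t0 tt0] : exists t : 'rV[R]_n, lf t t = 1.
  exists (ev i0); rewrite /lf (eq_bigr (fun i => ev i0 ord0 i * (i0 == i)%:R)).
    by rewrite sum_deltar evE eqxx.
  by move=> i _; rewrite !evE eq_sym.
have ann s (t : 'rV[R]_n) : lf t t = 1 -> ga' <= s -> s <= ga -> annulus (ga' ^+ 2) (ga ^+ 2) (s *: t).
  move=> tt s1 s2; rewrite /annulus /= r2Z r2_lf tt mulr1 !ler_pXn2r ?nnegrE ?s1 //; lra.
have cE x : annulus (ga' ^+ 2) (ga ^+ 2) x -> {for x, continuous (fun x => Euler h x * Euler h x)}.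
  move=> /andP [h1 _]; have Ux : exterior r0 x.
    apply/(exteriorE _ (ltW r0_gt0)); apply: lt_le_trans h1; rewrite ltr_pXn2r ?nnegrE //; lra.
  have oU : open (exterior r0 : set 'rV[R]_n) by exact: open_exterior (ltW r0_gt0).
  by apply: smooth_continuous Ux; smt.
have [z0 _ z0m] := annulus_max (ann ga t0 tt0 (ltW g2) (lexx _)) cE.
pose M := Euler h z0 * Euler h z0 + 1.
have M1 : 1 <= M by rewrite /M lerDr -expr2 sqr_ge0.
have EM x : annulus (ga' ^+ 2) (ga ^+ 2) x -> `|Euler h x| <= M.
  move=> /z0m; rewrite /M; move: (Euler h x) (Euler h z0 * _) => y Q hQ.
  by rewrite ler_norml; apply/andP; split; nra.
have dh s (t : 'rV[R]_n) : lf t t = 1 -> r0 < s -> is_derive s (1 : R) (fun s => h (s *: t)) (s^-1 * Euler h (s *: t)).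
  by move=> tt rs; exact: (ray_isd_Euler r0_gt0 (lexx r0) sh tt rs).
have Uga s (t : 'rV[R]_n) : lf t t = 1 -> ga < s -> exterior ga (s *: t).
  by move=> tt; exact: (U_unit r0_gt0 r0ga tt).
have gg1 : ga < ga + 1 by rewrite ltrDl.
pose c := h ((ga + 1) *: t0).
have c0 : c != 0.
  rewrite /c /h mulf_neq0 //; last by apply: Vn; exact: Uga.
  by rewrite gt_eqF // u_gt0 //; apply: Ust => //; lra.
(* The sphere itself is not in the open region beyond [ga]; the mean value theorem reaches it from
   outside. *)
have hga (t : 'rV[R]_n) : lf t t = 1 -> h (ga *: t) = c.
  move=> tt.
  have hc : h ((ga + 1) *: t) = c by exact: (uV_const r0_gt0 r0ga n2 su u_gt0 sV hessE scalE Vn tg (Uga _ t tt gg1) (Uga _ t0 tt0 gg1)).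
  have [z [z1 z2 e]] := MVT_isd gg1 (fun s hs => dh s t tt (lt_le_trans rg (proj1 (andP hs)))).
  apply/esym/eqP; rewrite -hc -subr_eq0 e.
  by rewrite (Euler_uV r0_gt0 r0ga n2 su u_gt0 sV hessE scalE Vn tg (Uga _ t tt z1)) mulr0 mul0r.
(* Within this distance of [ga], uV changes by less than |c|/2. The maximum with [ga'] stays in the
   annulus where M bounds the radial derivative. *)
pose si := Num.max ga' (ga - `|c| * ga' / (2 * M)).
have cp : 0 < `|c| by rewrite normr_gt0.
have M2 : 0 < 2 * M by lra.
have sig : si < ga.
  by rewrite gt_max g2 /= ltrBlDr ltrDl divr_gt0 // mulr_gt0.
have gs : ga' <= si by rewrite le_max lexx.
have r0si : r0 <= si by lra.
have si0 : 0 < si by lra.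
have UEs (x : 'rV[R]_n) : exterior si x <-> si ^+ 2 < r2 x by exact: exteriorE (ltW si0).
have pol (x : 'rV[R]_n) : exterior si x -> exists s t, [/\ si < s, lf t t = 1 & x = s *: t].
  move=> Ux; have [s [t [s0 tt xE]]] := unit_exists (r2_gt0 (ltW si0) Ux).
  by exists s, t; split=> //; apply: (ray_U si0 UEs tt s0); rewrite -xE.
have Vs (x : 'rV[R]_n) : exterior si x -> V x != 0.
  move=> /pol [s [t [ss tt ->]]].
  have [sg|sg] := ltP ga s; first by apply: Vn; exact: Uga.
  suff : h (s *: t) != 0 by rewrite /h mulf_eq0 negb_or => /andP [].
  have fd z : s <= z <= ga -> is_derive z (1 : R) (fun s => h (s *: t)) (z^-1 * Euler h (z *: t)).
    by move=> /andP [sz _]; apply: dh => //; apply: lt_le_trans sz; exact: le_lt_trans ss.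
  have fb z : s <= z <= ga -> `|z^-1 * Euler h (z *: t)| <= ga'^-1 * M.
    move=> /andP [sz zg]; have gz : ga' <= z by apply: le_trans gs (le_trans (ltW ss) sz).
    have z0' : 0 < z := lt_le_trans ga'0 gz.
    apply: normM_le; last by apply: EM; exact: ann.
    by rewrite ger0_norm ?invr_ge0 ?(ltW z0') // lef_pV2.
  have := isd_bound sg fd fb; rewrite hga // => hb.
  apply/negP => /eqP h0; move: hb; rewrite h0 subr0 leNgt => /negP; apply.
  have s3 : ga - s < `|c| * ga' / (2 * M).
    have : ga - `|c| * ga' / (2 * M) <= si by rewrite le_max lexx orbT.
    lra.
  have K0 : 0 < ga'^-1 * M by rewrite mulr_gt0 ?invr_gt0 //; lra.
  apply: (@lt_le_trans _ _ (ga'^-1 * M * (`|c| * ga' / (2 * M)))); first by rewrite ltr_pM2l.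
  have -> : ga'^-1 * M * (`|c| * ga' / (2 * M)) = `|c| / 2 by field; rewrite !gt_eqF //; lra.
  lra.
exists si => //; split=> // x v Ux xv.
have H := log_static_uV r0_gt0 r0si n2 su u_gt0 sV hessE Vs.
have [s [t [ss tt xE]]] := pol x Ux.
have tv : lf t v = 0.
  move: xv; rewrite xE lfC lfZ lfC => /eqP; rewrite mulf_eq0 gt_eqF ?(lt_trans si0 ss) //= => /eqP //.
have sf : si < ga + 1 by lra.
have tl (v' : 'rV[R]_n) : lf t v' = 0 -> dirv v' (lnu u) ((ga + 1) *: t) = 0 /\ dirv v' (lnabs V) ((ga + 1) *: t) = 0.
  move=> tv'; have Ug := Uga _ t tt gg1.
  apply: (tg_ln r0_gt0 r0ga su u_gt0 sV Vn tg Ug).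
  by rewrite lfC lfZ lfC tv' mulr0.
have [h1 h2] := tangential_ray H n2 si0 UEs tt sf ss tl tv.
by rewrite -xE in h1 h2; exact: (radial_of_log r0si Vs Ux h1 h2).
Qed.

(** The infimum of the admissible radii is admissible, because the condition concerns the open
    region beyond it; if it exceeded r0, [radial_step] would lower it. *)
Lemma radial_everywhere : radial_beyond r0.
Proof.
pose S : set R := [set g | radial_beyond g].
have S0 : S !=set0 by have [ra h] := radial_far; exists ra.
have lbS : lbound S r0 by move=> g [].
have hS : has_inf S by split=> //; exists r0.
pose ga := inf S.
have r0ga : r0 <= ga by apply: lb_le_inf.
have Sex (x : 'rV[R]_n) : exterior ga x -> exists2 g, S g & exterior g x.
  rewrite /exterior /= => gx; have e0 : 0 < eradius x - ga by rewrite subr_gt0.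
  have [g Sg hg] := inf_adherent e0 hS.
  by exists g => //; rewrite /exterior /=; rewrite -/ga addrC subrK in hg.
have Kga : radial_beyond ga.
  split=> // [x /Sex [g [_ h _] gx]|x v /Sex [g [_ _ h] gx]]; [exact: h|exact: h].
move: r0ga; rewrite le_eqVlt => /orP [/eqP -> //|rg].
have [si sg Ksi] := radial_step Kga rg.
have : ga <= si by apply: ge_inf => //; exists r0.
by rewrite leNgt sg.
Qed.
End Rigidity.

(** * Reading off the mass and the potential *)

Theorem theorem1p2 (R : realType) (n : nat) (r0 : R) (u V : 'rV[R]_n -> R) :
  (3 <= n)%N -> 0 < r0 ->
  smooth_on (exterior r0) u ->
  (forall x, exterior r0 x -> 0 < u x) ->
  smooth_on (exterior r0) V ->
  (exists C : R, forall x, exterior r0 x -> `|V x| <= C) ->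
  (exists x, exterior r0 x /\ V x != 0) ->
  (forall x, exterior r0 x -> forall i j : 'I_n,
      hess u V i j x = V x * ricci u i j x) ->
  (forall x, exterior r0 x -> lap u V x = 0) ->
  exists m : R,
    r_m n m <= r0 /\
    (forall x, exterior r0 x -> u x = (Num.sqrt (schw n m (eradius x)))^-1) /\
    (exists c : R, forall x, exterior r0 x ->
        V x = c * Num.sqrt (schw n m (eradius x))).
Proof.
move=> n2 r0_gt0 su u_gt0 sV bV V_nz hessE lapE.
have [_ Vn tg] := radial_everywhere n2 r0_gt0 su u_gt0 sV bV V_nz hessE lapE.
have scalE := scal_all n2 r0_gt0 su u_gt0 sV hessE lapE V_nz.
have [x0 [Ux0 Vx0]] := V_nz; have r0r := lexx r0.
(* Half the value of the conserved quantity of [mass_const], taken at a point where V is nonzero;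
   the factor c of the potential is the value of uV there. *)
pose m : R := 2^-1 * ((1 - Eu u x0) * eradius x0 ^+ (n - 2)).
have rp (x : 'rV[R]_n) : exterior r0 x -> 0 < eradius x by exact: lt_trans.
have mE (x : 'rV[R]_n) : exterior r0 x -> schw n m (eradius x) = Eu u x.
  move=> Ux; rewrite /schw /m mulrA divff ?pnatr_eq0 // mul1r.
  rewrite -(mass_const r0_gt0 r0r n2 su u_gt0 sV hessE scalE Vn tg Ux Ux0).
  by rewrite mulfK ?expf_neq0 ?gt_eqF ?rp //; ring.
have sE (x : 'rV[R]_n) : exterior r0 x -> Num.sqrt (schw n m (eradius x)) = (u x)^-1.
  by move=> Ux; rewrite mE // /Eu -expr2 sqrtr_sqr ger0_norm // invr_ge0 ltW // u_gt0.
exists m; split; last first.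
  split=> [x Ux|]; first by rewrite sE // invrK.
  exists (u x0 * V x0) => x Ux; rewrite sE //.
  rewrite -(uV_const r0_gt0 r0r n2 su u_gt0 sV hessE scalE Vn tg Ux Ux0).
  by rewrite mulrAC divff ?mul1r // gt_eqF // u_gt0.
(* If r_m exceeded r0, the sphere of radius r_m would lie in the domain, where u^-2 is positive
   although the Schwarzschild factor vanishes there. *)
rewrite leNgt; apply/negP => r0m.
have k0 : (n - 2)%:R != 0 :> R by rewrite pnatr_eq0 subn_eq0 -ltnNge.
pose rho := r_m n m; have rho0 : 0 < rho by exact: lt_trans r0m.
have [i0 _] : exists i0 : 'I_n, true by exists (Ordinal (ltn_trans (ltn0Sn 1) n2)).
have tt : lf (ev i0) (ev i0) = 1 :> R.
  rewrite /lf (eq_bigr (fun i => ev i0 ord0 i * (i0 == i)%:R)) => [|i _]; first by rewrite sum_deltar evE eqxx.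
  by rewrite !evE eq_sym.
have Ur : exterior r0 (rho *: ev i0 : 'rV[R]_n) by exact: (U_unit r0_gt0 r0r tt r0m).
have er : eradius (rho *: ev i0 : 'rV[R]_n) = rho by rewrite eradius_r2 r2Z r2_lf tt mulr1 sqrtr_sqr gtr0_norm.
have := mE _ Ur; rewrite er /schw => sch.
have Ep : 0 < Eu u (rho *: ev i0) by rewrite /Eu mulr_gt0 // invr_gt0 u_gt0.
(* For m <= 0 the radius r_m is the power of 0 with a nonzero exponent, hence 0, against [rho0]. *)
have [m0|m0] := leP (2 * m) 0.
  by move: rho0; rewrite /rho /r_m max_r // powR0 ?ltxx // invr_eq0.
have rhoE : rho ^+ (n - 2) = 2 * m.
  rewrite /rho /r_m max_l ?ltW // -powR_mulrn ?powR_ge0 // -powRrM mulVf // powRr1 // ltW //.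
by move: Ep; rewrite -sch rhoE divff ?subrr ?ltxx // gt_eqF.
Qed.
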